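(* Let $d\in\{2,3\}$ and let $(\mathsf u,\mathsf p)$ be the solution of the time-dependent Stokes problem on $\Omega=(0,1)^d$ described in the context. Assume that $\mathsf u\in W^{3,\infty}((0,T);\mathbf H^2(\Omega))\cap W^{2,\infty}((0,T);D(B))$ and $\mathsf p\in W^{3,\infty}((0,T);Y)$. Let $(u_\tau,p_\tau)$ be the solution of the direction splitting scheme described in the context (two-dimensional scheme if $d=2$, three-dimensional scheme if $d=3$) with $\chi=0$, the initialization being such that $\|\mathsf p(\tfrac{\tau}{2})-p^{\star,\frac12}\|_{L^2}\le c\,\tau$ with $c$ independent of $\tau$. Then there is a constant $c$, which may depend on the data and on the exact solution but not on $\tau$ or the discrete solution, such that $$\|\epsilon_\tau\|_{\ell^2(\triangle)}\le c\,\tau ,\qquad\text{where}\qquad \|q\|_{\triangle}:=\sup_{0\ne v\in\mathbf Z}\frac{\langle\nabla q,v\rangle}{\|v\|_{\mathbf Z}} .$$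
   Context: **Continuous problem.** $T>0$, $\Omega=(0,1)^d$, $d\in\{2,3\}$. $(\mathsf u,\mathsf p)$ solves $\mathsf u_t-\Delta\mathsf u+\nabla\mathsf p=f$ in $\Omega\times(0,T]$, $\nabla\cdot\mathsf u=0$ in $\Omega\times[0,T]$, $\mathsf u|_{\partial\Omega}=0$ on $(0,T]$, $\mathsf u|_{t=0}=\mathsf u_0$, with $\mathsf p$ of zero mean, $f$ a smooth source term and $\mathsf u_0$ solenoidal with zero normal trace. With $f_0=f|_{t=0}$, the initial pressure $\mathsf p_0=\mathsf p|_{t=0}$ solves $\Delta\mathsf p_0=\nabla\cdot(f_0+\Delta\mathsf u_0)$, $\partial_n\mathsf p_0|_{\partial\Omega}=(f_0+\Delta\mathsf u_0)\cdot n$, and the compatibility condition $(-\Delta\mathsf u_0+\nabla\mathsf p_0-f_0)|_{\partial\Omega}=0$ is assumed. **Spaces and operators.** Bold letters denote spaces of vector-valued functions; $\langle\cdot,\cdot\rangle$ is the $L^2(\Omega)$ inner product. $\tilde L^2$, $\tilde H^1$ are the zero-mean functions in $L^2(\Omega)$, $H^1(\Omega)$. $\|q\|_{H^1}:=\|\nabla q\|_{L^2}$ for $q\in\tilde H^1$. Pressure operator: for $d=2$, $A=(1-\partial_{xx})(1-\partial_{yy})$ with $D(A)=\{p\in\tilde L^2:\partial_{yy}p,Ap\in L^2,\ \partial_yp|_{y=0,1}=0,\ \partial_x(1-\partial_{yy})p|_{x=0,1}=0\}$; for $d=3$, $A=(1-\partial_{xx})(1-\partial_{yy})(1-\partial_{zz})$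 with $D(A)=\{p\in\tilde L^2:\partial_{zz}p,(1-\partial_{yy})(1-\partial_{zz})p,Ap\in L^2,\ \partial_zp|_{z=0,1}=0,\ \partial_y(1-\partial_{zz})p|_{y=0,1}=0,\ \partial_x(1-\partial_{yy})(1-\partial_{zz})p|_{x=0,1}=0\}$. $\|q\|_A:=\langle Aq,q\rangle^{1/2}$ on $D(A)$; $Y$ is the zero-mean part of the completion of smooth functions in this norm. Explicitly, for $d=2$, $Y=\{q\in\tilde H^1:\partial_{xy}q\in L^2\}$, $\|q\|_A^2=\|q\|_{H^1}^2+\|\partial_{xy}q\|_{L^2}^2$; for $d=3$, $Y=\{q\in\tilde H^1:\partial_{xy}q,\partial_{yz}q,\partial_{zx}q,\partial_{xyz}q\in L^2\}$, $\|q\|_A^2=\|q\|_{H^1}^2+\|\partial_{xy}q\|_{L^2}^2+\|\partial_{yz}q\|_{L^2}^2+\|\partial_{zx}q\|_{L^2}^2+\|\partial_{xyz}q\|_{L^2}^2$. Velocity operator: $Bv=\partial_{xxyy}v$ for $d=2$; $Bv=(\partial_{xxyy}+\partial_{yyzz}+\partial_{zzxx}-\frac\tau2\partial_{xxyyzz})v$ for $d=3$; $D(B)=\{v\in\mathbf H^1_0(\Omega):Bv\in\mathbf L^2(\Omega)\}$ with the graph norm; $\|v\|_B:=\langle v,Bv\rangle^{1/2}$, i.e. $\|v\|_B^2=\|\partial_{xy}v\|_{L^2}^2$ for $d=2$ and $\|v\|_B^2=\|\partial_{xy}v\|_{L^2}^2+\|\partial_{yz}v\|_{L^2}^2+\|\partial_{xz}v\|_{L^2}^2+\frac\tau2\|\partial_{xyz}v\|_{L^2}^2$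 for $d=3$. The Hilbert space $\mathbf Z$ is the intersection with $\mathbf H^1_0(\Omega)$ of the completion of smooth vector fields with respect to $\|\cdot\|_B$, with norm $\|\cdot\|_{\mathbf Z}=\|\cdot\|_B$. **Time grid.** $\tau>0$, $t_k=k\tau$, $0\le k\le K=\lceil T/\tau\rceil$; $\psi^k=\psi(t_k)$ for a time-dependent function $\psi$ (also for half-integer indices); $\bar\psi^{k+\frac12}=\frac12(\psi^{k+1}+\psi^k)$. **Scheme** (discrete in time only; $\chi\ge0$ is a parameter). Set $p^{-\frac12}=\mathsf p_0$, $\phi^{-\frac12}=\phi^{\star,-\frac12}$ (a chosen approximation of $\frac12\tau\partial_t\mathsf p(0)$), $u^0=\mathsf u_0$. For $k\ge0$: (1) $p^{\star,k+\frac12}=p^{k-\frac12}+\phi^{k-\frac12}$. (2) Velocity, $d=2$: find $u^{k+\frac12},u^{k+1}$ with $\frac{u^{k+1/2}-u^k}{\tau/2}-\partial_{xx}u^{k+\frac12}-\partial_{yy}u^k+\nabla p^{\star,k+\frac12}=f^{k+\frac12}$, $u^{k+\frac12}|_{x=0,1}=0$; $\frac{u^{k+1}-u^{k+1/2}}{\tau/2}-\partial_{xx}u^{k+\frac12}-\partial_{yy}u^{k+1}+\nabla p^{\star,k+\frac12}=f^{k+\frac12}$, $u^{k+1}|_{y=0,1}=0$. Velocity, $d=3$: find $\xi^{k+1},\eta^{k+1},\zeta^{k+1},u^{k+1}$ with $\frac{\xi^{k+1}-u^k}{\tau}-\Delta u^k+\nabla p^{\star,k+\frac12}=f^{k+\frac12}$,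 $\xi^{k+1}|_{\partial\Omega}=0$; $\frac{\eta^{k+1}-\xi^{k+1}}{\tau}-\frac12\partial_{xx}(\eta^{k+1}-u^k)=0$, $\eta^{k+1}|_{x=0,1}=0$; $\frac{\zeta^{k+1}-\eta^{k+1}}{\tau}-\frac12\partial_{yy}(\zeta^{k+1}-u^k)=0$, $\zeta^{k+1}|_{y=0,1}=0$; $\frac{u^{k+1}-\zeta^{k+1}}{\tau}-\frac12\partial_{zz}(u^{k+1}-u^k)=0$, $u^{k+1}|_{z=0,1}=0$. (3) $A\phi^{k+\frac12}=-\frac1\tau\nabla\cdot u^{k+1}$. (4) $p^{k+\frac12}=p^{k-\frac12}+\phi^{k+\frac12}-\chi\nabla\cdot\bar u^{k+\frac12}$. **Errors and norms.** $\epsilon^{k+\frac12}=\mathsf p(t_{k+\frac12})-p^{k+\frac12}$ ($k\ge0$), and $\|\epsilon_\tau\|_{\ell^2(\triangle)}=(\tau\sum_k\|\epsilon^{k+\frac12}\|_{\triangle}^2)^{1/2}$, the sum being over all $k\ge 0$ for which the terms are defined with times in $[0,T]$. *)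

(* Defs.v *)
From HB Require Import structures.
From mathcomp Require Import all_boot all_order all_algebra.
From mathcomp Require Import all_classical all_reals all_analysis.
Set Implicit Arguments.
Unset Strict Implicit.
Unset Printing Implicit Defensive.
Import Order.TTheory GRing.Theory Num.Theory.
Import numFieldNormedType.Exports.
Local Open Scope classical_set_scope.
Local Open Scope ring_scope.

Section row_measurable.
Context (R : realType) (n : nat).

Definition row_sigma : set (set 'rV[R]_n) :=
  g_sigma_preimage (fun (i : 'I_n) (x : 'rV[R]_n) => x ord0 i : measurableTypeR R).

Let row_sigma0 : row_sigma set0.
Proof. exact: sigma_algebra0. Qed.

Let row_sigmaC A : row_sigma A -> row_sigma (~` A).
Proof. exact: sigma_algebraC. Qed.

Let row_sigma_bigcup (F : (set 'rV[R]_n)^nat) :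
  (forall i, row_sigma (F i)) -> row_sigma (\bigcup_i F i).
Proof. exact: sigma_algebra_bigcup. Qed.

HB.instance Definition _ := @isMeasurable.Build default_measure_display
  'rV[R]_n row_sigma row_sigma0 row_sigmaC row_sigma_bigcup.

End row_measurable.

Section cube_measure.
Context (R : realType).

Definition row_cons n (z : measurableTypeR R * 'rV[R]_n) : 'rV[R]_n.+1 :=
  row_mx (z.1)%:M z.2.

Lemma measurable_row_cons n : measurable_fun [set: _] (@row_cons n).
Proof.
apply: (@measurability _ _ _ 'rV[R]_n.+1 _ _ _ erefl) => _ [B + <-].
rewrite -bigcup_mkord_ord => -[i _ [C mC <-]].
rewrite !setTI -comp_preimage; set j := inord i.
suff mj : measurable_fun [set: _] (fun z => row_cons z ord0 j : measurableTypeR R).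
  by rewrite -[X in measurable X]setTI; exact: mj.
case: (unliftP ord0 j) => [k ->|->].
  rewrite (_ : (fun z => _) = (fun y : 'rV[R]_n => y ord0 k : measurableTypeR R) \o snd).
    apply: measurableT_comp => //; move=> _ D mD; rewrite setTI.
    apply: sub_sigma_algebra => /=; rewrite -bigcup_seq/=.
    by exists k; [rewrite /= mem_index_enum|exists D => //; rewrite setTI].
  apply/funext => z /=.
  have -> : lift ord0 k = rshift 1 k :> 'I_(1 + n) by apply: val_inj.
  exact: (row_mxEr (z.1)%:M z.2 ord0 k).
rewrite (_ : (fun z => _) = fst)//; apply/funext => z /=.
have -> : ord0 = lshift n ord0 :> 'I_(1 + n) by apply: val_inj.
by rewrite /row_cons [LHS](row_mxEl (z.1)%:M z.2 ord0 ord0) mxE.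
Qed.

HB.instance Definition _ n :=
  isMeasurableFun.Build _ _ _ _ (@row_cons n) (@measurable_row_cons n).

Fixpoint cube_measure n : probability 'rV[R]_n R :=
  match n with
  | 0 => \d_ (0 : 'rV[R]_0)
  | m.+1 => distribution (uniform_prob (@ltr01 R) \x cube_measure m)%E (@row_cons m)
  end.

End cube_measure.

Section smooth.
Context (R : realType) (V : normedModType R).

Definition iter_derive (s : seq V) (phi : V -> R) : V -> R :=
  foldr (fun v (psi : V -> R) x => 'D_v psi x) phi s.

Definition smooth (phi : V -> R) : Prop :=
  forall s : seq V, continuous (iter_derive s phi) /\
    forall v x, derivable (iter_derive s phi) x v.

Definition test_function (O : set V) (phi : V -> R) : Prop :=
  smooth phi /\
  exists K : set V, [/\ compact K, K `<=` O & forall x, ~ K x -> phi x = 0].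

End smooth.

Section function_spaces.
Context (R : realType) (d : nat).

Definition scalar_field := 'rV[R]_d -> R.
Definition vector_field := 'I_d -> scalar_field.

Implicit Types (f g v w q phi psi : scalar_field) (i : 'I_d) (s : seq 'I_d).

Definition cube : set 'rV[R]_d := [set x : 'rV[R]_d | forall i, 0 < x ord0 i < 1].

Definition cube_boundary : set 'rV[R]_d :=
  [set x : 'rV[R]_d | (forall i, 0 <= x ord0 i <= 1) /\ ~ cube x].

Definition ae_eq_cube f g : Prop := {ae cube_measure R d, forall x, f x = g x}.

Definition L2 f : Prop := f \in Lfun (cube_measure R d) 2%:E.

Definition ip f g : R := \int[cube_measure R d]_x (f x * g x).

Definition normL2 f : R := Num.sqrt (ip f f).

Definition zero_mean f : Prop := L2 f /\ \int[cube_measure R d]_x f x = 0.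

(* [g] is [P f] in the sense of distributions on the cube, where [Padj] is the
   formal adjoint of the differential operator [P]. *)
Definition weakly (Padj : scalar_field -> scalar_field) f g : Prop :=
  [/\ L2 f, L2 g &
      forall phi, test_function cube phi -> ip g phi = ip f (Padj phi)].

Definition partial s phi : scalar_field :=
  iter_derive [seq delta_mx ord0 i | i <- s] phi.

Definition is_weak_partial s : scalar_field -> scalar_field -> Prop :=
  weakly (fun phi x => (-1) ^+ size s * partial s phi x).

Definition weakly_diff s f : Prop := exists g, is_weak_partial s f g.

(* Junk value 0 unless [weakly_diff s f]. *)
Definition wpartial s f : scalar_field := xget (cst 0) (is_weak_partial s f).

Definition wlaplacian f : scalar_field := fun x => \sum_i wpartial [:: i; i] f x.

Definition is_div (F : vector_field) g : Prop :=
  [/\ forall i, L2 (F i), L2 g &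
      forall phi, test_function cube phi ->
        ip g phi = - \sum_i ip (F i) (partial [:: i] phi)].

Definition div (F : vector_field) : scalar_field := xget (cst 0) (is_div F).

Definition H1 f : Prop := forall i, weakly_diff [:: i] f.

Definition H2 f : Prop := forall s, (size s <= 2)%N -> weakly_diff s f.

Definition normH2 f : R :=
  Num.sqrt (normL2 f ^+ 2 + \sum_i normL2 (wpartial [:: i] f) ^+ 2
            + \sum_i \sum_j normL2 (wpartial [:: i; j] f) ^+ 2).

Definition H10 f : Prop := H1 f /\
  forall e, 0 < e -> exists phi, [/\ test_function cube phi,
    normL2 (fun x => f x - phi x) < e &
    forall i, normL2 (fun x => wpartial [:: i] f x - partial [:: i] phi x) < e].

(* [w] vanishes on the two faces [x_i = 0] and [x_i = 1]. Only [w] and its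
   [i]-th derivative need be square integrable; the trace is the one given by
   Green's formula in the direction [i], whose boundary term lives on these two
   faces. *)
Definition zero_trace i w : Prop := weakly_diff [:: i] w /\
  forall psi, weakly_diff [:: i] psi ->
    ip w (wpartial [:: i] psi) + ip (wpartial [:: i] w) psi = 0.

(* [F . n = 0] on the boundary, for [F] in H(div). *)
Definition zero_normal_trace (F : vector_field) : Prop :=
  (exists g, is_div F g) /\
  forall psi, H1 psi ->
    \sum_i ip (F i) (wpartial [:: i] psi) + ip (div F) psi = 0.

(* [(1 - d_ii) q = r] with [d_i q = 0] on the faces [x_i = 0] and [x_i = 1]. *)
Definition neumann_factor i q r : Prop :=
  [/\ weakly_diff [:: i] q, zero_trace i (wpartial [:: i] q) &
      ae_eq_cube r (fun x => q x - wpartial [:: i] (wpartial [:: i] q) x)].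

Fixpoint neumann_chain s q r : Prop :=
  match s with
  | [::] => ae_eq_cube q r
  | i :: s' => exists q', neumann_factor i q q' /\ neumann_chain s' q' r
  end.

(* [q] is in D(A) and [A q = r]. The factor of the last coordinate is applied
   first, as in the boundary conditions that define D(A). *)
Definition is_A q r : Prop :=
  zero_mean q /\ neumann_chain (rev (enum 'I_d)) q r.

(* The mixed derivatives in the norm of [Y], first derivatives included, are
   those along the nonempty sets of coordinates. *)
Definition Y q : Prop := zero_mean q /\
  forall A : {set 'I_d}, A != finset.set0 -> weakly_diff (enum A) q.

Definition normY q : R :=
  Num.sqrt (\sum_(A : {set 'I_d} | A != finset.set0) normL2 (wpartial (enum A) q) ^+ 2).

(* For [d = 2] there is one pair of coordinates and no triple: the operator is
   [d_xxyy]. It is formally self-adjoint. *)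
Definition B_symbol (tau : R) phi : scalar_field := fun x =>
  \sum_(A : {set 'I_d} | #|A| == 2) partial (enum A ++ enum A) phi x
  - tau / 2 * \sum_(A : {set 'I_d} | #|A| == 3) partial (enum A ++ enum A) phi x.

Definition is_B tau : scalar_field -> scalar_field -> Prop :=
  weakly (B_symbol tau).

Definition DB tau v : Prop := H10 v /\ exists g, is_B tau v g.

Definition normDB tau v : R :=
  Num.sqrt (normL2 v ^+ 2 + normL2 (xget (cst 0) (is_B tau v)) ^+ 2).

Definition Z (v : vector_field) : Prop := forall i, H10 (v i) /\
  forall A : {set 'I_d}, (#|A| == 2) || (#|A| == 3) -> weakly_diff (enum A) (v i).

Definition normZ (tau : R) (v : vector_field) : R :=
  Num.sqrt (\sum_i
    (\sum_(A : {set 'I_d} | #|A| == 2) normL2 (wpartial (enum A) (v i)) ^+ 2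
     + tau / 2 * \sum_(A : {set 'I_d} | #|A| == 3)
                   normL2 (wpartial (enum A) (v i)) ^+ 2)).

Definition norm_triangle (tau : R) q : \bar R :=
  ereal_sup [set r | exists v : vector_field,
    [/\ Z v, ~ (forall i, ae_eq_cube (v i) (cst 0)) &
        r = ((\sum_i ip (wpartial [:: i] q) (v i)) / normZ tau v)%:E]].

End function_spaces.
Arguments cube {R d}.
Arguments cube_boundary {R d}.

Section time_dependent.
Context (R : realType) (d : nat).
Local Notation scalar_field := (scalar_field R d).
Local Notation vector_field := (vector_field R d).

Implicit Types (T : R) (g h : R -> scalar_field).

Definition continuous_in_L2 T g : Prop :=
  forall t, 0 <= t <= T -> L2 (g t) /\
    (fun s => normL2 (fun x => g s x - g t x))
      @ within `[0, T] (nbhs t) --> (0 : R).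

Definition is_time_derivative T g t (gt : scalar_field) : Prop := L2 gt /\
  (fun s => normL2 (fun x => (g s x - g t x) / (s - t) - gt x))
    @ within [set s | 0 <= s <= T /\ s != t] (nbhs t) --> (0 : R).

Section bochner.
(* A space of functions on the cube, with its norm. *)
Variables (X : scalar_field -> Prop) (N : scalar_field -> R).

Definition simple_curve g : Prop :=
  exists n (E : 'I_n -> set (measurableTypeR R)) (e : 'I_n -> scalar_field),
    (forall j, measurable (E j) /\ X (e j)) /\
    forall t x, g t x = \sum_j \1_(E j) t * e j x.

Definition strongly_measurable T g : Prop :=
  (forall t, 0 < t < T -> X (g t)) /\
  exists S : nat -> R -> scalar_field, (forall n, simple_curve (S n)) /\
    forall t, 0 < t < T ->
      (fun n => N (fun x => S n t x - g t x)) @ \oo --> (0 : R).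

Definition Linfty T g : Prop := strongly_measurable T g /\
  exists M : R, {ae @lebesgue_measure R, forall t, 0 < t < T -> N (g t) <= M}.

(* The identity [int theta' g = - int theta h] of Bochner integrals, tested
   against the elements of L^2. *)
Definition weak_time_derivative T g h : Prop :=
  forall theta : R -> R, test_function `]0, T[ theta ->
  forall w : scalar_field, L2 w ->
    \int[@lebesgue_measure R]_(t in `]0, T[) (ip (g t) w * derive1 theta t)
    = - \int[@lebesgue_measure R]_(t in `]0, T[) (ip (h t) w * theta t).

(* [W^{m, oo}((0, T); X)] for [m >= 1]; [g] itself is the representative that
   is continuous on the closed interval, so that its values at the points of
   the time grid make sense. *)
Definition Winfty (m : nat) T g : Prop := continuous_in_L2 T g /\
  exists D : nat -> R -> scalar_field,
    [/\ {ae @lebesgue_measure R, forall t, 0 < t < T -> ae_eq_cube (g t) (D 0%N t)},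
        forall j, (j <= m)%N -> Linfty T (D j) &
        forall j, (j < m)%N -> weak_time_derivative T (D j) (D j.+1)].

End bochner.

Definition stokes_solution T (f : R -> vector_field) (u0 : vector_field)
    (u : R -> vector_field) (p : R -> scalar_field) : Prop :=
  [/\ forall t, 0 < t <= T -> forall i, exists ut : scalar_field,
        [/\ is_time_derivative T (fun s => u s i) t ut,
            forall j, weakly_diff [:: j; j] (u t i),
            weakly_diff [:: i] (p t) &
            ae_eq_cube
              (fun x => ut x - wlaplacian (u t i) x + wpartial [:: i] (p t) x)
              (f t i)],
      forall t, 0 <= t <= T -> is_div (u t) (cst 0),
      forall t, 0 < t <= T -> forall i, H10 (u t i),
      forall i, ae_eq_cube (u 0 i) (u0 i) &
      forall t, 0 <= t <= T -> zero_mean (p t)].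

(* With [G = grad p0 - f0 - Lap u0], the Neumann problem for [p0] says that
   [div G = 0] and [G . n = 0] on the boundary. *)
Definition initial_data (f0 u0 : vector_field) (p0 : scalar_field) : Prop :=
  let G : vector_field :=
    fun i x => - wlaplacian (u0 i) x + wpartial [:: i] p0 x - f0 i x in
  [/\ is_div u0 (cst 0) /\ zero_normal_trace u0,
      H1 p0 /\ forall i j, weakly_diff [:: j; j] (u0 i),
      is_div G (cst 0) /\ zero_normal_trace G &
      forall i, H10 (G i)].

End time_dependent.

Section scheme.
Context (R : realType).

(* [F] is the source term, [q] the predicted pressure, and [uk], [uk1] are the
   velocities at the old and the new time levels. *)
Definition velocity_step2 (tau : R) (F : vector_field R 2)
    (q : scalar_field R 2) (uk uk1 : vector_field R 2) : Prop :=
  let ex : 'I_2 := @Ordinal 2 0 isT in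
  let ey : 'I_2 := @Ordinal 2 1 isT in
  exists uh : vector_field R 2, forall i,
    [/\ weakly_diff [:: i] q,
        [/\ weakly_diff [:: ex; ex] (uh i), weakly_diff [:: ey; ey] (uk i) &
            weakly_diff [:: ey; ey] (uk1 i)],
        ae_eq_cube
          (fun x => (uh i x - uk i x) / (tau / 2)
             - wpartial [:: ex; ex] (uh i) x - wpartial [:: ey; ey] (uk i) x
             + wpartial [:: i] q x) (F i) /\
        zero_trace ex (uh i) &
        ae_eq_cube
          (fun x => (uk1 i x - uh i x) / (tau / 2)
             - wpartial [:: ex; ex] (uh i) x - wpartial [:: ey; ey] (uk1 i) x
             + wpartial [:: i] q x) (F i) /\
        zero_trace ey (uk1 i)].

(* [xi] is explicit and in general only square integrable, so that it has no
   trace: its boundary condition is read pointwise. *)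
Definition velocity_step3 (tau : R) (F : vector_field R 3)
    (q : scalar_field R 3) (uk uk1 : vector_field R 3) : Prop :=
  let ex : 'I_3 := @Ordinal 3 0 isT in
  let ey : 'I_3 := @Ordinal 3 1 isT in
  let ez : 'I_3 := @Ordinal 3 2 isT in
  let half_implicit (j : 'I_3) (a b c : scalar_field R 3) :=
    let w : scalar_field R 3 := fun x => b x - c x in
    [/\ weakly_diff [:: j; j] w,
        ae_eq_cube
          (fun x => (b x - a x) / tau - 2^-1 * wpartial [:: j; j] w x) (cst 0) &
        zero_trace j b] in
  exists xi eta zeta : vector_field R 3, forall i,
    [/\ [/\ weakly_diff [:: i] q,
            forall j, weakly_diff [:: j; j] (uk i),
            L2 (xi i),
            ae_eq_cube
              (fun x => (xi i x - uk i x) / tau - wlaplacian (uk i) x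
                        + wpartial [:: i] q x) (F i) &
            forall x, cube_boundary x -> xi i x = 0],
        half_implicit ex (xi i) (eta i) (uk i),
        half_implicit ey (eta i) (zeta i) (uk i) &
        half_implicit ez (zeta i) (uk1 i) (uk i)].

Definition velocity_step (d : nat) :
    R -> vector_field R d -> scalar_field R d ->
    vector_field R d -> vector_field R d -> Prop :=
  match d with
  | 2 => velocity_step2
  | 3 => velocity_step3
  | _ => fun _ _ _ _ _ => False
  end.

Definition half_time (tau : R) (k : nat) : R := (k%:R + 2^-1) * tau.

(* [U k], [P k] and [Phi k] stand for the velocity at time [k tau] and for the
   pressure and its increment at time [(k - 1/2) tau]. *)
Definition splitting_scheme (d : nat) (chi T tau : R)
    (f : R -> vector_field R d) (u0 : vector_field R d)
    (p0 phi0 : scalar_field R d) (U : nat -> vector_field R d)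
    (P Phi : nat -> scalar_field R d) : Prop :=
  [/\ U 0%N = u0, P 0%N = p0, Phi 0%N = phi0 &
      forall k, half_time tau k <= T ->
      let pstar : scalar_field R d := fun x => P k x + Phi k x in
      let ubar : vector_field R d := fun i x => (U k.+1 i x + U k i x) / 2 in
      [/\ velocity_step tau (f (half_time tau k)) pstar (U k) (U k.+1),
          exists g, is_div (U k.+1) g,
          is_A (Phi k.+1) (fun x => - tau^-1 * div (U k.+1) x) &
          ae_eq_cube (P k.+1)
            (fun x => P k x + Phi k.+1 x - chi * div ubar x)]].

(* The number [K] of steps is the ceiling of [T / tau]. *)
Definition nb_steps (T tau : R) : nat := `|Num.ceil (T / tau)|%N.

Definition pressure_error (d : nat) (tau : R) (p : R -> scalar_field R d)
    (P : nat -> scalar_field R d) (k : nat) : scalar_field R d :=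
  fun x => p (half_time tau k) x - P k.+1 x.

Definition l2_norm_triangle (d : nat) (T tau : R)
    (eps : nat -> scalar_field R d) : \bar R :=
  poweR (tau%:E *
    \sum_(0 <= k < nb_steps T tau | (half_time tau k <= T)%R)
      norm_triangle tau (eps k) ^+ 2)%E 2^-1.

End scheme.

(* Main.v *)
(* Expand the velocity error in the sine basis and the pressure error in the
   cosine basis of the cube: every operator of the scheme is then diagonal,
   except for the gradient, which after scaling by the symbol of A^(1/2) is a
   contraction G. The discrete errors thus satisfy
     (1 + beta) (e' - e) + kappa / 2 (e' + e) + G (predicted q) = O(tau^3),
     q' - q = G^T e' + r,
   with beta = tau^2 / 4 B and kappa = - tau Lap. An energy argument gives
   sum |e' - e|^2 + sum |q' - q|^2 = O(tau^3), sum kappa |e' + e|^2 = O(tau^2)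
   and beta |e|^2 = O(tau^2). The momentum equation, tested against an element
   of Z, then bounds the gradient of the pressure error. The consistency errors
   are bounded by duality: a weak bound on the m-th time derivative bounds the
   m-th differences of every coefficient. *)

From HB Require Import structures.
From mathcomp Require Import all_boot all_order all_algebra.
From mathcomp Require Import all_classical all_reals all_analysis.
From mathcomp Require Import measurable_realfun ring lra.
Set Implicit Arguments.
Unset Strict Implicit.
Unset Printing Implicit Defensive.
Import Order.TTheory GRing.Theory Num.Theory.
Import numFieldNormedType.Exports.
Local Open Scope classical_set_scope.
Local Open Scope ring_scope.
Require Import Defs.

(** * Quadratic sums over finite index types *)

Section finite_vectors.
Context (R : realType).
Implicit Types I J : finType.

(** Velocities expand in sines and pressures in cosines, so the gradient couples all modes. The
    energy argument is run on finite truncations whose errors are pushed below the consistency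
    errors; its bounds do not depend on the truncation and pass to the limit.

    The pressure is extrapolated, which puts the negative term [- sq (z k)] into the energy.
    Coercivity is saved only by the contraction property, that is, by the fact that the symbol of
    the Laplacian is below the symbol of [A].

    Tested against [Z], the momentum equation bounds [tau] times the pressure error by the
    increments of the velocity error. The rate [tau] therefore needs squared increments that sum to
    order [tau ^+ 3], one power better than what the energy of the errors themselves gives.

    Boundary conditions and differential equations are all weak. They reach the coefficients through
    one principle, [ip_extension], which carries an identity against test functions over to
    trigonometric functions. Conversely, [vanish_sum] reads a zero trace off the decay of sine
    coefficients. *)

Definition sq I (u : I -> R) : R := \sum_i u i ^+ 2.
Definition dot I (u v : I -> R) : R := \sum_i u i * v i.

Lemma sq_ge0 I (u : I -> R) : 0 <= sq u.
Proof. by apply: sumr_ge0 => i _; exact: sqr_ge0. Qed.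

Lemma dot_CS2 I (u v : I -> R) : dot u v ^+ 2 <= sq u * sq v.
Proof.
have [v0|v0] := eqVneq (sq v) 0.
  have vi i : v i = 0.
    apply/eqP; rewrite -sqrf_eq0; move/eqP: v0.
    rewrite psumr_eq0 => [/allP/(_ i)|j _]; last exact: sqr_ge0.
    by rewrite mem_index_enum => /(_ isT).
  rewrite v0 mulr0 /dot big1 ?expr0n// => i _.
  by rewrite vi mulr0.
have vp : 0 < sq v by rewrite lt_def v0 sq_ge0.
have : 0 <= sq (fun i => sq v * u i - dot u v * v i) by exact: sq_ge0.
have aux b c : sq (fun i => b * u i - c * v i) =
    b ^+ 2 * sq u - 2 * b * c * dot u v + c ^+ 2 * sq v.
  rewrite /sq /dot !mulr_sumr -sumrB -big_split/=.
  by apply: eq_bigr => i _; ring.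
have -> : sq (fun i => sq v * u i - dot u v * v i) =
    sq v * (sq u * sq v - dot u v ^+ 2) by rewrite aux; ring.
by rewrite pmulr_rge0// subr_ge0.
Qed.

Lemma dot_CS I (u v : I -> R) (a b : R) : 0 <= a -> 0 <= b ->
  sq u <= a ^+ 2 -> sq v <= b ^+ 2 -> `|dot u v| <= a * b.
Proof.
move=> a0 b0 ua vb.
rewrite -(ler_pXn2r (n:=2))// ?nnegrE ?mulr_ge0// -normrX ger0_norm ?sqr_ge0//.
apply: (le_trans (dot_CS2 u v)); rewrite exprMn.
by apply: ler_pM => //; exact: sq_ge0.
Qed.

Lemma sqD_le2 I (u v : I -> R) : sq (fun i => u i + v i) <= 2 * sq u + 2 * sq v.
Proof.
rewrite /sq !mulr_sumr -big_split/=; apply: ler_sum => i _.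
have := sqr_ge0 (u i - v i); lra.
Qed.

Lemma sqB_le2 I (u v : I -> R) : sq (fun i => u i - v i) <= 2 * sq u + 2 * sq v.
Proof.
rewrite /sq !mulr_sumr -big_split/=; apply: ler_sum => i _.
have := sqr_ge0 (u i + v i); lra.
Qed.

End finite_vectors.

(** * The discrete energy and its increments for an abstract contraction *)

Section energy.
Context (R : realType) (I J : finType) (G : I -> J -> R) (kap bet : I -> R).
Context (kap0 : forall i, 0 <= kap i).
Context (bet0 : forall i, 0 <= bet i).

Definition wsq (w u : I -> R) : R := \sum_i w i * u i ^+ 2.
Definition mulG (q : J -> R) (i : I) : R := \sum_j G i j * q j.
Definition tmulG (e : I -> R) (j : J) : R := \sum_i e i * G i j.
Context (Gcontr : forall e, sq (tmulG e) <= sq e).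

Lemma wsq_ge0 w u : (forall i, 0 <= w i) -> 0 <= wsq w u.
Proof. by move=> w0; apply: sumr_ge0 => i _; rewrite mulr_ge0// sqr_ge0. Qed.

Lemma dot_mulG e q : dot e (mulG q) = dot (tmulG e) q.
Proof.
rewrite /dot /mulG /tmulG.
under eq_bigr do rewrite mulr_sumr.
rewrite exchange_big/=; apply: eq_bigr => j _.
by rewrite mulr_suml; apply: eq_bigr => i _; rewrite mulrA.
Qed.

Lemma tmulGD e e' j : tmulG (fun i => e i + e' i) j = tmulG e j + tmulG e' j.
Proof. by rewrite -big_split/=; apply: eq_bigr => i _; rewrite mulrDl. Qed.

Lemma tmulGB e e' j : tmulG (fun i => e i - e' i) j = tmulG e j - tmulG e' j.
Proof. by rewrite -sumrB/=; apply: eq_bigr => i _; rewrite mulrBl. Qed.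

(** A matrix and its transpose have the same operator norm: Cauchy-Schwarz is applied to
    [tmulG (mulG q)] and [q], whose product is [sq (mulG q)]. *)
Lemma mulG_contr q : sq (mulG q) <= sq q.
Proof.
have [->|n0] := eqVneq (sq (mulG q)) 0; first exact: sq_ge0.
have p0 : 0 < sq (mulG q) by rewrite lt_def n0 sq_ge0.
rewrite -(ler_pM2l p0).
have e1 : dot (tmulG (mulG q)) q = sq (mulG q).
  by rewrite -dot_mulG; apply: eq_bigr => i _; rewrite expr2.
have := dot_CS2 (tmulG (mulG q)) q.
rewrite e1 expr2 => /le_trans; apply; apply: ler_wpM2r; first exact: sq_ge0.
exact: Gcontr.
Qed.

Section run.
Context (n : nat) (e : nat -> I -> R) (F : nat -> I -> R)
  (q z s r : nat -> J -> R).

Context (momentum : forall k, (k < n)%N -> forall i,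
  (1 + bet i) * (e k.+1 i - e k i) + kap i / 2 * (e k.+1 i + e k i)
  + mulG (fun j => q k j + z k j + s k j) i = F k i).
Context (zE : forall k, (k <= n)%N -> forall j, z k j = tmulG (e k) j + r k j).
Context (qE : forall k, (k < n)%N -> forall j, q k.+1 j = q k j + z k.+1 j).

(** In the recursion [q k - z k] is the pressure one step earlier, so the last term averages the
    pressure over two levels. The negative term is the price of extrapolating the pressure by
    [z k]. *)
Definition energy k : R := sq (e k) + wsq bet (e k) - sq (z k)
  + 2^-1 * (sq (q k) + sq (fun j => q k j - z k j)).

(** The momentum equation is tested with [e k.+1 + e k]. Moving [G] to the other side turns this
    into [z k.+1 + z k], up to [r]. Its product with the extrapolated pressure [q k + z k] is an
    exact difference plus half the square of [z k.+1 + z k], a numerical dissipation that later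
    absorbs [s]. *)
Lemma energy_step k : (k < n)%N ->
  energy k.+1 - energy k + 2^-1 * wsq kap (fun i => e k.+1 i + e k i)
   + 2^-1 * sq (fun j => z k.+1 j + z k j) =
  dot (fun i => e k.+1 i + e k i) (F k)
  + dot (fun j => r k.+1 j + r k j) (fun j => q k j + z k j + s k j)
  - dot (s k) (fun j => z k.+1 j + z k j).
Proof.
move=> kn.
set ee := fun i => e k.+1 i + e k i.
set Q := fun j => q k j + z k j + s k j.
have H : dot ee (F k) = sq (e k.+1) + wsq bet (e k.+1) - (sq (e k) + wsq bet (e k))
   + 2^-1 * wsq kap ee + dot (tmulG ee) Q.
  rewrite -dot_mulG /sq /dot /wsq !mulr_sumr -!big_split/= -sumrB -!big_split/=.
  apply: eq_bigr => i _; rewrite -(momentum kn i) /ee -/Q.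
  by set g := mulG Q i; field.
have H2 : dot (tmulG ee) Q = dot (fun j => z k.+1 j + z k j) Q
    - dot (fun j => r k.+1 j + r k j) Q.
  rewrite /dot -sumrB; apply: eq_bigr => j _.
  rewrite tmulGD (zE (ltnW kn)) (zE kn); ring.
rewrite H H2 /energy.
suff -> : dot (fun j => z k.+1 j + z k j) Q =
   2^-1 * (sq (q k.+1) + sq (fun j => q k.+1 j - z k.+1 j)) - sq (z k.+1)
   - (2^-1 * (sq (q k) + sq (fun j => q k j - z k j)) - sq (z k))
   + 2^-1 * sq (fun j => z k.+1 j + z k j)
   + dot (s k) (fun j => z k.+1 j + z k j) by ring.
rewrite /sq /dot !mulrDr !mulr_sumr -!big_split/= -!sumrB -!big_split/=.
by apply: eq_bigr => j _; rewrite (qE kn) /Q; field.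
Qed.

Definition size2 k : R := sq (e k) + wsq bet (e k) + sq (q k)
  + sq (fun j => q k j - z k j).

(** The two bounds on [sq (z k)], one through [e] and one through the two pressures, can be mixed
    with weights 7/8 and 1/8: the first then uses 29/32 of [sq (e k)], the second one half of the
    pressure terms, and [r] costs less than 26 times [rho ^+ 2]. *)
Lemma size2_energy k (rho : R) : (k <= n)%N -> 0 <= rho -> sq (r k) <= rho ^+ 2 ->
  size2 k <= 16 * (energy k + 26 * rho ^+ 2).
Proof.
move=> kn rho0 hr.
have z1 : sq (z k) <= sq (tmulG (e k)) + 2 * dot (tmulG (e k)) (r k) + sq (r k).
  rewrite /sq /dot !mulr_sumr -!big_split/=; apply: ler_sum => j _.
  rewrite (zE kn); lra.
have z2 : sq (z k) <= 2 * sq (q k) + 2 * sq (fun j => q k j - z k j).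
  apply: le_trans (sqB_le2 (q k) (fun j => q k j - z k j)).
  by apply: ler_sum => j _; rewrite opprB addrC subrK.
have d1 : 2 * dot (tmulG (e k)) (r k) <= 28^-1 * sq (e k) + 28 * rho ^+ 2.
  have : 2 * dot (tmulG (e k)) (r k) <= 28^-1 * sq (tmulG (e k)) + 28 * sq (r k).
    rewrite /sq /dot !mulr_sumr -!big_split/=; apply: ler_sum => j _.
    have := sqr_ge0 (tmulG (e k) j - 28 * r k j); lra.
  have := Gcontr (e k); lra.
have := Gcontr (e k).
have := wsq_ge0 (e k) bet0; have := sq_ge0 (e k); have := sq_ge0 (q k).
have := sq_ge0 (fun j => q k j - z k j).
rewrite /size2 /energy.
move: (wsq _ _) (sq (e k)) (sq (tmulG _)) (sq (q k)) (sq (fun _ => _)) d1 z1 z2.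
move=> W E T Q Q'; move: hr; move: (dot _ _) (sq (z k)) (sq (r k)) (rho ^+ 2).
by move=> D Z RR P hr d1 z1 z2 q' qq ee w te; lra.
Qed.

(** No exponential factor appears: the sources are tested against quantities bounded by the largest
    size of the run, so the energy at that index is at most linear in its square root [m] and is
    absorbed by [m ^+ 2]. Only the sum [Phi] of the sources matters, so a few of them may be larger
    than the others. *)
Lemma energy_bound (f rho sigma : nat -> R) (Phi X0 : R) :
  (forall k, [/\ 0 <= f k, 0 <= rho k & 0 <= sigma k]) ->
  (forall k, (k < n)%N -> sq (F k) <= f k ^+ 2) ->
  (forall k, (k <= n)%N -> sq (r k) <= rho k ^+ 2) ->
  (forall k, (k < n)%N -> sq (s k) <= sigma k ^+ 2) ->
  (forall k, (k <= n)%N -> rho k <= Phi) ->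
  \sum_(0 <= k < n) (f k + sigma k + rho k + rho k.+1) <= Phi ->
  0 <= X0 -> energy 0 <= X0 ->
  [/\ forall k, (k <= n)%N -> size2 k <= 32 * 10 ^+ 2 * (X0 + Phi ^+ 2),
     \sum_(0 <= k < n) wsq kap (fun i => e k.+1 i + e k i)
       <= 2 * 10 ^+ 4 * (X0 + Phi ^+ 2) &
     \sum_(0 <= k < n) sq (fun j => z k.+1 j + z k j)
       <= 2 * 10 ^+ 4 * (X0 + Phi ^+ 2)].
Proof.
move=> fp hF hr hs rhoP PhiE X00 E0.
have Phi0 : 0 <= Phi by apply: le_trans (rhoP 0%N _); [by have [] := fp 0%N|].
have size0 k : 0 <= size2 k.
  by rewrite /size2 !addr_ge0// ?sq_ge0//; exact: wsq_ge0.
pose k0 : 'I_n.+1 := [arg max_(i > ord0) size2 i]%O.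
have k0P : forall k, (k <= n)%N -> size2 k <= size2 k0.
  move=> k kn; rewrite /k0; case: (@Order.TotalTheory.arg_maxP) => //= i _ /(_ (Ordinal (kn : (k < n.+1)%N))).
  exact.
pose m := Num.sqrt (size2 k0).
have m0 : 0 <= m by exact: sqrtr_ge0.
have mE : m ^+ 2 = size2 k0 by rewrite sqr_sqrtr.
have em k : (k <= n)%N -> sq (e k) <= m ^+ 2.
  move=> /k0P; rewrite mE; apply: le_trans; rewrite /size2 -!addrA lerDl.
  by rewrite !addr_ge0 ?sq_ge0//; exact: wsq_ge0.
have qm k : (k <= n)%N -> sq (q k) <= m ^+ 2.
  move=> /k0P; rewrite mE; apply: le_trans.
  have := wsq_ge0 (e k) bet0; have := sq_ge0 (e k).
  have := sq_ge0 (fun j => q k j - z k j); rewrite /size2; lra.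
have zm k : (k <= n)%N -> sq (z k) <= (2 * m) ^+ 2.
  move=> kn; have := k0P _ kn; rewrite exprMn mE.
  have := wsq_ge0 (e k) bet0; have := sq_ge0 (e k).
  have : sq (z k) <= 2 * sq (q k) + 2 * sq (fun j => q k j - z k j).
    apply: le_trans (sqB_le2 (q k) (fun j => q k j - z k j)).
    by apply: ler_sum => j _; rewrite opprB addrC subrK.
  have := size0 k; rewrite /size2; lra.
have sP k : (k < n)%N -> sigma k <= Phi.
  move=> kn; apply: le_trans PhiE; rewrite (bigD1_seq k)/= ?mem_index_iota ?iota_uniq//.
  have [? ? ?] := fp k; have [? ? ?] := fp k.+1.
  rewrite -!addrA addrCA lerDl !addr_ge0// sumr_ge0// => i _.
  by have [? ? ?] := fp i; have [? ? ?] := fp i.+1; rewrite !addr_ge0.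
pose diss k := 2^-1 * wsq kap (fun i => e k.+1 i + e k i)
    + 4^-1 * sq (fun j => z k.+1 j + z k j).
have step k : (k < n)%N -> energy k.+1 + diss k <=
    energy k + (3 * m + Phi) * (f k + sigma k + rho k + rho k.+1).
  move=> kn; have := energy_step kn.
  have [f0 r0 s0] := fp k; have [_ r1 _] := fp k.+1.
  have d1 : dot (fun i => e k.+1 i + e k i) (F k) <= 2 * m * f k.
    have -> : dot (fun i => e k.+1 i + e k i) (F k) = dot (e k.+1) (F k) + dot (e k) (F k).
      by rewrite /dot -big_split/=; apply: eq_bigr => i _; rewrite mulrDl.
    have := ler_norm (dot (e k.+1) (F k)); have := ler_norm (dot (e k) (F k)).
    have := dot_CS m0 f0 (em _ (ltnW kn)) (hF _ kn).
    have := dot_CS m0 f0 (em _ kn) (hF _ kn); lra.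
  have dr l : (l <= n)%N ->
      dot (r l) (fun j => q k j + z k j + s k j) <= (3 * m + Phi) * rho l.
    move=> ln; have [_ rl _] := fp l.
    have -> : dot (r l) (fun j => q k j + z k j + s k j) =
        dot (r l) (q k) + dot (r l) (z k) + dot (r l) (s k).
      by rewrite /dot -!big_split/=; apply: eq_bigr => i _; rewrite !mulrDr.
    have := ler_norm (dot (r l) (q k)); have := ler_norm (dot (r l) (z k)).
    have := ler_norm (dot (r l) (s k)).
    have := dot_CS rl m0 (hr _ ln) (qm _ (ltnW kn)).
    have := dot_CS rl (mulr_ge0 (ler0n _ 2) m0) (hr _ ln) (zm _ (ltnW kn)).
    have := dot_CS rl s0 (hr _ ln) (hs _ kn).
    have : rho l * sigma k <= rho l * Phi by rewrite ler_wpM2l// sP.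
    lra.
  have -> : dot (fun j => r k.+1 j + r k j) (fun j => q k j + z k j + s k j) =
     dot (r k.+1) (fun j => q k j + z k j + s k j)
      + dot (r k) (fun j => q k j + z k j + s k j).
    by rewrite /dot -big_split/=; apply: eq_bigr => i _; rewrite mulrDl.
  have d2 := dr _ kn; have d3 := dr _ (ltnW kn).
  (* One half of the dissipation of [energy_step] pays for [s]; the other half stays in [diss]. *)
  have d4 : - dot (s k) (fun j => z k.+1 j + z k j) <=
      sq (s k) + 4^-1 * sq (fun j => z k.+1 j + z k j).
    rewrite /dot /sq mulr_sumr -sumrN -big_split/=; apply: ler_sum => j _.
    have := sqr_ge0 (s k j + 2^-1 * (z k.+1 j + z k j)); lra.
  have d5 : sq (s k) <= Phi * sigma k.
    by apply: le_trans (hs _ kn) _; rewrite expr2 ler_wpM2r// sP.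
  have := mulr_ge0 m0 f0; have := mulr_ge0 Phi0 f0; have := mulr_ge0 m0 s0.
  rewrite /diss; lra.
have tot k : (k <= n)%N -> energy k + \sum_(0 <= l < k) diss l <=
    X0 + (3 * m + Phi) * \sum_(0 <= l < k) (f l + sigma l + rho l + rho l.+1).
  elim: k => [_|k IH kn]; first by rewrite !big_geq// mulr0 !addr0.
  have := IH (ltnW kn); have := step _ kn.
  rewrite !(@big_nat_recr _ _ _ k 0%N)//= (mulrDr (3 * m + Phi)); lra.
have tot' k : (k <= n)%N -> energy k + \sum_(0 <= l < k) diss l <=
    X0 + (3 * m + Phi) * Phi.
  move=> kn; apply: (le_trans (tot k kn)); rewrite lerD2l ler_wpM2l ?addr_ge0 ?mulr_ge0//.
  apply: le_trans PhiE; rewrite [leRHS](@big_cat_nat _ _ _ k)//= lerDl sumr_ge0// => i _.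
  by have [? ? ?] := fp i; have [? ? ?] := fp i.+1; rewrite !addr_ge0.
have diss0 l : 0 <= diss l.
  by rewrite /diss addr_ge0// mulr_ge0 ?invr_ge0// ?sq_ge0//; exact: wsq_ge0.
have Sdiss0 k : 0 <= \sum_(0 <= l < k) diss l by rewrite sumr_ge0.
have coer k : (k <= n)%N -> size2 k <= 16 * (energy k + 26 * Phi ^+ 2).
  by move=> kn; apply: size2_energy => //; apply: (le_trans (hr _ kn));
     rewrite ler_pXn2r ?nnegrE ?rhoP//; have [] := fp k.
(* At the maximal index, [m ^+ 2] is at most [16 * X0 + 48 * m * Phi + 432 * Phi ^+ 2]. Splitting
   the middle term with the square of [m - 48 * Phi] gives the constants 32 and 3168. *)
have mb : m ^+ 2 <= 32 * 10 ^+ 2 * (X0 + Phi ^+ 2).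
  have kn : (k0 <= n)%N by rewrite -ltnS.
  rewrite {1}mE; have := coer _ kn; have := tot' _ kn; have := Sdiss0 k0.
  rewrite -mE; have := sqr_ge0 (m - 48 * Phi); have := sqr_ge0 Phi; have := sqr_ge0 m.
  lra.
have dissb : \sum_(0 <= l < n) diss l <= 5 * 10 ^+ 3 * (X0 + Phi ^+ 2).
  have := tot' n (leqnn n); have := coer n (leqnn n); have := size0 n.
  have := sqr_ge0 (m - 2 * Phi); have := sqr_ge0 Phi; have := sqr_ge0 m; lra.
split=> [k kn||].
- by apply: (le_trans (k0P _ kn)); rewrite -mE.
- suff : \sum_(0 <= k < n) wsq kap (fun i => e k.+1 i + e k i) <=
      2 * \sum_(0 <= l < n) diss l by have := sqr_ge0 Phi; lra.
  rewrite mulr_sumr; apply: ler_sum => k _.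
  have := sq_ge0 (fun j => z k.+1 j + z k j); rewrite /diss; lra.
- suff : \sum_(0 <= k < n) sq (fun j => z k.+1 j + z k j) <=
      4 * \sum_(0 <= l < n) diss l by have := sqr_ge0 Phi; lra.
  rewrite mulr_sumr; apply: ler_sum => k _.
  have := wsq_ge0 (fun i => e k.+1 i + e k i) kap0; rewrite /diss; lra.
Qed.

(* Testing the homogeneous equation with the increment of [e]; the increments of
   [z] that summation by parts produces are absorbed since [tmulG] is a
   contraction. *)
Lemma increment_bound (X0 : R) :
  (forall k, (k < n)%N -> F k = cst 0) -> (forall k, (k < n)%N -> s k = cst 0) ->
  (forall k, (k <= n)%N -> r k = cst 0) ->
  0 <= X0 -> energy 0 <= X0 -> wsq kap (e 0) <= X0 -> sq (z 0) <= X0 ->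
  sq (q 0) <= X0 ->
  \sum_(0 <= k < n) sq (fun i => e k.+1 i - e k i) <= 2 * 10 ^+ 5 * X0 /\
  \sum_(0 <= k < n) sq (z k.+1) <= 2 * 10 ^+ 5 * X0.
Proof.
move=> hF hs hr X00 E0 K0 z0 q0.
have [] := @energy_bound (cst 0) (cst 0) (cst 0) 0 X0.
- by move=> k.
- by move=> k kn; rewrite hF// /sq big1 => [|i _]; rewrite /= expr0n.
- by move=> k kn; rewrite hr// /sq big1 => [|i _]; rewrite /= expr0n.
- by move=> k kn; rewrite hs// /sq big1 => [|i _]; rewrite /= expr0n.
- by [].
- by rewrite big1// => i _; rewrite !addr0.
- by [].
- by [].
rewrite expr0n addr0 => hsize _ hz.
have zE' k : (k <= n)%N -> forall j, z k j = tmulG (e k) j.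
  by move=> kn j; rewrite zE// hr//= addr0.
have dzde k : (k < n)%N ->
    sq (fun j => z k.+1 j - z k j) <= sq (fun i => e k.+1 i - e k i).
  move=> kn; apply: le_trans (Gcontr _); apply: ler_sum => j _.
  by rewrite tmulGB zE'// zE'// ltnW.
have step k : (k < n)%N ->
    sq (fun i => e k.+1 i - e k i) + 2^-1 * wsq kap (e k.+1)
      + dot (q k.+1) (z k.+1) + 2^-1 * sq (z k.+1) <=
    2^-1 * wsq kap (e k) + dot (q k) (z k) + 2^-1 * sq (z k)
     + sq (z k.+1) + 2^-1 * sq (fun j => z k.+1 j - z k j).
  move=> kn.
  have H : 0 = sq (fun i => e k.+1 i - e k i) + wsq bet (fun i => e k.+1 i - e k i)
     + 2^-1 * (wsq kap (e k.+1) - wsq kap (e k))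
     + dot (tmulG (fun i => e k.+1 i - e k i)) (fun j => q k j + z k j + s k j).
    transitivity (dot (fun i => e k.+1 i - e k i) (F k)).
      by rewrite hF// /dot big1// => i _; rewrite mulr0.
    rewrite -dot_mulG /sq /dot /wsq -sumrB !mulr_sumr -!big_split/=.
    apply: eq_bigr => i _; rewrite -(momentum kn i).
    by set g := mulG _ i; field.
  (* Summation by parts in [k]: the transpose maps the increment of [e] to that of [z], and [q k.+1]
     is [q k + z k.+1]. *)
  have H2 : dot (tmulG (fun i => e k.+1 i - e k i)) (fun j => q k j + z k j + s k j) =
     dot (q k.+1) (z k.+1) - dot (q k) (z k) - sq (z k.+1)
     + 2^-1 * (sq (z k.+1) - sq (z k) - sq (fun j => z k.+1 j - z k j)).
    rewrite /sq /dot -!sumrB !mulr_sumr -!big_split/=.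
    apply: eq_bigr => j _.
    by rewrite tmulGB -!zE'// ?(ltnW kn)// hs//= qE//; field.
  rewrite H2 in H; have := wsq_ge0 (fun i => e k.+1 i - e k i) bet0; lra.
(* With [dzde], the right side of [step] then costs 1/2 + 3/8 of the squared increment of [e], and
   one eighth survives. The sums [z k.+1 + z k] are the dissipation already bounded by
   [energy_bound]. *)
have zsum k : (k < n)%N -> sq (z k.+1) <=
    3 / 8 * sq (fun j => z k.+1 j - z k j) + 3 / 4 * sq (fun j => z k.+1 j + z k j).
  move=> kn; rewrite /sq !mulr_sumr -big_split/=; apply: ler_sum => j _.
  have := sqr_ge0 (z k.+1 j + 3 * z k j); lra.
pose D k := \sum_(0 <= l < k) sq (fun i => e l.+1 i - e l i).
pose ZZ k := \sum_(0 <= l < k) sq (fun j => z l.+1 j + z l j).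
have tot k : (k <= n)%N -> 8^-1 * D k + 2^-1 * wsq kap (e k)
      + dot (q k) (z k) + 2^-1 * sq (z k) <=
    2^-1 * wsq kap (e 0) + dot (q 0) (z 0) + 2^-1 * sq (z 0) + 3 / 4 * ZZ k.
  rewrite /D /ZZ; elim: k => [_|k IH kn]; first by rewrite !big_geq//; lra.
  have := IH (ltnW kn); have := step _ kn; have := zsum _ kn; have := dzde _ kn.
  rewrite !(@big_nat_recr _ _ _ k 0%N)//= ; lra.
have dotb (u v : J -> R) : `|dot u v| <= 2^-1 * sq u + 2^-1 * sq v.
  rewrite ler_norml; apply/andP; split.
    rewrite /dot /sq -subr_ge0 opprK !mulr_sumr -!big_split/=; apply: sumr_ge0 => j _.
    have := sqr_ge0 (u j + v j); lra.
  rewrite /dot /sq -subr_ge0 !mulr_sumr -big_split -sumrB/=; apply: sumr_ge0 => j _.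
  have := sqr_ge0 (u j - v j); lra.
have Db : D n <= 2 * 10 ^+ 5 * X0.
  have := tot n (leqnn n); have := wsq_ge0 (e n) kap0; have := sq_ge0 (z n).
  have := hsize n (leqnn n); rewrite /size2.
  have := wsq_ge0 (e n) bet0; have := sq_ge0 (e n).
  have := sq_ge0 (fun j => q n j - z n j).
  have : sq (z n) <= 2 * sq (q n) + 2 * sq (fun j => q n j - z n j).
    apply: le_trans (sqB_le2 (q n) (fun j => q n j - z n j)).
    by apply: ler_sum => j _; rewrite opprB addrC subrK.
  have := dotb (q n) (z n); have := ler_norm (- dot (q n) (z n)); rewrite normrN.
  have := dotb (q 0) (z 0); have := ler_norm (dot (q 0) (z 0)).
  move: hz; rewrite -/(ZZ n); lra.
split; first by rewrite -/(D n); lra.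
have : \sum_(0 <= k < n) sq (z k.+1) <= 3 / 8 * D n + 3 / 4 * ZZ n.
  rewrite /D /ZZ !mulr_sumr -big_split/= big_nat_cond [leRHS]big_nat_cond.
  apply: ler_sum => k; rewrite andbT => /= kn.
  have := zsum k kn; have := dzde k kn; lra.
move: hz; rewrite -/(ZZ n); lra.
Qed.

End run.
End energy.

(** * Stability of the error recursion, first step included *)

Section stability.
Context (R : realType) (I J : finType) (G : I -> J -> R) (kap bet : I -> R).
Context (kap0 : forall i, 0 <= kap i).
Context (bet0 : forall i, 0 <= bet i).
Context (Gcontr : forall e, sq (tmulG G e) <= sq e).

(** Without sources a step is explicit: the implicit part is diagonal and the pressure enters
    through known values only. *)
Definition homogeneous_step (x : (I -> R) * (J -> R)) : (I -> R) * (J -> R) :=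
  let e1 := fun i => ((1 + bet i - kap i / 2) * x.1 i
     - mulG G (fun j => x.2 j + tmulG G x.1 j) i) / (1 + bet i + kap i / 2) in
  (e1, fun j => x.2 j + tmulG G e1 j).

(** Starting from [q = tmulG G e1] amounts to a zero pressure error one step earlier, so [q - z]
    vanishes in the initial energy. *)
Definition homogeneous_run (e1 : I -> R) (k : nat) : (I -> R) * (J -> R) :=
  iter k homogeneous_step (e1, tmulG G e1).

Lemma homogeneous_runP e1 (e := fun k => (homogeneous_run e1 k).1)
    (q := fun k => (homogeneous_run e1 k).2) k :
  (forall i, (1 + bet i) * (e k.+1 i - e k i) + kap i / 2 * (e k.+1 i + e k i)
     + mulG G (fun j => q k j + tmulG G (e k) j + 0) i = 0) /\
  forall j, q k.+1 j = q k j + tmulG G (e k.+1) j.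
Proof.
split=> // i; rewrite /e /q /homogeneous_run iterS.
case: (iter k _ _) => e0 q0 /=.
rewrite (_ : mulG G (fun j => _ + 0) i = mulG G (fun j => q0 j + tmulG G e0 j) i).
  set g := mulG _ _ _.
  have D0 : 1 + bet i + kap i / 2 != 0.
    by rewrite gt_eqF// -addrA ltr_pwDl// addr_ge0// divr_ge0.
  set X := _ - g; set D := 1 + _ + _ in D0 *.
  transitivity (D * (X / D) - X); last by rewrite mulrCA divff// mulr1 subrr.
  by rewrite /X /D; set Y := _ / _; field.
by apply: eq_bigr => j _; rewrite addr0.
Qed.

Lemma mulGB (u v : J -> R) i :
  mulG G (fun j => u j - v j) i = mulG G u i - mulG G v i.
Proof. by rewrite -sumrB; apply: eq_bigr => j _; rewrite mulrBr. Qed.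

(* The initial pressure error, of order [tau] in [L^2] only, makes [e 1] of order
   [tau ^ (3 / 2)]; the consistency error makes the energy of [e] of order
   [tau ^ 2] only, but that of its increments of order [tau ^ 4]. Hence [e] is
   split into the homogeneous solution that starts from [e 1], whose increments
   are controlled by [increment_bound], and a remainder that vanishes at time 1,
   whose increments are controlled by their energy. *)
Lemma splitting_stability (C0 : R) (n : nat) (tau : R)
    (e F : nat -> I -> R) (q z s r : nat -> J -> R)
    (C := 5 * 10 ^+ 9 * C0 ^+ 6) :
  1 <= C0 -> 0 < tau -> tau <= C0 -> n%:R * tau <= C0 ->
  (forall i, e 0%N i = 0) -> (forall j, q 0%N j = 0) ->
  (forall i, (1 + bet i) * e 1%N i + kap i / 2 * e 1%N i = F 0%N i) ->
  (forall v, dot (F 0%N) v ^+ 2 <= C0 ^+ 2 * tau ^+ 3 * (sq v + wsq kap v)) ->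
  (forall k, (0 < k < n.+1)%N -> forall i,
     (1 + bet i) * (e k.+1 i - e k i) + kap i / 2 * (e k.+1 i + e k i)
       + mulG G (fun j => q k j + z k j + s k j) i = F k i) ->
  (forall k, (0 < k <= n.+1)%N -> forall j, z k j = tmulG G (e k) j + r k j) ->
  (forall k, (k < n.+1)%N -> forall j, q k.+1 j = q k j + z k.+1 j) ->
  (forall k, (0 < k < n.+1)%N -> sq (F k) <= (C0 * tau ^+ 3) ^+ 2) ->
  (forall k, (0 < k <= n.+1)%N -> sq (r k) <= (C0 * tau ^+ 2) ^+ 2) ->
  (forall k, (1 < k < n.+1)%N ->
     sq (fun j => r k.+1 j - r k j) <= (C0 * tau ^+ 3) ^+ 2) ->
  sq (s 1%N) <= (C0 * tau ^+ 2) ^+ 2 ->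
  (forall k, (1 < k < n.+1)%N -> sq (s k) <= (C0 * tau ^+ 3) ^+ 2) ->
  [/\ \sum_(0 <= k < n.+1) sq (fun i => e k.+1 i - e k i) <= C * tau ^+ 3,
      \sum_(0 <= k < n.+1) sq (z k.+1) <= C * tau ^+ 3,
      \sum_(0 <= k < n.+1) wsq kap (fun i => e k.+1 i + e k i) <= C * tau ^+ 2 &
      forall k, (k <= n.+1)%N -> wsq bet (e k) <= C * tau ^+ 2].
Proof.
move=> C1 t0 tC nC e0 q0 eq0 F0 eqk zk qk Fk rk drk s1 sk.
have C00 : 0 < C0 by apply: lt_le_trans C1.
(* A common bound for all the sources: it dominates both [C0 * tau ^+ 2] and [C0 * tau ^+ 3]. *)
pose T := C0 ^+ 2 * tau ^+ 2.
have T0 : 0 <= T by rewrite mulr_ge0 ?exprn_ge0// ltW.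
have t20 : 0 <= tau ^+ 2 by rewrite exprn_ge0// ltW.
have cT1 : C0 * tau ^+ 2 <= T.
  by rewrite /T expr2 -mulrA ler_peMl// mulr_ge0// ltW.
have cT2 : C0 * tau ^+ 3 <= T.
  rewrite /T exprS mulrA [C0 ^+ 2]expr2; apply: ler_wpM2r => //.
  by apply: ler_wpM2l => //; exact: ltW.
have cp2 : 0 <= C0 * tau ^+ 2 by rewrite mulr_ge0// ltW.
have cp3 : 0 <= C0 * tau ^+ 3 by rewrite mulr_ge0 ?exprn_ge0// ltW.
have b2T : (C0 * tau ^+ 2) ^+ 2 <= T ^+ 2 by rewrite lerXn2r.
have b3T : (C0 * tau ^+ 3) ^+ 2 <= T ^+ 2 by rewrite lerXn2r.
have F1T k : (0 < k < n.+1)%N -> sq (F k) <= T ^+ 2 by move=> /Fk h; apply: le_trans h _.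
have r1T k : (0 < k <= n.+1)%N -> sq (r k) <= T ^+ 2 by move=> /rk h; apply: le_trans h _.
have s1T k : (0 < k < n.+1)%N -> sq (s k) <= T ^+ 2.
  by case: k => // -[_|k kn]; [exact: (le_trans s1 b2T)|exact: (le_trans (sk k.+2 kn) b3T)].
have q1 j : q 1%N j = z 1%N j by rewrite qk// q0 add0r.
(* The first equation tested with [e 1]. Its source is controlled by the quantities that make up
   [Y], so one factor [Y] cancels and [Y] is of order [tau ^+ 3]. *)
pose Y := sq (e 1%N) + wsq bet (e 1%N) + 2^-1 * wsq kap (e 1%N).
have YE : Y = dot (F 0%N) (e 1%N).
  rewrite /Y /sq /wsq /dot mulr_sumr -!big_split/=; apply: eq_bigr => i _.
  by rewrite -eq0; field.
have se0 := sq_ge0 (e 1%N); have be0 := wsq_ge0 (e 1%N) bet0.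
have ke0 := wsq_ge0 (e 1%N) kap0.
have t3 : 0 < C0 ^+ 2 * tau ^+ 3 by rewrite mulr_gt0// exprn_gt0.
have Yb : Y <= 2 * (C0 ^+ 2 * tau ^+ 3).
  have [Y0|Y0] := leP Y 0; first by apply: (le_trans Y0); rewrite mulr_ge0// ltW.
  rewrite -(ler_pM2l Y0) -expr2 {1}YE; apply: (le_trans (F0 _)).
  have -> : Y * (2 * (C0 ^+ 2 * tau ^+ 3)) = C0 ^+ 2 * tau ^+ 3 * (2 * Y) by ring.
  by apply: ler_wpM2l; [exact: ltW|rewrite /Y; lra].
have t3t2 : C0 ^+ 2 * tau ^+ 3 <= C0 ^+ 3 * tau ^+ 2.
  have -> : C0 ^+ 2 * tau ^+ 3 = T * tau by rewrite /T; ring.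
  have -> : C0 ^+ 3 * tau ^+ 2 = T * C0 by rewrite /T; ring.
  exact: ler_wpM2l.
have Tt3 m : m%:R * tau <= C0 -> m%:R * T ^+ 2 <= C0 ^+ 5 * tau ^+ 3.
  move=> mC; have -> : m%:R * T ^+ 2 = C0 ^+ 4 * tau ^+ 3 * (m%:R * tau) by rewrite /T; ring.
  have -> : C0 ^+ 5 * tau ^+ 3 = C0 ^+ 4 * tau ^+ 3 * C0 by ring.
  by rewrite ler_wpM2l// mulr_ge0 ?exprn_ge0// ltW.
have C6 m : (m <= 6)%N -> C0 ^+ m <= C0 ^+ 6 by move=> ?; rewrite ler_weXn2l.
have Ct3 m : (m <= 6)%N -> C0 ^+ m * tau ^+ 3 <= C0 ^+ 6 * tau ^+ 3.
  by move=> m6; rewrite ler_wpM2r ?C6// exprn_ge0// ltW.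
have Ct2 m : (m <= 6)%N -> C0 ^+ m * tau ^+ 2 <= C0 ^+ 6 * tau ^+ 2.
  by move=> m6; rewrite ler_wpM2r ?C6// exprn_ge0// ltW.
have C6t3 : 0 <= C0 ^+ 6 * tau ^+ 3 by rewrite mulr_ge0// exprn_ge0// ltW.
have C6t2 : 0 <= C0 ^+ 6 * tau ^+ 2 by rewrite mulr_ge0// exprn_ge0// ltW.
(* The run starts at index 1, since the first step has no predicted pressure in scaled form. At most
   [C0 / tau] steps with four sources of size [T] make [Phi] of order [tau]. *)
have [|||||||||||] := @energy_bound R I J G kap bet kap0 bet0 Gcontr n
   (fun k => e k.+1) (fun k => F k.+1) (fun k => q k.+1) (fun k => z k.+1)
   (fun k => s k.+1) (fun k => r k.+1) _ _ _
   (fun=> T) (fun=> T) (fun=> T) (4 * C0 ^+ 3 * tau) (2 * C0 ^+ 3 * tau ^+ 2).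
- by move=> k kn; apply: eqk.
- by move=> k kn; apply: zk.
- by move=> k kn; apply: qk.
- by move=> k; split.
- by move=> k kn; apply: F1T.
- by move=> k kn; apply: r1T.
- by move=> k kn; apply: s1T.
- move=> k kn; have c2t : 0 <= C0 ^+ 2 * tau by rewrite mulr_ge0 ?exprn_ge0// ltW.
  have -> : T = C0 ^+ 2 * tau * tau by rewrite /T; ring.
  have -> : 4 * C0 ^+ 3 * tau = 4 * (C0 ^+ 2 * tau * C0) by ring.
  have := ler_wpM2l c2t tC; have := mulr_ge0 c2t (ltW C00); lra.
- rewrite sumr_const_nat subn0 -[_ *+ n]mulr_natl.
  have -> : n%:R * (T + T + T + T) = 4 * C0 ^+ 2 * tau * (n%:R * tau) by rewrite /T; ring.
  have -> : 4 * C0 ^+ 3 * tau = 4 * C0 ^+ 2 * tau * C0 by ring.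
  by rewrite ler_wpM2l// !mulr_ge0 ?exprn_ge0// ltW.
- by rewrite mulr_ge0 ?mulr_ge0 ?exprn_ge0// ltW.
- rewrite /energy.
  have -> : sq (q 1%N) = sq (z 1%N) by apply: eq_bigr => j _; rewrite q1.
  have -> : sq (fun j => q 1%N j - z 1%N j) = 0.
    by apply: big1 => j _; rewrite q1 subrr expr0n.
  have := sq_ge0 (z 1%N); rewrite addr0.
  move: Yb t3t2; rewrite /Y; lra.
move=> sizeb kapb _.
have Phi2 : 2 * C0 ^+ 3 * tau ^+ 2 + (4 * C0 ^+ 3 * tau) ^+ 2 <= 18 * (C0 ^+ 6 * tau ^+ 2).
  have := Ct2 3%N isT; have -> : (4 * C0 ^+ 3 * tau) ^+ 2 = 16 * (C0 ^+ 6 * tau ^+ 2) by ring.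
  lra.
have c3 : \sum_(0 <= k < n.+1) wsq kap (fun i => e k.+1 i + e k i) <= C * tau ^+ 2.
  rewrite big_nat_recl//=.
  have -> : wsq kap (fun i => e 1%N i + e 0%N i) = wsq kap (e 1%N).
    by apply: eq_bigr => i _; rewrite e0 addr0.
  have := Ct2 3%N isT; rewrite /C; move: Yb; rewrite /Y; lra.
have c4 k : (k <= n.+1)%N -> wsq bet (e k) <= C * tau ^+ 2.
  case: k => [_|k kn].
    rewrite /wsq big1 => [|i _]; last by rewrite e0 expr0n mulr0.
    by rewrite /C !mulr_ge0// ?exprn_ge0// ltW.
  have := sizeb k kn; rewrite /size2.
  have := sq_ge0 (e k.+1); have := sq_ge0 (q k.+1).
  have := sq_ge0 (fun j => q k.+1 j - z k.+1 j); rewrite /C; lra.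
pose eI k := (homogeneous_run (e 1%N) k).1.
pose qI k := (homogeneous_run (e 1%N) k).2.
pose zI k := tmulG G (eI k).
(* The factor 4 is set by [wsq kap (e 1)], which enters [Y] with weight 1/2. *)
have [|||||||||||hI1 hI2] := @increment_bound R I J G kap bet kap0 bet0 Gcontr n
   eI (fun=> cst 0) qI zI (fun=> cst 0) (fun=> cst 0) _ _ _
   (4 * (C0 ^+ 2 * tau ^+ 3)).
- by move=> k kn i; have [-> _] := homogeneous_runP (e 1%N) k.
- by move=> k kn j; rewrite addr0.
- by move=> k kn j; have [_ h] := homogeneous_runP (e 1%N) k; rewrite /qI h.
- by [].
- by [].
- by [].
- by rewrite mulr_ge0// ltW.
- rewrite /energy /eI /qI /zI/=.
  have -> : sq (fun j => tmulG G (e 1%N) j - tmulG G (e 1%N) j) = 0.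
    by apply: big1 => j _; rewrite subrr expr0n.
  have := sq_ge0 (tmulG G (e 1%N)); rewrite /Y in Yb; lra.
- by move: Yb; rewrite /Y /eI/=; lra.
- by apply: le_trans (Gcontr _) _; move: Yb; rewrite /Y /eI/=; lra.
- by apply: le_trans (Gcontr _) _; move: Yb; rewrite /Y /eI/=; lra.
(* The increments of the remainder solve the same recursion, with [z2] in the role of [q], the
   increments of [z2] in the role of [z], and differenced sources. These are of order [tau ^+ 3]
   after the start, so [Phi] is of order [tau ^+ 2] and each squared increment of order
   [tau ^+ 4]. *)
have rem : forall k, (k < n)%N ->
   sq (fun i => (e k.+2 i - eI k.+1 i) - (e k.+1 i - eI k i)) <= 7 * 10 ^+ 5 * T ^+ 2 /\
   sq (fun j => z k.+2 j - zI k.+1 j) <= 7 * 10 ^+ 5 * T ^+ 2.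
  case: n eqk zk qk Fk rk drk sk nC F1T r1T s1T {kapb hI1 hI2 sizeb c3 c4}
    => // m eqk zk qk Fk rk drk sk nC F1T r1T s1T.
  pose e2 k i := e k.+1 i - eI k i.
  pose z2 k j := z k.+1 j - zI k j.
  have z2E k j : (k <= m.+1)%N -> z2 k j = tmulG G (e2 k) j + r k.+1 j.
    by move=> km; rewrite /z2 /e2 tmulGB zk// addrAC.
  have q2E k j : (k <= m)%N -> q k.+2 j - qI k.+1 j = q k.+1 j - qI k j + z2 k.+1 j.
    move=> km; rewrite qk//; have [_ h] := homogeneous_runP (e 1%N) k.
    have {}h : qI k.+1 j = qI k j + zI k.+1 j := h j.
    by rewrite h /z2; set a := zI _ _; ring.
  have eq2 k i : (k <= m)%N ->
      (1 + bet i) * (e2 k.+1 i - e2 k i) + kap i / 2 * (e2 k.+1 i + e2 k i)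
       + mulG G (fun j => (q k.+1 j - qI k j) + z2 k j + s k.+1 j) i = F k.+1 i.
    move=> km; rewrite -eqk//; have [h _] := homogeneous_runP (e 1%N) k.
    have {}h := h i.
    transitivity ((1 + bet i) * (e k.+2 i - e k.+1 i) + kap i / 2 * (e k.+2 i + e k.+1 i)
       + mulG G (fun j => q k.+1 j + z k.+1 j + s k.+1 j) i - 0); last by rewrite subr0.
    rewrite -h -/(eI k) -/(eI k.+1) -/(qI k).
    have -> : mulG G (fun j => (q k.+1 j - qI k j) + z2 k j + s k.+1 j) i =
        mulG G (fun j => q k.+1 j + z k.+1 j + s k.+1 j) i -
        mulG G (fun j => qI k j + tmulG G (eI k) j + 0) i.
      by rewrite -mulGB; apply: eq_bigr => j _; rewrite /z2 /zI; congr (_ * _); ring.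
    rewrite /e2; set a := mulG _ _ _; set b := mulG _ _ _; ring.
  have e20 i : e2 0%N i = 0 by rewrite /e2 /eI subrr.
  have z20 j : z2 0%N j = r 1%N j.
    by rewrite z2E// /tmulG big1 ?add0r// => i _; rewrite e20 mul0r.
  (* At the start of the remainder both [q] and [z] reduce to [r 1], hence the pressure
     [2 * r 1 + s 1] in the equation of its first increment. *)
  pose W i := F 1%N i - mulG G (fun j => 2 * r 1%N j + s 1%N j) i.
  have d0 i : (1 + bet i + kap i / 2) * e2 1%N i = W i.
    rewrite /W -(eq2 0%N i)// e20.
    rewrite [in RHS](_ : mulG G (fun j => (q 1%N j - qI 0%N j) + z2 0%N j + s 1%N j) i =
      mulG G (fun j => 2 * r 1%N j + s 1%N j) i); first by set a := mulG _ _ _; ring.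
    apply: eq_bigr => j _; congr (_ * _); rewrite z20 q1.
    have := z20 j; rewrite /z2 => /(canRL (subrK _)) ->; rewrite /zI /qI /eI/=; ring.
  have WT : sq W <= 22 * T ^+ 2.
    have := sqB_le2 (F 1%N) (mulG G (fun j => 2 * r 1%N j + s 1%N j)).
    have := mulG_contr Gcontr (fun j => 2 * r 1%N j + s 1%N j).
    have := sqD_le2 (fun j => 2 * r 1%N j) (s 1%N).
    have -> : sq (fun j => 2 * r 1%N j) = 4 * sq (r 1%N).
      by rewrite /sq mulr_sumr; apply: eq_bigr => j _; ring.
    have := F1T 1%N isT; have := r1T 1%N isT; have := s1T 1%N isT; rewrite /W; lra.
  have d0T : sq (e2 1%N) + wsq bet (e2 1%N) <= 22 * T ^+ 2.
    apply: le_trans WT.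
    have : dot W (e2 1%N) <= 2^-1 * sq W + 2^-1 * sq (e2 1%N).
      rewrite /dot /sq !mulr_sumr -big_split/=; apply: ler_sum => i _.
      have := sqr_ge0 (W i - e2 1%N i); lra.
    have -> : dot W (e2 1%N) = sq (e2 1%N) + wsq bet (e2 1%N) + 2^-1 * wsq kap (e2 1%N).
      rewrite /sq /wsq /dot mulr_sumr -!big_split/=; apply: eq_bigr => i _.
      by rewrite -d0; field.
    have := wsq_ge0 (e2 1%N) kap0; have := wsq_ge0 (e2 1%N) bet0; lra.
  have z21 : sq (z2 1%N) <= 46 * T ^+ 2.
    have -> : sq (z2 1%N) = sq (fun j => tmulG G (e2 1%N) j + r 2%N j).
      by apply: eq_bigr => j _; rewrite z2E.
    have := sqD_le2 (tmulG G (e2 1%N)) (r 2%N).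
    have := r1T 2%N isT; have := Gcontr (e2 1%N); have := wsq_ge0 (e2 1%N) bet0; lra.
  have T3 : C0 * tau ^+ 3 * m%:R <= T.
    have -> : C0 * tau ^+ 3 * m%:R = C0 * tau ^+ 2 * (m%:R * tau) by ring.
    have -> : T = C0 * tau ^+ 2 * C0 by rewrite /T; ring.
    rewrite ler_wpM2l ?mulr_ge0 ?exprn_ge0// ?(ltW t0) ?(ltW C00)//.
    by apply: le_trans nC; rewrite ler_wpM2r ?ler_nat// ltW.
  (* The indicator of [k = 0] singles out the differences that involve [r 1] and [s 1]. They are
     only of order [tau ^+ 2], but they occur once in the sum. *)
  have sum0 (c : R) : 0 <= c -> \sum_(0 <= k < m) (k == 0%N)%:R * c <= c.
    move=> c0; case: (m) => [|m']; first by rewrite big_geq.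
    by rewrite big_nat_recl//= mul1r big1 ?addr0// => k _; rewrite mul0r.
  have [|||||||||||] := @energy_bound R I J G kap bet kap0 bet0 Gcontr m
     (fun k i => e2 k.+1 i - e2 k i) (fun k i => F k.+2 i - F k.+1 i)
     (fun k => z2 k.+1) (fun k j => z2 k.+1 j - z2 k j)
     (fun k j => s k.+2 j - s k.+1 j) (fun k j => r k.+2 j - r k.+1 j) _ _ _
     (fun=> 2 * (C0 * tau ^+ 3))
     (fun k => C0 * tau ^+ 3 + (k == 0%N)%:R * (2 * T))
     (fun k => 2 * (C0 * tau ^+ 3) + (k == 0%N)%:R * (2 * T)) (12 * T) (50 * T ^+ 2).
  - move=> k km i; rewrite -(eq2 k.+1 i km) -(eq2 k i (ltnW km)).
    have -> : mulG G (fun j => z2 k.+1 j + (z2 k.+1 j - z2 k j) + (s k.+2 j - s k.+1 j)) i =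
       mulG G (fun j => q k.+2 j - qI k.+1 j + z2 k.+1 j + s k.+2 j) i -
       mulG G (fun j => q k.+1 j - qI k j + z2 k j + s k.+1 j) i.
      by rewrite -mulGB; apply: eq_bigr => j _; rewrite q2E 1?ltnW//; congr (_ * _); ring.
    by set a := mulG _ _ _; set b := mulG _ _ _; ring.
  - by move=> k km j; rewrite tmulGB !z2E// 1?leqW//; ring.
  - by move=> k km j; ring.
  - by move=> k; split; rewrite ?addr_ge0// ?mulr_ge0// ?ler0n ?exprn_ge0// ?ltW//.
  - move=> k km; have := sqB_le2 (F k.+2) (F k.+1).
    have := Fk k.+2 km; have := Fk k.+1 (leq_trans km (leqnSn _)); rewrite [(2 * _) ^+ 2]exprMn; lra.
  - case=> [|k] km; last by rewrite mul0r addr0; exact: drk.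
    rewrite mul1r; apply: (@le_trans _ _ ((2 * T) ^+ 2)).
      have := sqB_le2 (r 2%N) (r 1%N); have := r1T 2%N isT; have := r1T 1%N isT.
      rewrite [(2 * T) ^+ 2]exprMn; lra.
    by rewrite ler_pXn2r ?nnegrE ?addr_ge0 ?mulr_ge0// ?lerDr// ltW.
  - case=> [|k] km.
      rewrite mul1r; apply: (@le_trans _ _ ((2 * T) ^+ 2)).
        have := sqB_le2 (s 2%N) (s 1%N); have := s1T 2%N km; have := s1T 1%N isT.
        rewrite [(2 * T) ^+ 2]exprMn; lra.
      by rewrite ler_pXn2r ?nnegrE ?addr_ge0 ?mulr_ge0// ?lerDr// ?mulr_ge0// ltW.
    rewrite mul0r addr0; have := sqB_le2 (s k.+3) (s k.+2).
    have := sk k.+3 km; have := sk k.+2 (leq_trans km (leqnSn _)); rewrite [(2 * _) ^+ 2]exprMn; lra.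
  - move=> k km.
    have := cT2.
    by case: (k == 0%N); rewrite /= ?mul1r ?mul0r ?addr0; lra.
  - have -> : \sum_(0 <= k < m) (2 * (C0 * tau ^+ 3)
        + (2 * (C0 * tau ^+ 3) + (k == 0%N)%:R * (2 * T))
        + (C0 * tau ^+ 3 + (k == 0%N)%:R * (2 * T))
        + (C0 * tau ^+ 3 + (k.+1 == 0%N)%:R * (2 * T))) =
       6 * (C0 * tau ^+ 3 * m%:R) + 2 * \sum_(0 <= k < m) (k == 0%N)%:R * (2 * T).
      rewrite mulr_sumr (_ : 6 * _ = \sum_(0 <= k < m) (6 * (C0 * tau ^+ 3))).
        by rewrite -big_split/=; apply: eq_bigr => k _; rewrite mul0r; ring.
      by rewrite sumr_const_nat subn0 -mulr_natr; ring.
    have := sum0 (2 * T) (mulr_ge0 (ler0n _ 2) T0); lra.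
  - by rewrite mulr_ge0// sqr_ge0.
  - rewrite /energy.
    have -> : sq (fun i => e2 1%N i - e2 0%N i) = sq (e2 1%N).
      by apply: eq_bigr => i _; rewrite e20 subr0.
    have -> : wsq bet (fun i => e2 1%N i - e2 0%N i) = wsq bet (e2 1%N).
      by apply: eq_bigr => i _; rewrite e20 subr0.
    have -> : sq (fun j => z2 1%N j - (z2 1%N j - z2 0%N j)) = sq (r 1%N).
      by apply: eq_bigr => j _; rewrite opprB addrC subrK z20.
    have := r1T 1%N isT; have := sq_ge0 (fun j => z2 1%N j - z2 0%N j); have := sqr_ge0 T; lra.
  move=> sb _ _ k km; have := sb k km; rewrite /size2 -/(e2 k.+1) -/(z2 k.+1).
  have := sq_ge0 (fun i => e2 k.+1 i - e2 k i).
  have := wsq_ge0 (fun i => e2 k.+1 i - e2 k i) bet0.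
  have := sq_ge0 (z2 k.+1); have := sq_ge0 (fun j => z2 k.+1 j - (z2 k.+1 j - z2 k j)).
  have -> : (12 * T) ^+ 2 = 144 * T ^+ 2 by ring.
  have := sqr_ge0 T.
  by rewrite /e2 /z2; split; lra.
(* About [C0 / tau] increments of squared size [T ^+ 2] add up to order [tau ^+ 3]. *)
have nT := Tt3 n nC.
split => //.
- rewrite big_nat_recl//=.
  have -> : sq (fun i => e 1%N i - e 0%N i) = sq (e 1%N).
    by apply: eq_bigr => i _; rewrite e0 subr0.
  have : \sum_(0 <= k < n) sq (fun i => e k.+2 i - e k.+1 i) <=
     2 * \sum_(0 <= k < n) sq (fun i => eI k.+1 i - eI k i) + 2 * n%:R * (7 * 10 ^+ 5 * T ^+ 2).
    rewrite (_ : 2 * n%:R * _ = \sum_(0 <= k < n) (2 * (7 * 10 ^+ 5 * T ^+ 2))).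
      rewrite mulr_sumr -big_split/= big_nat_cond [leRHS]big_nat_cond.
      apply: ler_sum => k; rewrite andbT => /= kn; have [h _] := rem k kn.
      have := sqD_le2 (fun i => eI k.+1 i - eI k i)
        (fun i => (e k.+2 i - eI k.+1 i) - (e k.+1 i - eI k i)).
      rewrite (_ : sq (fun i => _ + _) = sq (fun i => e k.+2 i - e k.+1 i)); first by lra.
      by apply: eq_bigr => i _; congr (_ ^+ 2); ring.
    by rewrite sumr_const_nat subn0 -mulr_natr; ring.
  have := Ct3 2%N isT; have := Ct3 5%N isT; move: Yb; rewrite /Y /C; lra.
- rewrite big_nat_recl//=.
  have z1 : sq (z 1%N) <= 2 * sq (e 1%N) + 2 * T ^+ 2.
    have -> : sq (z 1%N) = sq (fun j => tmulG G (e 1%N) j + r 1%N j).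
      by apply: eq_bigr => j _; rewrite zk.
    have := sqD_le2 (tmulG G (e 1%N)) (r 1%N).
    have := r1T 1%N isT; have := Gcontr (e 1%N); lra.
  have T1 := Tt3 1%N; rewrite !mul1r in T1; have {}T1 := T1 tC.
  have : \sum_(0 <= k < n) sq (z k.+2) <=
     2 * \sum_(0 <= k < n) sq (zI k.+1) + 2 * n%:R * (7 * 10 ^+ 5 * T ^+ 2).
    rewrite (_ : 2 * n%:R * _ = \sum_(0 <= k < n) (2 * (7 * 10 ^+ 5 * T ^+ 2))).
      rewrite mulr_sumr -big_split/= big_nat_cond [leRHS]big_nat_cond.
      apply: ler_sum => k; rewrite andbT => /= kn; have [_ h] := rem k kn.
      have := sqD_le2 (zI k.+1) (fun j => z k.+2 j - zI k.+1 j).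
      rewrite (_ : sq (fun i => _ + _) = sq (z k.+2)); first by lra.
      by apply: eq_bigr => i _; congr (_ ^+ 2); ring.
    by rewrite sumr_const_nat subn0 -mulr_natr; ring.
  have := Ct3 2%N isT; have := Ct3 5%N isT; move: Yb; rewrite /Y /C; lra.
Qed.

End stability.

(** * Smooth functions of one variable and the flat function *)

Section smooth1.
Context (R : realType).
Implicit Types (f g h : R -> R) (x : R).

(** A greatest fixed point: membership in some set of derivable functions that is stable under
    derivation. Smoothness is then proved by exhibiting such a family, without counting
    derivatives. *)
Definition smooth1 h : Prop := exists S : set (R -> R), S h /\
  forall f, S f -> (forall x, derivable f x 1) /\ S (derive1 f).

Lemma smooth1_is_derive h x : smooth1 h -> is_derive x 1 h (derive1 h x).
Proof.
by move=> [S [Sh SP]]; split; [exact: (SP h Sh).1|rewrite derive1E].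
Qed.

Lemma smooth1_derive1 h : smooth1 h -> smooth1 (derive1 h).
Proof. by move=> [S [Sh SP]]; exists S; split=> //; exact: (SP h Sh).2. Qed.

Lemma smooth1_derive1n n h : smooth1 h -> smooth1 (iter n (@derive1 R R) h).
Proof. by elim: n => //= n IH /IH; exact: smooth1_derive1. Qed.

Lemma is_derive1_continuous f g : (forall x, is_derive x 1 f (g x)) -> continuous f.
Proof.
move=> df x; apply: differentiable_continuous; apply/derivable1_diffP.
by have [] := df x.
Qed.

Lemma smooth1_continuous h : smooth1 h -> continuous h.
Proof.
move=> sh; apply: (@is_derive1_continuous _ (derive1 h)) => x.
exact: smooth1_is_derive.
Qed.

Lemma is_derive_derive1 f g : (forall x, is_derive x 1 f (g x)) -> derive1 f = g.
Proof. by move=> df; apply/funext => x; rewrite derive1E; have [_ ->] := df x. Qed.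

Lemma smooth1P (S : set (R -> R)) h : S h ->
  (forall f, S f -> exists2 g, S g & forall x, is_derive x 1 f (g x)) -> smooth1 h.
Proof.
move=> Sh SP; exists S; split=> // f /SP[g Sg fg]; split=> [x|].
  by have [] := fg x.
by rewrite (is_derive_derive1 fg).
Qed.

Lemma smooth1_primitive f g : smooth1 g -> (forall x, is_derive x 1 f (g x)) ->
  smooth1 f.
Proof.
move=> [S [Sg SP]] fg; apply: (@smooth1P (fun h => h = f \/ S h)); first by left.
move=> h [->|Sh]; first by exists g; [right|].
exists (derive1 h); first by right; exact: (SP h Sh).2.
by move=> x; split; [exact: (SP h Sh).1|rewrite derive1E].
Qed.

(** The Leibniz rule makes this family stable under derivation. *)
Inductive mul_span (A B : set (R -> R)) : (R -> R) -> Prop :=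
| mul_span_mul f g of A f & B g : mul_span A B (f * g)
| mul_span_add f g of mul_span A B f & mul_span A B g : mul_span A B (f + g).

Lemma smooth1M f g : smooth1 f -> smooth1 g -> smooth1 (f * g).
Proof.
move=> [A [Af AP]] [B [Bg BP]].
apply: (@smooth1P (mul_span A B)); first exact: mul_span_mul.
have dA h (Ah : A h) x : is_derive x 1 h (derive1 h x).
  by split; [exact: (AP h Ah).1|rewrite derive1E].
have dB h (Bh : B h) x : is_derive x 1 h (derive1 h x).
  by split; [exact: (BP h Bh).1|rewrite derive1E].
move=> h; elim => [u v Au Bv|u v _ [u' Su du] _ [v' Sv dv]].
- exists (u * derive1 v + derive1 u * v).
    by apply: mul_span_add; apply: mul_span_mul => //;
      [exact: (BP v Bv).2|exact: (AP u Au).2].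
  move=> x; have du := dA u Au x; have dv := dB v Bv x.
  apply: is_derive_eq; rewrite !fctE /= addrC [v x *: _]mulrC addrC //.
- exists (u' + v'); first exact: mul_span_add.
  by move=> x; have ? := du x; have ? := dv x; exact: is_deriveD.
Qed.

Lemma smooth1_cst c : smooth1 (cst c).
Proof.
apply: (@smooth1P (fun h => exists c, h = cst c)); first by exists c.
by move=> _ [a ->]; exists (cst 0); [exists 0|move=> x; exact: is_derive_cst].
Qed.

Lemma smooth1Z c f : smooth1 f -> smooth1 (fun x => c * f x).
Proof. by move=> /(smooth1M (smooth1_cst c)). Qed.

Lemma smooth1D f g : smooth1 f -> smooth1 g -> smooth1 (f + g).
Proof.
move=> sf sg; apply: (@smooth1_primitive _ (derive1 f + derive1 g)).
  move: sf sg => [A [Af AP]] [B [Bg BP]].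
  apply: (@smooth1P (fun h => exists u v, [/\ A u, B v & h = u + v])).
    by exists (derive1 f), (derive1 g); split=> //; [exact: (AP f Af).2|exact: (BP g Bg).2].
  move=> _ [u [v [Au Bv ->]]]; exists (derive1 u + derive1 v).
    by exists (derive1 u), (derive1 v); split=> //; [exact: (AP u Au).2|exact: (BP v Bv).2].
  move=> x; apply: is_deriveD; split; rewrite ?derive1E//.
    exact: (AP u Au).1.
  exact: (BP v Bv).1.
by move=> x; apply: is_deriveD; exact: smooth1_is_derive.
Qed.

Lemma is_derive_affine f g a b : (forall x, is_derive x 1 f (g x)) ->
  forall x, is_derive x 1 (fun x => f (a * x + b)) (a * g (a * x + b)).
Proof.
move=> fg x; rewrite mulrC.
apply: (@is_derive1_comp R f (fun x => a * x + b)).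
have -> : (fun x => a * x + b) = a *: id + cst b.
  by apply/funext => y; rewrite !fctE.
by apply: is_derive_eq; rewrite addr0 /GRing.scale/= mulr1.
Qed.

Lemma smooth1_affine f a b : smooth1 f -> smooth1 (fun x => f (a * x + b)).
Proof.
move=> [A [Af AP]].
apply: (@smooth1P (fun h => exists c u, A u /\ h = fun x => c * u (a * x + b))).
  by exists 1, f; split=> //; apply/funext => x; rewrite mul1r.
move=> _ [c [u [Au ->]]]; exists (fun x => c * a * derive1 u (a * x + b)).
  by exists (c * a), (derive1 u); split=> //; exact: (AP u Au).2.
move=> x.
have du (y : R) : is_derive y 1 u (derive1 u y).
  by split; [exact: (AP u Au).1|rewrite derive1E].
have ? := is_derive_affine a b du x.
have -> : (fun x => c * u (a * x + b)) = c *: (fun x => u (a * x + b)) by [].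
by apply: is_derive_eq; rewrite /GRing.scale/= mulrA.
Qed.

Lemma smooth1_trig (a b : R) : smooth1 (fun x => a * sin x + b * cos x).
Proof.
apply: (@smooth1P (fun h => exists a b, h = fun x => a * sin x + b * cos x)).
  by exists a, b.
move=> _ [{}a [{}b ->]]; exists (fun x => (- b) * sin x + a * cos x).
  by exists (- b), a.
move=> x.
have -> : (fun x => a * sin x + b * cos x) = a *: (@sin R) + b *: (@cos R) by [].
have ds := is_derive_sin x; have dc := is_derive_cos x.
have D := is_deriveD (is_deriveZ a ds) (is_deriveZ b dc).
apply: is_derive_eq; change (a * cos x + b * (- sin x) = - b * sin x + a * cos x); ring.
Qed.

Lemma smooth1_sin : smooth1 (@sin R).
Proof.
have -> : @sin R = fun x => 1 * sin x + 0 * cos x; last exact: smooth1_trig.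
by apply/funext => x; rewrite mul1r mul0r addr0.
Qed.

Lemma smooth1_cos : smooth1 (@cos R).
Proof.
have -> : @cos R = fun x => 0 * sin x + 1 * cos x; last exact: smooth1_trig.
by apply/funext => x; rewrite mul1r mul0r add0r.
Qed.

(* [flat 1] is the flat function [exp (- 1 / x)]; the factor [p.[x^-1]] makes the
   family stable under derivation. *)
Definition flat (p : {poly R}) (x : R) : R :=
  if 0 < x then p.[x^-1] * expR (- x^-1) else 0.

(** Powers of [x^-1] lose against the exponential, because [expR y] is at least
    [(y / n.+1) ^+ n.+1]. The bound is linear because derivability at 0 needs exactly that. *)
Lemma flat_bound p : exists2 C, 0 <= C & forall x, `|flat p x| <= C * `|x|.
Proof.
have mono n : exists2 C, 0 <= C & forall x : R, 0 < x ->
    x^-1 ^+ n * expR (- x^-1) <= C * x.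
  exists (n.+1%:R ^+ n.+1); first by rewrite exprn_ge0.
  move=> x x0; have y0 : 0 < x^-1 by rewrite invr_gt0.
  rewrite -ler_pdivrMr// -mulrA [expR _ * _]mulrC mulrA -exprSr.
  rewrite expRN ler_pdivrMr ?expR_gt0//.
  have : (x^-1 / n.+1%:R) ^+ n.+1 <= expR (x^-1 / n.+1%:R) ^+ n.+1.
    rewrite lerXn2r ?nnegrE ?expR_ge0// ?divr_ge0 ?(ltW y0)//.
    by apply: le_trans (expR_ge1Dx _); rewrite lerDr.
  rewrite -expRM_natr divfK ?pnatr_eq0//.
  by rewrite expr_div_n ler_pdivrMr ?exprn_gt0// mulrC.
rewrite -[p]coefK poly_def.
elim/big_ind : _ => [|q r [C C0 hC] [D D0 hD]|i _].
- by exists 0 => // x; rewrite /flat horner0 mul0r; case: ifP; rewrite normr0 mul0r.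
- exists (C + D); first exact: addr_ge0.
  move=> x; rewrite mulrDl; apply: le_trans (lerD (hC x) (hD x)).
  rewrite /flat; case: ifP => _; last by rewrite normr0 addr0.
  by rewrite hornerD mulrDl ler_normD.
- have [C C0 hC] := mono i; exists (`|p`_i| * C); first exact: mulr_ge0.
  move=> x; rewrite /flat; case: ifPn => [x0|_]; last by rewrite normr0 !mulr_ge0.
  rewrite hornerZ hornerXn -!mulrA normrM ler_wpM2l// (ger0_norm (ltW x0)).
  by rewrite ger0_norm ?hC// mulr_ge0 ?expR_ge0// exprn_ge0// invr_ge0 ltW.
Qed.

Lemma is_derive_flat p x :
  is_derive x 1 (flat p) (flat ((p - p^`()) * 'X ^+ 2) x).
Proof.
have [x0|x0|x0] := ltgtP x 0.
- have nx : \forall y \near x, cst 0 y = flat p y.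
    near=> y; rewrite /flat ifF//; apply/negbTE; rewrite -leNgt ltW//.
    by near: y; exact: lt_nbhsl.
  rewrite [X in is_derive _ _ _ X](_ : _ = 0).
    exact: (near_eq_is_derive nx (is_derive_cst _ _ _)).
  by rewrite /flat ifF//; apply/negbTE; rewrite -leNgt ltW.
- have nx : \forall y \near x, p.[y^-1] * expR (- y^-1) = flat p y.
    by near=> y; rewrite /flat ifT//; near: y; exact: lt_nbhsr.
  rewrite {2}/flat x0.
  apply: (near_eq_is_derive nx).
  have xn0 : x != 0 by rewrite gt_eqF.
  have dV : is_derive x 1 (fun y : R => y^-1) (- x ^- 2).
    by have := @is_deriveV R id x 1 1 xn0 (is_derive_id x 1); rewrite /GRing.scale/= mulr1.
  have dp : is_derive x 1 (horner p \o (fun y : R => y^-1)) (p^`().[x^-1] * - x ^- 2).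
    by apply: is_derive1_comp; exact: is_derive_poly.
  have de : is_derive x 1 (expR \o (fun y : R => - y^-1)) (expR (- x^-1) * x ^- 2).
    apply: is_derive1_comp.
    by rewrite -[x ^- 2]opprK; exact: is_deriveN.
  have := is_deriveM dp de.
  move=> h; apply: (is_derive_eq h).
  rewrite /GRing.scale/= !hornerE /=; move: (expR _) p.[_] (p^`()).[_] => e a b; field.
  exact: xn0.
(* At 0 the difference quotient of [flat p] is [flat ('X * p)], which tends to 0 by the linear
   bound. *)
- rewrite x0 {2}/flat ltxx.
  have [C C0 hC] := flat_bound ('X * p).
  suff H : (fun t : R => t^-1 *: ((flat p \o shift 0) (t *: 1) - flat p 0)) @ 0^' --> (0:R).
    by split; [apply/cvg_ex; exists 0|exact/cvg_lim].
  apply/cvgrPdist_le => e e0; near=> t.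
  rewrite sub0r normrN /= addr0 [t *: 1]mulr1 {2}/flat ltxx subr0.
  have tn0 : t != 0 by near: t; exact: nbhs_dnbhs_neq.
  have -> : t^-1 *: flat p t = flat ('X * p) t.
    rewrite /flat; case: ifP => _; last by rewrite scaler0.
    by rewrite hornerM hornerX /GRing.scale/= mulrA.
  apply: (le_trans (hC t)).
  apply: (@le_trans _ _ ((C + 1) * `|t|)).
    by rewrite ler_wpM2r// lerDl.
  rewrite mulrC -ler_pdivlMr ?ltr_pwDr// ltW//.
  near: t; apply: dnbhs0_lt; rewrite divr_gt0// ltr_pwDr//.
Unshelve. all: by end_near. Qed.

Lemma smooth1_flat p : smooth1 (flat p).
Proof.
apply: (@smooth1P (fun h => exists p, h = flat p)); first by exists p.
move=> _ [{}p ->]; exists (flat ((p - p^`()) * 'X ^+ 2)); first by eexists.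
by move=> x; exact: is_derive_flat.
Qed.

Definition smooth_bump (x : R) : R := flat 1 x * flat 1 (1 - x).

Lemma smooth1_bump : smooth1 smooth_bump.
Proof.
apply: smooth1M; first exact: smooth1_flat.
rewrite (_ : (fun x => _) = fun x => flat 1 (- 1 * x + 1)).
  exact/smooth1_affine/smooth1_flat.
by apply/funext => x; rewrite mulN1r addrC.
Qed.

Lemma smooth_bump_ge0 x : 0 <= smooth_bump x.
Proof.
by rewrite mulr_ge0// /flat; case: ifP => // _; rewrite hornerC mul1r expR_ge0.
Qed.

Lemma smooth_bump_gt0 x : 0 < x < 1 -> 0 < smooth_bump x.
Proof.
move=> /andP[x0 x1]; rewrite /smooth_bump /flat x0 subr_gt0 x1 !hornerC !mul1r.
by rewrite mulr_gt0 ?expR_gt0.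
Qed.

Lemma smooth_bump_out x : ~~ (0 < x < 1) -> smooth_bump x = 0.
Proof.
rewrite negb_and => /orP[/negbTE h|/negbTE h]; rewrite /smooth_bump /flat.
  by rewrite h mul0r.
by rewrite subr_gt0 h mulr0.
Qed.

End smooth1.

(** * Primitives, smooth steps and cut-off functions *)

Section primitives.
Context (R : realType).
Implicit Types (f g : R -> R) (x : R).

Lemma MVT_is_derive f g (a b : R) : (forall x, is_derive x 1 f (g x)) -> a <= b ->
  exists2 c, a <= c <= b & f b - f a = g c * (b - a).
Proof.
move=> df; rewrite le_eqVlt => /predU1P[->|ab].
  by exists b; rewrite ?lexx// !subrr mulr0.
have [|x xab xE] := @MVT R f g a b ab.
  exact/continuous_subspaceT/(is_derive1_continuous df).
by exists x => //; move: xab; rewrite in_itv/= => /andP[/ltW-> /ltW->].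
Qed.

Lemma smooth1_antiderivative f (b : R) : smooth1 f -> (forall x, x <= b -> f x = 0) ->
  exists F, (forall x, is_derive x 1 F (f x)) /\ forall x, x <= b -> F x = 0.
Proof.
move=> sf f0; have cf := smooth1_continuous sf.
(* Integration starts at [b - 1] so that every [x >= b], including [b], is interior for the
   fundamental theorem of calculus. *)
pose F x := (\int[@lebesgue_measure R]_(t in [set` `[b - 1, x]]) f t)%R.
have F0 x : x <= b -> F x = 0.
  move=> xb; rewrite /F (@eq_Rintegral _ _ _ _ _ (cst 0)) ?Rintegral_cst ?mul0r//.
  by move=> y; rewrite inE/= in_itv/= => /andP[_ yx]; rewrite f0// (le_trans yx).
exists F; split => // x.
have [xb|xb] := ltP x b.
  rewrite f0 ?ltW//; apply: (near_eq_is_derive _ (is_derive_cst (0:R) x 1)).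
  near=> y; rewrite F0// ltW//; near: y; exact: lt_nbhsl.
have [] := @continuous_FTC1_closed R f (b - 1) x (x + 1).
- by rewrite ltrDl.
- apply: continuous_compact_integrable; first exact: segment_compact.
  exact: continuous_subspaceT.
- by rewrite ltrBlDr (le_lt_trans xb)// ltrDl.
- exact: cf.
by move=> dF FE; split; [exact: dF|rewrite -derive1E; exact: FE].
Unshelve. all: by end_near. Qed.

Lemma smooth_bump_le1 x : smooth_bump x <= 1.
Proof.
have f1 y : flat (1 : {poly R}) y <= 1.
  rewrite /flat; case: ifP => // y0; rewrite hornerC mul1r -expR0 ler_expR.
  by rewrite oppr_le0 invr_ge0 ltW.
have f0 y : 0 <= flat (1 : {poly R}) y.
  by rewrite /flat; case: ifP => // y0; rewrite hornerC mul1r expR_ge0.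
by rewrite /smooth_bump -[leRHS]mulr1 ler_pM.
Qed.

(** The step is the primitive of [smooth_bump] divided by its total mass; [C] is the inverse of that
    mass. *)
Lemma smooth_step_ex : exists C, exists s rho : R -> R,
  [/\ smooth1 rho, forall x, is_derive x 1 s (rho x),
      forall x, 0 <= rho x <= C, forall x, ~~ (0 < x < 1) -> rho x = 0 &
      [/\ forall x, 0 <= s x <= 1, forall x, x <= 0 -> s x = 0 &
          forall x, 1 <= x -> s x = 1]].
Proof.
have [x x0|F [dF F0]] := @smooth1_antiderivative (@smooth_bump R) 0 (smooth1_bump R).
  by rewrite smooth_bump_out// negb_and -leNgt x0.
have I0 : 0 < F 1.
  have [|x x01] := @MVT R F (@smooth_bump R) 0 1 ltr01.
    exact/continuous_subspaceT/(is_derive1_continuous dF).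
  rewrite (F0 0)// !subr0 mulr1 => ->; apply: smooth_bump_gt0.
  by move: x01; rewrite in_itv.
have F1 x : 1 <= x -> F x = F 1.
  move=> x1; have [c /andP[c1 _]] := MVT_is_derive dF x1.
  rewrite smooth_bump_out ?mul0r; first by move/subr0_eq.
  by rewrite negb_and -!leNgt c1 orbT.
have Fmono x y : x <= y -> F x <= F y.
  move=> xy; have [c _] := MVT_is_derive dF xy.
  by rewrite -subr_ge0 => ->; rewrite mulr_ge0 ?smooth_bump_ge0// subr_ge0.
exists (F 1)^-1, (fun x => (F 1)^-1 * F x), (fun x => (F 1)^-1 * smooth_bump x); split.
- exact/smooth1Z/smooth1_bump.
- move=> x; have ? := dF x.
  have -> : (fun x => (F 1)^-1 * F x) = (F 1)^-1 *: F by [].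
  exact: is_derive_eq.
- move=> x; rewrite mulr_ge0 ?invr_ge0 ?(ltW I0) ?smooth_bump_ge0//= ler_piMr ?smooth_bump_le1//.
  by rewrite invr_ge0 ltW.
- by move=> x /smooth_bump_out ->; rewrite mulr0.
split => [x|x /F0 ->|x /F1 ->]; [|by rewrite mulr0|by rewrite mulVf// gt_eqF].
have Fx0 : 0 <= F x.
  have [x0|x0] := leP x 0; first by rewrite F0.
  by rewrite -(F0 0)// Fmono// ltW.
rewrite mulr_ge0 ?invr_ge0 ?(ltW I0)//= mulrC ler_pdivrMr// mul1r.
have [x1|x1] := leP 1 x; first by rewrite F1.
by rewrite Fmono// ltW.
Qed.

(* Bounded convergence on the open interval of cut-off functions, as required by
   dominated convergence on the cube. *)
Definition cutoff_of (h : R -> R) (a : nat -> R -> R) : Prop :=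
  [/\ forall m, smooth1 (a m),
      forall m, exists2 e, 0 < e & forall x, ~~ (e <= x <= 1 - e) -> a m x = 0,
      exists C, forall m x, 0 < x < 1 -> `|a m x| <= C &
      forall x, 0 < x < 1 -> \forall m \near \oo, a m x = h x].

Definition bounded_cvg (h : R -> R) (a : nat -> R -> R) : Prop :=
  (exists C, forall m x, 0 < x < 1 -> `|a m x| <= C) /\
  forall x, 0 < x < 1 -> \forall m \near \oo, a m x = h x.

(** The derivative of a cut-off grows like the inverse width of its boundary layer. When [h]
    vanishes linearly at both ends, its smallness in the layer compensates, and the derivatives
    converge boundedly too. This is how a factor that vanishes on the faces allows one more
    derivative. *)
Lemma cutoff_ex h (C : R) : smooth1 h -> (forall x, 0 < x < 1 -> `|h x| <= C) ->
  exists2 a, cutoff_of h a & forall D D',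
    (forall x, 0 < x < 1 -> `|derive1 h x| <= D) ->
    (forall x, 0 < x < 1 -> `|h x| <= D' * x /\ `|h x| <= D' * (1 - x)) ->
    bounded_cvg (derive1 h) (fun m => derive1 (a m)).
Proof.
move=> sh hC.
have [B [s [rho [srho ds rhoB rho0 [s01 s0 s1]]]]] := smooth_step_ex.
have ss : smooth1 s by exact: smooth1_primitive srho ds.
have B0 : 0 <= B by have /andP[+ ] := rhoB 0; exact: le_trans.
pose M m : R := m.+3%:R.
have M0 m : 0 < M m by rewrite ltr0n.
(* Zero within distance [1 / M m] of an end, and 1 beyond [2 / M m]. *)
pose chi m := (fun x => s (M m * x + (-1))) * (fun x => s (- M m * x + (M m - 1))).
have schi m : smooth1 (chi m) by apply: smooth1M; exact: smooth1_affine.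
pose dchi m x := (M m * rho (M m * x + (-1))) * s (- M m * x + (M m - 1)) +
   s (M m * x + (-1)) * (- M m * rho (- M m * x + (M m - 1))).
have dchiE m x : is_derive x 1 (chi m) (dchi m x).
  have d1 := is_derive_affine (M m) (-1) ds x.
  have d2 := is_derive_affine (- M m) (M m - 1) ds x.
  by apply: is_derive_eq; rewrite /dchi /GRing.scale/= addrC; congr (_ + _); rewrite mulrC.
have chi01 m x : 0 <= chi m x <= 1.
  have /andP[a0 a1] := s01 (M m * x + (-1)).
  have /andP[b0 b1] := s01 (- M m * x + (M m - 1)).
  by rewrite /chi !fctE mulr_ge0//= -[leRHS]mulr1 ler_pM.
have farl x : 0 < x -> \forall m \near \oo, 1 < M m * x - 1.
  move=> x0; near=> m; rewrite ltrBrDr -ltr_pdivrMr// /M.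
  apply: (@lt_le_trans _ _ m%:R); last by rewrite ler_nat !leqW.
  by near: m; exact: nbhs_infty_gtr.
have chi1 x : 0 < x < 1 -> \forall m \near \oo, chi m x = 1 /\ dchi m x = 0.
  move=> /andP[x0 x1].
  have y0 : 0 < 1 - x by rewrite subr_gt0.
  near=> m.
  have h1 : 1 < M m * x - 1 by near: m; exact: farl.
  have h2 : 1 < - M m * x + (M m - 1).
    have : 1 < M m * (1 - x) - 1 by near: m; exact: farl.
    by lra.
  rewrite /dchi /chi !fctE (s1 _ (ltW h1)) (s1 _ (ltW h2)) (rho0 _ _) ?(rho0 (- _ * _ + _) _).
  - by rewrite !(mulr0,mul0r,mulr1,addr0).
  - by rewrite negb_and -!leNgt (ltW h2) orbT.
  - by rewrite negb_and -!leNgt (ltW h1) orbT.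
exists (fun m => h * chi m); first split.
- by move=> m; exact: smooth1M.
- move=> m; exists (M m)^-1; first by rewrite invr_gt0.
  move=> x; rewrite negb_and -!ltNge => /orP[hx|hx]; rewrite !fctE.
    rewrite [X in _ * (X * _)]s0 ?mul0r ?mulr0//.
    have : M m * x < M m * (M m)^-1 by rewrite ltr_pM2l.
    by rewrite mulfV ?gt_eqF//; lra.
  rewrite [X in _ * (_ * X)]s0 ?mulr0//.
  have : M m * (1 - (M m)^-1) < M m * x by rewrite ltr_pM2l.
  by rewrite mulrBr mulr1 mulfV ?gt_eqF//; lra.
- exists C => m x x01; rewrite fctE normrM -[leRHS]mulr1.
  have /andP[c0 c1] := chi01 m x.
  by rewrite ler_pM ?hC// ger0_norm.
- move=> x /chi1; apply: filterS => m [+ _].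
  by rewrite fctE => ->; rewrite mulr1.
move=> D D' hD hD'.
have dE m x : derive1 (h * chi m) x = h x * dchi m x + chi m x * derive1 h x.
  have dh := smooth1_is_derive x sh; have dc := dchiE m x.
  by rewrite derive1E; have [_ ->] := is_deriveM dh dc.
split; last first.
  move=> x /chi1; apply: filterS => m [c1 c2].
  by rewrite dE c1 c2 mulr0 mul1r add0r.
exists (4 * `|D'| * B + D) => m x x01; rewrite dE.
have /andP[c0 c1] := chi01 m x.
apply: (le_trans (ler_normD _ _)); apply: lerD; last first.
  by rewrite normrM ger0_norm// -[leRHS]mul1r ler_pM// hD.
have [h1 h2] := hD' x x01; have /andP[x0 x1] := x01.
have y0 : 0 < 1 - x by rewrite subr_gt0.
(* Where [rho] does not vanish, [M m * y] is below 2. *)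
have rhob y : 0 <= y -> M m * y * rho (M m * y - 1) <= 2 * B.
  move=> yp; have [My|My] := ltP (M m * y) 2.
    have /andP[r0 r1] := rhoB (M m * y - 1).
    by rewrite ler_pM// ?mulr_ge0// ltW.
  rewrite rho0 ?mulr0 ?mulr_ge0//.
  by rewrite negb_and -!leNgt; apply/orP; right; lra.
rewrite /dchi mulrDr; apply: (le_trans (ler_normD _ _)).
have -> : 4 * `|D'| * B = `|D'| * (2 * B) + `|D'| * (2 * B) by ring.
have /andP[a0 a1] := s01 (M m * x + (-1)).
have /andP[b0 b1] := s01 (- M m * x + (M m - 1)).
have /andP[r0 _] := rhoB (M m * x + (-1)).
have /andP[r0' _] := rhoB (- M m * x + (M m - 1)).
apply: lerD.
  have -> : h x * (M m * rho (M m * x + -1) * s (- M m * x + (M m - 1))) =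
    (M m * rho (M m * x + -1) * s (- M m * x + (M m - 1))) * h x by rewrite mulrC.
  rewrite normrM (@ger0_norm _ (_ * _ * _)) ?mulr_ge0 ?(ltW (M0 m))//.
  apply: (@le_trans _ _ (M m * rho (M m * x + -1) * 1 * (`|D'| * x))).
    apply: ler_pM; rewrite ?mulr_ge0 ?(ltW (M0 m))//.
      by rewrite ler_wpM2l// mulr_ge0// ltW.
    by apply: (le_trans h1); rewrite ler_wpM2r ?ler_norm// ltW.
  have := rhob x (ltW x0); have := normr_ge0 D'.
  move=> d0 /(ler_wpM2l d0); congr (_ <= _); ring.
have -> : h x * (s (M m * x + -1) * (- M m * rho (- M m * x + (M m - 1)))) =
    - ((M m * rho (- M m * x + (M m - 1)) * s (M m * x + -1)) * h x) by ring.
rewrite normrN normrM (@ger0_norm _ (_ * _ * _)) ?mulr_ge0 ?(ltW (M0 m))//.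
apply: (@le_trans _ _ (M m * rho (- M m * x + (M m - 1)) * 1 * (`|D'| * (1 - x)))).
  apply: ler_pM; rewrite ?mulr_ge0 ?(ltW (M0 m))//.
    by rewrite ler_wpM2l// mulr_ge0// ltW.
  by apply: (le_trans h2); rewrite ler_wpM2r ?ler_norm// ltW.
have := rhob (1 - x) (ltW y0); have := normr_ge0 D'.
have -> : M m * (1 - x) - 1 = - M m * x + (M m - 1) by ring.
move=> d0 /(ler_wpM2l d0); congr (_ <= _); ring.
Unshelve. all: by end_near. Qed.

End primitives.

(** * Tensor products of functions of one variable *)

Section tensor.
Context (R : realType) (d : nat).
Implicit Types (h : 'I_d -> R -> R) (x v : 'rV[R]_d).

Definition tensor h : 'rV[R]_d -> R := fun x => \prod_i h i (x ord0 i).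

Definition upd h (i : 'I_d) (g : R -> R) : 'I_d -> R -> R :=
  fun j => if j == i then g else h j.

Lemma tensor_upd h i g x :
  tensor (upd h i g) x = g (x ord0 i) * \prod_(j | j != i) h j (x ord0 j).
Proof.
rewrite /tensor (bigD1 i)//= /upd eqxx; congr (_ * _).
by apply: eq_bigr => j /negbTE ->.
Qed.

Lemma tensorD1 h i x :
  tensor h x = h i (x ord0 i) * \prod_(j | j != i) h j (x ord0 j).
Proof. by rewrite /tensor (bigD1 i). Qed.

Lemma is_derive_coord (g : R -> R) (i : 'I_d) x v : smooth1 g ->
  is_derive x v (fun y : 'rV[R]_d => g (y ord0 i)) (v ord0 i * derive1 g (x ord0 i)).
Proof.
move=> sg.
have dg : differentiable g (x ord0 i).
  by apply/derivable1_diffP; have [] := smooth1_is_derive (x ord0 i) sg.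
have H : (fun t : R => t^-1 *: (((fun y : 'rV[R]_d => g (y ord0 i)) \o shift x) (t *: v)
     - g (x ord0 i))) =
    (fun t : R => t^-1 *: ((g \o shift (x ord0 i)) (t *: v ord0 i) - g (x ord0 i))).
  by apply/funext => t /=; rewrite !mxE.
have dv : derivable g (x ord0 i) (v ord0 i) by exact: diff_derivable.
split; first by rewrite /derivable H.
rewrite /derive H -/(derive g (x ord0 i) (v ord0 i)) deriveE//.
rewrite derive1E' // -[in LHS](mulr1 (v ord0 i)).
by rewrite -[_ * 1]/(v ord0 i *: (1 : R^o)) linearZ.
Qed.

Lemma is_derive_prod (r : seq 'I_d) (g : 'I_d -> R -> R) x v :
  uniq r -> (forall i, smooth1 (g i)) ->
  is_derive x v (fun y : 'rV[R]_d => \prod_(i <- r) g i (y ord0 i))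
    (\sum_(i <- r) v ord0 i * \prod_(j <- r) upd g i (derive1 (g i)) j (x ord0 j)).
Proof.
move=> + sg; elim: r => [_|k r IH /= /andP[kr ur]].
  rewrite big_nil (_ : (fun y => _) = cst 1); first exact: is_derive_cst.
  by apply/funext => y; rewrite big_nil.
have := IH ur; set P := fun y : 'rV[R]_d => _; set dP := (X in is_derive _ _ _ X) => hP.
rewrite (_ : (fun y => _) = (fun y : 'rV[R]_d => g k (y ord0 k)) * P); last first.
  by apply/funext => y; rewrite big_cons.
have hk := is_derive_coord k x v (sg k).
apply: (is_derive_eq (is_deriveM hk hP)).
rewrite big_cons addrC /GRing.scale/=; congr (_ + _).
  rewrite big_cons {1}/upd eqxx [LHS]mulrCA; congr (_ * _); rewrite mulrC; congr (_ * _).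
  rewrite /P big_seq [in RHS]big_seq; apply: eq_bigr => j jr.
  by rewrite /upd; case: eqP jr kr => // -> ->.
rewrite /dP mulr_sumr big_seq [in RHS]big_seq; apply: eq_bigr => i ir.
rewrite big_cons {2}/upd; case: eqP => [ki|_]; last by rewrite mulrCA.
by rewrite ki ir in kr.
Qed.

Lemma is_derive_tensor h x v : (forall i, smooth1 (h i)) ->
  is_derive x v (tensor h) (\sum_i v ord0 i * tensor (upd h i (derive1 (h i))) x).
Proof. by move=> sh; apply: is_derive_prod => //; exact: index_enum_uniq. Qed.

Lemma smooth1_upd h i g : (forall i, smooth1 (h i)) -> smooth1 g ->
  forall j, smooth1 (upd h i g j).
Proof. by move=> sh sg j; rewrite /upd; case: eqP. Qed.

(** Stable under directional derivatives, so the smoothness of all its members reduces to their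
    continuity and derivability. *)
Inductive tensor_span : ('rV[R]_d -> R) -> Prop :=
| tensor_span0 : tensor_span (fun=> 0)
| tensor_spanZ c h of (forall i, smooth1 (h i)) : tensor_span (fun x => c * tensor h x)
| tensor_spanD f g of tensor_span f & tensor_span g : tensor_span (fun x => f x + g x).

Lemma tensor_span_sum (I : Type) (r : seq I) (F : I -> 'rV[R]_d -> R) :
  (forall i, tensor_span (F i)) -> tensor_span (fun x => \sum_(i <- r) F i x).
Proof.
move=> sF; elim: r => [|i r IH].
  rewrite (_ : (fun x => _) = fun=> 0); first exact: tensor_span0.
  by apply/funext => x; rewrite big_nil.
rewrite (_ : (fun x => _) = fun x => F i x + \sum_(j <- r) F j x).
  exact: tensor_spanD.
by apply/funext => x; rewrite big_cons.
Qed.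

Lemma tensor_span_derive f : tensor_span f -> exists2 g : 'rV[R]_d -> 'rV[R]_d -> R,
  forall v, tensor_span (g v) & forall x v, is_derive x v f (g v x).
Proof.
elim=> [|c h sh|{}f f' _ [g sg dg] _ [g' sg' dg']].
- by exists (fun v x => 0) => [v|x v]; [exact: tensor_span0|exact: is_derive_cst].
- exists (fun v x => \sum_i c * v ord0 i * tensor (upd h i (derive1 (h i))) x) => [v|x v].
    apply: tensor_span_sum => i; apply: tensor_spanZ.
    by apply: smooth1_upd => //; exact: smooth1_derive1.
  have ? := is_derive_tensor x v sh.
  have -> : (fun x => c * tensor h x) = c *: tensor h by [].
  apply: is_derive_eq; rewrite /GRing.scale/= mulr_sumr.
  by apply: eq_bigr => i _; rewrite mulrA.
- exists (fun v x => g v x + g' v x) => [v|x v]; first exact: tensor_spanD.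
  by have ? := dg x v; have ? := dg' x v; exact: is_deriveD.
Qed.

Lemma tensor_span_continuous f : tensor_span f -> continuous f.
Proof.
elim=> [|c h sh|{}f g _ cf _ cg] x.
- exact: cst_continuous.
- apply: (@cvgM _ _ (nbhs x) _ (fun=> c) (tensor h) c (tensor h x)); first exact: cvg_cst.
  rewrite /tensor; apply: cvg_big => [|i _]; first exact: mul_continuous.
  apply: (@continuous_comp _ _ _ (fun y : 'rV[R]_d => y ord0 i) (h i)).
    exact: coord_continuous.
  exact: smooth1_continuous.
- exact: (@cvgD _ _ _ (nbhs x) _ f g (f x) (g x) (cf x) (cg x)).
Qed.

Lemma smooth_tensor_span f : tensor_span f -> smooth f.
Proof.
move=> sf; suff H s : tensor_span (iter_derive s f).
  move=> s; split; first exact: tensor_span_continuous.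
  by move=> v x; have [g _ dg] := tensor_span_derive (H s); have [] := dg x v.
elim: s => //= v s IH; have [g sg dg] := tensor_span_derive IH.
rewrite (_ : (fun x => _) = g v)//; apply/funext => x.
by have [_ ->] := dg x v.
Qed.

Lemma smooth_tensor h : (forall i, smooth1 (h i)) -> smooth (tensor h).
Proof.
move=> sh; apply: smooth_tensor_span.
rewrite (_ : tensor h = fun x => 1 * tensor h x); first exact: tensor_spanZ.
by apply/funext => x; rewrite mul1r.
Qed.

Lemma continuous_tensor h : (forall i, smooth1 (h i)) -> continuous (tensor h).
Proof. by move=> /smooth_tensor /(_ [::])[]. Qed.

Lemma partial_tensor (s : seq 'I_d) h : (forall i, smooth1 (h i)) ->
  partial s (tensor h) = tensor (fun i => iter (count_mem i s) (@derive1 R R) (h i)).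
Proof.
move=> sh; elim: s => [|i s IH]; first by [].
rewrite /partial /= -/(partial s (tensor h)) IH; apply/funext => x.
have sh' k : smooth1 (iter (count_mem k s) (@derive1 R R) (h k)).
  exact: smooth1_derive1n.
have [_ ->] := is_derive_tensor x (delta_mx ord0 i) sh'.
rewrite (bigD1 i)//= mxE !eqxx mul1r big1 ?addr0; last first.
  by move=> j ji; rewrite mxE eqxx (negbTE ji) mul0r.
apply: eq_bigr => j _; rewrite /upd [i == j]eq_sym; case: eqP => [->|] //.
Qed.

Lemma test_function_tensor h : (0 < d)%N -> (forall i, smooth1 (h i)) ->
  (forall i, exists2 e, 0 < e & forall y, ~~ (e <= y <= 1 - e) -> h i y = 0) ->
  test_function (@cube R d) (tensor h).
Proof.
move=> d0 sh supp; split; first exact: smooth_tensor.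
have [e he] := choice (fun i => (match supp i with ex_intro2 e a b => ex_intro _ e (conj a b) end) :
  exists e, 0 < e /\ forall y, ~~ (e <= y <= 1 - e) -> h i y = 0).
exists [set x : 'rV[R]_d | forall i, `[e i, 1 - e i]%classic (x ord0 i)]; split.
- by apply: (@rV_compact R d (fun i => `[e i, 1 - e i]%classic)) => i; exact: segment_compact.
- move=> x /= xe i; have [ei _] := he i; have := xe i.
  by rewrite /= in_itv/= => /andP[h1 h2]; apply/andP; split; lra.
- move=> x /existsNP[i]; rewrite /= in_itv/= => /negP xi.
  by have [_ hi] := he i; rewrite (tensorD1 _ i) hi// mul0r.
Qed.

End tensor.

(** * The inner product of the cube *)

Section L2_toolkit.
Context (R : realType) (d : nat).
Local Notation mu := (cube_measure R d).
Local Notation field := (scalar_field R d).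
Implicit Types (f g h : field) (a b C : R).

Lemma L2_measurable f : L2 f -> measurable_fun [set: 'rV[R]_d] f.
Proof. by rewrite /L2 inE => /andP[]; rewrite inE. Qed.

Lemma L2_sqr f : L2 f -> mu.-integrable setT (EFin \o (fun x => f x ^+ 2)).
Proof. exact: Lfun2_integrable_sqr. Qed.

Lemma L2I f : measurable_fun [set: 'rV[R]_d] f ->
  mu.-integrable setT (EFin \o (fun x => f x ^+ 2)) -> L2 f.
Proof.
move=> mf /integrableP[_ fi]; rewrite /L2 inE; apply/andP; split; rewrite inE//=.
rewrite /finite_norm unlock; apply: poweR_lty; apply: le_lt_trans fi.
rewrite le_eqVlt; apply/orP; left; apply/eqP; apply: eq_integral => x _ /=.
by rewrite powR_mulrn// -normrX.
Qed.

Lemma L2_mul f g : L2 f -> L2 g -> mu.-integrable setT (EFin \o (fun x => f x * g x)).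
Proof. by move=> lf lg; apply/Lfun1_integrable; exact: Lfun2_mul_Lfun1. Qed.

Lemma L2_D f g : L2 f -> L2 g -> L2 (fun x => f x + g x).
Proof. by move=> lf lg; exact: (Lfun_addr_closed mu (lee1n 2)).2. Qed.

Lemma L2_Z a f : L2 f -> L2 (fun x => a * f x).
Proof.
move=> lf; have := @Lfun_scale _ _ _ mu f a 2 _ lf; rewrite /L2.
rewrite (_ : a \o* f = (fun x => a * f x)); first by apply; rewrite ler1n.
by apply/funext => x /=; rewrite mulrC.
Qed.

Lemma L2_N f : L2 f -> L2 (fun x => - f x).
Proof.
move=> /(L2_Z (-1)); rewrite (_ : (fun x => _) = fun x => - f x)//.
by apply/funext => x; rewrite mulN1r.
Qed.

Lemma L2_B f g : L2 f -> L2 g -> L2 (fun x => f x - g x).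
Proof. by move=> lf /L2_N; exact: L2_D. Qed.

Lemma L2_cst a : L2 (cst a : field).
Proof. exact: Lfun_cst. Qed.

Lemma L2_sum (I : Type) (r : seq I) (F : I -> field) : (forall i, L2 (F i)) ->
  L2 (fun x => \sum_(i <- r) F i x).
Proof.
move=> lF; elim: r => [|i r IH].
  rewrite (_ : (fun x => _) = cst 0); first exact: L2_cst.
  by apply/funext => x; rewrite big_nil.
rewrite (_ : (fun x => _) = fun x => F i x + \sum_(j <- r) F j x); first exact: L2_D.
by apply/funext => x; rewrite big_cons.
Qed.

Lemma ipC f g : ip f g = ip g f.
Proof. by apply: eq_Rintegral => x _; rewrite mulrC. Qed.

Lemma ip_Dl f g h : L2 f -> L2 g -> L2 h -> ip (fun x => f x + g x) h = ip f h + ip g h.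
Proof.
move=> lf lg lh; rewrite /ip -RintegralD//; [|exact: L2_mul|exact: L2_mul].
by apply: eq_Rintegral => x _; rewrite mulrDl.
Qed.

Lemma ip_Zl a f h : L2 f -> L2 h -> ip (fun x => a * f x) h = a * ip f h.
Proof.
move=> lf lh; rewrite /ip -RintegralZl//; last exact: L2_mul.
by apply: eq_Rintegral => x _; rewrite mulrA.
Qed.

Lemma ip_Nl f h : L2 f -> L2 h -> ip (fun x => - f x) h = - ip f h.
Proof.
move=> lf lh; rewrite -mulN1r -ip_Zl//; apply: eq_Rintegral => x _.
by rewrite mulN1r.
Qed.

Lemma ip_Bl f g h : L2 f -> L2 g -> L2 h -> ip (fun x => f x - g x) h = ip f h - ip g h.
Proof. by move=> lf lg lh; rewrite ip_Dl ?ip_Nl//; exact: L2_N. Qed.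

Lemma ip_0l h : ip (cst 0) h = 0.
Proof. by rewrite /ip (@eq_Rintegral _ _ _ _ _ (cst 0)) ?Rintegral_cst ?mul0r// => x _; rewrite mul0r. Qed.

Lemma ip_suml (I : Type) (r : seq I) (F : I -> field) h : (forall i, L2 (F i)) -> L2 h ->
  ip (fun x => \sum_(i <- r) F i x) h = \sum_(i <- r) ip (F i) h.
Proof.
move=> lF lh; elim: r => [|i r IH].
  rewrite big_nil -[RHS](ip_0l h); apply: eq_Rintegral => x _.
  by rewrite big_nil.
rewrite big_cons -IH -ip_Dl//; last exact: L2_sum.
by apply: eq_Rintegral => x _; rewrite big_cons.
Qed.

Lemma ip_Dr f g h : L2 f -> L2 g -> L2 h -> ip h (fun x => f x + g x) = ip h f + ip h g.
Proof. by move=> ? ? ?; rewrite !(ipC h) ip_Dl. Qed.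

Lemma ip_Zr a f h : L2 f -> L2 h -> ip h (fun x => a * f x) = a * ip h f.
Proof. by move=> ? ?; rewrite !(ipC h) ip_Zl. Qed.

Lemma ip_Br f g h : L2 f -> L2 g -> L2 h -> ip h (fun x => f x - g x) = ip h f - ip h g.
Proof. by move=> ? ? ?; rewrite !(ipC h) ip_Bl. Qed.

Lemma ip_sumr (I : Type) (r : seq I) (F : I -> field) h : (forall i, L2 (F i)) -> L2 h ->
  ip h (fun x => \sum_(i <- r) F i x) = \sum_(i <- r) ip h (F i).
Proof. by move=> lF lh; rewrite ipC ip_suml//; apply: eq_bigr => i _; rewrite ipC. Qed.

Lemma ip_ge0 f : 0 <= ip f f.
Proof. by apply: Rintegral_ge0 => x _; rewrite -expr2 sqr_ge0. Qed.

Lemma ip_eq0 f : L2 f -> ip f f = 0 -> ae_eq_cube f (cst 0).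
Proof.
move=> lf f0; have := L2_mul lf lf => ff.
have : (\int[mu]_x `|(f x * f x)%:E| = 0)%E.
  rewrite (_ : (\int[mu]_x _ = \int[mu]_x (f x * f x)%:E)%E); last first.
    by apply: eq_integral => x _; rewrite gee0_abs// lee_fin -expr2 sqr_ge0.
  by rewrite -(@fineK _ (\int[mu]_x _)%E) ?integrable_fin_num// -[fine _]/(ip f f) f0.
move/(ae_eq_integral_abs mu measurableT (measurable_int _ ff)).
apply: filterS => x /= /(_ I) /= /eqP; rewrite eqe -expr2 sqrf_eq0 => /eqP.
exact.
Qed.

Lemma ip_ae f f' g : L2 f -> L2 f' -> L2 g -> ae_eq_cube f f' -> ip f g = ip f' g.
Proof.
move=> lf lf' lg ff'; rewrite /ip /Rintegral; congr fine; apply: ae_eq_integral => //.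
- exact: measurable_int (L2_mul lf lg).
- exact: measurable_int (L2_mul lf' lg).
- by apply: filterS ff' => x /= -> _.
Qed.

Lemma ip_sqrD f g (t : R) : L2 f -> L2 g ->
  ip (fun x => f x + t * g x) (fun x => f x + t * g x) =
  ip f f + 2 * t * ip f g + t ^+ 2 * ip g g.
Proof.
move=> lf lg; have lt := L2_Z t lg; have lft := L2_D lf lt.
by rewrite ip_Dl// !ip_Dr// !ip_Zl// !ip_Zr// (ipC g f); ring.
Qed.

Lemma ip_CS2 f g : L2 f -> L2 g -> ip f g ^+ 2 <= ip f f * ip g g.
Proof.
move=> lf lg; have g0 := ip_ge0 g.
have H t := ip_ge0 (fun x => f x + t * g x).
have {}H t : 0 <= ip f f + 2 * t * ip f g + t ^+ 2 * ip g g by rewrite -ip_sqrD.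
have [g00|gn0] := eqVneq (ip g g) 0.
  have gz := ip_eq0 lg g00.
  rewrite ipC (ip_ae lg (L2_cst 0) lf gz) ip_0l expr0n/= g00 mulr0//.
have gp : 0 < ip g g by rewrite lt_def gn0.
have := H (- ip f g / ip g g).
set a := ip f f; set b := ip f g; set c := ip g g in gp gn0 *.
have -> : a + 2 * (- b / c) * b + (- b / c) ^+ 2 * c = (a * c - b ^+ 2) / c by field.
by rewrite pmulr_lge0 ?invr_gt0// subr_ge0.
Qed.

Lemma ip_CS f g : L2 f -> L2 g -> `|ip f g| <= normL2 f * normL2 g.
Proof.
move=> lf lg; rewrite -(ler_pXn2r (n:=2))// ?nnegrE ?mulr_ge0 ?sqrtr_ge0//.
rewrite -normrX ger0_norm ?sqr_ge0// exprMn !sqr_sqrtr ?ip_ge0//.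
exact: ip_CS2.
Qed.

Lemma normL2_sqr f : normL2 f ^+ 2 = ip f f.
Proof. by rewrite sqr_sqrtr ?ip_ge0. Qed.

Lemma normL2_ge0 f : 0 <= normL2 f.
Proof. exact: sqrtr_ge0. Qed.

Lemma measurable_coord (i : 'I_d) :
  measurable_fun [set: 'rV[R]_d] (fun x : 'rV[R]_d => x ord0 i : measurableTypeR R).
Proof.
move=> _ D mD; rewrite setTI; apply: sub_sigma_algebra => /=.
rewrite -bigcup_seq/=; exists i; first by rewrite /= mem_index_enum.
by exists D => //; rewrite setTI.
Qed.

Lemma L2_bounded f C : measurable_fun [set: 'rV[R]_d] f ->
  {ae mu, forall x, `|f x| <= C} -> L2 f.
Proof.
move=> mf fC; apply: L2I => //.
apply/integrableP; split; first by apply/measurable_EFinP; exact: measurable_funX.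
apply: (@le_lt_trans _ _ (\int[mu]_x (C ^+ 2)%:E)%E).
  apply: ae_ge0_le_integral => //.
  - by apply: measurableT_comp => //; apply/measurable_EFinP; exact: measurable_funX.
  - by move=> x _; rewrite lee_fin sqr_ge0.
  - apply: filterS fC => x h _ /=; rewrite lee_fin normrX lerXn2r// ?nnegrE//.
    exact: le_trans h.
by rewrite integral_cst//= [X in (_ * X)%E]probability_setT mule1 ltry.
Qed.

Lemma ip_dct w (F : nat -> field) f C : L2 w ->
  (forall m, measurable_fun [set: 'rV[R]_d] (F m)) ->
  measurable_fun [set: 'rV[R]_d] f ->
  {ae mu, forall x, forall m, `|F m x| <= C} ->
  {ae mu, forall x, F m x @[m --> \oo] --> f x} ->
  ip w (F m) @[m --> \oo] --> ip w f.
Proof.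
move=> lw mF mf FC Ff.
have mw := L2_measurable lw.
have iw : mu.-integrable setT (fun x => (`|w x| * `|C|)%:E).
  have := L2_mul lw (L2_cst `|C|) => /integrable_abse; apply: eq_integrable => // x _ /=.
  by rewrite normrM normr_id.
have [] := @dominated_convergence _ _ _ mu setT measurableT
  (fun m x => (w x * F m x)%:E) (fun x => (w x * f x)%:E) (fun x => (`|w x| * `|C|)%:E).
- by move=> m; apply/measurable_EFinP; exact: measurable_funM.
- by apply/measurable_EFinP; exact: measurable_funM.
- apply: filterS Ff => x Fx _; apply: cvg_EFin; first by near=> n.
  exact: cvgMl_tmp.
- exact: iw.
- apply: filterS FC => x Fx n _; rewrite lee_fin normrM ler_wpM2l//.
  by apply: le_trans (Fx n) _; exact: ler_norm.
move=> iwf _ /= H; rewrite /ip.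
have fwf : (\int[mu]_x (w x * f x)%:E)%E \is a fin_num by exact: integrable_fin_num.
by move: H; rewrite -(fineK fwf); exact: fine_cvg.
Unshelve. all: by end_near. Qed.

End L2_toolkit.

(** * Integration by slices and completeness of tensor families *)

Section cube_fubini.
Context (R : realType).
Local Notation unif := (uniform_prob (@ltr01 R)).

Lemma row_cons0 m (z : measurableTypeR R * 'rV[R]_m) : row_cons z ord0 ord0 = z.1.
Proof.
have -> : ord0 = lshift m ord0 :> 'I_(1 + m) by apply: val_inj.
by rewrite /row_cons [LHS](row_mxEl (z.1)%:M z.2 ord0 ord0) mxE.
Qed.

Lemma row_cons_lift m (z : measurableTypeR R * 'rV[R]_m) k :
  row_cons z ord0 (lift ord0 k) = z.2 ord0 k.
Proof.
have -> : lift ord0 k = rshift 1 k :> 'I_(1 + m) by apply: val_inj.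
exact: (row_mxEr (z.1)%:M z.2 ord0 k).
Qed.

Lemma tensor_row_cons m (h : 'I_m.+1 -> R -> R) z :
  tensor h (row_cons z) = h ord0 z.1 * tensor (fun i => h (lift ord0 i)) z.2.
Proof.
rewrite /tensor big_ord_recl row_cons0; congr (_ * _).
by apply: eq_bigr => i _; rewrite row_cons_lift.
Qed.

Lemma ge0_integral_cubeS m (f : 'rV[R]_m.+1 -> \bar R) :
  measurable_fun [set: 'rV[R]_m.+1] f -> (forall x, 0 <= f x)%E ->
  (\int[cube_measure R m.+1]_x f x =
   \int[unif]_x \int[cube_measure R m]_y f (row_cons (x, y)))%E.
Proof.
move=> mf f0.
rewrite /cube_measure -/(cube_measure R m) /distribution.
rewrite ge0_integral_pushforward//.
rewrite preimage_setT [LHS](@fubini_tonelli1 _ _ _ _ _ unif (cube_measure R m) (f \o @row_cons R m))//.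
  by apply: measurableT_comp => //; exact: measurable_row_cons.
by move=> z; exact: f0.
Qed.

Lemma integrable_cubeS m (f : 'rV[R]_m.+1 -> R) :
  (cube_measure R m.+1).-integrable setT (EFin \o f) ->
  (unif \x cube_measure R m)%E.-integrable setT (fun z => (f (row_cons z))%:E).
Proof.
move=> /integrableP[mf fi].
have mc : measurable_fun setT (fun z => (f (@row_cons R m z))%:E).
  exact: (measurableT_comp mf (@measurable_row_cons R m)).
apply/integrableP; split => //.
move: fi; rewrite /cube_measure -/(cube_measure R m) /distribution.
rewrite ge0_integral_pushforward//; exact: measurableT_comp.
Qed.

Lemma integral_cubeS m (f : 'rV[R]_m.+1 -> R) :
  (cube_measure R m.+1).-integrable setT (EFin \o f) ->
  (\int[cube_measure R m.+1]_x (f x)%:E =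
   \int[unif]_x \int[cube_measure R m]_y (f (row_cons (x, y)))%:E)%E.
Proof.
move=> fi; have fi2 := integrable_cubeS fi.
rewrite [RHS](@fubini1 _ _ _ _ _ unif (cube_measure R m) (fun z => (f (row_cons z))%:E) fi2).
rewrite /cube_measure -/(cube_measure R m) /distribution.
rewrite integral_pushforward//; first exact: measurable_int fi.
Qed.

Lemma ae_cubeS m (P : 'rV[R]_m.+1 -> Prop) : measurable [set x | P x] ->
  {ae unif, forall x, {ae cube_measure R m, forall y, P (row_cons (x, y))}} ->
  {ae cube_measure R m.+1, forall z, P z}.
Proof.
move=> mP aeP; exists (~` [set x | P x]); split => //; first exact: measurableC.
have mN : measurable (~` [set x | P x]) by exact: measurableC.
have mi : measurable_fun setT (EFin \o \1_(~` [set x | P x]) : 'rV[R]_m.+1 -> \bar R).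
  exact/measurable_EFinP.
have mc : measurable_fun setT (fun z => (\1_(~` [set x | P x]) (@row_cons R m z))%:E : \bar R).
  exact: (measurableT_comp mi (@measurable_row_cons R m)).
have <- : (\int[cube_measure R m.+1]_x (\1_(~` [set x | P x]) x)%:E = cube_measure R m.+1 (~` [set x | P x]))%E.
  by rewrite integral_indic// setIT.
rewrite (ge0_integral_cubeS (f := fun x => (\1_(~` [set x | P x]) x)%:E))//.
- rewrite (ae_eq_integral (cst 0%E))//.
  + exact: integral0.
  + by apply: (@measurable_fun_fubini_tonelli_F _ _ _ _ _ (cube_measure R m)
      (fun z => (\1_(~` [set x | P x]) (@row_cons R m z))%:E)) => // z; rewrite lee_fin.
  + apply: filterS aeP => x px _ /=.
    rewrite (ae_eq_integral (cst 0%E))//.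
    * exact: integral0.
    * exact: measurableT_comp mc (measurable_pair1 x).
    * apply: filterS px => y Py _ /=; rewrite indicE memNset//.
Qed.

Lemma integral_unif (f : measurableTypeR R -> \bar R) : measurable_fun setT f ->
  (\int[unif]_x f x = \int[@lebesgue_measure R]_(x in `[0%R, 1%R]) f x)%E.
Proof.
move=> mf; rewrite integralE [RHS]integralE.
have one : ((1 - 0)^-1 : R)%:E = 1%E by rewrite subr0 invr1.
congr (_ - _)%E; rewrite integral_uniform ?one ?mul1e//.
- exact: measurable_funepos.
- exact: measurable_funeneg.
Qed.

Lemma ae_unif01 : {ae unif, forall x : R, 0 < x < 1}.
Proof.
pose N : set R := ~` `]0, 1[%classic.
have mN : measurable (N : set (measurableTypeR R)).
  by apply: measurableC; exact: measurable_itv.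
exists N; split => //.
have mi : measurable_fun setT (EFin \o \1_N : measurableTypeR R -> \bar R).
  exact/measurable_EFinP/measurable_indic.
have <- : (\int[unif]_x (\1_N x)%:E = unif N)%E by rewrite integral_indic ?setIT.
rewrite (integral_unif mi) -integral_itv_bndo_bndc; last exact: measurable_funTS.
rewrite -integral_itv_obnd_cbnd; last exact: measurable_funTS.
rewrite -[RHS](@integral0 _ _ _ (@lebesgue_measure R) `]0%R, 1%R[%classic).
apply: eq_integral => x; rewrite inE => x01 /=.
by rewrite indicE memNset//; apply.
Qed.

#[global] Instance unif_ae_filter : Filter (almost_everywhere unif).
Proof. exact: (@ae_filter_ringOfSetsType _ _ _ unif). Qed.

Lemma ae_cube d : {ae cube_measure R d, forall x, @cube R d x}.
Proof.
elim: d => [|m IH]; first by apply: aeW => x -[].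
apply: ae_cubeS.
  rewrite (_ : [set x | _] = \bigcap_(i in [set` enum 'I_m.+1])
      ((fun x : 'rV[R]_m.+1 => x ord0 i : measurableTypeR R) @^-1` `]0, 1[%classic)).
    apply: fin_bigcap_measurable => // i _; rewrite -[X in measurable X]setTI.
    by apply: measurable_coord => //; exact: measurable_itv.
  apply/seteqP; split=> x /= h.
    by move=> i _; rewrite /= in_itv/=; exact: h.
  by move=> i; have := h i; rewrite /= mem_enum in_itv/= => /(_ isT).
apply: filterS ae_unif01 => x x01; apply: filterS IH => y cy i.
by have [k ->|->] := unliftP ord0 i; [rewrite row_cons_lift|rewrite row_cons0].
Qed.

(* Only the values on the cube matter, but bounds on the whole space are all that
   the trigonometric factors need. *)
Definition nice (h : R -> R) : Prop :=
  measurable_fun [set: measurableTypeR R] (h : measurableTypeR R -> R) /\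
  exists C, forall x, `|h x| <= C.

Lemma nice_continuous_bounded h C : continuous h -> (forall x, `|h x| <= C) -> nice h.
Proof. by move=> ch hC; split; [exact: continuous_measurable_fun|exists C]. Qed.

Lemma niceM h g : nice h -> nice g -> nice (fun x => h x * g x).
Proof.
move=> [mh [C hC]] [mg [D gD]]; split; first exact: measurable_funM.
by exists (C * D) => x; rewrite normrM ler_pM.
Qed.

Lemma unif_integrable h : nice h -> unif.-integrable setT (EFin \o h).
Proof.
move=> [mh [C hC]]; apply: measurable_bounded_integrable => //.
  by rewrite [X in (X < _)%E]probability_setT ltry.
exists C; split; first exact: num_real.
by move=> M CM x _; apply: le_trans (hC x) (ltW CM).
Qed.

Lemma measurable_tensor_nice d (h : 'I_d -> R -> R) : (forall i, nice (h i)) ->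
  measurable_fun [set: 'rV[R]_d] (tensor h).
Proof.
move=> nh; apply: measurable_prod => i _.
apply: (@measurableT_comp _ _ _ _ _ _ (h i : measurableTypeR R -> R) _
  (fun x : 'rV[R]_d => x ord0 i : measurableTypeR R)).
  by have [] := nh i.
exact: measurable_coord.
Qed.

Lemma tensor_bounded d (h : 'I_d -> R -> R) : (forall i, nice (h i)) ->
  exists2 C, 0 <= C & forall x, `|tensor h x| <= C.
Proof.
move=> nh; have [C hC] := choice (fun i => (nh i).2).
exists (\prod_i `|C i|); first exact: prodr_ge0.
move=> x; rewrite /tensor normr_prod; apply: ler_prod => i _.
by rewrite normr_ge0/=; apply: le_trans (hC i _) (ler_norm _).
Qed.

Lemma tensor_integrable d (h : 'I_d -> R -> R) : (forall i, nice (h i)) ->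
  (cube_measure R d).-integrable setT (EFin \o tensor h).
Proof.
move=> nh; have [C C0 hC] := tensor_bounded nh.
apply: measurable_bounded_integrable => //; first by rewrite [X in (X < _)%E]probability_setT ltry.
  exact: measurable_tensor_nice.
exists C; split; first exact: num_real.
by move=> M CM x _; apply: le_trans (hC x) (ltW CM).
Qed.

Lemma L2_tensor d (h : 'I_d -> R -> R) : (forall i, nice (h i)) -> L2 (tensor h).
Proof.
move=> nh; have [C C0 hC] := tensor_bounded nh.
by apply: (@L2_bounded _ _ _ C); [exact: measurable_tensor_nice|exact: aeW].
Qed.

Lemma integral_tensor d (h : 'I_d -> R -> R) : (forall i, nice (h i)) ->
  \int[cube_measure R d]_x tensor h x = \prod_i \int[unif]_x h i x.
Proof.
elim: d h => [|m IH] h nh.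
  rewrite big_ord0 /Rintegral integral_dirac//= /tensor ?big_ord0//.
    by rewrite indicE mem_set// mulr1.
  by apply/measurable_EFinP; exact: measurable_tensor_nice.
have nh' i : nice (h (lift ord0 i)) by [].
have ti := tensor_integrable nh.
rewrite /Rintegral (integral_cubeS ti) big_ord_recl -IH//.
transitivity (fine (\int[unif]_x ((h ord0 x)%:E *
   (\int[cube_measure R m]_y tensor (fun i => h (lift ord0 i)) y)%:E))%E).
  congr fine; apply: eq_integral => x _.
  under eq_integral => y _ do rewrite tensor_row_cons/= EFinM.
  rewrite integralZl//; last exact: (tensor_integrable nh').
  by rewrite /Rintegral fineK// integrable_fin_num//; exact: (tensor_integrable nh').
rewrite integralZr//; last exact: (unif_integrable (nh ord0)).
rewrite fineM//; apply: integrable_fin_num => //.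
exact: (unif_integrable (nh ord0)).
Qed.

Lemma ip_tensor d (h g : 'I_d -> R -> R) : (forall i, nice (h i)) -> (forall i, nice (g i)) ->
  ip (tensor h) (tensor g) = \prod_i \int[unif]_x (h i x * g i x).
Proof.
move=> nh ng; rewrite -(integral_tensor (h := fun i x => h i x * g i x)).
  by apply: eq_Rintegral => x _; rewrite /tensor big_split.
by move=> i; exact: niceM.
Qed.

(* Completeness in L^1, which goes through Fubini's theorem more easily than
   completeness in L^2. *)
Definition complete1 (F : nat -> R -> R) : Prop := forall g : measurableTypeR R -> R,
  unif.-integrable setT (EFin \o g) ->
  (forall n, (\int[unif]_x (g x * F n x)%:E = 0)%E) -> {ae unif, forall x, g x = 0}.

Lemma integrableM_nice d (f : 'rV[R]_d -> R) (h : 'I_d -> R -> R) :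
  (cube_measure R d).-integrable setT (EFin \o f) -> (forall i, nice (h i)) ->
  (cube_measure R d).-integrable setT (EFin \o (fun x => f x * tensor h x)).
Proof.
move=> fi nh; have [C C0 hC] := tensor_bounded nh.
have mf := measurable_int _ fi.
apply: (le_integrable measurableT _ _ (integrableZr measurableT C fi)).
  apply/measurable_EFinP; apply: measurable_funM; first exact/measurable_EFinP.
  exact: measurable_tensor_nice.
move=> x _ /=; rewrite lee_fin !normrM ler_wpM2l//.
by apply: le_trans (hC x) (ler_norm _).
Qed.

(** Induction on the dimension. With the modes of the last coordinates fixed, integrating these
    coordinates out leaves a function of the first one that is orthogonal to a complete family,
    hence zero. The modes are countable, so almost every slice of [f] is orthogonal to all of them
    and the induction hypothesis applies to it. *)
Lemma tensor_complete d (F : 'I_d -> nat -> R -> R) (f : 'rV[R]_d -> R) :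
  (forall i n, nice (F i n)) -> (forall i, complete1 (F i)) ->
  (cube_measure R d).-integrable setT (EFin \o f) ->
  (forall n : {ffun 'I_d -> nat},
     (\int[cube_measure R d]_x (f x * tensor (fun i => F i (n i)) x)%:E = 0)%E) ->
  {ae cube_measure R d, forall x, f x = 0}.
Proof.
elim: d F f => [|m IH] F f nF cF fi fF.
  have := fF [ffun i => 0%N].
  rewrite integral_dirac//; last first.
    by apply: measurable_int (integrableM_nice fi _).
  rewrite diracT mul1e /tensor big_ord0 mulr1 => -[f0].
  apply: aeW => x; rewrite -f0; congr f.
  by apply/rowP => -[].
have nF' i n : nice (F (lift ord0 i) n) by [].
have mf := measurable_int _ fi.
have fi2 := integrable_cubeS fi.
pose T (n : {ffun 'I_m -> nat}) := tensor (fun i => F (lift ord0 i) (n i)).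
have nFT (n : {ffun 'I_m -> nat}) i : nice (F (lift ord0 i) (n i)) by [].
have Tint (n : {ffun 'I_m -> nat}) :
    (unif \x cube_measure R m)%E.-integrable setT (fun z => (f (row_cons z) * T n z.2)%:E).
  (* A constant factor 1 in the first coordinate makes the product with [T n] a tensor product on
     the whole cube. *)
  pose h (i : 'I_m.+1) := if unlift ord0 i is Some k then F (lift ord0 k) (n k) else cst 1.
  have nh i : nice (h i).
    rewrite /h; case: unliftP => [j _|_] //; split; first exact: measurable_cst.
    by exists 1 => x; rewrite normr1.
  apply: eq_integrable (integrable_cubeS (integrableM_nice fi nh)) => // z _ /=.
  rewrite tensor_row_cons /h unlift_none mul1r /T; congr (_ * _)%:E.
  by apply: eq_bigr => i _; rewrite liftK.
have G0 (n : {ffun 'I_m -> nat}) : {ae unif, forall x,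
    (\int[cube_measure R m]_y (f (row_cons (x, y)) * T n y)%:E = 0)%E}.
  have Gi := integrable_fubini_F (Tint n).
  have Gfin := integrable_ae measurableT Gi.
  pose G x := fine (fubini_F (cube_measure R m) (fun z => (f (row_cons z) * T n z.2)%:E) x).
  have GE : {ae unif, forall x, (G x)%:E =
      fubini_F (cube_measure R m) (fun z => (f (row_cons z) * T n z.2)%:E) x}.
    by apply: filterS Gfin => x /(_ I) h; rewrite fineK.
  have mG : measurable_fun setT (EFin \o G).
    apply/measurable_EFinP; apply: (measurableT_comp (f := fine)).
      exact: fine_measurable.
    exact: measurable_int Gi.
  have Gint : unif.-integrable setT (EFin \o G).
    apply: (le_integrable measurableT mG _ Gi) => x _ /=.
    by rewrite /G; case: (fubini_F _ _ x) => [r||] /=; rewrite ?lexx ?normr0 ?leey.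
  suff : {ae unif, forall x, G x = 0}.
    by apply: filterS2 GE => x Gx G0x; rewrite -[LHS]Gx G0x.
  apply: (cF ord0 G Gint) => l.
  pose nl : {ffun 'I_m.+1 -> nat} :=
    [ffun i => if unlift ord0 i is Some k then n k else l].
  rewrite -[RHS](fF nl) (integral_cubeS (integrableM_nice fi _))//.
  apply: ae_eq_integral => //.
  - apply/measurable_EFinP; apply: measurable_funM; first exact/measurable_EFinP.
    by have [] := nF ord0 l.
  - have /integrable_fubini_F := integrable_cubeS (integrableM_nice fi
      (h := fun i => F i (nl i)) (fun i => nF i _)).
    exact: measurable_int.
  have Ti := ae_integrable1 (Tint n).
  apply: filterS2 GE Ti => x Gx Tix _ /=.
  rewrite EFinM Gx /fubini_F -integralZr//.
  apply: eq_integral => y _.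
  rewrite tensor_row_cons /= /nl ffunE unlift_none -EFinM; congr EFin.
  rewrite -mulrA; congr (_ * _); rewrite mulrC; congr (_ * _).
  by apply: eq_bigr => i _; rewrite ffunE liftK.
have {}G0 : {ae unif, forall x, forall n : {ffun 'I_m -> nat},
    (\int[cube_measure R m]_y (f (row_cons (x, y)) * T n y)%:E = 0)%E}.
  (* The modes are enumerated through [unpickle], with [True] on the numbers that code no mode, to
     intersect countably many sets of full measure. *)
  have : {ae unif, forall x, forall l : nat, oapp (fun n : {ffun 'I_m -> nat} =>
      (\int[cube_measure R m]_y (f (row_cons (x, y)) * T n y)%:E = 0)%E) True (unpickle l)}.
    apply: ae_foralln => l; case: (unpickle l) => [n|] /=; first exact: G0.
    exact: aeW.
  by apply: filterS => x h n; have := h (pickle n); rewrite pickleK.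
apply: ae_cubeS.
  rewrite (_ : [set x | _] = f @^-1` [set 0]); last by [].
  by rewrite -[X in measurable X]setTI; move/measurable_EFinP: mf; apply.
have fxi := ae_integrable1 fi2.
apply: filterS2 G0 fxi => x Gx fxi.
exact: (IH (fun i => F (lift ord0 i)) (fun y => f (row_cons (x, y)))).
Qed.

End cube_fubini.

(** * Completeness of the cosines and of the sines *)

Section trig_complete.
Context (R : realType).
Local Notation unif := (uniform_prob (@ltr01 R)).

Definition tcos (n : nat) (x : R) : R :=
  (if n == 0%N then 1 else Num.sqrt 2) * cos (pi * n%:R * x).
Definition tsin (n : nat) (x : R) : R := Num.sqrt 2 * sin (pi * n%:R * x).

Lemma smooth1_cosn (a : R) : smooth1 (fun x => cos (a * x)).
Proof.
have := smooth1_affine a 0 (@smooth1_cos R); congr smooth1.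
by apply/funext => x; rewrite addr0.
Qed.

Lemma smooth1_sinn (a : R) : smooth1 (fun x => sin (a * x)).
Proof.
have := smooth1_affine a 0 (@smooth1_sin R); congr smooth1.
by apply/funext => x; rewrite addr0.
Qed.

Lemma smooth1_tcos n : smooth1 (tcos n).
Proof. exact/smooth1Z/smooth1_cosn. Qed.

Lemma smooth1_tsin n : smooth1 (tsin n).
Proof. exact/smooth1Z/smooth1_sinn. Qed.

Lemma normr_cos_le1 (x : R) : `|cos x| <= 1.
Proof. by rewrite ler_norml cos_geN1 cos_le1. Qed.

Lemma normr_sin_le1 (x : R) : `|sin x| <= 1.
Proof. by rewrite ler_norml sin_geN1 sin_le1. Qed.

Lemma nice_cosn (a : R) : nice (fun x => cos (a * x)).
Proof.
apply: (@nice_continuous_bounded _ _ 1).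
  exact/smooth1_continuous/smooth1_cosn.
by move=> x; exact: normr_cos_le1.
Qed.

Lemma nice_cst (a : R) : nice (cst a).
Proof.
by apply: (@nice_continuous_bounded _ _ `|a|) => //; exact: cst_continuous.
Qed.

Lemma nice_tcos n : nice (tcos n).
Proof. exact: (niceM (nice_cst _) (nice_cosn _)). Qed.

Lemma nice_sinn (a : R) : nice (fun x => sin (a * x)).
Proof.
apply: (@nice_continuous_bounded _ _ 1).
  exact/smooth1_continuous/smooth1_sinn.
by move=> x; exact: normr_sin_le1.
Qed.

Lemma nice_tsin n : nice (tsin n).
Proof. exact: (niceM (nice_cst _) (nice_sinn _)). Qed.

Lemma niceD (h k : R -> R) : nice h -> nice k -> nice (fun x => h x + k x).
Proof.
move=> [mh [C hC]] [mk [D kD]]; split; first exact: measurable_funD.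
by exists (C + D) => x; apply: (le_trans (ler_normD _ _)); exact: lerD.
Qed.

Lemma niceX (h : R -> R) n : nice h -> nice (fun x => h x ^+ n).
Proof.
move=> nh; elim: n => [|n IH]; first exact: (nice_cst 1).
by under eq_fun do rewrite exprS; exact: niceM.
Qed.

Section functional.
Context (g : measurableTypeR R -> R).
Context (gi : unif.-integrable setT (EFin \o g)).
Let J (h : R -> R) : R := \int[unif]_x (g x * h x).

Lemma unif_integrableM (h : R -> R) : nice h ->
  unif.-integrable setT (EFin \o (fun x => g x * h x)).
Proof.
move=> [mh [C hC]]; have mg := measurable_int _ gi.
apply: (le_integrable measurableT _ _ (integrableZr measurableT C gi)).
  by apply/measurable_EFinP; apply: measurable_funM => //; exact/measurable_EFinP.
move=> x _ /=; rewrite lee_fin !normrM ler_wpM2l//.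
by apply: le_trans (hC x) (ler_norm _).
Qed.

Let JD (h k : R -> R) : nice h -> nice k -> J (fun x => h x + k x) = J h + J k.
Proof.
move=> nh nk; rewrite /J -RintegralD//; [|exact: unif_integrableM|exact: unif_integrableM].
by apply: eq_Rintegral => x _; rewrite mulrDr.
Qed.

Let JZ (a : R) (h : R -> R) : nice h -> J (fun x => a * h x) = a * J h.
Proof.
move=> nh; rewrite /J -RintegralZl//; last exact: unif_integrableM.
by apply: eq_Rintegral => x _; rewrite mulrCA.
Qed.

Let J_eq (h k : R -> R) : (forall x, h x = k x) -> J h = J k.
Proof. by move=> hk; apply: eq_Rintegral => x _; rewrite hk. Qed.

Context (gcos : forall n, J (fun x => cos (pi * n%:R * x)) = 0).

(** The product formula for cosines trades one power of [cos (pi * x)] for two neighbouring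
    frequencies. *)
Let J_cosX k n : J (fun x => cos (pi * x) ^+ k * cos (pi * n%:R * x)) = 0.
Proof.
have nc (a : R) := nice_cosn a.
have ncX j : nice (fun x : R => cos (pi * x) ^+ j) by apply: niceX; exact: nc.
elim: k n => [|k IH] n; first by rewrite -(gcos n); apply: J_eq => x; rewrite mul1r.
have prod (x : R) : cos (pi * x) * cos (pi * n.+1%:R * x) =
    2^-1 * cos (pi * n.+2%:R * x) + 2^-1 * cos (pi * n%:R * x).
  have -> : pi * n.+2%:R * x = pi * n.+1%:R * x + pi * x.
    by rewrite -[n.+2%:R]natr1; ring.
  have -> : pi * n%:R * x = pi * n.+1%:R * x - pi * x by rewrite -[n.+1%:R]natr1; ring.
  by rewrite cosD cosB; lra.
case: n prod => [|n] prod.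
  rewrite -(IH 1%N); apply: J_eq => x.
  by rewrite mulr0 mul0r cos0 mulr1 exprSr mulr1.
pose n' := n.
have prod' (x : R) : cos (pi * x) * cos (pi * n.+1%:R * x) =
    2^-1 * cos (pi * n.+2%:R * x) + 2^-1 * cos (pi * n%:R * x).
  have -> : pi * n.+2%:R * x = pi * n.+1%:R * x + pi * x.
    by rewrite -[n.+2%:R]natr1; ring.
  have -> : pi * n%:R * x = pi * n.+1%:R * x - pi * x by rewrite -[n.+1%:R]natr1; ring.
  by rewrite cosD cosB; lra.
transitivity (J (fun x => 2^-1 * (cos (pi * x) ^+ k * cos (pi * n.+2%:R * x))
   + 2^-1 * (cos (pi * x) ^+ k * cos (pi * n%:R * x)))).
  by apply: J_eq => x; rewrite exprSr -mulrA prod'; ring.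
have nk j : nice (fun x : R => cos (pi * x) ^+ k * cos (pi * j%:R * x)).
  exact: niceM.
by rewrite JD ?JZ ?IH ?mulr0 ?addr0//; apply: (niceM (nice_cst _)).
Qed.

Let nice_horner_cos (p : {poly R}) : nice (fun x => p.[cos (pi * x)]).
Proof.
elim/poly_ind: p => [|p c IH].
  by under eq_fun do rewrite horner0; exact: (nice_cst 0).
under eq_fun do rewrite hornerMXaddC.
by apply: niceD; [apply: niceM => //; exact: nice_cosn|exact: (nice_cst c)].
Qed.

Let J_poly (p : {poly R}) : J (fun x => p.[cos (pi * x)]) = 0.
Proof.
have nX j : nice (fun x : R => cos (pi * x) ^+ j) by apply: niceX; exact: nice_cosn.
have JX k : J (fun x => cos (pi * x) ^+ k) = 0.
  by rewrite -(J_cosX k 0); apply: J_eq => x; rewrite mulr0 mul0r cos0 mulr1.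
have H (r : seq 'I_(size p)) : nice (fun x => \sum_(i <- r) p`_i * cos (pi * x) ^+ i) /\
    J (fun x => \sum_(i <- r) p`_i * cos (pi * x) ^+ i) = 0.
  elim: r => [|i r [nr IH]].
    have e : (fun x : R => \sum_(i <- @nil 'I_(size p)) p`_i * cos (pi * x) ^+ i) = cst (0:R).
      by apply/funext => x; rewrite big_nil.
    rewrite e; split; first exact: nice_cst.
    rewrite /J (@eq_Rintegral _ _ _ _ _ (cst 0)) ?Rintegral_cst ?mul0r//.
    by move=> x _; rewrite mulr0.
  have e : (fun x : R => \sum_(i <- i :: r) p`_i * cos (pi * x) ^+ i) =
      fun x => p`_i * cos (pi * x) ^+ i + \sum_(i <- r) p`_i * cos (pi * x) ^+ i.
    by apply/funext => x; rewrite big_cons.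
  have ni : nice (fun x => p`_i * cos (pi * x) ^+ i) by apply: (niceM (nice_cst _)).
  by rewrite e JD// IH addr0 JZ// JX mulr0; split => //; exact: niceD.
rewrite -[RHS](H (index_enum _)).2; apply: J_eq => x; rewrite horner_coef //.
Qed.

(* [(1 - t ^ n) ^ (2 ^ n)] converges boundedly on [0, 1] to the indicator function
   of [t < 1 / 2]. *)
Let threshold (n : nat) (t : R) : R := (1 - t ^+ n) ^+ (2 ^ n)%N.

Let threshold01 n t : 0 <= t <= 1 -> 0 <= threshold n t <= 1.
Proof.
move=> /andP[t0 t1]; have tn0 : 0 <= t ^+ n by rewrite exprn_ge0.
have tn1 : t ^+ n <= 1 by rewrite exprn_ile1.
by rewrite exprn_ge0 ?subr_ge0//= exprn_ile1 ?subr_ge0// lerBlDr lerDl.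
Qed.

Let threshold_lt t : 0 <= t -> t < 2^-1 -> threshold n t @[n --> \oo] --> (1:R).
Proof.
move=> t0 t2.
have lo n : 1 - (2 * t) ^+ n <= threshold n t.
  have bern m (x : R) : 0 <= x <= 1 -> 1 - m%:R * x <= (1 - x) ^+ m.
    move=> /andP[x0 x1]; elim: m => [|m IH]; first by rewrite mul0r subr0 expr0.
    rewrite exprS; apply: (@le_trans _ _ ((1 - x) * (1 - m%:R * x))); last first.
      by rewrite ler_wpM2l// subr_ge0.
    rewrite -[m.+1%:R]natr1; have : 0 <= m%:R * x * x by rewrite !mulr_ge0.
    lra.
  rewrite exprMn -natrX; apply: bern.
  by rewrite exprn_ge0//= exprn_ile1//; lra.
apply: (@squeeze_cvgr _ _ _ _ (fun n => 1 - (2 * t) ^+ n) (fun=> 1)).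
- near=> n; rewrite lo/=.
  by have /andP[] : 0 <= threshold n t <= 1 by apply: threshold01; lra.
- rewrite -[X in _ --> X]subr0; apply: cvgB; first exact: cvg_cst.
  by apply: cvg_expr; rewrite ger0_norm; lra.
- exact: cvg_cst.
Unshelve. all: by end_near. Qed.

Let threshold_gt t : 2^-1 < t -> t <= 1 -> threshold n t @[n --> \oo] --> (0:R).
Proof.
move=> t2 t1; have t0 : 0 < t by lra.
have up n : threshold n t <= (2 * t) ^- n.
  have tn0 : 0 < t ^+ n by rewrite exprn_gt0.
  have tn1 : t ^+ n <= 1 by rewrite exprn_ile1// ltW.
  have bern m (x : R) : 0 <= x <= 1 -> (1 - x) ^+ m * (1 + m%:R * x) <= 1.
    move=> /andP[x0 x1]; elim: m => [|m IH]; first by rewrite mul0r expr0 addr0 mulr1.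
    apply: le_trans IH; rewrite exprSr -mulrA ler_wpM2l ?exprn_ge0 ?subr_ge0//.
    rewrite -[m.+1%:R]natr1; have : 0 <= m%:R * x * x by rewrite !mulr_ge0.
    have := sqr_ge0 x; lra.
  have two0 : 0 < (2 * t) ^+ n by rewrite exprn_gt0// mulr_gt0.
  rewrite -[leRHS]mul1r ler_pdivlMr//.
  have := bern (2 ^ n)%N (t ^+ n); rewrite (ltW tn0) tn1 => /(_ isT).
  apply: le_trans; rewrite /threshold ler_wpM2l//.
    by rewrite exprn_ge0// subr_ge0.
  by rewrite exprMn natrX lerDr.
apply: (@squeeze_cvgr _ _ _ _ (fun=> 0) (fun n => (2 * t) ^- n)).
- near=> n; rewrite up andbT.
  by have /andP[] : 0 <= threshold n t <= 1 by apply: threshold01; lra.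
- exact: cvg_cst.
- under eq_fun do rewrite -exprVn.
  by apply: cvg_expr; rewrite ger0_norm ?invr_ge0; [rewrite invf_lt1; lra|lra].
Unshelve. all: by end_near. Qed.

Let cos_ltr (x b : R) : 0 <= x -> x < b -> b <= 1 -> cos (pi * b) < cos (pi * x).
Proof.
move=> x0 xb b1; have p0 := pi_gt0 R.
rewrite ltr_cos ?in_itv/=.
- by rewrite ltr_pM2l.
- by apply/andP; split; [rewrite mulr_ge0// ltW|rewrite ler_piMr ?(ltW p0)//; lra].
- by apply/andP; split; [rewrite mulr_ge0 ?(ltW p0)//; lra|rewrite ler_piMr ?(ltW p0)//; lra].
Qed.

(** Since [cos (pi * x)] decreases on the interval, [x < b] means [t x < 2^-1]. The thresholds of
    [t] are polynomials in [cos (pi * x)], which the functional annihilates, and they converge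
    boundedly to the indicator of [x < b]. The divisor 4 keeps [t] between 0 and 1. *)
Let integral_lt (b : R) : 0 < b < 1 ->
  (\int[@lebesgue_measure R]_(x in `[0%R, b]) (g x)%:E = 0)%E.
Proof.
move=> /andP[b0 b1].
pose t x := 2^-1 + (cos (pi * b) - cos (pi * x)) / 4.
have t01 x : 0 <= t x <= 1.
  have := cos_le1 (pi * b); have := cos_geN1 (pi * b).
  have := cos_le1 (pi * x); have := cos_geN1 (pi * x); rewrite /t.
  by move=> ? ? ? ?; apply/andP; split; lra.
pose p n : {poly R} := (1 - ((2^-1 + cos (pi * b) / 4)%:P - (4^-1)%:P * 'X) ^+ n) ^+ (2 ^ n)%N.
have pE n x : (p n).[cos (pi * x)] = threshold n (t x).
  by rewrite /p /threshold !hornerE /=; congr ((1 - _ ^+ _) ^+ _); rewrite /t; field.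
pose ind x := (x < b)%R%:R : R.
have mi : measurable_fun setT (ind : measurableTypeR R -> R).
  rewrite (_ : ind = \1_(`]-oo, b[%classic)); first exact: measurable_indic.
  by apply/funext => x; rewrite indicE /ind -[(x \in _)]/(`[< _ >]) /=; congr (_%:R); rewrite asboolb in_itv.
have Jind : (\int[unif]_x (g x * ind x)%:E = 0)%E.
  have [] := @dominated_convergence _ _ _ unif setT measurableT
    (fun n x => (g x * (p n).[cos (pi * x)])%:E) (fun x => (g x * ind x)%:E)
    (fun x => `|(g x)%:E|%E).
  - by move=> n; exact: measurable_int (unif_integrableM (nice_horner_cos (p n))).
  - apply/measurable_EFinP; apply: measurable_funM => //.
    by apply/measurable_EFinP; exact: measurable_int gi.
  - have : {ae unif, forall x : R, x != b}.
      exists [set b]; split => //.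
        rewrite -[LHS](_ : \int[unif]_x (\1_[set b] x)%:E = _)%E; last first.
          by rewrite integral_indic ?setIT.
        rewrite integral_unif; last exact/measurable_EFinP/measurable_indic.
        rewrite integral_indic//; apply: (@subset_measure0 _ (measurableTypeR R) R (@lebesgue_measure R) _ [set b]) => //.
        + exact: measurableI.
        + exact: lebesgue_measure_set1.
      by move=> x /= /negP/negPn/eqP.
    apply: filterS2 (ae_unif01 R) => x /andP[x0 x1] xb _.
    apply: cvg_EFin; first by near=> n.
    apply: cvgMl_tmp; under eq_fun do rewrite pE.
    rewrite /ind; move: xb; rewrite neq_lt => /orP[xb|xb].
      rewrite xb; apply: threshold_lt; first by have /andP[] := t01 x.
      by rewrite /t; have := cos_ltr (ltW x0) xb (ltW b1); lra.
    rewrite ltNge (ltW xb)/=; apply: threshold_gt; last by have /andP[] := t01 x.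
    by rewrite /t; have := cos_ltr (ltW b0) xb (ltW x1); lra.
  - exact: integrable_abse.
  - apply: aeW => x n _; rewrite pE lee_fin normrM ler_piMr//.
    by have /andP[h0 h1] := threshold01 n (t01 x); rewrite ger0_norm.
  move=> _ _ /= H; have : (cst 0%E : nat -> \bar R) @ \oo --> (\int[unif]_x (g x * ind x)%:E)%E.
    apply: cvg_trans H; apply: near_eq_cvg; near=> n.
    have := J_poly (p n); rewrite /J /Rintegral => h.
    rewrite -[LHS]fineK; first by rewrite h.
    by apply: integrable_fin_num => //; exact: unif_integrableM.
  by move=> /cvg_lim <-//; rewrite lim_cst.
have mg := measurable_int _ gi.
rewrite -integral_itv_bndo_bndc; last exact: measurable_funTS.
rewrite -{}Jind integral_unif; last first.
  by apply/measurable_EFinP; apply: measurable_funM => //; exact/measurable_EFinP.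
rewrite integral_mkcond [RHS]integral_mkcond; apply: eq_integral => x _.
rewrite !patchE !mem_setE !in_itv/= /ind.
have [x0|x0] := leP 0 x => //=; have [xb|xb] := ltP x b.
  by rewrite (le_trans (ltW xb) (ltW b1)) mulr1.
by rewrite mulr0; case: ifP.
Unshelve. all: by end_near. Qed.

(** All integrals of [g] over [[0, b]] vanish, and Lebesgue differentiation recovers [g] almost
    everywhere. *)
Lemma ae_eq0_cos : {ae unif, forall x, g x = 0}.
Proof.
pose g1 : R -> R := g \_ `[0, 1]%classic.
have mg := measurable_int _ gi.
have ig : (@lebesgue_measure R).-integrable `[0, 1]%classic (EFin \o g).
  have /integrableP[_ fi] := gi; apply/integrableP; split; first exact: measurable_funTS.
  by move: fi; rewrite integral_unif//; exact: measurableT_comp.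
have ig1 : (@lebesgue_measure R).-integrable setT (EFin \o g1).
  have := (integrable_mkcond (EFin \o g) (measurable_itv `[0%R, 1%R] : measurable (`[0%R, 1%R]%classic : set (measurableTypeR R)))).1 ig.
  by apply: eq_integrable => // x _; rewrite /g1 /= !patchE; case: ifP.
have ig1y y : (@lebesgue_measure R).-integrable [set` Interval (BLeft 0) (BRight y)]
    (EFin \o g1).
  by apply: (integrableS measurableT _ _ ig1) => //; exact: measurable_itv.
have ig1l : locally_integrable [set: R] g1.
  split; first exact: (measurable_EFinP _ _).1 (measurable_int _ ig1).
    exact: openT.
  move=> K _ cK; have mK : measurable (K : set (measurableTypeR R)).
    by apply: closed_measurable; apply: compact_closed.
  have /integrableP[_] := integrableS measurableT mK (@subsetT _ _) ig1.
  by apply.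
have [N [mN N0 NP]] := @FTC1 R g1 (BLeft 0) ig1y ig1l.
have unifN : unif N = 0%E.
  rewrite -[LHS](_ : \int[unif]_x (\1_N x)%:E = _)%E; last first.
    by rewrite integral_indic ?setIT.
  rewrite integral_unif; last exact/measurable_EFinP/measurable_indic.
  rewrite integral_indic//; apply: (@subset_measure0 _ (measurableTypeR R) R (@lebesgue_measure R) _ N) => //.
  exact: measurableI.
have : {ae unif, forall x, ~ N x} by exists N; split => // x /= /contrapT.
apply: filterS2 (ae_unif01 R) => x x01 Nx; have /andP[x0 x1] := x01.
pose F (y : R) : R := \int[@lebesgue_measure R]_(t in [set` Interval (BLeft 0) (BRight y)]) g1 t.
have [_] : derivable F x 1 /\ derive1 F x = g1 x.
  by apply: contrapT => h; apply: Nx; apply: NP => /= h'; apply: h; apply: h'; rewrite lte_fin.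
rewrite /g1 patchE mem_set/= ?in_itv/= ?(ltW x0) ?(ltW x1)// => <-.
rewrite derive1E.
have [_ <-] := is_derive_cst (0:R) (x:R) 1.
apply: near_eq_derive; near=> y.
have y01 : 0 < y < 1.
  by apply/andP; split; near: y; [exact: lt_nbhsr|exact: lt_nbhsl].
rewrite /F /Rintegral; apply: EFin_inj.
rewrite -[RHS](integral_lt y01); have /andP[y0 y1] := y01.
transitivity (fine (\int[lebesgue_measure]_(t in `[0%R, y]) (g t)%:E))%E%:E.
  congr (fine _)%:E; apply: eq_integral => z; rewrite inE/= in_itv/= => /andP[z0 zy].
  by rewrite /g1 patchE mem_set//= in_itv/= z0 (le_trans zy (ltW y1)).
by rewrite (integral_lt y01).
Unshelve. all: by end_near. Qed.

End functional.

Lemma complete1_tcos : complete1 tcos.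
Proof.
move=> g gi gtcos; apply: ae_eq0_cos => // n.
have c0 : (if n == 0%N then 1 else Num.sqrt 2) != 0 :> R.
  by case: ifP => _; rewrite ?oner_neq0// gt_eqF// sqrtr_gt0.
apply: (mulfI c0); rewrite mulr0 -[RHS]/(fine 0%E) -(gtcos n).
rewrite -RintegralZl//; last by apply: unif_integrableM => //; exact: nice_cosn.
by apply: eq_Rintegral => x _; rewrite mulrCA.
Qed.

(** Reduction to cosines: a sine times a cosine is a combination of sines, so [g] times
    [sin (pi * x)] is orthogonal to every cosine, and [sin (pi * x)] is positive inside the
    interval. *)
Lemma complete1_tsin : complete1 tsin.
Proof.
move=> g gi gtsin.
have c0 : Num.sqrt 2 != 0 :> R by rewrite gt_eqF// sqrtr_gt0.
have Js n : \int[unif]_x (g x * sin (pi * n%:R * x)) = 0.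
  apply: (mulfI c0); rewrite mulr0 -[RHS]/(fine 0%E) -(gtsin n).
  rewrite -RintegralZl//; last by apply: unif_integrableM => //; exact: nice_sinn.
  by apply: eq_Rintegral => x _; rewrite mulrCA.
have ns a := @nice_sinn a.
pose g' : measurableTypeR R -> R := fun x => g x * sin (pi * x).
have g'i : unif.-integrable setT (EFin \o g') by exact: (unif_integrableM gi (ns pi)).
have : {ae unif, forall x, g' x = 0}.
  apply: ae_eq0_cos => // n; case: n => [|n].
    rewrite -[RHS](Js 1%N); apply: eq_Rintegral => x _.
    by rewrite /g' mulr0 mul0r cos0 !mulr1.
  transitivity (2^-1 * \int[unif]_x (g x * sin (pi * n.+2%:R * x))
     - 2^-1 * \int[unif]_x (g x * sin (pi * n%:R * x))); last by rewrite !Js mulr0 subr0.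
  rewrite -!RintegralZl//; [|exact: unif_integrableM|exact: unif_integrableM].
  rewrite -RintegralB//; [|exact: integrableZl (unif_integrableM gi (ns _))|exact: integrableZl (unif_integrableM gi (ns _))].
  apply: eq_Rintegral => x _; rewrite /g'.
  have -> : pi * n.+2%:R * x = pi * n.+1%:R * x + pi * x.
    by rewrite -[n.+2%:R]natr1; ring.
  have -> : pi * n%:R * x = pi * n.+1%:R * x - pi * x by rewrite -[n.+1%:R]natr1; ring.
  by rewrite sinD sinB; field.
apply: filterS2 (ae_unif01 R) => x /andP[x0 x1] /eqP; rewrite mulf_eq0 => /orP[/eqP//|].
rewrite gt_eqF// sin_gt0_pi// mulr_gt0 ?pi_gt0//=.
by rewrite gtr_pMr ?pi_gt0.
Qed.

End trig_complete.

(** * Completeness of L^2 *)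

Section riesz_fischer.
Context (R : realType) (d : nat).
Local Notation mu := (cube_measure R d).
Local Notation field := (scalar_field R d).
Implicit Types (f g w : field).

Definition dist2 f g : R := ip (fun x => f x - g x) (fun x => f x - g x).

Lemma dist2_ge0 f g : 0 <= dist2 f g.
Proof. exact: ip_ge0. Qed.

Lemma dist2C f g : dist2 f g = dist2 g f.
Proof. by apply: eq_Rintegral => x _; ring. Qed.

Lemma L2_abs f : L2 f -> L2 (fun x => `|f x|).
Proof.
move=> lf; have mf := L2_measurable lf; apply: L2I; first exact: measurableT_comp.
have := L2_sqr lf; congr (_.-integrable _ _).
by apply/funext => x /=; rewrite -normrX ger0_norm ?sqr_ge0.
Qed.

Lemma L1_le_L2 f : L2 f -> (\int[mu]_x `|(f x)%:E| <= (Num.sqrt (ip f f))%:E)%E.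
Proof.
move=> lf; have la := L2_abs lf.
have := ip_CS la (@L2_cst R d 1); rewrite /normL2.
have -> : ip (cst 1 : field) (cst 1) = 1.
  rewrite /ip; under eq_Rintegral => x _ do rewrite mulr1.
  by rewrite Rintegral_cst// mul1r -[LHS]/(fine (mu setT)) [X in fine X]probability_setT.
have -> : ip (fun x => `|f x|) (fun x => `|f x|) = ip f f.
  by apply: eq_Rintegral => x _; rewrite -normrM ger0_norm// -expr2 sqr_ge0.
rewrite sqrtr1 mulr1 => /(le_trans (ler_norm _)); rewrite -lee_fin; apply: le_trans.
rewrite /ip /Rintegral fineK; last by apply: integrable_fin_num => //; exact: (L2_mul la (@L2_cst R d 1)).
by rewrite le_eqVlt; apply/orP; left; apply/eqP; apply: eq_integral => x _; rewrite /= mulr1.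
Qed.

(** A subsequence whose squared increments are below [4^-1 ^+ k] has summable increments in L^1,
    hence converges almost everywhere. Fatou's lemma carries the Cauchy bound over to the limit. *)
Lemma L2_complete (u : nat -> field) : (forall n, L2 (u n)) ->
  (forall e : R, 0 < e -> exists N, forall m n, (N <= m)%N -> (N <= n)%N ->
     dist2 (u m) (u n) <= e) ->
  exists2 f, L2 f & forall e : R, 0 < e -> exists N, forall n, (N <= n)%N ->
     dist2 (u n) f <= e.
Proof.
move=> lu cau.
have e0 k : 0 < (4^-1 : R) ^+ k by rewrite exprn_gt0.
have [phi phiP] := choice (fun k => cau _ (e0 k)).
pose psi k : nat := (\sum_(j < k.+1) (phi j).+1)%N.
have psiS k : (psi k <= psi k.+1)%N by rewrite /psi [leqRHS]big_ord_recr/= leq_addr.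
have phi_psi k : (phi k <= psi k)%N.
  by rewrite /psi big_ord_recr/=; apply: leq_trans (leq_addl _ _).
have psi_ge k : (k <= psi k)%N.
  elim: k => // k IH; rewrite /psi big_ord_recr/= -/(psi k) addnS ltnS.
  exact: leq_trans IH (leq_addr _ _).
have psi_mono : {homo psi : k l / (k <= l)%N}.
  by apply: homo_leq => //; exact: leq_trans.
pose v k := u (psi k).
have lv k : L2 (v k) by exact: lu.
have mv k : measurable_fun setT (v k) by exact: L2_measurable.
pose w k (x : 'rV[R]_d) : R := `|v k.+1 x - v k x|.
have lw k : L2 (w k) by apply: L2_abs; exact: L2_B.
have wint k : (\int[mu]_x (w k x)%:E <= ((2^-1) ^+ k)%:E)%E.
  have -> : (\int[mu]_x (w k x)%:E = \int[mu]_x `|(v k.+1 x - v k x)%:E|)%E.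
    by apply: eq_integral.
  apply: (le_trans (L1_le_L2 (L2_B (lv k.+1) (lv k)))); rewrite lee_fin.
  have -> : (2^-1) ^+ k = Num.sqrt ((4^-1) ^+ k) :> R.
    rewrite (_ : 4^-1 = (2^-1) ^+ 2 :> R); last by field.
    by rewrite exprAC sqrtr_sqr ger0_norm// exprn_ge0.
  apply: ler_wsqrtr; apply: phiP.
    by apply: leq_trans (phi_psi k) _; exact: psiS.
  exact: phi_psi.
have mw k : measurable_fun setT (fun x => (w k x)%:E).
  by apply/measurable_EFinP; exact: L2_measurable.
have w0 k x : (0 <= (w k x)%:E)%E by rewrite lee_fin normr_ge0.
have sumfin : (\int[mu]_x (\sum_(0 <= k <oo) (w k x)%:E) < +oo)%E.
  rewrite integral_nneseries//.
  apply: (@le_lt_trans _ _ (\sum_(0 <= k <oo) ((2^-1) ^+ k : R)%:E)%E).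
    by apply: lee_nneseries => // k _ _; exact: integral_ge0.
  apply: (@le_lt_trans _ _ (2:R)%:E); last by rewrite ltry.
  apply: lime_le; first by apply: is_cvg_nneseries => k _ _; rewrite lee_fin exprn_ge0.
  near=> n; rewrite sumEFin lee_fin.
  have -> : \sum_(0 <= k < n) (2^-1) ^+ k = 2 - 2 * (2^-1) ^+ n :> R.
    elim: (n) => [|m IH]; first by rewrite big_geq// expr0; ring.
    by rewrite big_nat_recr//= IH exprS; field.
  by rewrite lerBlDr lerDl mulr_ge0// exprn_ge0.
(* An upper limit is measurable without any condition; almost everywhere it is the limit. *)
pose f x := fine (limn_esup (fun k => (v k x)%:E)).
have mf : measurable_fun setT f.
  apply: (measurableT_comp (f := fine)); first exact: fine_measurable.
  by apply: measurable_fun_limn_esup => k; apply/measurable_EFinP.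
have aecvg : {ae mu, forall x, v k x @[k --> \oo] --> f x}.
  have ifin : mu.-integrable setT (fun x => \sum_(0 <= k <oo) (w k x)%:E)%E.
    apply/integrableP; split; first exact: ge0_emeasurable_sum.
    apply: le_lt_trans sumfin; rewrite le_eqVlt; apply/orP; left; apply/eqP.
    by apply: eq_integral => x _; rewrite gee0_abs// nneseries_ge0.
  apply: filterS (integrable_ae measurableT ifin) => x /(_ I) Gx.
  have cv : cvgn (fun k => v k x).
    have : cvgn (series (fun k => v k.+1 x - v k x)).
      have : cvgn (fun n => \sum_(0 <= k < n) w k x); last exact: normed_cvg.
      apply: nondecreasing_is_cvgn.
        by apply/nondecreasing_seqP => k; rewrite big_nat_recr//= lerDl normr_ge0.
      exists (fine (\sum_(0 <= k <oo) (w k x)%:E)%E) => _ [k _ <-].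
      by rewrite -lee_fin fineK// -sumEFin; exact: nneseries_lim_ge.
    move=> /cvg_ex[l cl]; apply/cvg_ex; exists (v 0%N x + l).
    have -> : (fun k => v k x) = (fun k => v 0%N x + series (fun k => v k.+1 x - v k x) k).
      by apply/funext => k; rewrite /series/= telescope_sumr//; ring.
    by apply: cvgD => //; exact: cvg_cst.
  have ce : (fun k => (v k x)%:E) @ \oo --> (limn (fun k => v k x))%:E.
    by apply: cvg_EFin; [near=> k|exact: cv].
  by rewrite /f (cvg_limn_einf_sup ce).2/=.
have fat e n N : (forall m n, (N <= m)%N -> (N <= n)%N -> dist2 (u m) (u n) <= e) ->
    (N <= n)%N -> (\int[mu]_x ((u n x - f x) ^+ 2)%:E <= e%:E)%E.
  move=> hN nN.
  have mF k : measurable_fun setT (fun x => ((u n x - v k x) ^+ 2)%:E).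
    apply/measurable_EFinP; apply: measurable_funX; apply: measurable_funB => //.
    exact: L2_measurable.
  have := @fatou _ _ _ mu setT measurableT (fun k x => ((u n x - v k x) ^+ 2)%:E) mF.
  have -> : (\int[mu]_x ((u n x - f x) ^+ 2)%:E =
     \int[mu]_x limn_einf (fun k => ((u n x - v k x) ^+ 2)%:E))%E.
    apply: ae_eq_integral => //.
    - apply/measurable_EFinP; apply: measurable_funX; apply: measurable_funB => //.
      exact: L2_measurable.
    - rewrite (_ : (fun x => _) = fun x => (- limn_esup (-%E \o (fun k => ((u n x - v k x) ^+ 2)%:E)))%E).
        apply: measurableT_comp => //; apply: measurable_fun_limn_esup => k.
        exact: measurableT_comp.
      by apply/funext => x; rewrite limn_esupN oppeK.
    - apply: filterS aecvg => x cx _ /=.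
      apply/esym; apply: (cvg_limn_einf_sup _).1; apply: cvg_EFin; first by near=> k.
      have h : u n x - v k x @[k --> \oo] --> u n x - f x.
        by apply: cvgB => //; exact: cvg_cst.
      by rewrite expr2; under eq_fun do rewrite expr2; exact: cvgM.
  move=> H; apply: le_trans; first by apply: H => k x _; rewrite lee_fin sqr_ge0.
  rewrite limn_einf_lim; apply: lime_le; first exact: is_cvg_einfs.
  near=> k; apply: (@le_trans _ _ (\int[mu]_x ((u n x - v k x) ^+ 2)%:E)%E).
    by apply: ereal_inf_lbound; exists k => //=.
  have Nk : (N <= psi k)%N by apply: leq_trans (psi_ge k); near: k; exact: nbhs_infty_ge.
  have := hN n (psi k) nN Nk; rewrite -lee_fin; apply: le_trans.
  rewrite /dist2 /ip /Rintegral fineK; last first.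
    by apply: integrable_fin_num => //; apply: L2_mul; exact: L2_B.
  by rewrite le_eqVlt; apply/orP; left; apply/eqP; apply: eq_integral.
have lB n N e : (forall m n, (N <= m)%N -> (N <= n)%N -> dist2 (u m) (u n) <= e) ->
    (N <= n)%N -> L2 (fun x => u n x - f x).
  move=> hN nN.
  have mB : measurable_fun setT (fun x => u n x - f x).
    by apply: measurable_funB => //; exact: L2_measurable.
  apply: L2I => //; apply/integrableP; split.
    by apply/measurable_EFinP; exact: measurable_funX.
  apply: (@le_lt_trans _ _ e%:E); last by rewrite ltry.
  apply: le_trans (fat _ _ _ hN nN); rewrite le_eqVlt; apply/orP; left; apply/eqP.
  by apply: eq_integral => x _; rewrite gee0_abs// lee_fin sqr_ge0.
exists f.
  have [N hN] := cau 1 ltr01; have lN := lB N N 1 hN (leqnn N).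
  have := L2_B (lu N) lN; rewrite (_ : (fun x => _) = f)//.
  by apply/funext => x; rewrite opprB addrC subrK.
move=> e e0'; have [N hN] := cau e e0'; exists N => n nN.
rewrite -lee_fin; apply: le_trans (fat _ _ _ hN nN).
rewrite /dist2 /ip /Rintegral fineK; last first.
  by apply: integrable_fin_num => //; apply: L2_mul; exact: (lB n N e hN nN).
by rewrite le_eqVlt; apply/orP; left; apply/eqP; apply: eq_integral.
Unshelve. all: by end_near. Qed.

End riesz_fischer.

(** * Orthonormality in one variable *)

Section trig_orthonormal.
Context (R : realType).
Local Notation unif := (uniform_prob (@ltr01 R)).

Lemma integral_unif_derive (F h : R -> R) : (forall x : R, is_derive x 1 F (h x)) ->
  continuous h -> \int[unif]_x h x = F 1 - F 0.
Proof.
move=> dF ch.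
have mh : measurable_fun setT (EFin \o h : measurableTypeR R -> \bar R).
  apply: measurableT_comp => //; exact: (@continuous_measurable_fun R h).
rewrite /Rintegral (integral_unif mh) (@continuous_FTC2 _ _ F)//.
- exact: continuous_subspaceT.
- have cF : continuous F by exact: is_derive1_continuous dF.
  split; first by move=> x _; have [] := dF x.
    by apply: cvg_at_right_filter; exact: cF.
  by apply: cvg_at_left_filter; exact: cF.
- by move=> x _; rewrite derive1E; have [_ ->] := dF x.
Qed.

Lemma sin_pi_nat n : sin (pi * n%:R) = 0 :> R.
Proof.
elim: n => [|n IH]; first by rewrite mulr0 sin0.
by rewrite -natr1 mulrDr mulr1 sinDpi IH oppr0.
Qed.

Lemma integral_cos (a : R) : a != 0 -> sin (pi * a) = 0 ->
  \int[unif]_x cos (pi * a * x) = 0.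
Proof.
move=> a0 sa; have p0 := pi_gt0 R.
have pa0 : pi * a != 0 by rewrite mulf_neq0// gt_eqF.
pose F x := (pi * a)^-1 * sin (pi * a * x + 0).
have dF x : is_derive (x : R) 1 F (cos (pi * a * x)).
  have ds (y : R) : is_derive y 1 sin (cos y) := is_derive_sin y.
  have ? := is_derive_affine (pi * a) 0 ds x.
  have -> : F = (pi * a)^-1 *: (fun x => sin (pi * a * x + 0)) by [].
  by apply: is_derive_eq; rewrite addr0 /GRing.scale/= mulrA mulVf// mul1r.
rewrite (integral_unif_derive dF); last first.
  by apply: smooth1_continuous; exact: smooth1_cosn.
by rewrite /F mulr1 mulr0 !addr0 sa sin0 !mulr0 subr0.
Qed.

Lemma integral_cosB m n : \int[unif]_x cos (pi * (m%:R - n%:R) * x) = (m == n)%:R :> R.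
Proof.
have [->|mn] := eqVneq m n.
  under eq_Rintegral => x _ do rewrite subrr mulr0 mul0r cos0.
  by rewrite Rintegral_cst// mul1r [X in fine X]probability_setT.
apply: integral_cos; first by rewrite subr_eq0 eqr_nat.
by rewrite mulrBr sinB !sin_pi_nat mul0r mulr0 subr0.
Qed.

Lemma integral_cosD m n :
  \int[unif]_x cos (pi * (m%:R + n%:R) * x) = ((m == 0%N) && (n == 0%N))%:R :> R.
Proof.
rewrite -addn_eq0 -natrD -[(m + n)%:R]subr0 -[0]/(0%:R).
exact: integral_cosB.
Qed.

Let cint (a : R) : unif.-integrable setT (EFin \o (fun x => cos (a * x))).
Proof. exact: (unif_integrable (nice_cosn a)). Qed.

Lemma tcos_orth m n : \int[unif]_x (tcos m x * tcos n x) = (m == n)%:R :> R.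
Proof.
pose c k : R := if k == 0%N then 1 else Num.sqrt 2.
transitivity (c m * c n / 2 * (\int[unif]_x cos (pi * (m%:R + n%:R) * x)
   + \int[unif]_x cos (pi * (m%:R - n%:R) * x))).
  rewrite -RintegralD//.
  rewrite -RintegralZl//; last exact: integrableD (cint _) (cint _).
  apply: eq_Rintegral => x _; rewrite /tcos -/(c m) -/(c n).
  have -> : pi * (m%:R + n%:R) * x = pi * m%:R * x + pi * n%:R * x by rewrite mulrDr mulrDl.
  have -> : pi * (m%:R - n%:R) * x = pi * m%:R * x - pi * n%:R * x by rewrite mulrBr mulrBl.
  by rewrite cosB cosD; field.
rewrite integral_cosD integral_cosB /c.
have s2 : Num.sqrt 2 * Num.sqrt 2 = 2 :> R by rewrite -expr2 sqr_sqrtr.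
have [->|mn] := eqVneq m n; last first.
  case: (m =P 0%N) mn => [->|_] mn /=; last by rewrite addr0 mulr0.
  by rewrite eq_sym (negbTE mn) addr0 mulr0.
by case: (n =P 0%N) => _ /=; rewrite ?s2; field.
Qed.

Lemma tsin_orth m n :
  \int[unif]_x (tsin m x * tsin n x) = ((m == n) && (n != 0%N))%:R :> R.
Proof.
transitivity (\int[unif]_x cos (pi * (m%:R - n%:R) * x)
   - \int[unif]_x cos (pi * (m%:R + n%:R) * x)).
  rewrite -RintegralB//.
  apply: eq_Rintegral => x _; rewrite /tsin.
  have s2 : Num.sqrt 2 * Num.sqrt 2 = 2 :> R by rewrite -expr2 sqr_sqrtr.
  have -> : pi * (m%:R + n%:R) * x = pi * m%:R * x + pi * n%:R * x by rewrite mulrDr mulrDl.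
  have -> : pi * (m%:R - n%:R) * x = pi * m%:R * x - pi * n%:R * x by rewrite mulrBr mulrBl.
  by rewrite cosB cosD mulrACA s2; ring.
rewrite integral_cosD integral_cosB.
have [->|mn] := eqVneq m n; last first.
  case: (m =P 0%N) mn => [->|_] mn /=; last by rewrite subr0.
  by rewrite eq_sym (negbTE mn) subr0.
by case: (n =P 0%N) => _ /=; rewrite ?subrr ?subr0.
Qed.

End trig_orthonormal.

(** * Mixed sine and cosine bases of the cube *)

Section trig_basis.
Context (R : realType) (d : nat).
Local Notation mu := (cube_measure R d).
Local Notation field := (scalar_field R d).
Implicit Types (f g w : field) (A : {set 'I_d}).

Definition trig1 (b : bool) (n : nat) : R -> R := if b then tsin n else tcos n.

(** A derivative along [i] moves [i] into or out of the set [A] of sine coordinates, so derivatives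
    of sine and cosine modes all stay in this family. *)
Definition trig A (n : 'I_d -> nat) : field := tensor (fun i => trig1 (i \in A) (n i)).

Lemma nice_trig1 b n : nice (trig1 b n).
Proof. by case: b; [exact: nice_tsin|exact: nice_tcos]. Qed.

Lemma smooth1_trig1 b n : smooth1 (trig1 b n).
Proof. by case: b; [exact: smooth1_tsin|exact: smooth1_tcos]. Qed.

Lemma L2_trig A n : L2 (trig A n).
Proof. by apply: L2_tensor => i; exact: nice_trig1. Qed.

Lemma trig_orth A (m n : 'I_d -> nat) :
  ip (trig A m) (trig A n) = [forall i, (m i == n i) && ((i \in A) ==> (n i != 0%N))]%:R.
Proof.
rewrite ip_tensor; [|by move=> i; exact: nice_trig1|by move=> i; exact: nice_trig1].
have -> : \prod_i (\int[uniform_prob (@ltr01 R)]_x (trig1 (i \in A) (m i) x * trig1 (i \in A) (n i) x)) =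
    \prod_i ((m i == n i) && ((i \in A) ==> (n i != 0%N)))%:R :> R.
  apply: eq_bigr => i _; rewrite /trig1; case: (i \in A); first exact: tsin_orth.
  by rewrite andbT; exact: tcos_orth.
case: (boolP [forall i, _]) => [/forallP h|/forallPn[i /negbTE h]].
  by rewrite big1// => i _; rewrite h.
by rewrite (bigD1 i)//= h mul0r.
Qed.

(* The modes are enumerated by the natural numbers, so that the truncations of an
   expansion are nested; [freq l] is junk and [bas A l] is 0 when [l] is not the
   code of a mode. *)
Definition freq (l : nat) (i : 'I_d) : nat :=
  if @pickle_inv {ffun 'I_d -> nat} l is Some n then n i else 0%N.

Definition is_mode (l : nat) : bool := isSome (@pickle_inv {ffun 'I_d -> nat} l).

Definition bas A (l : nat) : field := fun x => (is_mode l)%:R * trig A (freq l) x.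

Definition coef A f (l : nat) : R := ip f (bas A l).

Lemma bas_modeE A (n : {ffun 'I_d -> nat}) : bas A (pickle n) = trig A n.
Proof.
apply/funext => x; rewrite /bas /is_mode /freq pickleK_inv/= mul1r.
by apply: eq_bigr.
Qed.

Lemma L2_bas A l : L2 (bas A l).
Proof. by apply: L2_Z; exact: L2_trig. Qed.

Lemma bas_orth A l m : ip (bas A l) (bas A m) =
  ((l == m) && is_mode l && [forall i, (i \in A) ==> (freq l i != 0%N)])%:R.
Proof.
rewrite /bas ip_Zl; [|exact: L2_trig|exact/L2_Z/L2_trig].
rewrite ip_Zr; [|exact: L2_trig|exact: L2_trig].
rewrite trig_orth.
have [->|lm] /= := eqVneq l m.
  case: (is_mode m); rewrite ?mul0r// !mul1r.
  by under eq_forallb do rewrite eqxx.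
rewrite /is_mode /freq.
have := @pickle_invK {ffun 'I_d -> nat} l; have := @pickle_invK {ffun 'I_d -> nat} m.
case: (pickle_inv m) => [nm|]; last by rewrite mul0r mulr0.
case: (pickle_inv l) => [nl|]; last by rewrite mul0r.
move=> /= pm pl; rewrite !mul1r; case: (boolP [forall i, _]) => // /forallP h.
move/negP: lm; case; rewrite -pm -pl; apply/eqP; congr pickle.
by apply/ffunP => i; have /andP[/eqP] := h i.
Qed.

Lemma bas_orth1 A l : ip (bas A l) (bas A l) = 0 \/ ip (bas A l) (bas A l) = 1.
Proof. by rewrite bas_orth; case: (_ && _); [right|left]. Qed.

Lemma bas_orth0 A l m : l != m -> ip (bas A l) (bas A m) = 0.
Proof. by move=> /negbTE lm; rewrite bas_orth lm. Qed.

(** Null basis functions, given by a sine of frequency 0 or by a number that codes no mode, are kept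
    in all the sums; their coefficients contribute nothing. *)
Lemma coef0 A f l : L2 f -> ip (bas A l) (bas A l) = 0 -> coef A f l = 0.
Proof.
move=> lf b0; have := ip_CS2 lf (L2_bas A l); rewrite b0 mulr0 => h.
by apply/eqP; rewrite -sqrf_eq0; apply/eqP/le_anti; rewrite h sqr_ge0.
Qed.

Definition part A (a : nat -> R) (m : nat) : field := fun x => \sum_(0 <= l < m) a l * bas A l x.

Lemma L2_part A a m : L2 (part A a m).
Proof. by apply: L2_sum => l; exact/L2_Z/L2_bas. Qed.

Lemma ip_part A a m f : L2 f -> ip f (part A a m) = \sum_(0 <= l < m) a l * coef A f l.
Proof.
move=> lf; rewrite ip_sumr//; last by move=> l; exact/L2_Z/L2_bas.
by apply: eq_bigr => l _; rewrite ip_Zr//; exact: L2_bas.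
Qed.

Lemma coef_part A a m l : (forall k, ip (bas A k) (bas A k) = 0 -> a k = 0) ->
  coef A (part A a m) l = if (l < m)%N then a l else 0.
Proof.
move=> a0; rewrite /coef ipC ip_part; last exact: L2_bas.
have H k : a k * coef A (bas A l) k = if k == l then a l else 0.
  case: eqP => [->|/eqP kl]; last by rewrite /coef ipC bas_orth0// mulr0.
  by rewrite /coef; have [h|->] := bas_orth1 A l; [rewrite h mulr0 a0|rewrite mulr1].
under eq_bigr do rewrite H.
case: ltnP => lm; last first.
  rewrite big_nat_cond big1// => k /andP[/andP[_ km] _].
  by case: eqP => // kl; rewrite kl ltnNge lm in km.
rewrite (bigD1_seq l)/= ?mem_index_iota ?iota_uniq// eqxx big1 ?addr0// => k /negbTE ->.
by [].
Qed.

Lemma part_sqr A a m : (forall k, ip (bas A k) (bas A k) = 0 -> a k = 0) ->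
  ip (part A a m) (part A a m) = \sum_(0 <= l < m) a l ^+ 2.
Proof.
move=> a0; rewrite ip_part; last exact: L2_part.
rewrite big_nat_cond [RHS]big_nat_cond; apply: eq_bigr => l /andP[/andP[_ lm] _].
by rewrite coef_part// lm expr2.
Qed.

Lemma dist2_part A f m : L2 f ->
  dist2 f (part A (coef A f) m) = ip f f - \sum_(0 <= l < m) coef A f l ^+ 2.
Proof.
move=> lf; have lp := L2_part A (coef A f) m.
have a0 k : ip (bas A k) (bas A k) = 0 -> coef A f k = 0 by exact: coef0.
rewrite /dist2 ip_Bl//; last exact: L2_B.
rewrite !ip_Br// (ipC _ f) part_sqr// ip_part//.
under eq_bigr do rewrite -expr2.
ring.
Qed.

Lemma bessel A f m : L2 f -> \sum_(0 <= l < m) coef A f l ^+ 2 <= ip f f.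
Proof. by move=> lf; rewrite -subr_ge0 -dist2_part// dist2_ge0. Qed.

(** The squared distance of two partial sums is a difference of values of the bounded monotone
    sequence [S]. *)
Lemma riesz_fischer A (a : nat -> R) C :
  (forall k, ip (bas A k) (bas A k) = 0 -> a k = 0) ->
  (forall m, \sum_(0 <= l < m) a l ^+ 2 <= C) ->
  exists f, [/\ L2 f, forall l, coef A f l = a l &
    forall e : R, 0 < e -> exists N, forall n, (N <= n)%N -> dist2 (part A a n) f <= e].
Proof.
move=> a0 aC.
pose S m := \sum_(0 <= l < m) a l ^+ 2.
have Smono : nondecreasing_seq S.
  by apply/nondecreasing_seqP => m; rewrite /S big_nat_recr//= lerDl sqr_ge0.
have Scvg : cvgn S by apply: nondecreasing_is_cvgn => //; exists C => _ [m _ <-]; exact: aC.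
have dS m n : (m <= n)%N -> dist2 (part A a n) (part A a m) = S n - S m.
  move=> mn; have lm := L2_part A a m; have ln := L2_part A a n.
  rewrite /dist2 ip_Bl//; last exact: L2_B.
  rewrite !ip_Br// (ipC (part A a m) (part A a n)) !part_sqr//.
  suff -> : ip (part A a n) (part A a m) = S m by rewrite /S; ring.
  rewrite ip_part//; rewrite /S big_nat_cond [RHS]big_nat_cond.
  apply: eq_bigr => l /andP[/andP[_ lm'] _].
  by rewrite coef_part// (leq_trans lm' mn) expr2.
have [e e0|f lf fP] := L2_complete (fun n => L2_part A a n).
  have /cvgrPdist_le/(_ (e / 2)) := Scvg; rewrite divr_gt0// => /(_ isT)[N _ hN].
  have h m n : (N <= m)%N -> (N <= n)%N -> S n - S m <= e.
    move=> Nm Nn; have := hN m Nm; have := hN n Nn; rewrite /= !ler_distl; lra.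
  exists N => m n Nm Nn; have [mn|/ltnW mn] := leqP m n.
    by rewrite dist2C dS// h.
  by rewrite dS// h.
exists f; split => // l.
apply/eqP; rewrite -subr_eq0 -normr_eq0; apply/eqP/le_anti; rewrite normr_ge0 andbT.
apply/ler_addgt0Pr => e e0; rewrite add0r.
have [N hN] := fP (e ^+ 2) (exprn_gt0 2 e0).
pose n := maxn N l.+1.
have := hN n (leq_maxl _ _).
have -> : a l = coef A (part A a n) l by rewrite coef_part// leq_maxr.
rewrite /coef distrC -ip_Bl//; [|exact: L2_part|exact: L2_bas].
move=> h; apply: (le_trans (ip_CS (L2_B (L2_part A a n) lf) (L2_bas A l))).
have b1 : normL2 (bas A l) <= 1.
  by rewrite /normL2; have [->|->] := bas_orth1 A l; rewrite ?sqrtr0 ?sqrtr1.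
apply: (@le_trans _ _ (normL2 (fun x => part A a n x - f x) * 1)).
  by rewrite ler_wpM2l// normL2_ge0.
rewrite mulr1 -[leRHS]ger0_norm ?(ltW e0)// -sqrtr_sqr.
exact: ler_wsqrtr.
Qed.

Lemma trig_complete A f : L2 f -> (forall l, coef A f l = 0) -> ae_eq_cube f (cst 0).
Proof.
move=> lf f0; apply: (@tensor_complete R d (fun i n => trig1 (i \in A) n)).
- by move=> i n; exact: nice_trig1.
- by move=> i; rewrite /trig1; case: (i \in A); [exact: complete1_tsin|exact: complete1_tcos].
- have := L2_mul lf (@L2_cst R d 1); congr (_.-integrable _ _).
  by apply/funext => x /=; rewrite mulr1.
- move=> n; have := f0 (pickle n); rewrite /coef bas_modeE /ip /Rintegral => h.
  rewrite -[LHS]fineK; first by rewrite h.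
  by apply: integrable_fin_num => //; exact: L2_mul lf (L2_trig A n).
Qed.

(** By completeness, [f] agrees almost everywhere with the function that [riesz_fischer] builds from
    its coefficients. *)
Lemma parseval A f : L2 f -> forall e : R, 0 < e -> exists N, forall n, (N <= n)%N ->
  dist2 f (part A (coef A f) n) <= e.
Proof.
move=> lf.
have a0 k : ip (bas A k) (bas A k) = 0 -> coef A f k = 0 by exact: coef0.
have [g [lg gc gP]] := riesz_fischer a0 (fun m => bessel A m lf).
have fg : ae_eq_cube (fun x => f x - g x) (cst 0).
  apply: (@trig_complete A); first exact: L2_B.
  move=> l; have := gc l; rewrite /coef ip_Bl//; last exact: L2_bas.
  by move=> ->; rewrite subrr.
move=> e /gP[N hN]; exists N => n /hN; rewrite dist2C => h.
suff -> : dist2 f (part A (coef A f) n) = dist2 g (part A (coef A f) n) by [].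
have lp := L2_part A (coef A f) n.
have ae' : ae_eq_cube (fun x => f x - part A (coef A f) n x) (fun x => g x - part A (coef A f) n x).
  by apply: filterS fg => x /= /subr0_eq ->.
rewrite /dist2 (ip_ae _ (L2_B lg lp) _ ae') ?(ipC (fun x => g x - _)) ?(ip_ae _ (L2_B lg lp) _ ae')//;
  exact: L2_B.
Qed.

End trig_basis.

(** * Continuous functions on the cube and integrals of derivatives *)

Section continuous_row.
Context (R : realType).
Local Notation unif := (uniform_prob (@ltr01 R)).

Lemma row_norm_le d (x : 'rV[R]_d) (e : R) : 0 <= e ->
  (forall i, `|x ord0 i| <= e) -> `|x| <= e.
Proof.
move=> e0 xe; rewrite [leLHS]/Num.norm/= mx_normrE; apply/bigmax_leP; split => // -[a i] _ /=.
by rewrite ord1.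
Qed.

Lemma continuous_rowP d (T : topologicalType) (g : T -> 'rV[R]_d) :
  (forall i, continuous (fun t => g t ord0 i)) -> continuous g.
Proof.
move=> cg t; apply/cvgrPdist_le => /= e e0.
have : \forall s \near t, forall i, `|g t ord0 i - g s ord0 i| <= e.
  by apply: filter_forall => i; move: e e0; exact/cvgrPdist_le/cg.
apply: filterS => s h; apply: row_norm_le => [|i]; first exact: ltW.
by rewrite !mxE.
Qed.

(** The measurable sets of rows are generated by the coordinates, not by the open sets. A continuous
    function is a pointwise limit of functions that are constant on the cells of a grid, and there
    are countably many cells, each a coordinate box. *)
Lemma measurable_continuous_row d (f : 'rV[R]_d -> R) : continuous f ->
  measurable_fun [set: 'rV[R]_d] f.
Proof.
move=> cf.
pose grid n (z : 'I_d -> int) : 'rV[R]_d := \row_i ((z i)%:~R / n.+1%:R).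
pose cell n (x : 'rV[R]_d) (i : 'I_d) : int := Num.floor (x ord0 i * n.+1%:R).
apply/measurable_EFinP.
apply: (emeasurable_fun_cvg (fun n x => (f (grid n (cell n x)))%:E)) => [n|x _].
  apply/measurable_EFinP => _ B mB; rewrite setTI.
  rewrite (_ : _ @^-1` B = \bigcup_(z in [set z : {ffun 'I_d -> int} | B (f (grid n z))])
     \bigcap_(i in [set` enum 'I_d])
       ((fun x : 'rV[R]_d => x ord0 i : measurableTypeR R) @^-1`
         `[(z i)%:~R / n.+1%:R, (z i + 1)%:~R / n.+1%:R[%classic)); last first.
    have fl (x : 'rV[R]_d) (i : 'I_d) (z : int) : (z%:~R / n.+1%:R <= x ord0 i < (z + 1)%:~R / n.+1%:R)
        = (z%:~R <= x ord0 i * n.+1%:R < (z + 1)%:~R).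
      by rewrite ler_pdivrMr// ltr_pdivlMr.
    apply/seteqP; split => x /=.
      move=> Bx; exists [ffun i => cell n x i].
        rewrite /= (_ : grid n _ = grid n (cell n x))//.
        by apply/rowP => i; rewrite !mxE ffunE.
      by move=> i _ /=; rewrite in_itv/= ffunE fl floor_itv.
    move=> [z Bz zx]; rewrite (_ : grid n _ = grid n z)//.
    apply/rowP => i; rewrite !mxE; congr (_%:~R / _); apply: floor_def.
    by have := zx i; rewrite /= in_itv/= fl; apply; rewrite mem_enum.
  have mz (z : {ffun 'I_d -> int}) : measurable (\bigcap_(i in [set` enum 'I_d])
       ((fun x : 'rV[R]_d => x ord0 i : measurableTypeR R) @^-1`
         `[(z i)%:~R / n.+1%:R, (z i + 1)%:~R / n.+1%:R[%classic)).
    apply: fin_bigcap_measurable => // i _.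
    rewrite -[X in measurable X]setTI.
    exact: (@measurable_coord R d i measurableT _ (measurable_itv _)).
  rewrite (_ : \bigcup_(z in _) _ = \bigcup_k
    (if @unpickle {ffun 'I_d -> int} k is Some z then
       (if z \in [set z : {ffun 'I_d -> int} | B (f (grid n z))] then
       \bigcap_(i in [set` enum 'I_d])
       ((fun x : 'rV[R]_d => x ord0 i : measurableTypeR R) @^-1`
         `[(z i)%:~R / n.+1%:R, (z i + 1)%:~R / n.+1%:R[%classic) else set0) else set0)); last first.
    apply/seteqP; split => x [].
      by move=> z Bz zx; exists (pickle z) => //; rewrite pickleK mem_set.
    move=> k _; case: unpickle => // z; case: ifPn => // /set_mem Bz zx.
    by exists z.
  apply: bigcup_measurable => k _; case: unpickle => // z.
  by case: ifP => // _; exact: mz.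
apply: cvg_EFin; first exact: nearW.
apply: (@cvg_comp _ _ _ (fun n => grid n (cell n x)) f _ (nbhs x)); last exact: cf.
apply/cvgrPdist_le => /= e e0.
near=> n.
have ne : n.+1%:R^-1 <= e by apply: ltW; near: n; exact: near_infty_natSinv_lt (PosNum e0).
apply: row_norm_le; first exact: ltW.
move=> i; rewrite !mxE; apply: le_trans ne.
have n0 : 0 < n.+1%:R :> R by [].
have := floor_itv (x ord0 i * n.+1%:R); rewrite -/(cell n x i) => /andP[h1 h2].
rewrite -(ler_pM2r n0) mulVf ?gt_eqF// -[X in _ * X]gtr0_norm// -normrM mulrBl divfK ?gt_eqF//.
rewrite ger0_norm ?subr_ge0// lerBlDl; apply: ltW; apply: lt_le_trans h2 _.
by rewrite intrD.
Unshelve. all: by end_near. Qed.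

Lemma integral_cubeS_swap m (f : 'rV[R]_m.+1 -> R) :
  (cube_measure R m.+1).-integrable setT (EFin \o f) ->
  (\int[cube_measure R m.+1]_x (f x)%:E =
   \int[cube_measure R m]_y \int[unif]_x (f (row_cons (x, y)))%:E)%E.
Proof.
move=> fi; have fi2 := integrable_cubeS fi; rewrite integral_cubeS//.
exact: (@Fubini _ _ _ _ _ unif (cube_measure R m) (fun z => (f (row_cons z))%:E) fi2).
Qed.

Lemma row_cons_derive m (f : 'rV[R]_m.+1 -> R) x y (k : 'I_m) l :
  is_derive (row_cons (x, y)) (delta_mx ord0 (lift ord0 k)) f l ->
  is_derive y (delta_mx ord0 k) (fun y => f (row_cons (x, y))) l.
Proof.
have E (h : R) : row_cons (x, h *: delta_mx ord0 k + y) =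
    h *: delta_mx ord0 (lift ord0 k) + row_cons (x, y).
  apply/rowP => i; rewrite [RHS]mxE; case: (unliftP ord0 i) => [j ->|->].
    by rewrite !row_cons_lift /= !mxE (inj_eq (@lift_inj _ ord0)).
  by rewrite !row_cons0 /= !mxE /= mulr0 add0r.
have Ed : (fun h : R => h^-1 *: (((fun y => f (row_cons (x, y))) \o shift y) (h *: delta_mx ord0 k) - f (row_cons (x, y)))) =
    (fun h : R => h^-1 *: ((f \o shift (row_cons (x, y))) (h *: delta_mx ord0 (lift ord0 k)) - f (row_cons (x, y)))).
  by apply/funext => h; rewrite /= E.
by move=> [df dl]; split; [rewrite /derivable Ed|rewrite -dl /derive Ed].
Qed.

Lemma row_cons_derive0 m (f : 'rV[R]_m.+1 -> R) (x : R) y l :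
  is_derive (row_cons (x, y)) (delta_mx ord0 ord0) f l ->
  is_derive x 1 (fun x => f (row_cons (x, y))) l.
Proof.
have E (h : R) : row_cons (h *: 1 + x, y) = h *: delta_mx ord0 ord0 + row_cons (x, y).
  apply/rowP => i; rewrite [RHS]mxE; case: (unliftP ord0 i) => [j ->|->].
    by rewrite !row_cons_lift /= !mxE /= mulr0 add0r.
  by rewrite !row_cons0 /= !mxE.
have Ed : (fun h : R => h^-1 *: (((fun x => f (row_cons (x, y))) \o shift x) (h *: (1 : R)) - f (row_cons (x, y)))) =
    (fun h : R => h^-1 *: ((f \o shift (row_cons (x, y))) (h *: delta_mx ord0 ord0) - f (row_cons (x, y)))).
  by apply/funext => h; rewrite /= E.
by move=> [df dl]; split; [rewrite /derivable Ed|rewrite -dl /derive Ed].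
Qed.

Lemma continuous_row_cons m (x : R) : continuous (fun y : 'rV[R]_m => row_cons (x, y)).
Proof.
apply: continuous_rowP => i; case: (unliftP ord0 i) => [j ->|->].
  under [X in continuous X]eq_fun do rewrite row_cons_lift.
  exact: coord_continuous.
under [X in continuous X]eq_fun do rewrite row_cons0.
by move=> z; exact: cst_continuous.
Qed.

Lemma continuous_row_cons1 m (y : 'rV[R]_m) : continuous (fun x : R => row_cons (x, y)).
Proof.
apply: continuous_rowP => i; case: (unliftP ord0 i) => [j ->|->].
  under [X in continuous X]eq_fun do rewrite row_cons_lift.
  by move=> z; exact: cst_continuous.
under [X in continuous X]eq_fun do rewrite row_cons0.
by move=> z; exact: cvg_id.
Qed.

(** Fubini's theorem isolates the direction [i], where the integral is a difference of values of [f]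
    on two faces, and the faces lie outside the open cube. *)
Lemma integral_partial0 d (f g : 'rV[R]_d -> R) (i : 'I_d) (C : R) :
  continuous f -> continuous g -> (forall x, is_derive x (delta_mx ord0 i) f (g x)) ->
  (forall x, `|g x| <= C) -> (forall x, ~ cube x -> f x = 0) ->
  (\int[cube_measure R d]_x (g x)%:E = 0)%E.
Proof.
elim: d f g i => [? ? []//|m IH] f g i cf cg df gC f0.
have gi : (cube_measure R m.+1).-integrable setT (EFin \o g).
  apply: measurable_bounded_integrable => //.
  - by rewrite [X in (X < _)%E]probability_setT ltry.
  - exact: measurable_continuous_row.
  - by exists C; split; [exact: num_real|move=> M CM x _; exact: le_trans (gC x) (ltW CM)].
case: (unliftP ord0 i) df => [k ->|->] df.
  rewrite integral_cubeS// integral0_eq// => x _.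
  apply: (IH (fun y => f (row_cons (x, y))) _ k).
  - by move=> y; apply: continuous_comp; [exact: continuous_row_cons|exact: cf].
  - by move=> y; apply: continuous_comp; [exact: continuous_row_cons|exact: cg].
  - by move=> y; exact: row_cons_derive.
  - by move=> y; exact: gC.
  - by move=> y ny; apply: f0 => c; apply: ny => j; have := c (lift ord0 j); rewrite row_cons_lift.
rewrite integral_cubeS_swap// integral0_eq// => y _.
have dfy x : is_derive (x : R) 1 (fun x => f (row_cons (x, y))) (g (row_cons (x, y))).
  exact: row_cons_derive0.
have cgy : continuous (fun x : R => g (row_cons (x, y))).
  by move=> x; apply: continuous_comp; [exact: continuous_row_cons1|exact: cg].
have := integral_unif_derive dfy cgy.
rewrite !f0; first last.
- by move=> /(_ ord0); rewrite row_cons0/= ltxx ?andbF.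
- by move=> /(_ ord0); rewrite row_cons0/= ltxx ?andbF.
rewrite subrr /Rintegral => h; rewrite -[LHS]fineK ?h//.
apply: integrable_fin_num => //; apply: measurable_bounded_integrable => //.
- by rewrite [X in (X < _)%E]probability_setT ltry.
- exact: (@continuous_measurable_fun R _ cgy).
- by exists C; split; [exact: num_real|move=> M CM x _; exact: le_trans (gC _) (ltW CM)].
Qed.

End continuous_row.

(** * Test functions and integration by parts *)

Section test_functions.
Context (R : realType) (d : nat).
Local Notation mu := (cube_measure R d).
Local Notation field := (scalar_field R d).
Implicit Types (f g w v phi : field) (i : 'I_d) (s : seq 'I_d).

Lemma continuous_bounded_compact (K : set 'rV[R]_d) f : compact K -> continuous f ->
  exists2 C, 0 <= C & forall x, K x -> `|f x| <= C.
Proof.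
move=> cK cf; have /compact_bounded[M [_ hM]] : compact (f @` K).
  by apply: continuous_compact => //; exact: continuous_subspaceT.
exists (`|M| + 1) => [|x Kx]; first by rewrite addr_ge0.
apply: hM; last by exists x.
by rewrite (le_lt_trans (ler_norm M))// ltrDl.
Qed.

Lemma L2_continuous f : continuous f -> L2 f.
Proof.
move=> cf; have [C C0 hC] := @continuous_bounded_compact _ f
  (@rV_compact R d (fun=> `[0, 1]%classic) (fun=> @segment_compact _ 0 1)) cf.
apply: (@L2_bounded R d f C); first exact: measurable_continuous_row.
apply: filterS (@ae_cube R d) => x cx; apply: hC => i /=.
by rewrite in_itv/=; have /andP[/ltW -> /ltW ->] := cx i.
Qed.

Lemma smooth_continuous f s : smooth f -> continuous (partial s f).
Proof. by move=> /(_ [seq delta_mx ord0 i | i <- s])[]. Qed.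

Lemma L2_smooth f s : smooth f -> L2 (partial s f).
Proof. by move=> sf; apply: L2_continuous; exact: smooth_continuous. Qed.

Lemma is_derive_partial f s i x : smooth f ->
  is_derive x (delta_mx ord0 i) (partial s f) (partial (i :: s) f x).
Proof. by move=> /(_ [seq delta_mx ord0 i | i <- s])[_ df]; split. Qed.

Lemma test_function_out phi K s : compact K -> (forall x, ~ K x -> phi x = 0) ->
  forall x, ~ K x -> partial s phi x = 0.
Proof.
move=> cK phi0; elim: s => [|i s IH]//= x nK.
rewrite /partial /= -/(partial s phi).
transitivity ('D_(delta_mx ord0 i) (cst (0 : R)) x); last exact: derive_cst.
apply: near_eq_derive.
have oK : open (~` K) by apply: closed_openC; apply: compact_closed => //; exact: norm_hausdorff.
have : nbhs x (~` K) by exact: open_nbhs_nbhs.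
by apply: filterS => y /IH ->.
Qed.

Lemma ip_partial_test phi f i : test_function cube phi -> smooth f ->
  ip (partial [:: i] phi) f = - ip phi (partial [:: i] f).
Proof.
move=> [sphi [K [cK Kc phi0]]] sf.
have cphi := smooth_continuous (s := [::]) sphi; have cf := smooth_continuous (s := [::]) sf.
have cphi' := smooth_continuous (s := [:: i]) sphi; have cf' := smooth_continuous (s := [:: i]) sf.
pose g x := partial [:: i] phi x * f x + phi x * partial [:: i] f x.
have cg : continuous g.
  move=> x; apply: (@continuousD _ _ _ (partial [:: i] phi * f) (phi * partial [:: i] f)).
    by apply: continuousM; [exact: cphi'|exact: cf].
  by apply: continuousM; [exact: cphi|exact: cf'].
have g0 x : ~ K x -> g x = 0.
  by move=> nK; rewrite /g phi0// (test_function_out [:: i] cK phi0)// !mul0r addr0.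
have [C C0 gC] := continuous_bounded_compact cK cg.
have {}gC x : `|g x| <= C.
  by have [/gC//|/g0 ->] := pselect (K x); rewrite normr0.
have c1 : continuous (fun x => phi x * f x).
  by move=> x; apply: (@continuousM _ _ phi f); [exact: cphi|exact: cf].
have c2 (x : 'rV[R]_d) : is_derive x (delta_mx ord0 i) (fun x => phi x * f x) (g x).
  have d1 : is_derive x (delta_mx ord0 i) phi (partial [:: i] phi x) := is_derive_partial [::] i x sphi.
  have d2 : is_derive x (delta_mx ord0 i) f (partial [:: i] f x) := is_derive_partial [::] i x sf.
  have -> : (fun x => phi x * f x) = phi * f by [].
  by apply: is_derive_eq; rewrite /g /GRing.scale/= addrC [X in X + _]mulrC.
have c3 x : ~ cube x -> phi x * f x = 0 by move=> nc; rewrite phi0 ?mul0r// => /Kc.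
have H : ip (partial [:: i] phi) f + ip phi (partial [:: i] f) = 0.
  rewrite /ip -RintegralD//; first by rewrite /Rintegral (integral_partial0 c1 cg c2 gC c3).
  - exact: L2_mul (L2_smooth [:: i] sphi) (L2_smooth [::] sf).
  - exact: L2_mul (L2_smooth [::] sphi) (L2_smooth [:: i] sf).
by apply/eqP; rewrite -addr_eq0 H.
Qed.

Lemma smooth_weak_partial f i : smooth f -> is_weak_partial [:: i] f (partial [:: i] f).
Proof.
move=> sf; split; [exact: (L2_smooth [::])|exact: L2_smooth|move=> phi tp].
rewrite /= expr1 ipC.
rewrite -[LHS]opprK; rewrite -(ip_partial_test i tp sf) ipC.
rewrite [RHS]ip_Zr ?mulN1r//; first exact: (L2_smooth [:: i] tp.1).
exact: (L2_smooth [::] sf).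
Qed.

End test_functions.

(** * From test functions to functions that do not vanish near the boundary *)

Section extension.
Context (R : realType) (d : nat) (d0 : (0 < d)%N).
Local Notation mu := (cube_measure R d).
Local Notation field := (scalar_field R d).
Implicit Types (f g w v : field) (i : 'I_d) (s : seq 'I_d) (h : 'I_d -> R -> R).

(* A weak form of "[v] has derivative [V] along [i] and vanishes on the two faces
   [x_i = 0] and [x_i = 1]". *)
Definition vanish i v V : Prop := L2 V /\ forall h, (forall j, smooth1 (h j)) ->
  ip v (partial [:: i] (tensor h)) = - ip V (tensor h).

Definition supported_in01 (h : R -> R) : Prop :=
  exists2 e, 0 < e & forall y, ~~ (e <= y <= 1 - e) -> h y = 0.

Lemma ip_dct_upd w h i (a : nat -> R -> R) b : L2 w -> (forall j, smooth1 (h j)) ->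
  (forall m, smooth1 (a m)) -> smooth1 b -> bounded_cvg b a ->
  ip w (tensor (upd h i (a m))) @[m --> \oo] --> ip w (tensor (upd h i b)).
Proof.
move=> lw sh sa sb [[C aC] ab].
have cst1 : forall j, smooth1 (upd h i (cst 1) j) by apply: smooth1_upd => //; exact: smooth1_cst.
have [D D0 hD] := @continuous_bounded_compact R d _ (tensor (upd h i (cst 1)))
  (@rV_compact R d (fun=> `[0, 1]%classic) (fun=> @segment_compact _ 0 1)) (continuous_tensor cst1).
apply: (@ip_dct R d w _ _ (`|C| * D)) => //.
- by move=> m; apply: measurable_continuous_row; apply: continuous_tensor; exact: smooth1_upd.
- by apply: measurable_continuous_row; apply: continuous_tensor; exact: smooth1_upd.
- apply: filterS (@ae_cube R d) => x cx m; rewrite tensor_upd normrM ler_pM//.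
    exact: le_trans (aC m _ (cx i)) (ler_norm C).
  have := hD x; rewrite tensor_upd mul1r; apply=> j /=.
  by rewrite in_itv/=; have /andP[/ltW -> /ltW ->] := cx j.
- apply: filterS (@ae_cube R d) => x cx; rewrite tensor_upd.
  apply: cvg_near_cst; apply: filterS (ab _ (cx i)) => m am.
  by rewrite tensor_upd am.
Qed.

Lemma partial_tensor_upd s h i b : (forall j, smooth1 (h j)) -> smooth1 b ->
  partial s (tensor (upd h i b)) =
  tensor (upd (fun j => iter (count_mem j s) (@derive1 R R) (h j)) i
    (iter (count_mem i s) (@derive1 R R) b)).
Proof.
move=> sh sb; rewrite partial_tensor; last exact: smooth1_upd.
by congr tensor; apply/funext => j; rewrite /upd; case: eqP => // ->.
Qed.

Lemma continuous_bounded01 (h : R -> R) : continuous h ->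
  exists C, forall x, 0 <= x <= 1 -> `|h x| <= C.
Proof.
move=> ch; have /compact_bounded[M [_ hM]] : compact (h @` `[0, 1]%classic).
  by apply: continuous_compact; [exact: continuous_subspaceT|exact: segment_compact].
exists (`|M| + 1) => x x01; apply: hM; first by rewrite (le_lt_trans (ler_norm M))// ltrDl.
by exists x => //=; rewrite in_itv.
Qed.

Lemma smooth1_linear_bound (h : R -> R) : smooth1 h -> exists D,
  (forall x, 0 < x < 1 -> `|derive1 h x| <= D) /\
  (h 0 = 0 /\ h 1 = 0 -> forall x, 0 < x < 1 -> `|h x| <= D * x /\ `|h x| <= D * (1 - x)).
Proof.
move=> sh; have [D hD] := continuous_bounded01 (smooth1_continuous (smooth1_derive1 sh)).
have dh x := smooth1_is_derive x sh.
exists D; split => [x /andP[/ltW x0 /ltW x1]|[h0 h1] x /andP[/ltW x0 /ltW x1]].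
  by apply: hD; rewrite x0.
split.
  have [c /andP[c0 cx]] := MVT_is_derive dh x0; rewrite h0 !subr0 => ->.
  rewrite normrM (ger0_norm x0) ler_wpM2r// hD// c0/=; exact: le_trans x1.
have [c /andP[cx c1]] := MVT_is_derive dh x1; rewrite h1 sub0r => H.
rewrite -normrN H normrM (@ger0_norm _ (1 - x)) ?subr_ge0// ler_wpM2r ?subr_ge0// hD// c1 andbT.
exact: le_trans cx.
Qed.

(** Here [n] derivatives fall on the cut-off factor along [i]. If [t] holds, one of them is first
    moved onto [v]; if [b] holds, the first derivatives of the cut-offs converge boundedly. Hence
    the budget [t + b]. *)
Lemma cvg_ip_cutoff v (V : field) (t b : bool) h i (a : nat -> R -> R) (g : R -> R) n :
  L2 v -> (t -> vanish i v V) -> (forall j, smooth1 (h j)) ->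
  (forall m, smooth1 (a m)) -> smooth1 g ->
  bounded_cvg g a -> (b -> bounded_cvg (derive1 g) (fun m => derive1 (a m))) ->
  (n <= t + b)%N ->
  ip v (tensor (upd h i (iter n (@derive1 R R) (a m)))) @[m --> \oo] -->
    ip v (tensor (upd h i (iter n (@derive1 R R) g))).
Proof.
move=> lv vV sh sa sg ag ag'.
have H w n' : L2 w -> (n' <= b)%N ->
    ip w (tensor (upd h i (iter n' (@derive1 R R) (a m)))) @[m --> \oo] -->
    ip w (tensor (upd h i (iter n' (@derive1 R R) g))).
  move=> lw; case: n' => [_|[|n'']]; first exact: ip_dct_upd.
    case: b ag' => // ag' _; apply: ip_dct_upd => //; last exact: ag'.
      by move=> m; exact: smooth1_derive1.
    exact: smooth1_derive1.
  by case: b {ag'}.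
case: t vV => [/(_ isT) [lV vV]|_]; last exact: H.
case: n => [_|n]; first exact: H.
rewrite add1n ltnS => nb.
have E q : smooth1 q -> ip v (tensor (upd h i (iter n.+1 (@derive1 R R) q))) =
    - ip V (tensor (upd h i (iter n (@derive1 R R) q))).
  move=> sq; rewrite -vV; last by apply: smooth1_upd => //; exact: smooth1_derive1n.
  rewrite partial_tensor_upd//; last exact: smooth1_derive1n.
  rewrite /= eqxx addn0 /=; congr (ip v (tensor _)); apply/funext => j.
  by rewrite /upd; case: eqP => // /eqP; rewrite eq_sym => /negbTE ->.
rewrite (E _ sg); under eq_fun do rewrite (E _ (sa _)).
by apply: cvgN; exact: H.
Qed.

(* An identity that holds against all test functions extends to factors that do
   not vanish near the boundary, one coordinate at a time: along [i], one
   derivative is allowed if [v] vanishes on the faces, one more if [h i] does. *)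
Lemma ip_extension (I : Type) (r : seq I) w (c : I -> R) (v : I -> field)
    (V : I -> 'I_d -> field) (s : I -> seq 'I_d) (t : I -> 'I_d -> bool) (b : 'I_d -> bool) h :
  L2 w -> (forall k, L2 (v k)) -> (forall k i, t k i -> vanish i (v k) (V k i)) ->
  (forall i, smooth1 (h i)) -> (forall i, b i -> h i 0 = 0 /\ h i 1 = 0) ->
  (forall k i, (count_mem i (s k) <= t k i + b i)%N) ->
  (forall phi, test_function cube phi ->
     ip w phi = \sum_(k <- r) c k * ip (v k) (partial (s k) phi)) ->
  ip w (tensor h) = \sum_(k <- r) c k * ip (v k) (partial (s k) (tensor h)).
Proof.
move=> lw lv vV sh h0 st H.
(* [J] lists the coordinates whose factor is already that of [h]; all the other factors are
   supported inside the open interval, so an empty [J] gives a test function. *)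
suff claim (J : seq 'I_d) h' : (forall i, smooth1 (h' i)) ->
    (forall i, i \in J -> h' i = h i) -> (forall i, i \notin J -> supported_in01 (h' i)) ->
    ip w (tensor h') = \sum_(k <- r) c k * ip (v k) (partial (s k) (tensor h')).
  by apply: (claim (enum 'I_d)) => // i; rewrite mem_enum.
elim: J h' => [|i J IH] h' sh' hJ hN.
  by apply: H; apply: test_function_tensor => // i; exact: hN.
have [iJ|iJ] := boolP (i \in J).
  by apply: IH => // j jJ; [apply: hJ; rewrite inE jJ orbT|apply: hN; rewrite inE negb_or jJ andbT; apply: contraNneq jJ => ->].
have [D [hD hD']] := smooth1_linear_bound (sh i).
have [C hC'] := continuous_bounded01 (smooth1_continuous (sh i)).
have hC x : 0 < x < 1 -> `|h i x| <= C by move=> /andP[/ltW x0 /ltW x1]; rewrite hC'// x0.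
have [a [sa supa aC ah] aD] := cutoff_ex (sh i) hC.
have h'E : h' = upd h' i (h i).
  by apply/funext => j; rewrite /upd; case: eqP => // ->; apply: hJ; rewrite inE eqxx.
have L m : ip w (tensor (upd h' i (a m))) =
    \sum_(k <- r) c k * ip (v k) (partial (s k) (tensor (upd h' i (a m)))).
  apply: IH => [j|j jJ|j jJ]; first exact: smooth1_upd.
    by rewrite /upd; case: eqP jJ iJ => [-> ->//|_ jJ _]; apply: hJ; rewrite inE jJ orbT.
  by rewrite /upd; case: eqP => [_|/eqP ji]; [exact: supa|apply: hN; rewrite inE negb_or ji].
have lim1 : ip w (tensor (upd h' i (a m))) @[m --> \oo] --> ip w (tensor h').
  by rewrite [in X in _ --> X]h'E; exact: ip_dct_upd.
have lim2 : \sum_(k <- r) c k * ip (v k) (partial (s k) (tensor (upd h' i (a m)))) @[m --> \oo]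
    --> \sum_(k <- r) c k * ip (v k) (partial (s k) (tensor h')).
  apply: cvg_big => [|k _]; first exact: add_continuous.
  apply: cvgMl_tmp; rewrite [in X in _ --> X]h'E partial_tensor_upd//.
  under eq_fun do rewrite partial_tensor_upd//.
  apply: (@cvg_ip_cutoff _ (V k i) (t k i) (b i)) => //.
  - by move=> /vV.
  - by move=> j; exact: smooth1_derive1n.
  - by move=> bi; apply: (aD D D) => //; exact/hD'/h0.
move: lim1; under eq_fun do rewrite L; move=> lim1.
exact: (cvg_unique _ lim1 lim2).
Qed.

End extension.

(** * Derivatives of the trigonometric modes *)

Section trig_derivatives.
Context (R : realType) (d : nat).
Local Notation field := (scalar_field R d).
Implicit Types (A B : {set 'I_d}) (i j : 'I_d).

Definition dfreq (b : bool) (n : nat) : R := (if b then 1 else -1) * (pi * n%:R).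

Lemma derive1_trig1 b n : derive1 (@trig1 R b n) = (fun x => dfreq b n * trig1 (~~ b) n x).
Proof.
apply: is_derive_derive1 => x; rewrite /trig1 /dfreq; case: b => /=.
  have ds (y : R) : is_derive y 1 sin (cos y) := is_derive_sin y.
  have := is_derive_affine (pi * n%:R) 0 ds x => dsx.
  have -> : tsin n = Num.sqrt 2 *: (fun x => sin (pi * n%:R * x + 0)) :> (R -> R).
    by apply/funext => y; rewrite /tsin -[pi * _ * y]addr0.
  apply: is_derive_eq; rewrite /GRing.scale/= addr0 /tcos mul1r.
  by case: (n =P 0%N) => [->|_]; [rewrite mulr0 !mul0r mulr0|rewrite mulrCA].
have dc (y : R) : is_derive y 1 cos (- sin y) := is_derive_cos y.
have := is_derive_affine (pi * n%:R) 0 dc x => dsx.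
pose c : R := if n == 0%N then 1 else Num.sqrt 2.
have -> : tcos n = c *: (fun x => cos (pi * n%:R * x + 0)) :> (R -> R).
  by apply/funext => y; rewrite /tcos -/c -[pi * _ * y]addr0.
apply: is_derive_eq; rewrite /GRing.scale/= addr0 /tsin /c.
by case: (n =P 0%N) => [->|_]; rewrite ?mulr0 ?mul0r ?mulr0//; ring.
Qed.

Lemma derive2_trig1 b n : derive1 (derive1 (@trig1 R b n)) =
  (fun x => - (pi * n%:R) ^+ 2 * trig1 b n x).
Proof.
rewrite derive1_trig1; apply: is_derive_derive1 => x.
have d2 := smooth1_is_derive x (@smooth1_trig1 R (~~ b) n).
have -> : (fun x => dfreq b n * trig1 (~~ b) n x) = dfreq b n *: (@trig1 R (~~ b) n) by [].
apply: is_derive_eq; rewrite derive1_trig1 negbK /GRing.scale/= /dfreq.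
by case: b {d2} => /=; ring.
Qed.

Lemma tensorZ (c : 'I_d -> R) (h : 'I_d -> R -> R) :
  tensor (fun i x => c i * h i x) = (fun x => (\prod_i c i) * tensor h x).
Proof. by apply/funext => x; rewrite /tensor big_split. Qed.

Lemma count_mem_enum B i : count_mem i (enum B) = (i \in B) :> nat.
Proof. by rewrite (count_uniq_mem _ (enum_uniq _)) mem_enum. Qed.

(** Differentiating once along each coordinate of [B] exchanges sine and cosine exactly in those
    coordinates. *)
Definition symdiff A B : {set 'I_d} := [set i | (i \in A) (+) (i \in B)].

Lemma symdiffCT B : symdiff (~: B) B = [set: 'I_d]%SET.
Proof. by apply/setP => i; rewrite !inE; case: (i \in B). Qed.

Lemma symdiff_id B : symdiff B B = finset.set0.
Proof. by apply/setP => i; rewrite !inE addbb. Qed.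

Lemma symdiff0s B : symdiff finset.set0 B = B.
Proof. by apply/setP => i; rewrite !inE. Qed.

Lemma partial_trig B A n : partial (enum B) (@trig R d A n) =
  (fun x => (\prod_(i in B) dfreq (i \in A) (n i)) * trig (symdiff A B) n x).
Proof.
rewrite partial_tensor; last by move=> i; exact: smooth1_trig1.
rewrite big_mkcond -tensorZ; congr tensor; apply/funext => i.
rewrite count_mem_enum inE; case: (i \in B) => /=.
  by rewrite derive1_trig1 addbT.
by rewrite addbF; apply/funext => x; rewrite mul1r.
Qed.

Lemma partial_trig2 B A n : partial (enum B ++ enum B) (@trig R d A n) =
  (fun x => (\prod_(i in B) - (pi * (n i)%:R) ^+ 2) * trig A n x).
Proof.
rewrite partial_tensor; last by move=> i; exact: smooth1_trig1.
rewrite big_mkcond -tensorZ; congr tensor; apply/funext => i.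
rewrite count_cat count_mem_enum; case: (i \in B) => /=.
  by rewrite derive2_trig1.
by apply/funext => x; rewrite mul1r.
Qed.

Lemma trig1_sin_faces n : @trig1 R true n 0 = 0 /\ @trig1 R true n 1 = 0.
Proof. by rewrite /trig1 /tsin mulr0 mulr1 sin0 sin_pi_nat mulr0. Qed.

End trig_derivatives.

(** * Weak derivatives and operators in terms of coefficients *)

Section weak_derivatives.
Context (R : realType) (d : nat) (d0 : (0 < d)%N).
Local Notation field := (scalar_field R d).
Implicit Types (f g w v q r : field) (A B : {set 'I_d}) (i j : 'I_d) (s : seq 'I_d).

Lemma coefE A f l : L2 f -> coef A f l = (is_mode d l)%:R * ip f (trig A (freq l)).
Proof. by move=> lf; rewrite /coef /bas ip_Zr//; exact: L2_trig. Qed.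

(** No derivative is involved, so orthogonality extends from test functions to every cosine mode
    without boundary conditions, and completeness concludes. *)
Lemma ae_eq0_test w : L2 w -> (forall phi, test_function cube phi -> ip w phi = 0) ->
  ae_eq_cube w (cst 0).
Proof.
move=> lw h; apply: (@trig_complete R d finset.set0) => // l.
rewrite coefE// (@ip_extension R d d0 unit [::] w (fun=> 0) (fun=> cst 0) (fun _ _ => cst 0) (fun=> [::])
  (fun _ _ => false) (fun=> false)) ?big_nil ?mulr0//.
- by move=> _; exact: L2_cst.
- by move=> i; exact: smooth1_trig1.
- by move=> phi /h ->; rewrite big_nil.
Qed.

Lemma ae_eq_test f g : L2 f -> L2 g ->
  (forall phi, test_function cube phi -> ip f phi = ip g phi) -> ae_eq_cube f g.
Proof.
move=> lf lg h; have /(ae_eq0_test (L2_B lf lg)) : forall phi, test_function cube phi ->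
    ip (fun x => f x - g x) phi = 0.
  by move=> phi tp; rewrite ip_Bl ?h ?subrr//; exact: (L2_smooth [::] tp.1).
by apply: filterS => x /= /subr0_eq.
Qed.

Lemma wpartialP s f : weakly_diff s f -> is_weak_partial s f (wpartial s f).
Proof. exact: xgetPex. Qed.

Lemma L2_wpartial s f : weakly_diff s f -> L2 (wpartial s f).
Proof. by move=> /wpartialP[]. Qed.

Lemma weakly_diff_L2 s f : weakly_diff s f -> L2 f.
Proof. by move=> [g []]. Qed.

Lemma wpartial_ae s f g : is_weak_partial s f g -> ae_eq_cube (wpartial s f) g.
Proof.
move=> hg; have [lf lp hp] : is_weak_partial s f (wpartial s f) by apply: wpartialP; exists g.
by have [_ lg hg'] := hg; apply: ae_eq_test => // phi tp; rewrite hp// hg'.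
Qed.

Lemma vanish_zero_trace i v : zero_trace i v -> vanish i v (wpartial [:: i] v).
Proof.
move=> [wv h]; split; first exact: L2_wpartial.
move=> a sa; have st := smooth_tensor sa; have wt := smooth_weak_partial i st.
have /h/eqP : weakly_diff [:: i] (tensor a) by exists (partial [:: i] (tensor a)).
rewrite addr_eq0 => /eqP <-; rewrite ipC [RHS]ipC; apply: ip_ae.
- exact: L2_smooth.
- by apply: L2_wpartial; exists (partial [:: i] (tensor a)).
- exact: weakly_diff_L2 wv.
- by apply: filterS (wpartial_ae wt) => x ->.
Qed.

(** The identity holds for the approximating test functions by integration by parts and passes to
    the limit; [c] collects the norms of the two fixed factors. *)
Lemma vanish_H10 i v : H10 v -> vanish i v (wpartial [:: i] v).
Proof.
move=> [h1 h]; have wv := h1 i; have lw := L2_wpartial wv; have lv := weakly_diff_L2 wv.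
split => // a sa; have st := smooth_tensor sa.
pose H := tensor a; have lH : L2 H := L2_smooth [::] st; have ldH : L2 (partial [:: i] H) := L2_smooth [:: i] st.
apply/eqP; rewrite -addr_eq0 -normr_le0; apply/ler_addgt0Pr => e e0.
pose c := normL2 (partial [:: i] H) + normL2 H + 1.
have c0 : 0 < c by rewrite ltr_wpDl ?addr_ge0 ?normL2_ge0.
have [phi [tp hphi hdphi]] := h (e / c) (divr_gt0 e0 c0).
have lphi : L2 phi := L2_smooth [::] tp.1; have ldphi : L2 (partial [:: i] phi) := L2_smooth [:: i] tp.1.
have -> : ip v (partial [:: i] H) + ip (wpartial [:: i] v) H =
    ip (fun x => v x - phi x) (partial [:: i] H) +
    ip (fun x => wpartial [:: i] v x - partial [:: i] phi x) H.
  by rewrite !ip_Bl// (ip_partial_test i tp st) -/H; ring.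
apply: (le_trans (ler_normD _ _)); rewrite add0r.
have l1 := ip_CS (L2_B lv lphi) ldH; have l2 := ip_CS (L2_B lw ldphi) lH.
apply: (le_trans (lerD l1 l2)).
apply: (@le_trans _ _ (e / c * normL2 (partial [:: i] H) + e / c * normL2 H)).
  by apply: lerD; rewrite ler_wpM2r ?normL2_ge0// ltW.
rewrite -mulrDr mulrAC ler_pdivrMr// ler_wpM2l ?ltW// /c; lra.
Qed.

Lemma ip_wpartial s f (V : 'I_d -> field) (t : 'I_d -> bool) A n : weakly_diff s f ->
  (forall i, t i -> vanish i f (V i)) ->
  (forall i, (count_mem i s <= t i + (i \in A))%N) ->
  ip (wpartial s f) (trig A n) = (-1) ^+ size s * ip f (partial s (trig A n)).
Proof.
move=> wf tV st; have [lf lp hp] := wpartialP wf.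
rewrite (@ip_extension R d d0 unit [:: tt] (wpartial s f) (fun=> (-1) ^+ size s) (fun=> f)
  (fun _ i => V i) (fun=> s) (fun _ i => t i) (fun i => i \in A)) ?big_seq1//.
- by move=> i; exact: smooth1_trig1.
- by move=> i ->; exact: trig1_sin_faces.
- by move=> phi tp; rewrite big_seq1 hp// ip_Zr//; exact: L2_smooth tp.1.
Qed.

(** Along [i] in [B] the boundary term is killed by the sine when [i] is in [A], and by the
    vanishing of [f] otherwise. *)
Lemma coef_wpartial f (V : 'I_d -> field) A B l : weakly_diff (enum B) f ->
  (forall i, i \in B -> i \notin A -> vanish i f (V i)) ->
  coef A (wpartial (enum B) f) l =
  (\prod_(i in B) - dfreq R (i \in A) (freq l i)) * coef (symdiff A B) f l.
Proof.
move=> wf BV; have lf := weakly_diff_L2 wf; have lw := L2_wpartial wf.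
rewrite !coefE// (@ip_wpartial _ _ V (fun i => (i \in B) && (i \notin A)))//; first last.
- by move=> i; rewrite count_mem_enum; case: (i \in B); case: (i \in A).
- by move=> i /andP[]; exact: BV.
rewrite partial_trig ip_Zr//; last exact: L2_trig.
by rewrite prodrN -cardE; ring.
Qed.

Definition lam (l : nat) i : R := (pi * (freq l i)%:R) ^+ 2.

Lemma lam_ge0 l i : 0 <= lam l i. Proof. exact: sqr_ge0. Qed.

Lemma coef_wpartial2 f (V : 'I_d -> field) B l : weakly_diff (enum B ++ enum B) f ->
  (forall i, i \in B -> vanish i f (V i)) ->
  coef [set: 'I_d] (wpartial (enum B ++ enum B) f) l =
  (\prod_(i in B) - lam l i) * coef [set: 'I_d] f l.
Proof.
move=> wf BV; have lf := weakly_diff_L2 wf; have lw := L2_wpartial wf.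
rewrite !coefE// (@ip_wpartial _ _ V (fun i => i \in B))//; last first.
  by move=> i; rewrite count_cat count_mem_enum inE; case: (i \in B).
rewrite partial_trig2 ip_Zr//; last exact: L2_trig.
by rewrite size_cat exprD -expr2 sqrr_sign; ring.
Qed.

Lemma coef_wpartial_ii f (V : field) i l : weakly_diff [:: i; i] f -> vanish i f V ->
  coef [set: 'I_d] (wpartial [:: i; i] f) l = - lam l i * coef [set: 'I_d] f l.
Proof.
move=> wf vf; have H := @coef_wpartial2 f (fun=> V) [set i] l.
rewrite big_set1 enum_set1 in H; apply: H; first exact: wf.
by move=> j /set1P ->.
Qed.

Lemma coef_ae A f g l : L2 f -> L2 g -> ae_eq_cube f g -> coef A f l = coef A g l.
Proof. by move=> lf lg fg; apply: ip_ae => //; exact: L2_bas. Qed.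

Definition B_coef (tau : R) (l : nat) : R :=
  \sum_(A : {set 'I_d} | #|A| == 2%N) \prod_(i in A) lam l i +
  tau / 2 * \sum_(A : {set 'I_d} | #|A| == 3%N) \prod_(i in A) lam l i.

(** Each coordinate may carry two derivatives, one thanks to the vanishing of [f] and one thanks to
    that of the sine. The factor [(-1) ^+ #|A|] from the second derivatives turns the minus sign of
    [B_symbol] on triples into a plus sign. *)
Lemma coef_B tau f g l : H10 f -> is_B tau f g ->
  coef [set: 'I_d] g l = B_coef tau l * coef [set: 'I_d] f l.
Proof.
move=> hf [lf lg hB].
pose c (A : {set 'I_d}) : R := (#|A| == 2%N)%:R - tau / 2 * (#|A| == 3%N)%:R.
have BE phi : smooth phi -> ip f (B_symbol tau phi) =
    \sum_A c A * ip f (partial (enum A ++ enum A) phi).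
  move=> sp; have lp (A : {set 'I_d}) : L2 (partial (enum A ++ enum A) phi) by exact: L2_smooth.
  transitivity (ip f (fun x => \sum_A c A * partial (enum A ++ enum A) phi x)).
    congr (ip f _); apply/funext => x; rewrite /B_symbol /c.
    rewrite big_mkcond [X in _ - _ * X]big_mkcond mulr_sumr -sumrB; apply: eq_bigr => A _.
    by rewrite mulrBl; case: (_ == 2%N); case: (_ == 3%N); rewrite ?mul1r ?mul0r ?mulr1 ?mulr0 ?mul0r.
  rewrite ip_sumr//; last by move=> A; exact: L2_Z.
  by apply: eq_bigr => A _; rewrite ip_Zr.
have bE : B_coef tau l = \sum_A c A * ((-1) ^+ #|A| * \prod_(i in A) lam l i).
  rewrite /B_coef big_mkcond [X in _ + _ * X]big_mkcond mulr_sumr -big_split/=.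
  apply: eq_bigr => A _; rewrite /c.
  have [->|_] := eqVneq #|A| 2%N; first by rewrite /= sqrrN expr1n !mul1r !mulr0 subr0 addr0 mul1r.
  have [->|_] := eqVneq #|A| 3%N; last by rewrite !mulr0 subr0 mul0r addr0.
  by rewrite exprS sqrrN expr1n /= add0r sub0r !mulr1 mulN1r mulrN mulNr opprK.
rewrite !coefE// (@ip_extension R d d0 _ (index_enum _) g c (fun=> f)
  (fun _ i => wpartial [:: i] f) (fun A => enum A ++ enum A) (fun _ _ => true) (fun=> true))//.
- rewrite [RHS]mulrCA bE mulr_suml; congr (_ * _); apply: eq_bigr => A _.
  rewrite -/(trig _ _) partial_trig2 ip_Zr//; last exact: L2_trig.
  by rewrite prodrN /lam !mulrA.
- by move=> _ i _; exact: vanish_H10.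
- by move=> i; exact: smooth1_trig1.
- by move=> i _; rewrite inE; exact: trig1_sin_faces.
- by move=> A i; rewrite count_cat count_mem_enum; case: (i \in A).
- by move=> phi tp; rewrite hB// BE//; exact: tp.1.
Qed.

Lemma coef_div (F : vector_field R d) (V : 'I_d -> field) g l : is_div F g ->
  (forall i, vanish i (F i) (V i)) ->
  coef finset.set0 g l = \sum_i pi * (freq l i)%:R * coef [set i] (F i) l.
Proof.
move=> [lF lg h] FV.
rewrite coefE// (@ip_extension R d d0 _ (index_enum _) g (fun=> -1) F (fun k i => V k)
  (fun i => [:: i]) (fun k i => k == i) (fun=> false))//.
- rewrite mulr_sumr; apply: eq_bigr => i _; rewrite coefE//.
  rewrite -enum_set1 partial_trig big_set1 inE /dfreq ip_Zr//; last exact: L2_trig.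
  by rewrite symdiff0s; ring.
- by move=> k i /eqP <-.
- by move=> i; exact: smooth1_trig1.
- by move=> phi tp; rewrite h// -sumrN; apply: eq_bigr => i _; rewrite mulN1r.
Qed.

(** The inner derivative is read in the basis with a sine along [i]; the outer one is read in
    cosines, where the Neumann condition supplies the vanishing. *)
Lemma coef_neumann i q l : weakly_diff [:: i] q -> zero_trace i (wpartial [:: i] q) ->
  coef finset.set0 (fun x => q x - wpartial [:: i] (wpartial [:: i] q) x) l =
  (1 + lam l i) * coef finset.set0 q l.
Proof.
move=> wq tq; have lq := weakly_diff_L2 wq.
have wqq := tq.1; have lqq := L2_wpartial wqq.
rewrite {1}/coef ip_Bl//; last exact: L2_bas.
rewrite -!/(coef _ _ _).
have := @coef_wpartial _ (fun=> wpartial [:: i] (wpartial [:: i] q)) finset.set0 [set i] l.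
rewrite symdiff0s enum_set1 => /(_ _ wqq) ->; last first.
  by move=> j /set1P -> _; exact: vanish_zero_trace.
have := @coef_wpartial _ (fun=> cst 0) [set i] [set i] l.
rewrite symdiff_id.
rewrite enum_set1 => /(_ _ wq) ->; last by move=> j ->.
by rewrite !big_set1 /dfreq !inE eqxx /lam; ring.
Qed.

Lemma coef_neumann_chain s q (q0 : field) r l : ae_eq_cube q q0 -> L2 q0 ->
  neumann_chain s q r -> L2 r ->
  coef finset.set0 r l = (\prod_(i <- s) (1 + lam l i)) * coef finset.set0 q0 l.
Proof.
elim: s q q0 => [|i s IH] q q0 qq0 lq0 /=.
  move=> qr lr; rewrite big_nil mul1r; apply: coef_ae => //.
  by apply: filterS2 qr qq0 => x <- ->.
move=> [q' [[wq tq q'E] hs]] lr; have lq := weakly_diff_L2 wq.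
rewrite (IH q' _ q'E _ hs lr); last exact: L2_B lq (L2_wpartial tq.1).
by rewrite coef_neumann// (coef_ae _ _ lq lq0 qq0) big_cons; ring.
Qed.

Lemma coef_A q r l : is_A q r -> L2 r ->
  coef finset.set0 r l = (\prod_i (1 + lam l i)) * coef finset.set0 q l.
Proof.
move=> [[lq _] h] lr; rewrite (coef_neumann_chain l _ lq h lr); last exact: aeW.
by congr (_ * _); rewrite (perm_big (enum 'I_d)) ?perm_rev//= big_enum.
Qed.

End weak_derivatives.

(** * Weighted coefficient sums, and traces read off coefficients *)

Section coefficient_sums.
Context (R : realType) (d : nat) (d0 : (0 < d)%N).
Local Notation field := (scalar_field R d).
Implicit Types (f g w v q r : field) (A B : {set 'I_d}) (i j : 'I_d).
Local Notation T := [set: 'I_d]%SET.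

Lemma ip_dist_cvg (u : nat -> field) f w : (forall n, L2 (u n)) -> L2 f -> L2 w ->
  (forall e : R, 0 < e -> exists N, forall n, (N <= n)%N -> dist2 (u n) f <= e) ->
  ip (u n) w @[n --> \oo] --> ip f w.
Proof.
move=> lu lf lw h; apply/cvgrPdist_le => /= e e0.
have W0 := ip_ge0 w.
have [N hN] := h (e ^+ 2 / (ip w w + 1)) (divr_gt0 (exprn_gt0 2 e0) (ltr_wpDl W0 ltr01)).
exists N => // n /= Nn; rewrite distrC -ip_Bl//.
have := ip_CS2 (L2_B (lu n) lf) lw; rewrite -/(dist2 (u n) f) => h1.
rewrite -[leRHS]ger0_norm ?(ltW e0)// -ler_sqr ?nnegrE// !real_normK ?num_real//.
apply: (le_trans h1); apply: (@le_trans _ _ (e ^+ 2 / (ip w w + 1) * ip w w)).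
  by rewrite ler_wpM2r// hN.
rewrite mulrAC ler_pdivrMr ?ltr_wpDl// ler_wpM2l ?sqr_ge0//; lra.
Qed.

Lemma part_cvg A f w : L2 f -> L2 w -> ip (part A (coef A f) n) w @[n --> \oo] --> ip f w.
Proof.
move=> lf lw; apply: ip_dist_cvg => // [n|e /(parseval A lf)[N hN]]; first exact: L2_part.
by exists N => n /hN; rewrite dist2C.
Qed.

Lemma ip_parseval A f w : L2 f -> L2 w ->
  \sum_(0 <= l < n) coef A f l * coef A w l @[n --> \oo] --> ip f w.
Proof.
move=> lf lw; have := part_cvg A lf lw.
by under eq_fun do rewrite ipC ip_part//.
Qed.

Lemma coef_wpartial_sum f (V : 'I_d -> field) A B m : weakly_diff (enum B) f ->
  (forall i, i \in B -> i \notin A -> vanish i f (V i)) ->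
  \sum_(0 <= l < m) (\prod_(i in B) lam R l i) * coef (symdiff A B) f l ^+ 2 <=
  ip (wpartial (enum B) f) (wpartial (enum B) f).
Proof.
move=> wf BV; have := bessel A m (L2_wpartial wf); apply: le_trans.
rewrite le_eqVlt; apply/orP; left; apply/eqP; apply: eq_bigr => l _.
rewrite (coef_wpartial d0 _ wf BV) exprMn -prodrXl; congr (_ * _); apply: eq_bigr => i _.
by rewrite sqrrN /dfreq exprMn /lam; case: (i \in A); rewrite ?sqrrN expr1n mul1r.
Qed.

(** The derivative is expanded with cosines along [B], so that the coefficients of [v] itself come
    out in the pure sine basis. *)
Lemma coef_sum_H10 v B m : H10 v -> weakly_diff (enum B) v ->
  \sum_(0 <= l < m) (\prod_(i in B) lam R l i) * coef T v l ^+ 2 <=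
  ip (wpartial (enum B) v) (wpartial (enum B) v).
Proof.
move=> hv wv; rewrite -(symdiffCT B).
by apply: (@coef_wpartial_sum _ (fun i => wpartial [:: i] v)) => // i _ _; exact: vanish_H10.
Qed.

Lemma coef_sum_Y q B m : weakly_diff (enum B) q ->
  \sum_(0 <= l < m) (\prod_(i in B) lam R l i) * coef finset.set0 q l ^+ 2 <=
  ip (wpartial (enum B) q) (wpartial (enum B) q).
Proof.
move=> wq; rewrite -(symdiff_id B).
by apply: (@coef_wpartial_sum _ (fun=> cst 0)) => // i -> .
Qed.

Lemma coef_vanish v V j l : L2 v -> vanish j v V ->
  coef (~: [set j]%SET) V l = pi * (freq l j)%:R * coef T v l.
Proof.
move=> lv [lV h]; rewrite !coefE//.
have := h _ (fun i => @smooth1_trig1 R (i \in ~: [set j]%SET) (freq l i)).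
rewrite -/(trig _ (freq l)) => /eqP; rewrite -eqr_oppLR => /eqP <-.
rewrite -enum_set1 partial_trig big_set1 symdiffCT ip_Zr//; last exact: L2_trig.
by rewrite /dfreq !inE eqxx/=; ring.
Qed.

Lemma lam_sum v V j m : L2 v -> vanish j v V ->
  \sum_(0 <= l < m) lam R l j * coef T v l ^+ 2 <= ip V V.
Proof.
move=> lv vV; have := bessel (~: [set j]%SET) m vV.1; apply: le_trans.
rewrite le_eqVlt; apply/orP; left; apply/eqP; apply: eq_bigr => l _.
by rewrite (coef_vanish _ lv vV) exprMn.
Qed.

Lemma bas_setT_null A l : ip (bas A l) (bas A l) = (0 : R) -> ip (bas T l) (bas T l) = (0 : R).
Proof.
rewrite !bas_orth eqxx /=; case: (is_mode d l) => //= /eqP.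
rewrite pnatr_eq0 eqb0 => /forallPn[i ni]; case: (boolP [forall i, _]) => // /forallP/(_ i).
by rewrite inE/= => fi; move: ni; rewrite fi implybT.
Qed.

Lemma ip_partial_sin j n h : (forall i, smooth1 (h i)) ->
  ip (partial [:: j] (tensor h)) (trig T n) = - ip (tensor h) (partial [:: j] (trig T n)) :> R.
Proof.
move=> sh; have st := smooth_tensor sh.
have ldh : L2 (partial [:: j] (tensor h)) := L2_smooth [:: j] st.
have lh : L2 (tensor h) := L2_smooth [::] st.
rewrite (@ip_extension R d d0 unit [:: tt] (partial [:: j] (tensor h)) (fun=> -1)
  (fun=> tensor h) (fun _ _ => cst 0) (fun=> [:: j]) (fun _ _ => false) (fun=> true))//; first last.
- move=> phi tp; rewrite big_seq1 mulN1r [ip (tensor h) _]ipC (ip_partial_test j tp st) opprK.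
  by rewrite ipC.
- by move=> _ i /=; case: eqP.
- by move=> i _; rewrite inE; exact: trig1_sin_faces.
- by move=> i; exact: smooth1_trig1.
by rewrite big_seq1 mulN1r.
Qed.

(** A converse of [lam_sum]. The derivative [V] is the termwise derivative of the sine series, which
    [riesz_fischer] sums; each partial sum satisfies the identity because its sines vanish on the
    faces. It gives a trace to functions known only through their coefficients. *)
Lemma vanish_sum v j (C : R) : L2 v ->
  (forall m, \sum_(0 <= l < m) lam R l j * coef T v l ^+ 2 <= C) -> exists V, vanish j v V.
Proof.
move=> lv hC; pose A := ~: [set j]%SET; pose a l := pi * (freq l j)%:R * coef T v l.
have a0 k : ip (bas A k : field) (bas A k) = 0 -> a k = 0.
  by move=> bA; have bT := bas_setT_null bA; rewrite /a (coef0 lv bT) mulr0.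
have aC m : \sum_(0 <= l < m) a l ^+ 2 <= C.
  apply: le_trans (hC m); rewrite le_eqVlt; apply/orP; left; apply/eqP.
  by apply: eq_bigr => l _; rewrite /a exprMn.
have [V [lV Va hV]] := riesz_fischer a0 aC.
exists V; split => // h sh; have st := smooth_tensor sh.
have ldh : L2 (partial [:: j] (tensor h)) := L2_smooth [:: j] st.
have lh : L2 (tensor h) := L2_smooth [::] st.
have c1 := part_cvg T lv ldh.
have c2 := ip_dist_cvg (fun n => L2_part A a n) lV lh hV.
suff E n : ip (part T (coef T v) n) (partial [:: j] (tensor h)) = - ip (part A a n) (tensor h).
  move: c1; under eq_fun do rewrite E; move=> c1.
  by have := cvg_unique _ c1 (cvgN c2); exact.
rewrite ipC ip_part// [ip (part A a n) _]ipC ip_part// -sumrN; apply: eq_bigr => l _.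
rewrite !coefE// (ip_partial_sin j _ sh).
rewrite -enum_set1 partial_trig big_set1 ip_Zr//; last exact: L2_trig.
have -> : symdiff T [set j]%SET = A by apply/setP => i; rewrite !inE; case: eqP.
by rewrite /dfreq inE /a coefE//; ring.
Qed.

End coefficient_sums.

(** * Weak time derivatives control finite differences *)

Section weak_time.
Context (R : realType).
Local Notation mu := (@lebesgue_measure R).
Implicit Types (f g F H : R -> R) (T s c t : R).

#[global] Instance lebesgue_ae_filter : Filter (almost_everywhere mu).
Proof. exact: (@ae_filter_ringOfSetsType _ _ _ mu). Qed.

Lemma smooth_smooth1 f : smooth1 f -> smooth (f : R -> R).
Proof.
move=> sf r.
have [c ->] : exists c, iter_derive r f = (fun x => c * iter (size r) (@derive1 R R) f x).
  elim: r => [|v r [c IH]]; first by exists 1; apply/funext => x; rewrite mul1r.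
  exists (v * c); apply/funext => x; rewrite /iter_derive /= -/(iter_derive r f) IH.
  have sg : smooth1 (fun x => c * iter (size r) (@derive1 R R) f x).
    by apply: smooth1Z; exact: smooth1_derive1n.
  have dg : differentiable (fun x => c * iter (size r) (@derive1 R R) f x) x.
    by apply/derivable1_diffP; have [] := smooth1_is_derive x sg.
  rewrite deriveE// -[v in LHS]mulr1 -[v * 1]/(v *: (1 : R^o)) linearZ/=.
  rewrite -deriveE// -derive1E /GRing.scale/= -mulrA; congr (_ * _).
  have dd := smooth1_is_derive x (smooth1_derive1n (size r) sf).
  have -> : (fun x => c * iter (size r) (@derive1 R R) f x) = c *: iter (size r) (@derive1 R R) f by [].
  by rewrite derive1E; apply: derive_val.
have sg : smooth1 (fun x => c * iter (size r) (@derive1 R R) f x).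
  by apply: smooth1Z; exact: smooth1_derive1n.
split; first exact: smooth1_continuous.
move=> v x; apply: diff_derivable; apply/derivable1_diffP.
by have [] := smooth1_is_derive x sg.
Qed.

Lemma test_function_itv T f (a b : R) : smooth1 f -> 0 < a -> b < T ->
  (forall x, ~~ (a <= x <= b) -> f x = 0) -> test_function `]0, T[ f.
Proof.
move=> sf a0 bT f0; split; first exact: smooth_smooth1.
exists `[a, b]%classic; split; first exact: segment_compact.
  by move=> x /=; rewrite !in_itv/= => /andP[ax xb]; rewrite (lt_le_trans a0 ax) (le_lt_trans xb).
by move=> x /=; rewrite in_itv/= => /negP; exact: f0.
Qed.

(** A bump of mass [c], the mass being recorded by a primitive that is constant on both sides of the
    support. *)
Definition kernel f (t0 t1 c : R) : Prop :=
  [/\ smooth1 f, forall x, 0 <= f x, forall x, ~~ (t0 <= x <= t1) -> f x = 0 &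
      exists F : R -> R, [/\ forall x : R, is_derive x 1 F (f x), forall x, x <= t0 -> F x = 0 &
        forall x, t1 <= x -> F x = c]].

Lemma kernel_ex (t0 t1 : R) : t0 < t1 -> exists f c, 0 < c /\ kernel f t0 t1 c.
Proof.
move=> t01; pose L := t1 - t0; have L0 : 0 < L by rewrite subr_gt0.
pose f x := @smooth_bump R (L^-1 * x + - (t0 / L)).
have fE x : L^-1 * x + - (t0 / L) = (x - t0) / L by field; rewrite gt_eqF.
have sf : smooth1 f by apply: smooth1_affine; exact: smooth1_bump.
have f0 x : ~~ (t0 < x < t1) -> f x = 0.
  move=> xt; rewrite /f fE smooth_bump_out//; move: xt; apply: contra.
  rewrite pmulr_lgt0 ?invr_gt0// ltr_pdivrMr// mul1r => /andP[h1 h2].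
  by apply/andP; split; [lra|move: h2; rewrite /L; lra].
have fge0 x : 0 <= f x by exact: smooth_bump_ge0.
have [F [dF F0]] : exists F, (forall x : R, is_derive x 1 F (f x)) /\ forall x, x <= t0 -> F x = 0.
  by apply: smooth1_antiderivative => // x xt; apply: f0; rewrite ltNge xt.
have Fmono x y : x <= y -> F x <= F y.
  move=> xy; have [z _ h] := MVT_is_derive dF xy.
  by rewrite -subr_ge0 h mulr_ge0// subr_ge0.
exists f, (F t1); split.
  pose a := t0 + L / 3; pose b := t0 + 2 * L / 3.
  have ab : a <= b by rewrite /a /b; lra.
  have [z /andP[z1 z2] h] := MVT_is_derive dF ab.
  have fz : 0 < f z.
    rewrite /f fE; apply: smooth_bump_gt0; rewrite pmulr_lgt0 ?invr_gt0// ltr_pdivrMr// mul1r.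
    by apply/andP; split; [move: z1; rewrite /a; lra|move: z2; rewrite /b; lra].
  have t0a : t0 <= a by rewrite /a; lra.
  have bt1 : b <= t1 by rewrite /b /L; move: L0; rewrite /L; lra.
  have := Fmono _ _ bt1; have := Fmono _ _ t0a; rewrite (F0 t0)//.
  have : 0 < F b - F a by rewrite h mulr_gt0// subr_gt0 /a /b; lra.
  by lra.
split => // [x xt|]; first by apply: f0; move: xt; apply: contra => /andP[/ltW -> /ltW ->].
exists F; split => // x xt; have [z /andP[z1 _] h] := MVT_is_derive dF xt.
by apply/eqP; rewrite -subr_eq0 h f0 ?mul0r// negb_and -!leNgt z1 orbT.
Qed.

Lemma is_derive_shift F f s : (forall x : R, is_derive x 1 F (f x)) ->
  forall x : R, is_derive x 1 (fun x => F (x - s)) (f (x - s)).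
Proof.
move=> dF x; have := is_derive_affine 1 (- s) dF x; rewrite !mul1r.
by congr is_derive; apply/funext => y; rewrite mul1r.
Qed.

Lemma smooth1_shift f s : smooth1 f -> smooth1 (fun x => f (x - s)).
Proof.
move=> sf; have := smooth1_affine 1 (- s) sf.
by congr smooth1; apply/funext => y; rewrite mul1r.
Qed.

Lemma smooth1B f g : smooth1 f -> smooth1 g -> smooth1 (fun x => f x - g x).
Proof.
move=> sf sg; have := smooth1D sf (smooth1Z (-1) sg); congr smooth1.
by apply/funext => x; rewrite -[in RHS]mulN1r.
Qed.

Definition bdiff s f x : R := f x - f (x - s).

Lemma is_derive_bdiff s F f : (forall x : R, is_derive x 1 F (f x)) ->
  forall x : R, is_derive x 1 (bdiff s F) (bdiff s f x).
Proof.
move=> dF x; have d1 := dF x; have d2 := is_derive_shift s dF x.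
have -> : bdiff s F = F - (fun x => F (x - s)) by [].
exact: is_deriveB.
Qed.

Lemma smooth1_bdiff s f : smooth1 f -> smooth1 (bdiff s f).
Proof. by move=> sf; apply: smooth1B => //; exact: smooth1_shift. Qed.

Lemma kernel_shift f t0 t1 c s : kernel f t0 t1 c ->
  kernel (fun x => f (x - s)) (t0 + s) (t1 + s) c.
Proof.
move=> [sf f0 fo [F [dF F0 F1]]]; split => //; first exact: smooth1_shift.
  by move=> x h; apply: fo; move: h; rewrite lerBrDr lerBlDr.
exists (fun x => F (x - s)); split; first exact: is_derive_shift.
  by move=> x h; apply: F0; rewrite lerBlDr.
by move=> x h; apply: F1; rewrite lerBrDr.
Qed.

(** The new kernel at [x] is the integral of [f] over [[x - s, x]]: convolution with the indicator
    of a step widens the support by [s] and multiplies the mass by [s]. *)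
Lemma kernel_int f t0 t1 c s : 0 < s -> t0 <= t1 -> kernel f t0 t1 c ->
  exists g, kernel g t0 (t1 + s) (s * c) /\ forall x : R, is_derive x 1 g (bdiff s f x).
Proof.
move=> s0 t01 [sf f0 fo [F [dF F0 F1]]].
have Fmono x y : x <= y -> F x <= F y.
  move=> xy; have [z _ h] := MVT_is_derive dF xy.
  by rewrite -subr_ge0 h mulr_ge0// subr_ge0.
have sF : smooth1 F by exact: smooth1_primitive dF.
have [FF [dFF FF0]] := smooth1_antiderivative sF F0.
exists (bdiff s F); split; last exact: is_derive_bdiff.
split.
- exact: smooth1_bdiff.
- by move=> x; rewrite subr_ge0; apply: Fmono; lra.
- move=> x; rewrite negb_and -!ltNge /bdiff => /orP[xt|xt].
    by rewrite !F0 ?subrr//; lra.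
  by rewrite !F1 ?subrr//; lra.
exists (bdiff s FF); split; first exact: is_derive_bdiff.
  by move=> x xt; rewrite /bdiff !FF0 ?subrr//; lra.
move=> x xt; have xs : x - s <= x by lra.
have [z /andP[z1 z2] h] := MVT_is_derive dFF xs.
by rewrite /bdiff h F1; [ring|lra].
Qed.

Definition ess_bounded T (M : R) H : Prop :=
  measurable_fun (`]0, T[ : set (measurableTypeR R)) (H : measurableTypeR R -> R) /\
  {ae mu, forall t, 0 < t < T -> `|H t| <= M}.

Lemma ess_integrable T M H f : 0 < T -> ess_bounded T M H -> continuous f ->
  mu.-integrable `]0, T[ (EFin \o (fun t => H t * f t)).
Proof.
move=> T0 [mH bH] cf.
have /compact_bounded[D [_ hD]] : compact (f @` `[0, T]%classic).
  by apply: continuous_compact; [exact: continuous_subspaceT|exact: segment_compact].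
have fD x : 0 < x < T -> `|f x| <= `|D| + 1.
  move=> /andP[x0 xT]; apply: hD; first by rewrite (le_lt_trans (ler_norm D))// ltrDl.
  by exists x => //=; rewrite in_itv/= (ltW x0) (ltW xT).
have mf : measurable_fun (`]0, T[ : set (measurableTypeR R)) (f : measurableTypeR R -> R).
  by apply: measurable_funTS; exact: continuous_measurable_fun.
have mHf : measurable_fun (`]0, T[ : set (measurableTypeR R))
    (EFin \o (fun t => H t * f t) : measurableTypeR R -> \bar R).
  by apply/measurable_EFinP; exact: measurable_funM.
have mI : measurable (`]0, T[ : set (measurableTypeR R)) by exact: measurable_itv.
apply/integrableP; split => //.
apply: (@le_lt_trans _ _ (\int[mu]_(t in `]0%R, T[) (`|M| * (`|D| + 1))%R%:E)%E).
  apply: ae_ge0_le_integral => //.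
  - exact: measurableT_comp.
  - apply: filterS bH => t h; rewrite /= in_itv/= => tT; rewrite lee_fin normrM ler_pM//.
      exact: le_trans (h tT) (ler_norm M).
    exact: fD.
rewrite integral_cst//= lebesgue_measure_itv/= lte_fin T0 -EFinD -EFinM.
exact: ltry.
Qed.

Lemma kernel_integral T f t0 t1 c : 0 < T -> 0 <= t0 -> t1 <= T -> kernel f t0 t1 c ->
  \int[mu]_(t in `]0, T[) f t = c.
Proof.
move=> T0 t00 t1T [sf f0 fo [F [dF F0 F1]]].
have cf := smooth1_continuous sf.
have i1 : mu.-integrable `]0, T[ (EFin \o f).
  have := @ess_integrable T 1 (cst 1) f T0; rewrite (_ : (fun t => _) = f); last first.
    by apply/funext => t; rewrite /= mul1r.
  by apply => //; split => //; apply: aeW => x _ /=; rewrite normr1.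
have mf A : measurable_fun (A : set (measurableTypeR R)) (EFin \o f : measurableTypeR R -> \bar R).
  by apply: measurable_funTS; apply: measurableT_comp => //; exact: (@continuous_measurable_fun R f).
rewrite Rintegral_itv_obnd_cbnd// /Rintegral integral_itv_bndo_bndc; last exact: mf.
rewrite (@continuous_FTC2 _ _ F)//=.
- by rewrite F1// F0// subr0.
- exact: continuous_subspaceT.
- have cF : continuous F by exact: is_derive1_continuous dF.
  split; first by move=> x _; have [] := dF x.
    by apply: cvg_at_right_filter; exact: cF.
  by apply: cvg_at_left_filter; exact: cF.
- by move=> x _; rewrite derive1E; have [_ ->] := dF x.
Qed.

Lemma ess_bound T M H f t0 t1 c : 0 < T -> 0 <= M -> 0 <= t0 -> t1 <= T ->
  mu.-integrable `]0, T[ (EFin \o (fun t => H t * f t)) ->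
  {ae mu, forall t, 0 < t < T -> t0 <= t <= t1 -> `|H t| <= M} ->
  kernel f t0 t1 c -> `|\int[mu]_(t in `]0, T[) (H t * f t)| <= M * c.
Proof.
move=> T0 M0 t00 t1T iH bH kf; have [sf f0 fo _] := kf.
have cf := smooth1_continuous sf.
have mI : measurable (`]0, T[ : set (measurableTypeR R)) by exact: measurable_itv.
have i1 : mu.-integrable `]0, T[ (EFin \o f).
  have := @ess_integrable T 1 (cst 1) f T0; rewrite (_ : (fun t => _) = f); last first.
    by apply/funext => t; rewrite /= mul1r.
  by apply => //; split => //; apply: aeW => x _ /=; rewrite normr1.
apply: (le_trans (le_normr_Rintegral mI iH)).
rewrite -(kernel_integral T0 t00 t1T kf) -RintegralZl//.
have iM : mu.-integrable `]0, T[ (EFin \o (fun t => M * f t)).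
  by have := integrableZl mI M i1; apply: eq_integrable => // t _ /=; rewrite EFinM.
rewrite /Rintegral fine_le//.
- apply: integrable_fin_num => //; have := integrable_abse iH.
  by apply: eq_integrable.
- exact: integrable_fin_num.
apply: ae_ge0_le_integral => //.
- have := measurable_int _ (integrable_abse iH).
  by apply: eq_measurable_fun.
- by move=> x _; rewrite lee_fin mulr_ge0.
- exact: measurable_int iM.
apply: filterS bH => t h; rewrite /= in_itv/= => tT; rewrite lee_fin normrM (ger0_norm (f0 t)).
by have [/(h tT)|/fo ->] := boolP (t0 <= t <= t1); [exact: ler_wpM2r|rewrite !mulr0].
Qed.

Definition weak_deriv T G H : Prop := forall theta, test_function `]0, T[ theta ->
  \int[mu]_(t in `]0, T[) (G t * derive1 theta t) = - \int[mu]_(t in `]0, T[) (H t * theta t).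

Lemma bdiff_out s t0 t1 m f : 0 < s -> (forall x, ~~ (t0 <= x <= t1) -> f x = 0) ->
  forall x, ~~ (t0 <= x <= t1 + m%:R * s) -> iter m (bdiff s) f x = 0.
Proof.
move=> s0 fo; elim: m => [|m IH] x; first by rewrite mul0r addr0; exact: fo.
rewrite -natr1 => xt; rewrite iterS /bdiff !IH ?subrr//; move: xt; rewrite !negb_and -!ltNge;
  by case/orP => h; apply/orP; [left|right]; lra.
Qed.

(** A backward difference of a kernel is the derivative of a wider kernel, so each difference is
    traded for one weak derivative of [G] and a factor [s] in the mass. *)
Lemma weak_bdiff T (G : nat -> R -> R) m M s : 0 < T -> 0 <= M -> 0 < s ->
  (forall j, (j < m)%N -> weak_deriv T (G j) (G j.+1)) -> ess_bounded T M (G m) ->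
  forall f t0 t1 c, 0 < t0 -> t0 <= t1 -> t1 + m%:R * s < T -> kernel f t0 t1 c ->
  `|\int[mu]_(t in `]0, T[) (G 0%N t * iter m (bdiff s) f t)| <= M * s ^+ m * c.
Proof.
move=> T0 M0 s0; elim: m G => [|m IH] G wG bG f t0 t1 c t00 t01; rewrite ?mul0r ?addr0 => t1T kf.
  rewrite mulr1; apply: (ess_bound T0 M0 (ltW t00) (ltW t1T) _ _ kf).
  - by apply: ess_integrable T0 bG _; apply: smooth1_continuous; have [] := kf.
  - by apply: filterS bG.2 => t h /h.
have [g [kg dg]] := kernel_int s0 t01 kf.
have dgm (x : R) : is_derive x 1 (iter m (bdiff s) g) (iter m (bdiff s) (bdiff s f) x).
  elim: m x {IH wG bG t1T} => [|m IH] x /=; first exact: dg.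
  exact: is_derive_bdiff.
have sg : smooth1 (iter m (bdiff s) g).
  have [sg _ _ _] := kg.
  by elim: (m) => //= k; exact: smooth1_bdiff.
have t1T' : t1 + s + m%:R * s < T by move: t1T; rewrite -natr1; lra.
have := wG 0%N (ltn0Sn m) (iter m (bdiff s) g).
rewrite (is_derive_derive1 dgm) -iterSr => ->; last first.
  apply: (test_function_itv sg t00 t1T').
  by have [_ _ go _] := kg; exact: bdiff_out.
rewrite normrN exprSr -!mulrA mulrA.
apply: (IH (fun j => G j.+1) _ bG g t0 (t1 + s)) => //; last by lra.
by move=> j jm; exact: wG.
Qed.

Definition fdiff s g t : R := g (t + s) - g t.

Lemma iter_bdiff_shift s m f x : iter m (bdiff s) f (x - s) =
  iter m (bdiff s) (fun y => f (y - s)) x.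
Proof. by elim: m x => //= m IH x; rewrite /bdiff !IH. Qed.

(** Against a narrow kernel the integral is nearly a point evaluation, and each backward difference
    on the kernel becomes, up to sign, a forward difference of the values of [g0]. *)
Lemma eval_bdiff T (M : R) G g0 s m (eta : R) : 0 < T -> 0 < s -> 0 <= eta -> ess_bounded T M G ->
  {ae mu, forall t, 0 < t < T -> g0 t = G t} ->
  forall f t0 t1 c, 0 < t0 -> t0 <= t1 -> t1 + m%:R * s < T -> kernel f t0 t1 c ->
  (forall j x, (j <= m)%N -> t0 + j%:R * s <= x <= t1 + j%:R * s ->
     `|g0 x - g0 (t0 + j%:R * s)| <= eta) ->
  `|\int[mu]_(t in `]0, T[) (G t * iter m (bdiff s) f t) - (-1) ^+ m * c * iter m (fdiff s) g0 t0|
    <= 2 ^+ m * eta * c.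
Proof.
move=> T0 s0 eta0 bG gG; elim: m => [|m IH] f t0 t1 c t00 t01; rewrite ?mul0r ?addr0 => t1T kf hj /=.
  have cf : continuous f by apply: smooth1_continuous; have [] := kf.
  have iG := ess_integrable T0 bG cf.
  have mc : measurable_fun (`]0, T[ : set (measurableTypeR R)) (cst (g0 t0) : measurableTypeR R -> R) by [].
  have ic : mu.-integrable `]0, T[ (EFin \o (fun t => g0 t0 * f t)).
    by apply: (@ess_integrable T `|g0 t0| (cst (g0 t0)) _ T0) => //; split => //; exact: aeW.
  rewrite !mul1r mulrC -[in X in _ - X](kernel_integral T0 (ltW t00) (ltW t1T) kf).
  rewrite -RintegralZl//; last first.
    have := @ess_integrable T 1 (cst 1) f T0; under [X in _ -> _ -> integrable _ _ X]eq_fun do rewrite /= mul1r.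
    by apply => //; split => //; apply: aeW => x _ /=; rewrite normr1.
  rewrite -RintegralB//.
  under eq_Rintegral do rewrite -mulrBl.
  apply: (@ess_bound T eta (fun t => G t - g0 t0) f t0 t1 c) => //; [exact: ltW|exact: ltW| | ].
  - have := integrableB _ iG ic; rewrite (_ : (_ \- _)%E = EFin \o (fun t => (G t - g0 t0) * f t)); first by apply.
    by apply/funext => t /=; rewrite -EFinB mulrBl.
  - apply: filterS gG => t h tT tt; rewrite -h//.
    by have := hj 0%N t isT; rewrite mul0r !addr0; apply.
have cf n h : smooth1 h -> continuous (iter n (bdiff s) h).
  by move=> sh; apply: smooth1_continuous; elim: n => //= n; exact: smooth1_bdiff.
have [sf _ _ _] := kf; have kf' := kernel_shift s kf; have [sf' _ _ _] := kf'.
have E : \int[mu]_(t in `]0, T[) (G t * bdiff s (iter m (bdiff s) f) t) =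
    \int[mu]_(t in `]0, T[) (G t * iter m (bdiff s) f t) -
    \int[mu]_(t in `]0, T[) (G t * iter m (bdiff s) (fun y => f (y - s)) t).
  rewrite -RintegralB//; [|exact: ess_integrable T0 bG (cf _ _ sf)|exact: ess_integrable T0 bG (cf _ _ sf')].
  by apply: eq_Rintegral => t _; rewrite /bdiff iter_bdiff_shift mulrBr.
have t1T' : t1 + s + m%:R * s < T by move: t1T; rewrite -natr1; lra.
have := IH _ (t0 + s) (t1 + s) c _ _ t1T' kf'.
have := IH _ t0 t1 c t00 t01 _ kf.
set I1 := Rintegral _ _ _; set I2 := Rintegral _ _ _.
rewrite {}E -/I1 -/I2 => h1 h2.
have {}h1 : `|I1 - (-1) ^+ m * c * iter m (fdiff s) g0 t0| <= 2 ^+ m * eta * c.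
  by apply: h1 => [|j x jm]; [lra|apply: hj; exact: leqW].
have {}h2 : `|I2 - (-1) ^+ m * c * iter m (fdiff s) g0 (t0 + s)| <= 2 ^+ m * eta * c.
  apply: h2 => [||j x jm xt]; [lra|lra|].
  have := hj j.+1 x; rewrite -natr1 mulrDl mul1r [j%:R * s + s]addrC !addrA; exact.
rewrite /fdiff exprS [in leRHS]exprS; move: h1 h2; rewrite !ler_norml => /andP[h1 h2] /andP[h3 h4].
by apply/andP; split; nra.
Qed.

(** The same integral is read in two ways: through the last weak derivative by [weak_bdiff], and as
    a difference of point values by [eval_bdiff]. The mass [c] of the kernel cancels, and the
    narrowness of the kernel makes the error arbitrarily small. *)
Lemma weak_difference_interior T (G : nat -> R -> R) g0 m (M0 M : R) : 0 < T -> 0 <= M ->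
  (forall t, 0 <= t <= T -> forall e, 0 < e -> exists2 r, 0 < r &
     forall x, 0 <= x <= T -> `|x - t| <= r -> `|g0 x - g0 t| <= e) ->
  {ae mu, forall t, 0 < t < T -> g0 t = G 0%N t} ->
  (forall j, (j < m)%N -> weak_deriv T (G j) (G j.+1)) ->
  ess_bounded T M0 (G 0%N) -> ess_bounded T M (G m) ->
  forall t s, 0 < s -> 0 < t -> t + m%:R * s < T ->
  `|iter m (fdiff s) g0 t| <= M * s ^+ m.
Proof.
move=> T0 M_ge0 cg gG wG b0 bm t s s0 t0 tT; apply/ler_addgt0Pr => e e0.
(* Chosen so that the error [2 ^+ m * eta * c] of [eval_bdiff] is [e * c]. *)
pose eta := e / 2 ^+ m; have eta0 : 0 < eta by rewrite divr_gt0// exprn_gt0.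
have ms0 : 0 <= m%:R * s by rewrite mulr_ge0// ltW.
have [r r0 hr] : exists2 r, 0 < r & forall j x, (j <= m)%N -> t + j%:R * s <= x <= T ->
    x <= t + j%:R * s + r -> `|g0 x - g0 (t + j%:R * s)| <= eta.
  have js j : (j <= m)%N -> j%:R * s <= m%:R * s by move=> jm; rewrite ler_wpM2r ?ler_nat// ltW.
  have js0 j : 0 <= j%:R * s by rewrite mulr_ge0// ltW.
  elim: {1 3}m (leqnn m) => [_|k IH km].
    have [r r0 hr] := cg t ltac:(apply/andP; split; lra) _ eta0; exists r => // j x.
    rewrite leqn0 => /eqP ->; rewrite mul0r addr0 => /andP[h1 h2] h3; apply: hr; first by apply/andP; split; lra.
    by rewrite ger0_norm; lra.
  have [r r0 hr] := IH (ltnW km).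
  have jk := js _ km; have jk0 := js0 k.+1.
  have [r' r'0 hr'] := cg (t + k.+1%:R * s) ltac:(apply/andP; split; lra) _ eta0.
  exists (Num.min r r'); first by rewrite lt_min r0.
  move=> j x; rewrite leq_eqVlt ltnS => /predU1P[->|jk'] /andP[h1 h2] h3.
    have m1 : Num.min r r' <= r' by rewrite ge_min lexx orbT.
    by apply: hr'; [apply/andP; split; lra|rewrite ger0_norm; lra].
  have m1 : Num.min r r' <= r by rewrite ge_min lexx.
  by apply: hr => //; [apply/andP; split|lra].
pose t1 := t + Num.min r ((T - (t + m%:R * s)) / 2).
have m1 : Num.min r ((T - (t + m%:R * s)) / 2) <= r by rewrite ge_min lexx.
have m2 : Num.min r ((T - (t + m%:R * s)) / 2) <= (T - (t + m%:R * s)) / 2 by rewrite ge_min lexx orbT.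
have m3 : 0 < Num.min r ((T - (t + m%:R * s)) / 2) by rewrite lt_min r0 /=; lra.
have tt1 : t < t1 by rewrite /t1; lra.
have t1T : t1 + m%:R * s < T by rewrite /t1; lra.
have [f [c [c0 kf]]] := kernel_ex tt1.
have h1 := weak_bdiff T0 M_ge0 s0 wG bm t0 (ltW tt1) t1T kf.
have h2 := eval_bdiff T0 s0 (ltW eta0) b0 gG t0 (ltW tt1) t1T kf.
have {}h2 : `|\int[mu]_(t in `]0, T[) (G 0%N t * iter m (bdiff s) f t) - (-1) ^+ m * c * iter m (fdiff s) g0 t|
    <= 2 ^+ m * eta * c.
  apply: h2 => j x jm /andP[h3 h4]; apply: hr => //; last by rewrite /t1 in h4; lra.
  have : j%:R * s <= m%:R * s by rewrite ler_wpM2r ?ler_nat// ltW.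
  by move=> jm'; apply/andP; split => //; lra.
have {}eta0 : 2 ^+ m * eta = e by rewrite /eta mulrC divfK// expf_neq0.
rewrite eta0 in h2.
have : c * `|iter m (fdiff s) g0 t| <= c * (M * s ^+ m + e).
  have -> : c * `|iter m (fdiff s) g0 t| = `|(-1) ^+ m * c * iter m (fdiff s) g0 t|.
    by rewrite !normrM normr_sign mul1r (gtr0_norm c0).
  set I := Rintegral _ _ _ in h1 h2.
  have := ler_normB I (I - (-1) ^+ m * c * iter m (fdiff s) g0 t).
  rewrite opprB addrC subrK => h3; apply: (le_trans h3); lra.
by rewrite ler_pM2l.
Qed.

(** Kernels need room inside the open interval. The end points are reached by contracting all the
    nodes towards [T / 2] and using the continuity of [g0]. *)
Lemma weak_difference_bound T (G : nat -> R -> R) g0 m (M0 M : R) : 0 < T -> 0 <= M ->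
  (forall t, 0 <= t <= T -> forall e, 0 < e -> exists2 r, 0 < r &
     forall x, 0 <= x <= T -> `|x - t| <= r -> `|g0 x - g0 t| <= e) ->
  {ae mu, forall t, 0 < t < T -> g0 t = G 0%N t} ->
  (forall j, (j < m)%N -> weak_deriv T (G j) (G j.+1)) ->
  ess_bounded T M0 (G 0%N) -> ess_bounded T M (G m) ->
  forall t s, 0 < s -> 0 <= t -> t + m%:R * s <= T ->
  `|iter m (fdiff s) g0 t| <= M * s ^+ m.
Proof.
move=> T0 M_ge0 cg gG wG b0 bm t s s0 t0 tT; apply/ler_addgt0Pr => e e0.
pose phi r x := (1 - r) * x + r * (T / 2).
have lim k x : 0 <= x -> x + k%:R * s <= T -> forall e, 0 < e -> exists2 r0, 0 < r0 &
    forall r, 0 < r < r0 ->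
    `|iter k (fdiff s) g0 x| <= `|iter k (fdiff ((1 - r) * s)) g0 (phi r x)| + e /\
    `|iter k (fdiff ((1 - r) * s)) g0 (phi r x) - iter k (fdiff s) g0 x| <= e.
  move=> x0 xT {}e {}e0.
  suff [r0 r00 hr] : exists2 r0, 0 < r0 & forall r, 0 < r < r0 ->
      `|iter k (fdiff ((1 - r) * s)) g0 (phi r x) - iter k (fdiff s) g0 x| <= e.
    exists r0 => // r /hr h; split => //; rewrite -lerBlDl; apply: le_trans h.
    by rewrite distrC; apply: lerB_dist.
  elim: k x x0 xT e e0 => [|k IH] x x0 xT {}e e0.
    have xT' : 0 <= x <= T by apply/andP; split; lra.
    have [d dp hd] := cg x xT' _ e0.
    exists (Num.min 1 (d / T)) => [|r]; first by rewrite lt_min ltr01 divr_gt0.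
    rewrite lt_min => /andP[r0 /andP[r1]]; rewrite ltr_pdivlMr// => rd.
    have E : phi r x - x = r * (T / 2 - x) by rewrite /phi; field.
    apply: hd; first by apply/andP; rewrite /phi; split; nra.
    rewrite E normrM gtr0_norm//; have : `|T / 2 - x| <= T by rewrite ler_norml; apply/andP; split; lra.
    by move=> h; apply: le_trans (ltW rd); rewrite ler_wpM2l// ltW.
  have e20 : 0 < e / 2 by lra.
  have ks0 : 0 <= k%:R * s by rewrite mulr_ge0// ltW.
  have [r1 r10 h1] := IH x x0 ltac:(by move: xT; rewrite -natr1; lra) _ e20.
  have [r2 r20 h2] := IH (x + s) ltac:(lra) ltac:(by move: xT; rewrite -natr1; lra) _ e20.
  exists (Num.min r1 r2) => [|r]; first by rewrite lt_min r10.
  rewrite lt_min => /andP[r0 /andP[rr1 rr2]].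
  have {}h1 := h1 r; have {}h2 := h2 r; rewrite r0/= in h1 h2.
  have {}h1 := h1 rr1; have {}h2 := h2 rr2.
  have E : phi r x + (1 - r) * s = phi r (x + s) by rewrite /phi; ring.
  rewrite /= {1 3}/fdiff E; move: h1 h2; rewrite !ler_norml => /andP[? ?] /andP[? ?].
  by apply/andP; split; lra.
have [r0 r00 hr] := lim m t t0 tT e e0.
pose r := Num.min (r0 / 2) (1 / 2).
have rr0 : r < r0 by rewrite /r gt_min; apply/orP; left; lra.
have r1 : r <= 1 / 2 by rewrite /r ge_min lexx orbT.
have rp : 0 < r by rewrite /r lt_min; apply/andP; split; lra.
have [h _] := hr r ltac:(by rewrite rp).
apply: (le_trans h); rewrite lerD2r.
have ms0 : 0 <= m%:R * s by rewrite mulr_ge0// ltW.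
have s'0 : 0 < (1 - r) * s by rewrite mulr_gt0//; lra.
apply: (@le_trans _ _ (M * ((1 - r) * s) ^+ m)).
  apply: (weak_difference_interior T0 M_ge0 cg gG wG b0 bm s'0).
    by rewrite /phi; nra.
  by rewrite mulrCA /phi; nra.
rewrite ler_wpM2l// lerXn2r ?nnegrE ?ltW//; nra.
Qed.

End weak_time.

(** * Difference formulas for scalar functions of time *)

Section numeric.
Context (R : realType).
Implicit Types (g : R -> R) (T K h t tau : R).

Definition diff_bound T (m : nat) K g : Prop :=
  forall t s, 0 < s -> 0 <= t -> t + m%:R * s <= T -> `|iter m (fdiff s) g t| <= K * s ^+ m.

Lemma diff_bound1 T K g x y : diff_bound T 1 K g -> 0 <= x -> x < y -> y <= T ->
  `|g y - g x| <= K * (y - x).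
Proof.
move=> h x0 xy yT; have := h x (y - x); rewrite subr_gt0 /= /fdiff mul1r expr1.
by rewrite [x + (y - x)]addrC subrK; apply.
Qed.

Lemma diff_bound2 T K g x h : diff_bound T 2 K g -> 0 <= x -> 0 < h -> x + 2 * h <= T ->
  `|g (x + 2 * h) - 2 * g (x + h) + g x| <= K * h ^+ 2.
Proof.
move=> H x0 h0 xT; have := H x h h0 x0 xT; rewrite /= /fdiff.
have -> : x + h + h = x + 2 * h by ring.
by congr (`|_| <= _); ring.
Qed.

Lemma diff_bound3 T K g x h : diff_bound T 3 K g -> 0 <= x -> 0 < h -> x + 3 * h <= T ->
  `|g (x + 3 * h) - 3 * g (x + 2 * h) + 3 * g (x + h) - g x| <= K * h ^+ 3.
Proof.
move=> H x0 h0 xT; have := H x h h0 x0 xT; rewrite /= /fdiff.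
have -> : x + h + h + h = x + 3 * h by ring.
have -> : x + h + h = x + 2 * h by ring.
by congr (`|_| <= _); ring.
Qed.

Definition deriv_within T m (l : R) g : Prop := forall e : R, 0 < e -> exists2 r : R, 0 < r &
  forall x, 0 <= x <= T -> x != m -> `|x - m| <= r -> `|(g x - g m) / (x - m) - l| <= e.

(* One-sided second-order formula; halving the step changes it by third differences. *)
Lemma one_sided_derivative T K g m l h : 0 <= K -> diff_bound T 3 K g ->
  deriv_within T m l g -> m <= T -> 0 < h -> 0 <= m - 2 * h ->
  `|3 * g m - 4 * g (m - h) + g (m - 2 * h) - 2 * h * l| <= 2 * K * h ^+ 3.
Proof.
move=> K0 H3 Hd mT h0 mh.
pose L h := (3 * g m - 4 * g (m - h) + g (m - 2 * h)) / (2 * h).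
(* The change of [L] under halving is a combination, with weights 3 and 1, of two third differences
   of step [x / 2]. *)
have halving x : 0 < x -> 0 <= m - 2 * x -> `|L x - L (x / 2)| <= K * x ^+ 2 / 4.
  move=> x0 mx; pose y := x / 2; have y0 : 0 < y by rewrite /y; lra.
  have xy : x = 2 * y by rewrite /y; field.
  have := diff_bound3 H3 mx y0 ltac:(rewrite /y; lra).
  have := diff_bound3 H3 (x := m - 2 * x + y) ltac:(rewrite /y; lra) y0 ltac:(rewrite /y; lra).
  have e1 : m - 2 * x + 3 * y = m - y by rewrite xy; ring.
  have e2 : m - 2 * x + 2 * y = m - x by rewrite xy; ring.
  have e3 : m - 2 * x + y + 3 * y = m by rewrite xy; ring.
  have e4 : m - 2 * x + y + 2 * y = m - y by rewrite xy; ring.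
  have e5 : m - 2 * x + y + y = m - x by rewrite xy; ring.
  rewrite e1 e2 e3 e4 e5 => h1 h2.
  have -> : L x - L (x / 2) = - ((3 * (g m - 3 * g (m - y) + 3 * g (m - x) - g (m - 2 * x + y)) +
      (g (m - y) - 3 * g (m - x) + 3 * g (m - 2 * x + y) - g (m - 2 * x))) / (4 * y)).
    rewrite /L -/y; have -> : m - 2 * y = m - x by rewrite xy.
    by rewrite xy; field; rewrite gt_eqF.
  rewrite normrN normrM normfV (@gtr0_norm _ (4 * y)) ?mulr_gt0// ler_pdivrMr ?mulr_gt0//.
  have -> : K * x ^+ 2 / 4 * (4 * y) = 3 * (K * y ^+ 3) + K * y ^+ 3 by rewrite xy; field.
  by move: h1 h2; rewrite !ler_norml => /andP[? ?] /andP[? ?]; apply/andP; split; lra.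
(* A geometric series of ratio 1/4, whence the factor 1/3. *)
have telescope n x : 0 < x -> 0 <= m - 2 * x -> `|L x - L (x / 2 ^+ n)| <= K * x ^+ 2 / 3.
  elim: n x => [|n IH] x x0 mx.
    by rewrite expr0 divr1 subrr normr0 divr_ge0// mulr_ge0// sqr_ge0.
  have := IH (x / 2) ltac:(lra) ltac:(lra); have := halving x x0 mx.
  have -> : x / 2 / 2 ^+ n = x / 2 ^+ n.+1 by rewrite exprS invfM mulrA.
  have -> : K * (x / 2) ^+ 2 / 3 = K * x ^+ 2 / 12 by field.
  by rewrite !ler_norml => /andP[? ?] /andP[? ?]; apply/andP; split; lra.
(* [L x] is twice the difference quotient of step [x] minus the one of step [2 * x]. *)
have lim e : 0 < e -> exists2 r, 0 < r & forall x, 0 < x -> 2 * x <= r -> 0 <= m - 2 * x ->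
    `|L x - l| <= 3 * e.
  move=> /Hd[r r0 hr]; exists r => // x x0 xr mx.
  have q1 := hr (m - x) ltac:(apply/andP; split; lra) ltac:(rewrite lt_eqF//; lra)
    ltac:(rewrite addrAC subrr add0r normrN gtr0_norm; lra).
  have q2 := hr (m - 2 * x) ltac:(apply/andP; split; lra) ltac:(rewrite lt_eqF//; lra)
    ltac:(rewrite addrAC subrr add0r normrN gtr0_norm; lra).
  have -> : L x - l = 2 * ((g (m - x) - g m) / (m - x - m) - l) -
      ((g (m - 2 * x) - g m) / (m - 2 * x - m) - l).
    rewrite /L; have -> : m - x - m = - x by ring.
    have -> : m - 2 * x - m = - (2 * x) by ring.
    by field; rewrite gt_eqF.
  by move: q1 q2; rewrite !ler_norml => /andP[? ?] /andP[? ?]; apply/andP; split; lra.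
have main : `|L h - l| <= K * h ^+ 2 / 3.
  apply/ler_addgt0Pr => e e0.
  have [r r0 hr] := lim (e / 3) ltac:(lra).
  have [n hn] : exists n, 2 * (h / 2 ^+ n) <= r.
    pose n := Num.truncn (2 * h / r); exists n.
    rewrite mulrA ler_pdivrMr ?exprn_gt0// [r * _]mulrC -ler_pdivrMr//.
    have /andP[_ /ltW h1] := truncn_itv (divr_ge0 (mulr_ge0 (ler0n R 2) (ltW h0)) (ltW r0)).
    by apply: (le_trans h1); rewrite -natrX ler_nat ltn_expl.
  have p2 : 0 < 2 ^+ n :> R by rewrite exprn_gt0.
  have hn0 : 0 < h / 2 ^+ n by rewrite divr_gt0.
  have hnh : h / 2 ^+ n <= h.
    by rewrite ler_pdivrMr// ler_peMr ?(ltW h0)// -natrX ler1n expn_gt0.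
  have := hr _ hn0 hn ltac:(lra); have := telescope n h h0 mh.
  by rewrite !ler_norml => /andP[? ?] /andP[? ?]; apply/andP; split; lra.
have -> : 3 * g m - 4 * g (m - h) + g (m - 2 * h) - 2 * h * l = (L h - l) * (2 * h).
  by rewrite /L; field; rewrite gt_eqF.
rewrite normrM (@gtr0_norm _ (2 * h)) ?mulr_gt0//.
apply: (@le_trans _ _ (K * h ^+ 2 / 3 * (2 * h))); first by rewrite ler_wpM2r// mulr_ge0// ltW.
have -> : K * h ^+ 2 / 3 * (2 * h) = 2 * K * h ^+ 3 / 3 by field.
by rewrite ler_pdivrMr// ler_peMr ?mulr_ge0 ?exprn_ge0 ?(ltW h0)//; lra.
Qed.

(* The last time step may leave [[0, T]]; there the value is extrapolated. *)
Definition extrap T tau t g : R := if t + tau <= T then g (t + tau)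
  else 3 * g t - 8 * g (t + tau / 4) + 6 * g (t + tau / 2).

(** The weights 3, -8, 6 of [extrap] are those of quadratic extrapolation from the nodes 0, 1, 2 to
    the node 4, in units of [h = tau / 4]. The extrapolated increment is exactly twice the one-sided
    formula at the midpoint; the true value at [t + tau] differs from it by two third differences,
    with weights 1 and 3. *)
Lemma extrap_derivative T K g t tau l : 0 <= K -> diff_bound T 3 K g -> 0 < tau -> 0 <= t ->
  t + tau / 2 <= T -> deriv_within T (t + tau / 2) l g ->
  `|extrap T tau t g - g t - tau * l| <= K * tau ^+ 3.
Proof.
move=> K0 H3 tau0 t0 tT Hd; pose h := tau / 4; have h0 : 0 < h by rewrite /h; lra.
have tauE : tau = 4 * h by rewrite /h; field.
have := one_sided_derivative K0 H3 Hd tT h0 ltac:(rewrite /h; lra).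
have e1 : t + tau / 2 = t + 2 * h by rewrite /h; field.
have -> : t + tau / 2 - h = t + h by rewrite /h; field.
have -> : t + tau / 2 - 2 * h = t by rewrite /h; field.
rewrite /extrap -/h e1 => h1.
have h30 : 0 <= K * h ^+ 3 by rewrite mulr_ge0// exprn_ge0// ltW.
have -> : K * tau ^+ 3 = 64 * (K * h ^+ 3) by rewrite tauE; ring.
move: h1; rewrite ler_norml => /andP[h1 h1'].
case: ifP => tT'; last by rewrite tauE ler_norml; apply/andP; split; lra.
have := diff_bound3 H3 t0 h0 ltac:(rewrite /h; lra).
have := diff_bound3 H3 (x := t + h) ltac:(lra) h0 ltac:(rewrite /h; lra).
have -> : t + h + 3 * h = t + tau by rewrite tauE; ring.
have -> : t + h + 2 * h = t + 3 * h by ring.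
have -> : t + h + h = t + 2 * h by ring.
rewrite !ler_norml tauE => /andP[? ?] /andP[? ?]; apply/andP; split; lra.
Qed.

Lemma extrap_mean T K g t tau : 0 <= K -> diff_bound T 2 K g -> 0 < tau -> 0 <= t ->
  t + tau / 2 <= T -> `|(extrap T tau t g + g t) / 2 - g (t + tau / 2)| <= K * tau ^+ 2.
Proof.
move=> K0 H2 tau0 t0 tT; have Kt : 0 <= K * tau ^+ 2 by rewrite mulr_ge0// sqr_ge0.
rewrite /extrap; case: ifP => tT'.
  have := diff_bound2 H2 t0 (h := tau / 2) ltac:(lra) ltac:(lra).
  have -> : t + 2 * (tau / 2) = t + tau by field.
  have -> : K * (tau / 2) ^+ 2 = K * tau ^+ 2 / 4 by field.
  by rewrite !ler_norml => /andP[? ?]; apply/andP; split; lra.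
have := diff_bound2 H2 t0 (h := tau / 4) ltac:(lra) ltac:(lra).
have -> : t + 2 * (tau / 4) = t + tau / 2 by field.
have -> : K * (tau / 4) ^+ 2 = K * tau ^+ 2 / 16 by field.
by rewrite !ler_norml => /andP[? ?]; apply/andP; split; lra.
Qed.

Lemma extrap_increment T K g t tau : 0 <= K -> diff_bound T 1 K g -> 0 < tau -> 0 <= t ->
  t + tau / 2 <= T -> `|extrap T tau t g - g t| <= 2 * K * tau.
Proof.
move=> K0 H1 tau0 t0 tT; have Kt : 0 <= K * tau by rewrite mulr_ge0// ltW.
rewrite /extrap; case: ifP => tT'.
  have := diff_bound1 H1 t0 (y := t + tau) ltac:(lra) tT'.
  have -> : t + tau - t = tau by ring.
  by rewrite !ler_norml => /andP[? ?]; apply/andP; split; lra.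
have := diff_bound1 H1 t0 (y := t + tau / 4) ltac:(lra) ltac:(lra).
have := diff_bound1 H1 (x := t + tau / 4) (y := t + tau / 2) ltac:(lra) ltac:(lra) tT.
have -> : K * (t + tau / 4 - t) = K * tau / 4 by field.
have -> : K * (t + tau / 2 - (t + tau / 4)) = K * tau / 4 by field.
by rewrite !ler_norml => /andP[? ?] /andP[? ?]; apply/andP; split; lra.
Qed.

End numeric.

(** * Curves with values in a space of fields, tested by duality *)

Section curves.
Context (R : realType) (d : nat).
Local Notation field := (scalar_field R d).
Local Notation mu := (@lebesgue_measure R).
Context (X : field -> Prop) (N : field -> R).
Context (XL2 : forall v, X v -> L2 v).
Implicit Types (g : R -> field) (w v : field) (T : R).

(** The functions whose norm strong measurability sends to 0. They need not lie in [X], which is not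
    assumed to be a vector space. *)
Definition simple_difference v : Prop := exists n (c : 'I_n -> R) (e : 'I_n -> field) (g' : field),
  (forall j, X (e j)) /\ X g' /\ v = (fun x => \sum_j c j * e j x - g' x).

Lemma simple_difference_L2 v : simple_difference v -> L2 v.
Proof.
move=> [n [c [e [g' [Xe [Xg ->]]]]]]; apply: L2_B; last exact: XL2.
by apply: L2_sum => j; apply: L2_Z; exact: XL2.
Qed.

Lemma measurable_curve T g w K' : strongly_measurable X N T g -> L2 w ->
  (forall v, simple_difference v -> `|ip v w| <= K' * N v) ->
  measurable_fun (`]0, T[ : set (measurableTypeR R)) (fun t : measurableTypeR R => ip (g t) w).
Proof.
move=> [Xg [S [sS Sg]]] lw wK.
apply/measurable_EFinP.
apply: (emeasurable_fun_cvg (fun n t => (ip (S n t) w)%:E)) => [n|t].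
  apply/measurable_EFinP; have [k [E [e [Ee SE]]]] := sS n.
  have -> : (fun t => ip (S n t) w) = (fun t => \sum_j \1_(E j) t * ip (e j) w).
    apply/funext => t; have -> : S n t = (fun x => \sum_j \1_(E j) t * e j x) by apply/funext.
    rewrite ip_suml//; last by move=> j; apply: L2_Z; exact: XL2 (Ee j).2.
    by apply: eq_bigr => j _; rewrite ip_Zl//; exact: XL2 (Ee j).2.
  apply: measurable_sum => j; apply: measurable_funM => //.
  by apply: measurable_funTS; apply: measurable_indic; exact: (Ee j).1.
rewrite /= in_itv/= => tT; apply: cvg_EFin; first exact: nearW.
have NS := Sg t tT; apply/cvgrPdist_le => /= e e0.
have K1 : 0 < `|K'| + 1 by rewrite ltr_wpDl.
move/cvgrPdist_le: NS => /(_ (e / (`|K'| + 1))); rewrite divr_gt0// => /(_ isT).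
apply: filterS => n; rewrite sub0r normrN => hn.
have [k [E [e' [Ee SE]]]] := sS n.
have sd : simple_difference (fun x => S n t x - g t x).
  exists k, (fun j => \1_(E j) t), e', (g t); split; first by move=> j; exact: (Ee j).2.
  by split; [exact: Xg|apply/funext => x; rewrite SE].
have lS : L2 (S n t).
  have -> : S n t = (fun x => \sum_j \1_(E j) t * e' j x) by apply/funext.
  by apply: L2_sum => j; apply: L2_Z; exact: XL2 (Ee j).2.
rewrite distrC -ip_Bl//; last exact: XL2 (Xg _ tT).
apply: (le_trans (wK _ sd)); apply: (le_trans (ler_norm _)); rewrite normrM.
rewrite -[e](@divfK _ (`|K'| + 1)) ?gt_eqF// mulrC ler_pM//.
by rewrite lerDl.
Qed.

(** [M] depends on the curve alone and [w] enters only through [K]; duality rests on this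
    uniformity. The bound by [K'] serves the measurability of the tested curve. *)
Lemma curve_difference T g m k : 0 < T -> Winfty X N m T g -> (k <= m)%N ->
  exists2 M, 0 <= M & forall w K, L2 w -> 0 <= K -> (forall v, X v -> `|ip v w| <= K * N v) ->
    (exists K', forall v, simple_difference v -> `|ip v w| <= K' * N v) ->
    diff_bound T k (K * M) (fun t => ip (g t) w).
Proof.
move=> T0 [cg [D [gD LD wD]]] km.
have [_ [M0 bM0]] := LD 0%N (leq0n m); have [_ [M bM]] := LD k km.
exists `|M| => // w K lw K0 wK [K' wK'] t s s0 t0 tT.
have eb j Mj : (j <= m)%N -> {ae mu, forall t, 0 < t < T -> N (D j t) <= Mj} ->
    ess_bounded T (K * `|Mj|) (fun t => ip (D j t) w).
  move=> jm bj; have [sm _] := LD j jm; split; first exact: measurable_curve wK'.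
  apply: filterS bj => x h xT; apply: (le_trans (wK _ (sm.1 _ xT))).
  by rewrite ler_wpM2l// (le_trans (h xT))// ler_norm.
apply: (@weak_difference_bound R T (fun j t => ip (D j t) w) (fun t => ip (g t) w) k _ _ T0 _ _ _ _
  (eb _ _ (leq0n m) bM0) (eb _ _ km bM)) => //.
- by rewrite mulr_ge0.
- move=> x xT e e0; have [lx] := cg x xT.
  have W1 : 0 < normL2 w + 1 by rewrite ltr_wpDl// normL2_ge0.
  move=> /cvgrPdist_le /(_ (e / (normL2 w + 1))); rewrite divr_gt0// => /(_ isT).
  move=> /nbhs_normP[/= r r0 hr]; exists (r / 2) => [|y yT yx]; first by rewrite divr_gt0.
  have := hr y; rewrite /= in_itv/= yT distrC => /(_ ltac:(lra) isT).
  rewrite sub0r normrN (ger0_norm (normL2_ge0 _)) => h.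
  have [ly _] := cg y yT; rewrite -ip_Bl//; apply: (le_trans (ip_CS (L2_B ly lx) lw)).
  rewrite -[e](@divfK _ (normL2 w + 1)) ?gt_eqF// ler_pM ?normL2_ge0//.
  by rewrite lerDl.
- apply: filterS gD => x h xT; apply: ip_ae => //; last exact: h.
    by apply: (cg x _).1; have /andP[/ltW -> /ltW ->] := xT.
  by have [[Xd _] _] := LD 0%N (leq0n m); apply: XL2; exact: Xd.
- by move=> j jk th tth; apply: wD => //; exact: leq_trans jk km.
Qed.

(** The test field [w] is chosen with coefficients [b l * (b l * coef A E l)], so that [ip E w] is
    the sum [S] to be bounded while [w] acts on [X] with constant [Num.sqrt S]. One factor
    [Num.sqrt S] cancels. Scalar error formulas, applied to one [w] at a time, thus bound the whole
    series of coefficients. *)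
Lemma dual_bound T g m k A (b : nat -> R) : 0 < T -> Winfty X N m T g -> (k <= m)%N ->
  (forall v n, X v -> \sum_(0 <= l < n) (b l * coef A v l) ^+ 2 <= N v ^+ 2) -> (forall v, 0 <= N v) ->
  (forall a n, exists K', forall v, simple_difference v -> `|ip v (part A a n)| <= K' * N v) ->
  exists2 M, 0 <= M & forall E B, L2 E -> 0 <= B ->
    (forall w K, L2 w -> 0 <= K -> diff_bound T k K (fun t => ip (g t) w) -> `|ip E w| <= K * B) ->
    forall n, \sum_(0 <= l < n) (b l * coef A E l) ^+ 2 <= (M * B) ^+ 2.
Proof.
move=> T0 Wg km bN N0 sd; have [M M0 hM] := curve_difference T0 Wg km.
exists M => // E B lE B0 HE n.
pose S := \sum_(0 <= l < n) (b l * coef A E l) ^+ 2; rewrite -/S.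
have S0 : 0 <= S by apply: sumr_ge0 => l _; exact: sqr_ge0.
pose a l := b l * (b l * coef A E l); pose w := part A a n.
have lw : L2 w by exact: L2_part.
have ipE : ip E w = S by rewrite ip_part//; apply: eq_bigr => l _; rewrite /a; ring.
have wK v : X v -> `|ip v w| <= Num.sqrt S * N v.
  move=> Xv; rewrite -ler_sqr ?nnegrE ?mulr_ge0 ?sqrtr_ge0// exprMn sqr_sqrtr// real_normK ?num_real//.
  rewrite ip_part; last exact: XL2.
  have -> : \sum_(0 <= l < n) a l * coef A v l =
      \sum_(0 <= l < n) (b l * coef A E l) * (b l * coef A v l).
    by apply: eq_bigr => l _; rewrite /a; ring.
  apply: (@le_trans _ _ (S * \sum_(0 <= l < n) (b l * coef A v l) ^+ 2)); last first.
    by rewrite ler_wpM2l// bN.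
  by rewrite /S !big_mkord; exact: (@dot_CS2 R 'I_n (fun l => b l * coef A E l) (fun l => b l * coef A v l)).
have := HE w (Num.sqrt S * M) lw (mulr_ge0 (sqrtr_ge0 _) M0)
  (hM w _ lw (sqrtr_ge0 _) wK (sd a n)).
rewrite ipE (ger0_norm S0) => h.
have [S00|Sp] := leP S 0; first by apply: (le_trans S00); exact: sqr_ge0.
have sp : 0 < Num.sqrt S by rewrite sqrtr_gt0.
have {}h : Num.sqrt S <= M * B.
  by rewrite -(ler_pM2l sp) -expr2 sqr_sqrtr// mulrA.
by rewrite -(sqr_sqrtr S0) lerXn2r ?nnegrE ?mulr_ge0 ?sqrtr_ge0.
Qed.

End curves.

(** * Regularity of the exact solution in coefficients *)

Section regularity.
Context (R : realType) (d : nat) (d0 : (0 < d)%N).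
Local Notation field := (scalar_field R d).
Local Notation ST := [set: 'I_d]%SET.
Implicit Types (g : R -> field) (v w q : field) (T t tau : R).

Definition extrapf T tau t g : field := fun x => extrap T tau t (fun s => g s x).

Lemma L2_extrapf T tau t g : 0 < tau -> 0 <= t -> t + tau / 2 <= T ->
  (forall s, 0 <= s <= T -> L2 (g s)) -> L2 (extrapf T tau t g).
Proof.
move=> tau0 t0 tT lg; rewrite /extrapf /extrap; case: (boolP (t + tau <= T)) => h.
  by apply: lg; apply/andP; split; lra.
apply: L2_D; last by apply: L2_Z; apply: lg; apply/andP; split; lra.
by apply: L2_B; apply: L2_Z; apply: lg; apply/andP; split; lra.
Qed.

Lemma ip_extrapf T tau t g w : 0 < tau -> 0 <= t -> t + tau / 2 <= T ->
  (forall s, 0 <= s <= T -> L2 (g s)) -> L2 w ->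
  ip (extrapf T tau t g) w = extrap T tau t (fun s => ip (g s) w).
Proof.
move=> tau0 t0 tT lg lw; rewrite /extrapf /extrap; case: (boolP (t + tau <= T)) => // h.
have l1 : L2 (g t) by apply: lg; apply/andP; split; lra.
have l2 : L2 (g (t + tau / 4)) by apply: lg; apply/andP; split; lra.
have l3 : L2 (g (t + tau / 2)) by apply: lg; apply/andP; split; lra.
rewrite ip_Dl//; [|exact/L2_B/L2_Z/l2/L2_Z|exact: L2_Z].
by rewrite ip_Bl//; [rewrite !ip_Zl|exact: L2_Z|exact: L2_Z].
Qed.

Lemma curve_L2 X N m T g : Winfty X N m T g -> forall s, 0 <= s <= T -> L2 (g s).
Proof. by move=> [cg _] s sT; exact: (cg s sT).1. Qed.

Lemma deriv_within_ip T g t gt w : (forall s, 0 <= s <= T -> L2 (g s)) -> 0 <= t <= T ->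
  L2 w -> is_time_derivative T g t gt -> deriv_within T t (ip gt w) (fun s => ip (g s) w).
Proof.
move=> lg tT lw [lgt h] e e0.
have W1 : 0 < normL2 w + 1 by rewrite ltr_wpDl// normL2_ge0.
move/cvgrPdist_le: h => /(_ (e / (normL2 w + 1))); rewrite divr_gt0// => /(_ isT).
move=> /nbhs_normP[/= r r0 hr]; exists (r / 2) => [|x xT xt xr]; first by rewrite divr_gt0.
have := hr x; rewrite /= distrC => /(_ ltac:(lra)); rewrite xT xt => /(_ (conj isT isT)).
rewrite sub0r normrN (ger0_norm (normL2_ge0 _)) => hx.
have lB : L2 (fun y => g x y - g t y) by apply: L2_B; exact: lg.
have lq : L2 (fun y => (g x y - g t y) / (x - t)).
  have := L2_Z (x - t)^-1 lB; congr L2; apply/funext => y; exact: mulrC.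
have -> : (ip (g x) w - ip (g t) w) / (x - t) - ip gt w =
    ip (fun y => (g x y - g t y) / (x - t) - gt y) w.
  rewrite ip_Bl//; congr (_ - _).
  rewrite (_ : (fun y => _) = (fun y => (x - t)^-1 * (g x y - g t y))).
    by rewrite ip_Zl// (ip_Bl (lg x xT) (lg t tT) lw) mulrC.
  by apply/funext => y; rewrite mulrC.
apply: (le_trans (ip_CS (L2_B lq lgt) lw)).
rewrite -[e](@divfK _ (normL2 w + 1)) ?gt_eqF// ler_pM ?normL2_ge0//.
by rewrite lerDl.
Qed.

Lemma H2_L2 v : H2 v -> L2 v.
Proof. by move=> /(_ [::] isT); exact: weakly_diff_L2. Qed.

Lemma DB_L2 tau v : DB tau v -> L2 v.
Proof. by move=> [[h _] _]; exact: weakly_diff_L2 (h (Ordinal d0)). Qed.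

Lemma normL2_le_H2 v : normL2 v <= normH2 v.
Proof.
have a0 : 0 <= \sum_i normL2 (wpartial [:: i] v) ^+ 2 by apply: sumr_ge0 => i _; exact: sqr_ge0.
have b0 : 0 <= \sum_i \sum_j normL2 (wpartial [:: i; j] v) ^+ 2.
  by apply: sumr_ge0 => i _; apply: sumr_ge0 => j _; exact: sqr_ge0.
have c0 := sqr_ge0 (normL2 v).
rewrite -ler_sqr ?nnegrE ?sqrtr_ge0// /normH2 [leRHS]sqr_sqrtr; last by rewrite !addr_ge0.
by rewrite -addrA lerDl addr_ge0.
Qed.

Lemma normDB_sqr tau v : normDB tau v ^+ 2 =
  normL2 v ^+ 2 + normL2 (xget (cst 0) (is_B tau v)) ^+ 2.
Proof. by rewrite [LHS]sqr_sqrtr// addr_ge0// sqr_ge0. Qed.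

Lemma normL2_le_DB tau v : normL2 v <= normDB tau v.
Proof. by rewrite -ler_sqr ?nnegrE ?sqrtr_ge0// normDB_sqr lerDl sqr_ge0. Qed.

Lemma simple_difference_CS (X : field -> Prop) N A (a : nat -> R) n : (forall v, X v -> L2 v) ->
  (forall v, normL2 v <= N v) ->
  exists K', forall v, simple_difference X v -> `|ip v (part A a n)| <= K' * N v.
Proof.
move=> XL NL; exists (normL2 (part A a n)) => v /(simple_difference_L2 XL) lv.
apply: (le_trans (ip_CS lv (L2_part A a n))); rewrite mulrC.
by rewrite ler_wpM2l// normL2_ge0.
Qed.

Lemma velocity_derivative_bound T g : 0 < T -> Winfty (@H2 R d) (@normH2 R d) 3 T g ->
  exists2 M, 0 <= M & forall t tau gt, 0 < tau -> 0 <= t -> t + tau / 2 <= T ->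
    is_time_derivative T g (t + tau / 2) gt ->
    forall n, \sum_(0 <= l < n)
      (coef ST (fun x => extrapf T tau t g x - g t x - tau * gt x) l) ^+ 2 <= (M * tau ^+ 3) ^+ 2.
Proof.
move=> T0 Wg; have lg := curve_L2 Wg.
have bN v n : H2 v -> \sum_(0 <= l < n) (1 * coef ST v l) ^+ 2 <= normH2 v ^+ 2.
  move=> /H2_L2 lv; under eq_bigr do rewrite mul1r.
  apply: (le_trans (bessel _ _ lv)); rewrite -normL2_sqr lerXn2r ?nnegrE ?sqrtr_ge0//.
  exact: normL2_le_H2.
have [M M0 hM] := dual_bound (A := ST) (b := fun=> 1) H2_L2 T0 Wg (leqnn 3) bN (fun v => sqrtr_ge0 _)
  (fun a n => simple_difference_CS _ a n H2_L2 normL2_le_H2).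
exists M => // t tau gt tau0 t0 tT Hd n.
have lgt := Hd.1; have lt : L2 (g t) by apply: lg; apply/andP; split; lra.
have lE := L2_extrapf tau0 t0 tT lg.
have := hM (fun x => extrapf T tau t g x - g t x - tau * gt x) (tau ^+ 3)
  (L2_B (L2_B lE lt) (L2_Z tau lgt)) (exprn_ge0 3 (ltW tau0)).
move=> H.
under eq_bigr do rewrite -[coef _ _ _]mul1r; apply: H => w K lw K0 H3.
rewrite ip_Bl//; [|exact: L2_B|exact: L2_Z]; rewrite ip_Bl// ip_Zl// ip_extrapf//.
apply: extrap_derivative => //; apply: deriv_within_ip => //.
by apply/andP; split; lra.
Qed.

(** The operator is frozen at parameter 1, so that the constant does not depend on the time step;
    [B_coef_le] returns to the actual parameter. *)
Lemma velocity_B_bound T g : 0 < T -> Winfty (@DB R d 1) (@normDB R d 1) 2 T g ->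
  exists2 M, 0 <= M &
    (forall t n, 0 <= t <= T -> \sum_(0 <= l < n) (B_coef d 1 l * coef ST (g t) l) ^+ 2 <= M ^+ 2) /\
    forall t tau, 0 < tau -> 0 <= t -> t + tau / 2 <= T -> forall n,
     \sum_(0 <= l < n) (B_coef d 1 l * coef ST (fun x => extrapf T tau t g x - g t x) l) ^+ 2
        <= (M * tau) ^+ 2 /\
     \sum_(0 <= l < n) (B_coef d 1 l *
        coef ST (fun x => 2^-1 * (extrapf T tau t g x + g t x) - g (t + tau / 2) x) l) ^+ 2
        <= (M * tau ^+ 2) ^+ 2.
Proof.
move=> T0 Wg; have lg := curve_L2 Wg.
have bN v n : DB 1 v -> \sum_(0 <= l < n) (B_coef d 1 l * coef ST v l) ^+ 2 <= normDB 1 v ^+ 2.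
  move=> [hv [B hB]]; have hB' : is_B 1 v (xget (cst 0) (is_B 1 v)) by apply: xgetPex; exists B.
  under eq_bigr do rewrite -(coef_B d0 _ hv hB').
  have [_ lB _] := hB'; apply: (le_trans (bessel _ _ lB)).
  by rewrite -normL2_sqr normDB_sqr lerDr sqr_ge0.
have sd (a : nat -> R) n := simple_difference_CS ST a n (@DB_L2 1) (@normL2_le_DB 1).
have bnd k (k2 : (k <= 2)%N) := dual_bound (@DB_L2 1) T0 Wg k2 bN (fun v => sqrtr_ge0 _) sd.
have [M0 M00 h0] := bnd 0%N isT; have [M1 M10 h1] := bnd 1%N isT; have [M2 M20 h2] := bnd 2%N isT.
exists (M0 + 2 * M1 + M2); first by rewrite !addr_ge0// mulr_ge0.
split => [t n tT|t tau tau0 t0 tT n].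
  have := h0 (g t) 1 (lg _ tT) ler01 _ n; rewrite mulr1 => H; apply: (@le_trans _ _ (M0 ^+ 2)).
    apply: H => w K lw K0 /(_ t 1 ltr01); rewrite mul0r addr0 expr0; apply; by have /andP[] := tT.
  by rewrite lerXn2r ?nnegrE ?addr_ge0 ?mulr_ge0// -addrA lerDl addr_ge0 ?mulr_ge0.
have lt : L2 (g t) by apply: lg; apply/andP; split; lra.
have lm : L2 (g (t + tau / 2)) by apply: lg; apply/andP; split; lra.
have lE := L2_extrapf tau0 t0 tT lg.
have tau2 : 0 <= tau ^+ 2 by exact: sqr_ge0.
split.
  apply: (@le_trans _ _ ((M1 * (2 * tau)) ^+ 2)).
    apply: h1; [exact: L2_B|by rewrite mulr_ge0// ltW|].
    move=> w K lw K0 H1; rewrite ip_Bl// ip_extrapf//.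
    by rewrite mulrA [K * 2]mulrC; exact: extrap_increment.
  by rewrite lerXn2r ?nnegrE ?mulr_ge0 ?addr_ge0 ?mulr_ge0 ?(ltW tau0)//; nra.
apply: (@le_trans _ _ ((M2 * tau ^+ 2) ^+ 2)).
  apply: h2 => //; first by apply: L2_B => //; apply: L2_Z; exact: L2_D.
  move=> w K lw K0 H2; rewrite ip_Bl//; last by apply: L2_Z; exact: L2_D.
  rewrite ip_Zl//; last exact: L2_D.
  by rewrite ip_Dl// ip_extrapf// mulrC; exact: extrap_mean.
have Mt : M2 * tau ^+ 2 <= (M0 + 2 * M1 + M2) * tau ^+ 2 by rewrite ler_wpM2r//; lra.
have M2t : 0 <= M2 * tau ^+ 2 by rewrite mulr_ge0.
by rewrite lerXn2r ?nnegrE// (le_trans M2t Mt).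
Qed.

Lemma weakly_diff_D s v w : weakly_diff s v -> weakly_diff s w ->
  weakly_diff s (fun x => v x + w x : R).
Proof.
move=> [V [lv lV hV]] [W [lw lW hW]]; exists (fun x => V x + W x); split; [exact: L2_D|exact: L2_D|].
move=> phi tp; have lphi : L2 phi := L2_smooth [::] tp.1.
have lp : L2 (fun x => (-1) ^+ size s * partial s phi x) by apply: L2_Z; exact: L2_smooth tp.1.
by rewrite !ip_Dl// hV// hW.
Qed.

Lemma weakly_diff_Z s (c : R) v : weakly_diff s v -> weakly_diff s (fun x => c * v x).
Proof.
move=> [V [lv lV hV]]; exists (fun x => c * V x); split; [exact: L2_Z|exact: L2_Z|].
move=> phi tp; have lphi : L2 phi := L2_smooth [::] tp.1.
have lp : L2 (fun x => (-1) ^+ size s * partial s phi x) by apply: L2_Z; exact: L2_smooth tp.1.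
by rewrite !ip_Zl// hV.
Qed.

Lemma zero_meanE q : L2 q -> zero_mean q <-> ip q (cst 1) = 0.
Proof.
move=> lq; have -> : ip q (cst 1) = \int[cube_measure R d]_x q x.
  by apply: eq_Rintegral => x _; rewrite mulr1.
by split => [[]|].
Qed.

Lemma Y_L2 q : Y q -> L2 q.
Proof. by move=> [[]]. Qed.

Lemma Y_simple_difference q : simple_difference (@Y R d) q -> Y q.
Proof.
move=> [n [c [e [g' [Ye [Yg ->]]]]]].
have l1 : L2 (cst 1 : field) := @L2_cst R d 1.
have YZ (a : R) v : Y v -> Y (fun x => a * v x).
  move=> [z w]; split; last by move=> A /w; exact: weakly_diff_Z.
  have lv := z.1; apply/(zero_meanE (L2_Z a lv)).
  by rewrite ip_Zl// ((zero_meanE lv).1 z) mulr0.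
have YD v w : Y v -> Y w -> Y (fun x => v x + w x : R).
  move=> [zv wv] [zw ww]; split; last by move=> A A0; apply: weakly_diff_D; [exact: wv|exact: ww].
  have lv := zv.1; have lw := zw.1; apply/(zero_meanE (L2_D lv lw)).
  by rewrite ip_Dl// ((zero_meanE lv).1 zv) ((zero_meanE lw).1 zw) addr0.
have Ys (r : seq 'I_n) : Y (fun x => \sum_(j <- r) c j * e j x : R).
  elim: r => [|j r IH].
    have := YZ 0 _ Yg; congr Y; apply/funext => x; by rewrite mul0r big_nil.
  have := YD _ _ (YZ (c j) _ (Ye j)) IH; congr Y; apply/funext => x.
  by rewrite big_cons.
have := YD _ _ (Ys (index_enum _)) (YZ (-1) _ Yg); congr Y; apply/funext => x.
by rewrite mulN1r.
Qed.

(** The symbol of the norm of [Y]: its square is the symbol of [A] minus 1, as [prod_1lam] shows. *)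
Definition Y_weight (l : nat) : R :=
  Num.sqrt (\sum_(A : {set 'I_d} | A != finset.set0) \prod_(i in A) lam R l i).

Lemma prod_lam_ge0 l (A : {set 'I_d}) : 0 <= \prod_(i in A) lam R l i.
Proof. by apply: prodr_ge0 => i _; exact: lam_ge0. Qed.

Lemma Y_weight_sqr l : Y_weight l ^+ 2 =
  \sum_(A : {set 'I_d} | A != finset.set0) \prod_(i in A) lam R l i.
Proof. by rewrite sqr_sqrtr// sumr_ge0// => A _; exact: prod_lam_ge0. Qed.

Lemma prod_1lam l : \prod_(i : 'I_d) (1 + lam R l i) = 1 + Y_weight l ^+ 2.
Proof.
rewrite Y_weight_sqr; under eq_bigr do rewrite addrC.
rewrite bigA_distr (bigD1 finset.set0)//=; congr (_ + _).
  by rewrite big1// => i _; rewrite inE.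
apply: eq_bigr => A _; rewrite [RHS]big_mkcond; apply: eq_bigr => i _.
by case: ifP.
Qed.

Lemma lam_ge1 l (i : 'I_d) : freq l i != 0%N -> 1 <= lam R l i.
Proof.
move=> f0; have f1 : 1 <= (freq l i)%:R :> R by rewrite ler1n lt0n.
have p1 : 1 <= pi :> R by have := pi_ge2 R; lra.
by rewrite /lam exprn_ege1// mulr_ege1.
Qed.

Lemma Y_weight_ge1 l (i : 'I_d) : freq l i != 0%N -> 1 <= Y_weight l.
Proof.
move=> fi; rewrite -(@ler_sqr R) ?nnegrE ?sqrtr_ge0// expr1n Y_weight_sqr.
rewrite (bigD1 [set i]%SET)/=; last by apply/set0Pn; exists i; rewrite inE.
rewrite big_set1; apply: (le_trans (lam_ge1 fi)); rewrite lerDl.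
by apply: sumr_ge0 => A _; exact: prod_lam_ge0.
Qed.

Lemma coef_mean q l : zero_mean q -> (forall i : 'I_d, freq l i = 0%N) -> coef finset.set0 q l = 0.
Proof.
move=> zq fl; have lq := zq.1; rewrite coefE//.
have -> : trig finset.set0 (freq l) = cst 1 :> field.
  apply/funext => x; rewrite /trig /tensor big1// => i _.
  by rewrite inE /trig1 /tcos fl eqxx mulr0 mul0r cos0 mulr1.
by rewrite ((zero_meanE lq).1 zq) mulr0.
Qed.

(** A Poincare inequality mode by mode: the zero mean removes the constant mode, and every other
    mode has weight at least 1. *)
Lemma coef_weight q l : zero_mean q ->
  (coef finset.set0 q l) ^+ 2 <= (Y_weight l * coef finset.set0 q l) ^+ 2.
Proof.
move=> zq; have [[i fi]|nf] := pselect (exists i : 'I_d, freq l i != 0%N).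
  rewrite exprMn ler_peMl ?sqr_ge0// exprn_ege1//; exact: Y_weight_ge1 fi.
rewrite coef_mean// ?mulr0// => i; apply/eqP; apply: contra_notT nf => fi.
by exists i.
Qed.

Lemma Y_sum q n : Y q ->
  \sum_(0 <= l < n) (Y_weight l * coef finset.set0 q l) ^+ 2 <= normY q ^+ 2.
Proof.
move=> [zq wq]; rewrite sqr_sqrtr; last by apply: sumr_ge0 => A _; exact: sqr_ge0.
under eq_bigr do rewrite exprMn Y_weight_sqr mulr_suml.
rewrite exchange_big/=; apply: ler_sum => A A0.
by rewrite normL2_sqr; apply: coef_sum_Y => //; exact: wq.
Qed.

Lemma pressure_bound T g : 0 < T -> Winfty (@Y R d) (@normY R d) 3 T g ->
  exists2 M, 0 <= M &
    (forall x y, 0 <= x -> x < y -> y <= T -> forall n,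
      \sum_(0 <= l < n) (Y_weight l * coef finset.set0 (fun z => g y z - g x z) l) ^+ 2
        <= (M * (y - x)) ^+ 2) /\
    forall x h, 0 <= x -> 0 < h -> x + 2 * h <= T -> forall n,
      \sum_(0 <= l < n) (Y_weight l *
        coef finset.set0 (fun z => g (x + 2 * h) z - 2 * g (x + h) z + g x z) l) ^+ 2
        <= (M * h ^+ 2) ^+ 2.
Proof.
move=> T0 Wg; have lg := curve_L2 Wg.
(* The norm of [Y] has no L^2 term, so the functional is bounded coefficient by coefficient; this
   uses that [Y] is stable under the linear combinations at hand. *)
have sd (a : nat -> R) n : exists K', forall v, simple_difference (@Y R d) v ->
    `|ip v (part finset.set0 a n)| <= K' * normY v.
  exists (\sum_(0 <= l < n) `|a l|) => v /Y_simple_difference Yv.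
  rewrite ip_part; last exact: Y_L2.
  apply: (le_trans (ler_norm_sum _ _ _)); rewrite mulr_suml.
  rewrite big_nat_cond [leRHS]big_nat_cond; apply: ler_sum => l /andP[/andP[_ ln] _].
  rewrite normrM ler_wpM2l// -ler_sqr ?nnegrE ?sqrtr_ge0// real_normK ?num_real//.
  apply: (le_trans (coef_weight l Yv.1)); apply: le_trans (Y_sum n Yv).
  rewrite (bigD1_seq l)/= ?mem_index_iota ?iota_uniq// lerDl.
  by apply: sumr_ge0 => k _; exact: sqr_ge0.
have bnd k (k3 : (k <= 3)%N) := dual_bound Y_L2 T0 Wg k3 (fun v n => @Y_sum v n) (fun v => sqrtr_ge0 _) sd.
have [M1 M10 h1] := bnd 1%N isT; have [M2 M20 h2] := bnd 2%N isT.
exists (M1 + M2); first exact: addr_ge0.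
split => [x y x0 xy yT n|x h x0 h0 xT n].
  have lx : L2 (g x) by apply: lg; apply/andP; split; lra.
  have ly : L2 (g y) by apply: lg; apply/andP; split; lra.
  have xy0 : 0 <= y - x by lra.
  apply: (@le_trans _ _ ((M1 * (y - x)) ^+ 2)).
    apply: h1 => //; first exact: L2_B.
    by move=> w K lw K0 H1; rewrite ip_Bl//; exact: (diff_bound1 H1).
  have Mt : M1 * (y - x) <= (M1 + M2) * (y - x) by rewrite ler_wpM2r//; lra.
  have M1t : 0 <= M1 * (y - x) by rewrite mulr_ge0.
  by rewrite lerXn2r ?nnegrE// (le_trans M1t Mt).
have l0 : L2 (g x) by apply: lg; apply/andP; split; lra.
have l1 : L2 (g (x + h)) by apply: lg; apply/andP; split; lra.
have l2 : L2 (g (x + 2 * h)) by apply: lg; apply/andP; split; lra.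
apply: (@le_trans _ _ ((M2 * h ^+ 2) ^+ 2)).
  apply: h2; [by apply: L2_D => //; apply: L2_B => //; exact: L2_Z|exact: sqr_ge0|].
  move=> w K lw K0 H2; rewrite ip_Dl//; last by apply: L2_B => //; exact: L2_Z.
  by rewrite ip_Bl//; [rewrite ip_Zl//; exact: (diff_bound2 H2)|exact: L2_Z].
have Mt : M2 * h ^+ 2 <= (M1 + M2) * h ^+ 2 by rewrite ler_wpM2r ?sqr_ge0//; lra.
have M2t : 0 <= M2 * h ^+ 2 by rewrite mulr_ge0// sqr_ge0.
by rewrite lerXn2r ?nnegrE// (le_trans M2t Mt).
Qed.

End regularity.

Section coef_linear.
Context (R : realType) (d : nat).
Local Notation field := (scalar_field R d).
Implicit Types (f g : field) (A : {set 'I_d}).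

Lemma coefD A f g l : L2 f -> L2 g -> coef A (fun x => f x + g x) l = coef A f l + coef A g l.
Proof. by move=> lf lg; rewrite /coef ip_Dl//; exact: L2_bas. Qed.

Lemma coefB A f g l : L2 f -> L2 g -> coef A (fun x => f x - g x) l = coef A f l - coef A g l.
Proof. by move=> lf lg; rewrite /coef ip_Bl//; exact: L2_bas. Qed.

Lemma coefZ A (c : R) f l : L2 f -> coef A (fun x => c * f x) l = c * coef A f l.
Proof. by move=> lf; rewrite /coef ip_Zl//; exact: L2_bas. Qed.

Lemma L2_divr (c : R) f : L2 f -> L2 (fun x => f x / c).
Proof. by move=> /(L2_Z c^-1); congr L2; apply/funext => x; rewrite mulrC. Qed.

Lemma coef_divr A (c : R) f l : L2 f -> coef A (fun x => f x / c) l = coef A f l / c.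
Proof.
move=> lf; rewrite mulrC -coefZ//; congr (coef _ _ _).
by apply/funext => x; rewrite mulrC.
Qed.

Lemma coef_sum A (F : 'I_d -> field) l : (forall i, L2 (F i)) ->
  coef A (fun x => \sum_i F i x) l = \sum_i coef A (F i) l.
Proof. by move=> lF; rewrite /coef ip_suml//; exact: L2_bas. Qed.

Lemma coef_cst0 A l : coef A (cst 0 : field) l = 0.
Proof. exact: ip_0l. Qed.

End coef_linear.

(** * The velocity steps in sine coefficients *)

Section recursion.
Context (R : realType).

Section any_dimension.
Context (d : nat) (d0 : (0 < d)%N).
Local Notation field := (scalar_field R d).
Local Notation ST := [set: 'I_d]%SET.
Implicit Types (f g v : field) (j : 'I_d).

Lemma vanish_B j v w V W : L2 v -> L2 w -> vanish j v V -> vanish j w W ->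
  vanish j (fun x => v x - w x : R) (fun x => V x - W x).
Proof.
move=> lv lw [lV hV] [lW hW]; split; first exact: L2_B.
move=> h sh; have lh := L2_smooth [::] (smooth_tensor sh); have lh' := L2_smooth [:: j] (smooth_tensor sh).
by rewrite !ip_Bl// hV// hW//; ring.
Qed.

(** A stage of the splitting imposes its boundary condition in one direction only. In the other
    directions the trace is inherited: the coefficients of the new stage are dominated by those of
    the old ones, and [vanish_sum] turns their decay into a trace. *)
Lemma vanish_dominated j v f g V W : L2 v -> L2 f -> L2 g -> vanish j f V -> vanish j g W ->
  (forall l, `|coef ST v l| <= 2 * `|coef ST f l| + 2 * `|coef ST g l|) ->
  exists V', vanish j v V'.
Proof.
move=> lv lf lg fV gW h.
apply: (@vanish_sum R d d0 v j (8 * ip V V + 8 * ip W W)) => // m.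
apply: (@le_trans _ _ (8 * (\sum_(0 <= l < m) lam R l j * coef ST f l ^+ 2) +
   8 * \sum_(0 <= l < m) lam R l j * coef ST g l ^+ 2)).
  rewrite !mulr_sumr -big_split/=; apply: ler_sum => l _.
  have H : coef ST v l ^+ 2 <= 8 * coef ST f l ^+ 2 + 8 * coef ST g l ^+ 2.
    rewrite -(real_normK (num_real (coef ST v l))) -(real_normK (num_real (coef ST f l)))
      -(real_normK (num_real (coef ST g l))).
    have := h l; have := normr_ge0 (coef ST v l); have := normr_ge0 (coef ST f l); have := normr_ge0 (coef ST g l).
    set a := `|coef ST v l|; set b := `|coef ST f l|; set c := `|coef ST g l| => c0 b0 a0 abc.
    have : a ^+ 2 <= (2 * b + 2 * c) ^+ 2 by rewrite lerXn2r ?nnegrE// addr_ge0 ?mulr_ge0.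
    by have := sqr_ge0 (b - c); nra.
  apply: (le_trans (ler_wpM2l (lam_ge0 R l j) H)).
  by rewrite le_eqVlt; apply/orP; left; apply/eqP; rewrite /=; ring.
by rewrite lerD// ler_wpM2l//; exact: lam_sum.
Qed.

Lemma half_implicit_coef (tau : R) j (a b c : field) (V W : field) l : 0 < tau -> L2 a -> L2 c ->
  weakly_diff [:: j; j] (fun x => b x - c x : R) ->
  ae_eq_cube (fun x => (b x - a x) / tau - 2^-1 * wpartial [:: j; j] (fun x => b x - c x) x) (cst 0) ->
  L2 b -> vanish j b V -> vanish j c W ->
  (1 + tau / 2 * lam R l j) * (coef ST b l - coef ST c l) = coef ST a l - coef ST c l.
Proof.
move=> tau0 la lc wd E lb bV cW; have vw := vanish_B lb lc bV cW.
have lw := L2_wpartial wd.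
have l1 := L2_divr tau (L2_B lb la).
have := coef_ae ST l (L2_B l1 (L2_Z 2^-1 lw)) (@L2_cst R d 0) E.
rewrite coef_cst0 coefB//; last exact: L2_Z.
rewrite coef_divr ?coefB//; last exact: L2_B.
rewrite coefZ// (coef_wpartial_ii d0 l wd vw) coefB//.
move=> H; apply/eqP; rewrite -subr_eq0; apply/eqP.
rewrite -[RHS](mulr0 tau) -[in RHS]H; field.
by rewrite gt_eqF.
Qed.

Lemma implicit_half_step (tau h u lh lu q F : R) : 0 < tau ->
  (h - u) / (tau / 2) - - lh * h - - lu * u + q = F ->
  (1 + tau / 2 * lh) * h = (1 - tau / 2 * lu) * u + tau / 2 * (F - q).
Proof. by move=> tau0 <-; field; rewrite gt_eqF. Qed.

Lemma implicit_half_step_coef (tau lh lu : R) (h u Wh Wu q F : field) l : 0 < tau ->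
  L2 h -> L2 u -> L2 Wh -> L2 Wu -> L2 q -> L2 F ->
  coef ST Wh l = - lh * coef ST h l -> coef ST Wu l = - lu * coef ST u l ->
  ae_eq_cube (fun x => (h x - u x) / (tau / 2) - Wh x - Wu x + q x) F ->
  (1 + tau / 2 * lh) * coef ST h l =
  (1 - tau / 2 * lu) * coef ST u l + tau / 2 * (coef ST F l - coef ST q l).
Proof.
move=> tau0 Lh Lu lWh lWu lq lF eh eu E; apply: implicit_half_step => //.
have l1 := L2_divr (tau / 2) (L2_B Lh Lu).
have := coef_ae ST l (L2_D (L2_B (L2_B l1 lWh) lWu) lq) lF E.
rewrite coefD//; last exact/L2_B/lWu/L2_B.
rewrite coefB//; last exact: L2_B.
rewrite coefB// coef_divr ?coefB//; last exact: L2_B.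
by rewrite eh eu.
Qed.

Lemma explicit_step_coef (tau : R) (xi u q F : field) l : 0 < tau -> L2 xi ->
  (forall j, weakly_diff [:: j; j] u) -> (forall j, exists V, vanish j u V) -> L2 q -> L2 F ->
  ae_eq_cube (fun x => (xi x - u x) / tau - wlaplacian u x + q x) F ->
  coef ST xi l - coef ST u l =
  tau * (coef ST F l - coef ST q l - (\sum_(j : 'I_d) lam R l j) * coef ST u l).
Proof.
move=> tau0 lxi wu hV lq lF E; have lu := weakly_diff_L2 (wu (Ordinal d0)).
have l1 := L2_divr tau (L2_B lxi lu).
have lw j : L2 (wpartial [:: j; j] u) := L2_wpartial (wu j).
have lL : L2 (wlaplacian u) by apply: L2_sum.
have := coef_ae ST l (L2_D (L2_B l1 lL) lq) lF E.
rewrite coefD//; last exact: L2_B.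
rewrite coefB// coef_divr ?coefB//; last exact: L2_B.
have -> : coef ST (wlaplacian u) l = - (\sum_(j : 'I_d) lam R l j) * coef ST u l.
  rewrite coef_sum// mulNr mulr_suml -sumrN; apply: eq_bigr => j _.
  by have [V vj] := hV j; rewrite (coef_wpartial_ii d0 l (wu j) vj) mulNr.
by move=> <-; field; rewrite gt_eqF.
Qed.

Lemma half_implicit_bound (x a b c : R) : 0 <= x -> (1 + x) * (b - c) = a - c ->
  `|b| <= 2 * `|a| + 2 * `|c|.
Proof.
move=> x0 h; have : `|b - c| <= `|a - c|.
  have x1 : 1 <= 1 + x by lra.
  rewrite -h normrM (@ger0_norm _ (1 + x)); last by lra.
  by rewrite ler_peMl.
by have := ler_normB a c; have := ler_normD (b - c) c; rewrite subrK; have := normr_ge0 a; lra.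
Qed.

End any_dimension.

Lemma subr_swap (a b c e F : R) : a - b - c + e = F -> a - c - b + e = F.
Proof. by move=> <-; ring. Qed.

(** Elimination of the intermediate velocity [h]: on coefficients the factors of the two half steps
    commute. *)
Lemma two_half_steps (tau a b h u u1 G : R) :
  (1 + tau / 2 * a) * h = (1 - tau / 2 * b) * u + tau / 2 * G ->
  (1 + tau / 2 * b) * u1 = (1 - tau / 2 * a) * h + tau / 2 * G ->
  (1 + tau / 2 * a) * (1 + tau / 2 * b) * (u1 - u) = tau * (G - (a + b) * u).
Proof.
move=> h1 h2.
have -> : (1 + tau / 2 * a) * (1 + tau / 2 * b) * (u1 - u) = (1 + tau / 2 * a) *
   ((1 + tau / 2 * b) * u1) - (1 + tau / 2 * a) * (1 + tau / 2 * b) * u by ring.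
rewrite h2.
have -> : (1 + tau / 2 * a) * ((1 - tau / 2 * a) * h + tau / 2 * G) =
    (1 - tau / 2 * a) * ((1 + tau / 2 * a) * h) + (1 + tau / 2 * a) * (tau / 2 * G) by ring.
by rewrite h1; field.
Qed.

Lemma two_half_steps_bound (tau a b h u u1 G : R) : 0 <= tau / 2 * b ->
  (1 + tau / 2 * a) * h = (1 - tau / 2 * b) * u + tau / 2 * G ->
  (1 + tau / 2 * b) * u1 = (1 - tau / 2 * a) * h + tau / 2 * G ->
  `|u1| <= 2 * `|h| + 2 * `|u|.
Proof.
set y := tau / 2 * b; set x := tau / 2 * a => y0 h1 h2.
have H : (1 + y) * u1 = 2 * h - (1 - y) * u by lra.
have y1 : 0 < 1 + y by lra.
have : (1 + y) * `|u1| <= 2 * `|h| + (1 + y) * `|u|.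
  rewrite -{1}(gtr0_norm y1) -normrM H; apply: (le_trans (ler_normB _ _)).
  rewrite !normrM ger0_norm// lerD2l ler_wpM2r//.
  by rewrite ler_norml; apply/andP; split; lra.
by have := normr_ge0 h; have := normr_ge0 u; have := normr_ge0 u1; nra.
Qed.

Lemma velocity_recursion2 (tau : R) (F : vector_field R 2) q (uk uk1 : vector_field R 2) i :
  0 < tau -> L2 (F i) -> velocity_step2 tau F q uk uk1 -> (forall j, exists V, vanish j (uk i) V) ->
  [/\ L2 (uk1 i), forall j, exists V, vanish j (uk1 i) V, weakly_diff [:: i] q & forall l,
   (\prod_(j : 'I_2) (1 + tau / 2 * lam R l j)) *
     (coef [set: 'I_2]%SET (uk1 i) l - coef [set: 'I_2]%SET (uk i) l) =
   tau * (coef [set: 'I_2]%SET (F i) l - coef [set: 'I_2]%SET (wpartial [:: i] q) l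
     - (\sum_(j : 'I_2) lam R l j) * coef [set: 'I_2]%SET (uk i) l)].
Proof.
move=> tau0 lF [uh /(_ i)[wq [wh wu wu1] [E1 zh] [E2 zu1]]] hV.
set ex := Ordinal _ in wh E1 zh E2; set ey := Ordinal _ in wu wu1 E1 E2 zu1.
have lh := weakly_diff_L2 wh; have lu := weakly_diff_L2 wu; have lu1 := weakly_diff_L2 wu1.
have lq := L2_wpartial wq; have lwh := L2_wpartial wh; have lwu := L2_wpartial wu; have lwu1 := L2_wpartial wu1.
have vh := vanish_zero_trace (isT : (0 < 2)%N) zh; have vu1 := vanish_zero_trace (isT : (0 < 2)%N) zu1.
have [V vu] := hV ey; have [W vux] := hV ex.
have t20 : tau / 2 != 0 by rewrite gt_eqF//; lra.
(* Once the two second derivatives are exchanged, the second half step has the shape of the first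
   with the directions swapped. *)
have E2' : ae_eq_cube (fun x => (uk1 i x - uh i x) / (tau / 2)
    - wpartial [:: ey; ey] (uk1 i) x - wpartial [:: ex; ex] (uh i) x + wpartial [:: i] q x) (F i).
  by apply: filterS E2 => x; apply: subr_swap.
have d2 : (0 < 2)%N by [].
have C1 l := implicit_half_step_coef tau0 lh lu lwh lwu lq lF
  (coef_wpartial_ii d2 l wh vh) (coef_wpartial_ii d2 l wu vu) E1.
have C2 l := implicit_half_step_coef tau0 lu1 lh lwu1 lwh lq lF
  (coef_wpartial_ii d2 l wu1 vu1) (coef_wpartial_ii d2 l wh vh) E2'.
have I2 (j : 'I_2) : j = ex \/ j = ey.
  by case: j => [[|[|//]]] ?; [left|right]; apply: val_inj.
split => // [j|l].
  have [->|->] := I2 j; last by eexists; exact: vu1.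
  (* Across the first coordinate, [uk1] inherits its trace from [uh] and [uk]. *)
  apply: (vanish_dominated (isT : (0 < 2)%N) lu1 lh lu vh vux) => // l.
  have b0 : 0 <= tau / 2 * lam R l ey by rewrite mulr_ge0 ?lam_ge0//; lra.
  exact: two_half_steps_bound b0 (C1 l) (C2 l).
rewrite !big_ord_recl !big_ord0 mulr1 addr0.
have -> : lift ord0 ord0 = ey :> 'I_2 by apply: val_inj.
have -> : ord0 = ex :> 'I_2 by apply: val_inj.
exact: two_half_steps (C1 l) (C2 l).
Qed.

Lemma velocity_recursion3 (tau : R) (F : vector_field R 3) q (uk uk1 : vector_field R 3) i :
  0 < tau -> L2 (F i) -> velocity_step3 tau F q uk uk1 -> (forall j, exists V, vanish j (uk i) V) ->
  [/\ L2 (uk1 i), forall j, exists V, vanish j (uk1 i) V, weakly_diff [:: i] q & forall l,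
   (\prod_(j : 'I_3) (1 + tau / 2 * lam R l j)) *
     (coef [set: 'I_3]%SET (uk1 i) l - coef [set: 'I_3]%SET (uk i) l) =
   tau * (coef [set: 'I_3]%SET (F i) l - coef [set: 'I_3]%SET (wpartial [:: i] q) l
     - (\sum_(j : 'I_3) lam R l j) * coef [set: 'I_3]%SET (uk i) l)].
Proof.
move=> tau0 lF [xi [eta [zeta /(_ i)[[wq wu lxi E0 _] [wx Ex zx] [wy Ey zy] [wz Ez zz]]]]] hV.
set ex := Ordinal _ in wx Ex zx; set ey := Ordinal _ in wy Ey zy; set ez := Ordinal _ in wz Ez zz.
have lu := weakly_diff_L2 (wu ex); have lq := L2_wpartial wq.
have vx := vanish_zero_trace (isT : (0 < 3)%N) zx; have vy := vanish_zero_trace (isT : (0 < 3)%N) zy; have vz := vanish_zero_trace (isT : (0 < 3)%N) zz.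
have le := weakly_diff_L2 zx.1; have lz := weakly_diff_L2 zy.1; have lu1 := weakly_diff_L2 zz.1.
have [Vx ux] := hV ex; have [Vy uy] := hV ey; have [Vz uz] := hV ez.
have a0 l (j : 'I_3) : 0 <= tau / 2 * lam R l j by rewrite mulr_ge0 ?lam_ge0//; lra.
have Cx l := half_implicit_coef (isT : (0 < 3)%N) l tau0 lxi lu wx Ex le vx ux.
have Cy l := half_implicit_coef (isT : (0 < 3)%N) l tau0 le lu wy Ey lz vy uy.
have Cz l := half_implicit_coef (isT : (0 < 3)%N) l tau0 lz lu wz Ez lu1 vz uz.
(* Across the first coordinate, [zeta] inherits its trace from [eta] and [uk]; the last stage then
   passes it on to [uk1]. *)
have zvx : exists V, vanish ex (zeta i) V.
  by apply: (vanish_dominated (isT : (0 < 3)%N) lz le lu vx ux) => l; exact: half_implicit_bound (a0 l ey) (Cy l).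
have [W zx'] := zvx.
have C0 l := explicit_step_coef (isT : (0 < 3)%N) l tau0 lxi wu hV lq lF E0.
split; [exact: lu1|move=> j|exact: wq|move=> l].
  have : [\/ j = ex, j = ey | j = ez].
    by case: j => [[|[|[|//]]]] ?; [constructor 1|constructor 2|constructor 3]; apply: val_inj.
  case=> ->; last by eexists; exact: vz.
  - by apply: (vanish_dominated (isT : (0 < 3)%N) lu1 lz lu zx' ux) => l; exact: half_implicit_bound (a0 l ez) (Cz l).
  - by apply: (vanish_dominated (isT : (0 < 3)%N) lu1 lz lu vy uy) => l; exact: half_implicit_bound (a0 l ez) (Cz l).
(* Measured from [uk], each implicit stage divides by one factor; multiplying the final increment by
   all three gives back the explicit increment of [xi]. *)
rewrite -C0 -Cx -Cy -Cz !big_ord_recl big_ord0 mulr1.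
have -> : lift ord0 (lift ord0 ord0) = ez :> 'I_3 by apply: val_inj.
have -> : lift ord0 ord0 = ey :> 'I_3 by apply: val_inj.
have -> : ord0 = ex :> 'I_3 by apply: val_inj.
by rewrite -!mulrA.
Qed.

Lemma velocity_recursion d (tau : R) (F : vector_field R d) q (uk uk1 : vector_field R d) i :
  0 < tau -> L2 (F i) -> velocity_step tau F q uk uk1 -> (forall j, exists V, vanish j (uk i) V) ->
  [/\ L2 (uk1 i), forall j, exists V, vanish j (uk1 i) V, weakly_diff [:: i] q & forall l,
   (\prod_(j : 'I_d) (1 + tau / 2 * lam R l j)) *
     (coef [set: 'I_d]%SET (uk1 i) l - coef [set: 'I_d]%SET (uk i) l) =
   tau * (coef [set: 'I_d]%SET (F i) l - coef [set: 'I_d]%SET (wpartial [:: i] q) l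
     - (\sum_(j : 'I_d) lam R l j) * coef [set: 'I_d]%SET (uk i) l)].
Proof.
move: d F q uk uk1 i => [|[|[|[|d]]]] F q uk uk1 i //=.
  exact: velocity_recursion2.
exact: velocity_recursion3.
Qed.

End recursion.

Lemma ler_sqr_le (R : realDomainType) (a b : R) : 0 <= a -> a <= b -> a ^+ 2 <= b ^+ 2.
Proof. by move=> a0 ab; rewrite lerXn2r ?nnegrE// (le_trans a0 ab). Qed.

(** * The scaled divergence and the symbols of the scheme *)

Section gradient.
Context (R : realType) (d : nat) (d0 : (0 < d)%N).
Local Notation field := (scalar_field R d).
Local Notation ST := [set: 'I_d]%SET.
Implicit Types (f g w : field) (v : 'I_d -> field) (A : {set 'I_d}) (i j : 'I_d) (l m : nat).

Definition comb A N (c : 'I_N -> R) : field := fun x => \sum_(l < N) c l * bas A l x.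

Lemma L2_comb A N (c : 'I_N -> R) : L2 (comb A c).
Proof. by apply: L2_sum => l; exact/L2_Z/L2_bas. Qed.

Lemma ip_comb A N (c : 'I_N -> R) f : L2 f -> ip f (comb A c) = \sum_(l < N) c l * coef A f l.
Proof.
move=> lf; rewrite ip_sumr//; last by move=> l; exact/L2_Z/L2_bas.
by apply: eq_bigr => l _; rewrite ip_Zr//; exact: L2_bas.
Qed.

Lemma comb_sqr_le A N (c : 'I_N -> R) : ip (comb A c) (comb A c) <= \sum_(l < N) c l ^+ 2.
Proof.
rewrite ip_comb; last exact: L2_comb.
apply: ler_sum => l _; rewrite /coef ipC ip_comb; last exact: L2_bas.
rewrite (bigD1 l)//= big1 ?addr0 => [|k kl]; last by rewrite /coef bas_orth0 ?mulr0// eq_sym.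
rewrite /coef; have [->|->] := bas_orth1 R A l; last by rewrite mulr1 expr2.
by rewrite !mulr0 sqr_ge0.
Qed.

Lemma part_comb A (a : nat -> R) N : part A a N = comb A (fun l : 'I_N => a l).
Proof. by apply/funext => x; rewrite /part big_mkord. Qed.

(** The derivative along [i] of the cosine mode [m]; likewise [dsin] is the derivative along [i] of
    the sine mode [l]. *)
Definition dbas i m : field := fun x => - (pi * (freq m i)%:R) * bas [set i]%SET m x.

Definition dsin i l : field := fun x => pi * (freq l i)%:R * bas (~: [set i]%SET) l x.

Lemma L2_dbas i m : L2 (dbas i m).
Proof. exact/L2_Z/L2_bas. Qed.

Lemma L2_dsin i l : L2 (dsin i l).
Proof. exact/L2_Z/L2_bas. Qed.

Lemma ip_dbas f i m : L2 f -> ip f (dbas i m) = - (pi * (freq m i)%:R) * coef [set i]%SET f m.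
Proof. by move=> lf; rewrite ip_Zr//; exact: L2_bas. Qed.

(** Integration by parts between a cosine and a sine mode, the sine killing the boundary term: up to
    sign, the divergence and the gradient have transposed matrices. *)
Lemma ip_dbas_dsin i m l : coef ST (dbas i m) l = - coef finset.set0 (dsin i l) m.
Proof.
rewrite /coef /dbas /dsin ip_Zl; [|exact: L2_bas|exact: L2_bas].
rewrite ip_Zl; [|exact: L2_bas|exact: L2_bas].
rewrite [ip (bas _ _) (bas finset.set0 _)]ipC /bas.
rewrite !(ip_Zl, ip_Zr); try by [exact: L2_trig|exact/L2_Z/L2_trig].
have := ip_partial_sin d0 i (freq l) (fun j => @smooth1_trig1 R (j \in (finset.set0 : {set 'I_d})) (freq m j)).
rewrite -/(trig finset.set0 (freq m)) -enum_set1 !partial_trig !big_set1 symdiff0s.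
have -> : symdiff ST [set i]%SET = ~: [set i]%SET by apply/setP => k; rewrite !inE.
rewrite ip_Zl; [|exact: L2_trig|exact: L2_trig].
rewrite ip_Zr; [|exact: L2_trig|exact: L2_trig].
rewrite /dfreq !inE mul1r mulN1r => H.
transitivity ((is_mode d m)%:R * (is_mode d l)%:R * (- (pi * (freq m i)%:R) *
    ip (@trig R d [set i]%SET (freq m)) (trig ST (freq l)))); first by ring.
by rewrite H; ring.
Qed.

Lemma prod_1add_ge (I : Type) (r : seq I) (x : I -> R) : (forall k, 0 <= x k) ->
  1 + \sum_(k <- r) x k <= \prod_(k <- r) (1 + x k).
Proof.
move=> x0; elim: r => [|k r IH]; first by rewrite !big_nil addr0.
rewrite !big_cons; have s0 : 0 <= \sum_(j <- r) x j by apply: sumr_ge0.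
by have := x0 k; nra.
Qed.

Definition alpha m : R := \prod_(i : 'I_d) (1 + lam R m i).

Lemma lam_le_alpha m : \sum_(i : 'I_d) lam R m i <= alpha m.
Proof.
by have := prod_1add_ge (index_enum _) (fun i : 'I_d => lam_ge0 R m i); rewrite /alpha; lra.
Qed.

Lemma alpha_gt0 m : 0 < alpha m.
Proof.
apply: lt_le_trans (prod_1add_ge (index_enum _) (fun i : 'I_d => lam_ge0 R m i)).
by rewrite ltr_wpDr// sumr_ge0// => i _; exact: lam_ge0.
Qed.

(** For fields with zero trace these are the cosine coefficients of minus [A^(-1/2)] applied to the
    divergence. The form by duality makes sense for every field in L^2, in particular for truncation
    tails. *)
Definition gdiv v m : R := (Num.sqrt (alpha m))^-1 * \sum_i ip (v i) (dbas i m).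

(** On each mode the sum of the [lam] is at most [alpha]; each component then has its own
    orthonormal family and its own Bessel inequality. *)
Lemma gdiv_contr v M : (forall i, L2 (v i)) ->
  \sum_(m < M) gdiv v m ^+ 2 <= \sum_i ip (v i) (v i).
Proof.
move=> lv; apply: (@le_trans _ _ (\sum_(m < M) \sum_i coef [set i]%SET (v i) m ^+ 2)).
  apply: ler_sum => m _; rewrite /gdiv exprMn exprVn sqr_sqrtr ?(ltW (alpha_gt0 _))//.
  rewrite mulrC ler_pdivrMr ?alpha_gt0//.
  under eq_bigr do rewrite ip_dbas//.
  have := dot_CS2 (fun i : 'I_d => - (pi * (freq m i)%:R)) (fun i : 'I_d => coef [set i]%SET (v i) m).
  move/le_trans; apply; rewrite mulrC ler_wpM2l ?sq_ge0//.
  apply: le_trans (lam_le_alpha m); rewrite le_eqVlt; apply/orP; left; apply/eqP.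
  by apply: eq_bigr => i _; rewrite sqrrN.
rewrite exchange_big/=; apply: ler_sum => i _.
by have := bessel [set i]%SET M (lv i); rewrite big_mkord.
Qed.

Definition kappa (tau : R) l : R := tau * \sum_(j : 'I_d) lam R l j.

(** What the product of the one-dimensional factors leaves beyond first order; [beta_B] identifies
    it as a multiple of the symbol of [B]. *)
Definition beta (tau : R) l : R :=
  \prod_(j : 'I_d) (1 + tau / 2 * lam R l j) - 1 - tau / 2 * \sum_(j : 'I_d) lam R l j.

Lemma kappa_ge0 tau l : 0 <= tau -> 0 <= kappa tau l.
Proof. by move=> t0; rewrite mulr_ge0// sumr_ge0// => j _; exact: lam_ge0. Qed.

Lemma beta_ge0 tau l : 0 <= tau -> 0 <= beta tau l.
Proof.
move=> t0; have := prod_1add_ge (index_enum 'I_d) (x := fun j : 'I_d => tau / 2 * lam R l j).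
rewrite /beta mulr_sumr => H; have {}H := H (fun j => mulr_ge0 (divr_ge0 t0 (ler0n R 2)) (lam_ge0 R l j)).
lra.
Qed.

End gradient.

(** * Truncation of the error equations to finitely many modes *)

Section semi_discrete.
Context (R : realType) (d : nat) (d0 : (0 < d)%N) (d3 : (d <= 3)%N).
Local Notation field := (scalar_field R d).
Local Notation ST := [set: 'I_d]%SET.

(* [e] is the velocity error, [w] the error of the predicted pressure, [q] the
   cosine coefficients of the pressure error, scaled by [tau * sqrt alpha]. *)
Lemma semi_discrete_stability (C0 tau : R) (n : nat) (e : nat -> 'I_d -> field)
    (w : nat -> field) (q r s : nat -> nat -> R) (F : nat -> 'I_d -> nat -> R)
    (C := 5 * 10 ^+ 9 * (10 * C0 ^+ 3) ^+ 6) :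
  1 <= C0 -> 0 < tau -> tau <= C0 -> n%:R * tau <= C0 ->
  (forall k i, L2 (e k i)) -> (forall k, L2 (w k)) ->
  (forall i l, coef ST (e 0%N i) l = 0) -> (forall m, q 0%N m = 0) ->
  (forall k, (k < n.+1)%N -> forall m, q k.+1 m - q k m = gdiv (e k.+1) m + r k.+1 m) ->
  (forall k, (0 < k < n.+1)%N -> forall m, tau * Num.sqrt (alpha R d m) * coef finset.set0 (w k) m =
     q k m + (q k m - q k.-1 m) + s k m) ->
  (forall k, (k < n.+1)%N -> forall i l,
     (1 + beta d tau l) * (coef ST (e k.+1 i) l - coef ST (e k i) l)
     + kappa d tau l / 2 * (coef ST (e k.+1 i) l + coef ST (e k i) l) =
     F k i l + tau * ip (w k) (dsin i l)) ->
  (forall k, (k < n.+1)%N -> forall N, \sum_i \sum_(l < N) F k i l ^+ 2 <= (C0 * tau ^+ 3) ^+ 2) ->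
  (forall k, (0 < k <= n.+1)%N -> forall M, \sum_(m < M) r k m ^+ 2 <= (C0 * tau ^+ 2) ^+ 2) ->
  (forall k, (1 < k < n.+1)%N -> forall M,
     \sum_(m < M) (r k.+1 m - r k m) ^+ 2 <= (C0 * tau ^+ 3) ^+ 2) ->
  (forall M, \sum_(m < M) s 1%N m ^+ 2 <= (C0 * tau ^+ 2) ^+ 2) ->
  (forall k, (1 < k < n.+1)%N -> forall M, \sum_(m < M) s k m ^+ 2 <= (C0 * tau ^+ 3) ^+ 2) ->
  ip (w 0%N) (w 0%N) <= (C0 * tau) ^+ 2 ->
  forall N M,
  [/\ \sum_(0 <= k < n.+1) \sum_i \sum_(l < N) (coef ST (e k.+1 i) l - coef ST (e k i) l) ^+ 2
        <= C * tau ^+ 3,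
      \sum_(0 <= k < n.+1) \sum_(m < M) (q k.+1 m - q k m) ^+ 2 <= C * tau ^+ 3,
      \sum_(0 <= k < n.+1) \sum_i \sum_(l < N)
        kappa d tau l * (coef ST (e k.+1 i) l + coef ST (e k i) l) ^+ 2 <= C * tau ^+ 2 &
      forall k, (k <= n.+1)%N -> \sum_i \sum_(l < N) beta d tau l * coef ST (e k i) l ^+ 2
        <= C * tau ^+ 2].
Proof.
move=> C1 t0 tC nC le lw e0 q0 qr qw eF Fb rb drb s1b sb w0 N M.
have C00 : 0 < C0 by lra.
have t0' := ltW t0.
(* The squared size of the consistency error of the momentum equation. The truncation errors below
   are made comparable to it. *)
have [del delE] : exists del : R, (C0 * tau ^+ 3) ^+ 2 = del by eexists.
have del0 : 0 < del by rewrite -delE exprn_gt0// mulr_gt0// exprn_gt0.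
have [N' NN' hN'] : exists2 N', (N <= N')%N & forall k i, (k < n.+2)%N ->
    dist2 (e k i) (part ST (coef ST (e k i)) N') <= del.
  have : \forall m \near \oo, forall k : 'I_n.+2, forall i : 'I_d,
      dist2 (e k i) (part ST (coef ST (e k i)) m) <= del.
    apply: filter_forall => k; apply: filter_forall => i.
    by have [m0 hm0] := parseval ST (le k i) del0; exists m0.
  move=> [m0 _ hm0]; exists (maxn N m0); first exact: leq_maxl.
  by move=> k i kn; exact: (hm0 (maxn N m0) (leq_maxr _ _) (Ordinal kn) i).
(* The part of the pressure term that the truncated cosine expansion of [w] misses; it joins the
   source [F]. *)
pose err k i l m := tau * (ip (w k) (dsin i l) -
  \sum_(0 <= j < m) coef finset.set0 (w k) j * coef finset.set0 (dsin i l) j).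
pose del' := del / (d * N').+1%:R.
have del'0 : 0 < del' by rewrite divr_gt0.
have [M' MM' hM'] : exists2 M', (M <= M')%N & forall k i l, (k < n.+1)%N -> (l < N')%N ->
    err k i l M' ^+ 2 <= del'.
  have : \forall m \near \oo, forall k : 'I_n.+1, forall i : 'I_d, forall l : 'I_N',
      err k i l m ^+ 2 <= del'.
    apply: filter_forall => k; apply: filter_forall => i; apply: filter_forall => l.
    have := ip_parseval finset.set0 (lw k) (L2_dsin R i l) => /cvgrPdist_le.
    have sd : 0 < Num.sqrt del' / tau by rewrite divr_gt0// sqrtr_gt0.
    move=> /(_ _ sd); apply: filterS => m hm.
    rewrite /err exprMn -(sqr_sqrtr (ltW del'0)) -[Num.sqrt del'](@divfK _ tau) ?gt_eqF//.
    rewrite [X in _ <= X]exprMn mulrC ler_wpM2r ?sqr_ge0//.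
    by rewrite -[X in X <= _]real_normK ?num_real// lerXn2r// ?nnegrE// ltW.
  move=> [m0 _ hm0]; exists (maxn M m0); first exact: leq_maxl.
  by move=> k i l kn lN; exact: (hm0 (maxn M m0) (leq_maxr _ _) (Ordinal kn) i (Ordinal lN)).
pose I : finType := ('I_d * 'I_N')%type; pose J : finType := 'I_M'.
(* The entries come from [dbas], so that [tmulG G] is [gdiv] of a finite sine sum and inherits its
   contraction property. *)
pose G (p : I) (m : J) : R := (Num.sqrt (alpha R d m))^-1 * coef ST (dbas p.1 m) p.2.
have psum (f : I -> R) : \sum_p f p = \sum_i \sum_l f (i, l).
  by rewrite pair_bigA; apply: eq_bigr => -[].
have tmulGE (f : I -> R) (m : J) : tmulG G f m = gdiv (fun i => comb ST (fun l => f (i, l))) m.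
  rewrite /tmulG /gdiv mulr_sumr psum/=.
  apply: eq_bigr => i _; rewrite ipC ip_comb; last exact: L2_dbas.
  by rewrite mulr_sumr; apply: eq_bigr => l _; rewrite /G/=; ring.
have sqI (f : 'I_d -> nat -> R) : sq (fun p : I => f p.1 p.2) = \sum_i \sum_(l < N') f i l ^+ 2.
  by rewrite /sq psum.
have Gc (f : I -> R) : sq (tmulG G f) <= sq f.
  rewrite {1}/sq; under eq_bigr do rewrite tmulGE.
  apply: (le_trans (gdiv_contr _ _)) => [i|]; first exact: L2_comb.
  rewrite /sq psum/=.
  by apply: ler_sum => i _; exact: comb_sqr_le.
pose ee k (p : I) : R := coef ST (e k p.1) p.2.
(* The sine modes beyond [N'] still contribute to the divergence; their contribution joins [r]. *)
pose tail k i : field := fun x => e k i x - part ST (coef ST (e k i)) N' x.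
have ltail k i : L2 (tail k i) by apply: L2_B => //; exact: L2_part.
pose rr k (m : J) : R := r k m + gdiv (tail k) m.
pose zz k (m : J) : R := q k m - q k.-1 m.
(* The initial pressure error is known in L^2 only, not in the scaled norm of [q], so at the first
   step its whole gradient counts as a source. *)
pose FF k (p : I) : R := if k is 0%N then F 0%N p.1 p.2 + tau * ip (w 0%N) (dsin p.1 p.2)
  else F k p.1 p.2 + err k p.1 p.2 M'.
have tail_sq k : (k < n.+2)%N -> sq (fun m : J => gdiv (tail k) m) <= 3 * del.
  move=> kn; apply: (le_trans (gdiv_contr _ (ltail k))).
  apply: (@le_trans _ _ (\sum_(i < d) del)); first by apply: ler_sum => i _; exact: hN'.
  by rewrite sumr_const card_ord -[leLHS]mulr_natl; apply: ler_wpM2r; [exact: ltW|rewrite ler_nat].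
have err_sq k : (k < n.+1)%N -> sq (fun p : I => err k p.1 p.2 M') <= del.
  move=> kn; rewrite (sqI (fun i l => err k i l M')).
  apply: (@le_trans _ _ (\sum_(i < d) \sum_(l < N') del')).
    by apply: ler_sum => i _; apply: ler_sum => l _; exact: hM'.
  rewrite !sumr_const !card_ord -mulrnA -[leLHS]mulr_natr /del' -mulrA ler_piMr ?(ltW del0)//.
  by rewrite mulrC ler_pdivrMr// mul1r ler_nat mulnC.
(* The factor 10 absorbs the added truncation errors, and the power of [C0] pays for converting
   [tau ^+ 3] into [C0 * tau ^+ 2]. *)
pose C2 := 10 * C0 ^+ 3.
have C03 : C0 <= C0 ^+ 3 by rewrite -[leLHS]expr1 ler_weXn2l.
have C0C2 : 10 * C0 <= C2 by rewrite /C2; lra.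
have t3C : tau ^+ 3 <= C0 * tau ^+ 2 by rewrite exprS ler_wpM2r// sqr_ge0.
have t3 : 0 <= tau ^+ 3 by rewrite exprn_ge0.
have t2 : 0 <= tau ^+ 2 by rewrite exprn_ge0.
have b3 : 100 * del <= (C2 * tau ^+ 3) ^+ 2.
  have -> : 100 * del = (10 * C0 * tau ^+ 3) ^+ 2 by rewrite -delE; ring.
  by apply: ler_sqr_le; [rewrite !mulr_ge0// ltW|rewrite ler_wpM2r].
have b2 : 10 * ((C0 * tau ^+ 2) ^+ 2 + del) <= (C2 * tau ^+ 2) ^+ 2.
  have c2 : 1 <= C0 ^+ 2 by rewrite exprn_ege1.
  have -> : (C2 * tau ^+ 2) ^+ 2 = 100 * (C0 ^+ 2 * C0 ^+ 2 * (C0 * tau ^+ 2) ^+ 2) by rewrite /C2; ring.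
  have x0 := sqr_ge0 (C0 * tau ^+ 2).
  have h1 : del <= C0 ^+ 2 * (C0 * tau ^+ 2) ^+ 2.
    rewrite -delE -exprMn; apply: ler_sqr_le; first by rewrite mulr_ge0// ltW.
    by rewrite ler_wpM2l// ltW.
  have h2 : C0 ^+ 2 * (C0 * tau ^+ 2) ^+ 2 <= C0 ^+ 2 * C0 ^+ 2 * (C0 * tau ^+ 2) ^+ 2.
    by rewrite ler_wpM2r// ler_peMl// sqr_ge0.
  have h3 : (C0 * tau ^+ 2) ^+ 2 <= C0 ^+ 2 * (C0 * tau ^+ 2) ^+ 2 by rewrite ler_peMl.
  by lra.
have [] := @splitting_stability R I J G (fun p => kappa d tau p.2) (fun p => beta d tau p.2)
  (fun p => kappa_ge0 d p.2 t0') (fun p => beta_ge0 d p.2 t0') Gc C2 n tau ee FF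
  (fun k m => q k m) zz (fun k m => s k m) rr.
- by lra.
- by [].
- by lra.
- by lra.
- by move=> p; exact: e0.
- by move=> m; exact: q0.
- move=> p; have := eF 0%N isT p.1 p.2; rewrite !e0 subr0 addr0; exact.
(* The gradient of [w 0] is moved onto the test vector: [V i] is the derivative along [i] of the
   sine sum with coefficients [f], and [tau] times its square is bounded by the [kappa] term. The
   remaining powers, [tau ^+ 2] from [w 0] and [tau] from the equation, give [tau ^+ 3]. *)
- move=> f; pose V i := comb (~: [set i]%SET) (fun l : 'I_N' => f (i, l) * (pi * (freq l i)%:R)).
  have lV i : L2 (V i) by exact: L2_comb.
  have E : dot (FF 0%N) f = dot (fun p : I => F 0%N p.1 p.2) f + tau * ip (w 0%N) (fun x => \sum_i V i x).
    rewrite /dot /FF; under eq_bigr do rewrite mulrDl.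
    rewrite big_split/=; congr (_ + _); rewrite ip_sumr// mulr_sumr.
    rewrite psum/=.
    apply: eq_bigr => i _; rewrite ip_comb// mulr_sumr; apply: eq_bigr => l _.
    by rewrite ip_Zr//; [rewrite /coef; ring|exact: L2_bas].
  have h1 : dot (fun p : I => F 0%N p.1 p.2) f ^+ 2 <= del * sq f.
    by apply: (le_trans (dot_CS2 _ _)); rewrite ler_wpM2r ?sq_ge0// (sqI (F 0%N)) -delE Fb.
  have h2 : (tau * ip (w 0%N) (fun x => \sum_i V i x)) ^+ 2 <=
      3 * C0 ^+ 2 * tau ^+ 3 * wsq (fun p : I => kappa d tau p.2) f.
    have lS : L2 (fun x => \sum_i V i x) by exact: L2_sum.
    have VV : ip (fun x => \sum_i V i x) (fun x => \sum_i V i x) <= 3 * \sum_i ip (V i) (V i).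
      rewrite ip_suml//; under eq_bigr do rewrite ip_sumr//.
      apply: (@le_trans _ _ (\sum_i \sum_j (2^-1 * ip (V i) (V i) + 2^-1 * ip (V j) (V j)))).
        apply: ler_sum => i _; apply: ler_sum => j _.
        have := ip_ge0 (fun x => V i x - V j x); rewrite ip_Bl//; last exact: L2_B.
        by rewrite !ip_Br// (ipC (V j) (V i)); lra.
      have -> : \sum_(i < d) \sum_(j < d) (2^-1 * ip (V i) (V i) + 2^-1 * ip (V j) (V j)) =
          d%:R * \sum_i ip (V i) (V i).
        under eq_bigr do rewrite big_split/= sumr_const card_ord -mulr_sumr -[_ *+ d]mulr_natl.
        by rewrite big_split/= -!mulr_sumr sumr_const card_ord -[_ *+ d]mulr_natl; field.
      apply: ler_wpM2r; last by rewrite ler_nat.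
      by apply: sumr_ge0 => i _; exact: ip_ge0.
    have VK : tau * \sum_i ip (V i) (V i) <= wsq (fun p : I => kappa d tau p.2) f.
      rewrite /wsq psum/= mulr_sumr.
      apply: ler_sum => i _; apply: (le_trans (ler_wpM2l t0' (comb_sqr_le _ _))).
      rewrite mulr_sumr; apply: ler_sum => l _; rewrite /kappa exprMn -/(lam R l i).
      rewrite [f _ ^+ 2 * _]mulrC mulrA ler_wpM2r ?sqr_ge0// ler_wpM2l//.
      by rewrite (bigD1 i)//= lerDl sumr_ge0// => j _; exact: lam_ge0.
    rewrite exprMn; apply: (le_trans (ler_wpM2l t2 (ip_CS2 (lw 0%N) lS))).
    apply: (@le_trans _ _ (tau ^+ 2 * ((C0 * tau) ^+ 2 * (3 * \sum_i ip (V i) (V i))))).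
      by rewrite ler_wpM2l// ler_pM// ip_ge0.
    have -> : tau ^+ 2 * ((C0 * tau) ^+ 2 * (3 * \sum_i ip (V i) (V i))) =
      3 * C0 ^+ 2 * tau ^+ 3 * (tau * \sum_i ip (V i) (V i)) by ring.
    apply: ler_wpM2l; last exact: VK.
    by apply: mulr_ge0 t3; apply: mulr_ge0; [exact: ler0n|exact: sqr_ge0].
  rewrite E; set a := dot _ f in h1 *; set b := tau * ip _ _ in h2 *.
  have h3 : (a + b) ^+ 2 <= 2 * a ^+ 2 + 2 * b ^+ 2 by have := sqr_ge0 (a - b); lra.
  apply: (le_trans h3).
  have W0 : 0 <= wsq (fun p : I => kappa d tau p.2) f.
    by apply: sumr_ge0 => p _; rewrite mulr_ge0 ?sqr_ge0// kappa_ge0.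
  have S0 := sq_ge0 f.
  have c1 : 6 * (C0 ^+ 2 * tau ^+ 3) <= C2 ^+ 2 * tau ^+ 3.
    rewrite mulrA ler_wpM2r//; have : (10 * C0) ^+ 2 <= C2 ^+ 2.
      by apply: ler_sqr_le => //; rewrite mulr_ge0// ltW.
    by rewrite exprMn; have := sqr_ge0 C0; lra.
  have c2 : 2 * del <= C2 ^+ 2 * tau ^+ 3.
    have -> : 2 * del = 2 * C0 ^+ 2 * tau ^+ 3 * tau ^+ 3 by rewrite -delE; ring.
    rewrite ler_wpM2r//; apply: (@le_trans _ _ (2 * C0 ^+ 2 * C0 ^+ 3)).
      have tC3 : tau ^+ 3 <= C0 ^+ 3 by rewrite lerXn2r ?nnegrE// ltW.
      by apply: ler_wpM2l tC3; apply: mulr_ge0; [exact: ler0n|exact: sqr_ge0].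
    have -> : C2 ^+ 2 = 100 * C0 ^+ 3 * C0 ^+ 3 by rewrite /C2; ring.
    have : C0 ^+ 2 <= C0 ^+ 3 by rewrite ler_weXn2l.
    have : 0 <= C0 ^+ 3 by rewrite exprn_ge0 ?ltW.
    by nra.
  rewrite mulrDr; apply: lerD.
    apply: (@le_trans _ _ (2 * del * sq f)); first by rewrite -mulrA ler_wpM2l.
    by rewrite ler_wpM2r.
  apply: (@le_trans _ _ (6 * (C0 ^+ 2 * tau ^+ 3) * wsq (fun p : I => kappa d tau p.2) f)).
    have -> : 6 * (C0 ^+ 2 * tau ^+ 3) * wsq (fun p : I => kappa d tau p.2) f =
      2 * (3 * C0 ^+ 2 * tau ^+ 3 * wsq (fun p : I => kappa d tau p.2) f) by ring.
    by rewrite ler_wpM2l.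
  by rewrite ler_wpM2r.
- move=> k kn p; have /andP[k0 kn'] := kn.
  have := eF k kn' p.1 p.2; rewrite -/(ee k.+1 p) -/(ee k p) => ->.
  rewrite /FF; case: k k0 kn kn' => // k _ kn kn'.
  suff -> : mulG G (fun j : J => q k.+1 j + zz k.+1 j + s k.+1 j) p =
      - (tau * \sum_(0 <= j < M') coef finset.set0 (w k.+1) j * coef finset.set0 (dsin p.1 p.2) j).
    by rewrite /err; ring.
  rewrite /mulG big_mkord mulr_sumr -sumrN; apply: eq_bigr => m _.
  rewrite /zz -(qw _ kn m) /G ip_dbas_dsin//.
  have sa : Num.sqrt (alpha R d m) != 0 by rewrite gt_eqF// sqrtr_gt0 alpha_gt0.
  by field.
- move=> k /andP[k0 kn] m; case: k k0 kn => // k _ kn.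
  rewrite /zz (qr k kn m) tmulGE /rr [RHS]addrCA [LHS]addrC; congr (_ + _).
  rewrite /gdiv -mulrDr -big_split/=; congr (_ * _); apply: eq_bigr => i _.
  rewrite /tail ip_Bl//; [|exact: L2_part|exact: L2_dbas].
  by rewrite part_comb addrC subrK.
- by move=> k kn m; rewrite /zz /= addrC subrK.
- move=> k /andP[k0 kn]; have h := err_sq k kn; have h' := Fb k kn N'.
  rewrite -(sqI (F k)) delE in h'; apply: le_trans b3.
  have := sqD_le2 (fun p : I => F k p.1 p.2) (fun p : I => err k p.1 p.2 M').
  rewrite /FF; case: k k0 kn h h' => // k _ kn h h' h2; apply: (le_trans h2).
  by move: h h' (ltW del0); clear; lra.
- move=> k /andP[k0 kn]; have h := tail_sq k kn; have h' := rb k ltac:(by rewrite k0) M'.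
  rewrite -/(sq (fun m : J => r k m)) in h'; apply: le_trans b2.
  apply: (le_trans (sqD_le2 (fun m : J => r k m) (fun m => gdiv (tail k) m))).
  by move: h h' (ltW del0) (sqr_ge0 (C0 * tau ^+ 2)); clear; lra.
- move=> k /andP[k0 kn]; have h := tail_sq k (leqW kn).
  have h2 := tail_sq k.+1 kn; have h' := drb k ltac:(by rewrite k0) M'.
  rewrite -/(sq (fun m : J => r k.+1 m - r k m)) delE in h'; apply: le_trans b3.
  have -> : sq (fun j => rr k.+1 j - rr k j) = sq (fun m : J => (r k.+1 m - r k m) +
      (gdiv (tail k.+1) m - gdiv (tail k) m)).
    apply: eq_bigr => m _; rewrite /rr; congr (_ ^+ 2).
    by move: (r k.+1 m) (r k m) (gdiv _ m) (gdiv _ m) => x y x' y'; ring.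
  apply: (le_trans (sqD_le2 (fun m : J => r k.+1 m - r k m) _)).
  have := sqB_le2 (fun m : J => gdiv (tail k.+1) m) (fun m => gdiv (tail k) m).
  by move: h h2 h' (ltW del0); clear; lra.
- have := s1b M'; rewrite -/(sq (fun m : J => s 1%N m)) => h; apply: (le_trans h); apply: le_trans b2.
  by move: (sqr_ge0 (C0 * tau ^+ 2)) (ltW del0); clear; lra.
- move=> k kn; have := sb k kn M'; rewrite -/(sq (fun m : J => s k m)) delE => h.
  have H : del <= (C2 * tau ^+ 3) ^+ 2 by move: (ltW del0) b3; clear; lra.
  exact: le_trans h H.
have shrinkN (x : 'I_d -> nat -> R) : (forall i l, 0 <= x i l) ->
    \sum_i \sum_(l < N) x i l <= \sum_i \sum_(l < N') x i l.
  move=> x0; apply: ler_sum => i _; rewrite -!(big_mkord xpredT (x i)) [leRHS](big_cat_nat (n := N))//=.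
  by rewrite lerDl sumr_ge0.
have shrinkM (x : nat -> R) : (forall l, 0 <= x l) -> \sum_(l < M) x l <= \sum_(l < M') x l.
  move=> x0; rewrite -!(big_mkord xpredT x) [leRHS](big_cat_nat (n := M))//=.
  by rewrite lerDl sumr_ge0.
rewrite -/C => r1 r2 r3 r4; split.
- apply: le_trans r1; apply: ler_sum => k _.
  rewrite (sqI (fun i l => coef ST (e k.+1 i) l - coef ST (e k i) l)).
  by apply: (shrinkN (fun i l => (coef ST (e k.+1 i) l - coef ST (e k i) l) ^+ 2)) => i l; exact: sqr_ge0.
- apply: le_trans r2; apply: ler_sum => k _.
  by apply: (shrinkM (fun l => (q k.+1 l - q k l) ^+ 2)) => l; exact: sqr_ge0.
- apply: le_trans r3; apply: ler_sum => k _.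
  rewrite /wsq psum/=.
  by apply: (shrinkN (fun i l => kappa d tau l * (coef ST (e k.+1 i) l + coef ST (e k i) l) ^+ 2)) => i l; rewrite mulr_ge0 ?sqr_ge0// kappa_ge0.
- move=> k kn; apply: le_trans (r4 k kn).
  rewrite /wsq psum/=.
  by apply: (shrinkN (fun i l => beta d tau l * coef ST (e k i) l ^+ 2)) => i l; rewrite mulr_ge0 ?sqr_ge0// beta_ge0.
Qed.

End semi_discrete.

(** * Comparison of the symbols *)

Section symbols.
Context (R : realType) (d : nat).
Implicit Types (tau : R) (l : nat).

Lemma sum_card1 (F : {set 'I_d} -> R) :
  \sum_(A : {set 'I_d} | #|A| == 1%N) F A = \sum_i F [set i]%SET.
Proof.
rewrite -(big_imset (h := fun i => [set i]%SET) F (A := 'I_d))/=; last by move=> i j _ _; exact: set1_inj.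
apply: eq_bigl => A; apply/cards1P/imsetP => [[i ->]|[i _ ->]]; by exists i.
Qed.

(** The product is expanded over sets of coordinates. Sizes 0 and 1 cancel, sizes 2 and 3 have
    weights [tau ^+ 2 / 4] and [tau ^+ 3 / 8], whence the factor [tau / 2] inside [B], and [d <= 3]
    excludes larger sets. *)
Lemma beta_B tau l : (d <= 3)%N -> beta d tau l = tau ^+ 2 / 4 * B_coef d tau l.
Proof.
move=> d3; pose F (A : {set 'I_d}) : R := \prod_(i in A) (tau / 2 * lam R l i).
have FE A : F A = (tau / 2) ^+ #|A| * \prod_(i in A) lam R l i.
  by rewrite /F big_split/= prodr_const.
have E : \prod_(j : 'I_d) (1 + tau / 2 * lam R l j) = \sum_(A : {set 'I_d}) F A.
  under eq_bigr do rewrite addrC.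
  rewrite bigA_distr; apply: eq_bigr => A _; rewrite /F [RHS]big_mkcond.
  by apply: eq_bigr => i _; case: ifP.
have E2 : \sum_(A : {set 'I_d}) F A = \sum_(A : {set 'I_d} | #|A| == 0%N) F A +
    \sum_(A : {set 'I_d} | #|A| == 1%N) F A + \sum_(A : {set 'I_d} | #|A| == 2%N) F A +
    \sum_(A : {set 'I_d} | #|A| == 3%N) F A.
  rewrite (big_mkcond (fun A : {set 'I_d} => #|A| == 0%N)) (big_mkcond (fun A : {set 'I_d} => #|A| == 1%N))
    (big_mkcond (fun A : {set 'I_d} => #|A| == 2%N)) (big_mkcond (fun A : {set 'I_d} => #|A| == 3%N)).
  rewrite -!big_split/=; apply: eq_bigr => A _.
  have : (#|A| <= 3)%N by apply: leq_trans (max_card _) _; rewrite card_ord.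
  by case: #|A| => [|[|[|[|]]]]//= _; rewrite ?addr0 ?add0r.
have E0 : \sum_(A : {set 'I_d} | #|A| == 0%N) F A = 1.
  rewrite (eq_bigl (fun A : {set 'I_d} => A == finset.set0)); last by move=> A; exact: cards_eq0.
  by rewrite big_pred1_eq /F big_set0.
rewrite /beta E E2 E0 sum_card1 /B_coef.
have -> : \sum_i F [set i]%SET = tau / 2 * \sum_(j : 'I_d) lam R l j.
  by rewrite mulr_sumr; apply: eq_bigr => i _; rewrite /F big_set1.
have S2 : \sum_(A : {set 'I_d} | #|A| == 2%N) F A =
    (tau / 2) ^+ 2 * \sum_(A : {set 'I_d} | #|A| == 2%N) \prod_(i in A) lam R l i.
  by rewrite mulr_sumr; apply: eq_bigr => A /eqP cA; rewrite FE cA.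
have S3 : \sum_(A : {set 'I_d} | #|A| == 3%N) F A =
    (tau / 2) ^+ 3 * \sum_(A : {set 'I_d} | #|A| == 3%N) \prod_(i in A) lam R l i.
  by rewrite mulr_sumr; apply: eq_bigr => A /eqP cA; rewrite FE cA.
rewrite S2 S3; move: (\sum_(A : {set 'I_d} | #|A| == 2%N) \prod_(i in A) lam R l i)
  (\sum_(A : {set 'I_d} | #|A| == 3%N) \prod_(i in A) lam R l i) (\sum_(j : 'I_d) lam R l j) => a b c.
by field.
Qed.

Definition pairs l : R := \sum_(A : {set 'I_d} | #|A| == 2%N) \prod_(i in A) lam R l i.
Definition triples l : R := \sum_(A : {set 'I_d} | #|A| == 3%N) \prod_(i in A) lam R l i.

Lemma B_coefE tau l : B_coef d tau l = pairs l + tau / 2 * triples l.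
Proof. by []. Qed.

Lemma pairs_ge0 l : 0 <= pairs l.
Proof. by apply: sumr_ge0 => A _; exact: prod_lam_ge0. Qed.

Lemma triples_ge0 l : 0 <= triples l.
Proof. by apply: sumr_ge0 => A _; exact: prod_lam_ge0. Qed.

Lemma pairs_le_B tau l : 0 <= tau -> pairs l <= B_coef d tau l.
Proof. by move=> t0; rewrite B_coefE lerDl mulr_ge0 ?triples_ge0// divr_ge0. Qed.

Lemma B_coef_le tau l : 0 <= tau -> B_coef d tau l <= (1 + tau) * B_coef d 1 l.
Proof. by move=> t0; rewrite !B_coefE; have := pairs_ge0 l; have := triples_ge0 l; nra. Qed.

(** When all frequencies are nonzero every [lam] is at least 1, so multiplying by a second one only
    increases. This is how [B] controls the Laplacian on sine series. *)
Lemma lam_le_pairs l (i : 'I_d) : (2 <= d)%N -> (forall j : 'I_d, freq l j != 0%N) ->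
  lam R l i <= pairs l.
Proof.
move=> d2 fl; have [j ij] : exists j : 'I_d, i != j.
  have : (1 < #|[set: 'I_d]%SET|)%N by rewrite cardsT card_ord.
  move=> /card_gt1P[x [y [_ _ xy]]]; case: (eqVneq i x) => [->|ix]; [by exists y|by exists x].
rewrite /pairs (bigD1 [set i; j]%SET)/=; last by rewrite cards2 ij.
rewrite big_setU1 ?big_set1/= ?inE//; have := lam_ge1 R (fl j); have := lam_ge0 R l i.
have : 0 <= \sum_(A : {set 'I_d} | (#|A| == 2%N) && (A != [set i; j]%SET)) \prod_(k in A) lam R l k.
  by apply: sumr_ge0 => A _; exact: prod_lam_ge0.
by nra.
Qed.

Lemma pairs_ge1 l : (2 <= d)%N -> (forall j : 'I_d, freq l j != 0%N) -> 1 <= pairs l.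
Proof.
move=> d2 fl; have i : 'I_d by exact: (Ordinal (leq_trans (isT : (0 < 2)%N) d2)).
exact: le_trans (lam_ge1 R (fl i)) (lam_le_pairs i d2 fl).
Qed.

Lemma coef_null (v : scalar_field R d) l (j : 'I_d) : L2 v -> freq l j = 0%N ->
  coef [set: 'I_d]%SET v l = 0.
Proof.
move=> lv fj; apply: coef0 => //; rewrite bas_orth eqxx /=.
case: (boolP [forall i, _]) => [/forallP/(_ j)|_]; last by rewrite andbF.
by rewrite inE/= fj.
Qed.

(** Symbols need comparison only where all frequencies are nonzero: elsewhere the sine mode is
    null. *)
Lemma coef_dominated (v : scalar_field R d) (x y : nat -> R) l : L2 v ->
  ((forall j : 'I_d, freq l j != 0%N) -> 0 <= x l <= y l) ->
  (x l * coef [set: 'I_d]%SET v l) ^+ 2 <= (y l * coef [set: 'I_d]%SET v l) ^+ 2.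
Proof.
move=> lv h; have [fl|/existsNP[j /negP]] := pselect (forall j : 'I_d, freq l j != 0%N); last first.
  by rewrite negbK => /eqP fj; rewrite (coef_null lv fj) !mulr0.
have /andP[x0 xy] := h fl; rewrite !exprMn ler_wpM2r ?sqr_ge0//.
exact: ler_sqr_le.
Qed.

Lemma sum_lam_le l : (2 <= d)%N -> (d <= 3)%N -> (forall j : 'I_d, freq l j != 0%N) ->
  \sum_(j : 'I_d) lam R l j <= 3 * pairs l.
Proof.
move=> d2 d3 fl; apply: (@le_trans _ _ (\sum_(j < d) pairs l)).
  by apply: ler_sum => j _; exact: lam_le_pairs.
rewrite sumr_const card_ord -[leLHS]mulr_natl ler_wpM2r ?pairs_ge0// ler_nat//.
Qed.

End symbols.

(** * Consistency errors *)

Section consistency.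
Context (R : realType) (d : nat) (d0 : (0 < d)%N) (d2 : (2 <= d)%N) (d3 : (d <= 3)%N).
Local Notation field := (scalar_field R d).
Local Notation ST := [set: 'I_d]%SET.
Implicit Types (g : R -> field) (T t tau : R).

(** The residual of the exact velocity in the factored momentum equation: time derivative, average
    over the step, and splitting term. *)
Definition defect T tau t g (gt : field) (l : nat) : R :=
  coef ST (fun x => extrapf T tau t g x - g t x - tau * gt x) l
  + tau * (\sum_(j : 'I_d) lam R l j) *
     coef ST (fun x => 2^-1 * (extrapf T tau t g x + g t x) - g (t + tau / 2) x) l
  + beta d tau l * coef ST (fun x => extrapf T tau t g x - g t x) l.

(** Orders are traded term by term: third differences in L^2, second differences weighted by [B]
    with one power of [tau] from the Laplacian term, first differences weighted by [B] with two
    powers from [beta]. *)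
Lemma defect_bound T g : 0 < T ->
  Winfty (@H2 R d) (@normH2 R d) 3 T g -> Winfty (@DB R d 1) (@normDB R d 1) 2 T g ->
  exists2 M, 0 <= M & forall t tau gt, 0 < tau -> tau <= 2 * T -> 0 <= t -> t + tau / 2 <= T ->
    is_time_derivative T g (t + tau / 2) gt ->
    forall N, \sum_(l < N) (defect T tau t g gt l) ^+ 2 <= (M * tau ^+ 3) ^+ 2.
Proof.
move=> T0 Wg Wb; have lg := curve_L2 Wg.
have [M1 M10 h1] := velocity_derivative_bound T0 Wg.
have [M2 M20 [_ h2]] := velocity_B_bound d0 T0 Wb.
exists (2 * M1 + 6 * M2 + 2 * (1 + 2 * T) * M2) => [|t tau gt tau0 tauT t0 tT Hd N].
  by rewrite !addr_ge0 ?mulr_ge0// ?addr_ge0 ?mulr_ge0// ltW.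
have tau0' := ltW tau0; have t3 : 0 <= tau ^+ 3 by rewrite exprn_ge0.
have lt : L2 (g t) by apply: lg; apply/andP; split; lra.
have lm : L2 (g (t + tau / 2)) by apply: lg; apply/andP; split; lra.
have lE := L2_extrapf tau0 t0 tT lg; have lgt := Hd.1.
have a1 := h1 t tau gt tau0 t0 tT Hd N; have [a3 a2] := h2 t tau tau0 t0 tT N.
rewrite !big_mkord in a1 a2 a3.
set E1 := (fun x => extrapf T tau t g x - g t x - tau * gt x) in a1.
set E2 := (fun x => 2^-1 * (extrapf T tau t g x + g t x) - g (t + tau / 2) x) in a2.
set E3 := (fun x => extrapf T tau t g x - g t x) in a3.
have lE2 : L2 E2 by apply: L2_B => //; apply: L2_Z; exact: L2_D.
have lE3 : L2 E3 by exact: L2_B.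
have b2 : \sum_(l < N) (tau * (\sum_(j : 'I_d) lam R l j) * coef ST E2 l) ^+ 2 <= (3 * M2 * tau ^+ 3) ^+ 2.
  apply: (@le_trans _ _ ((3 * tau) ^+ 2 * (M2 * tau ^+ 2) ^+ 2)); last first.
    by rewrite le_eqVlt; apply/orP; left; apply/eqP; ring.
  apply: le_trans (ler_wpM2l (sqr_ge0 _) a2).
  rewrite mulr_sumr; apply: ler_sum => l _; rewrite -exprMn mulrA.
  apply: (coef_dominated (x := fun l => tau * (\sum_(j : 'I_d) lam R l j)) (y := fun l => 3 * tau * B_coef d 1 l)) => // fl.
  apply/andP; split; first by rewrite mulr_ge0// sumr_ge0// => j _; exact: lam_ge0.
  rewrite [3 * tau]mulrC -mulrA ler_wpM2l//; apply: (le_trans (sum_lam_le R d2 d3 fl)).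
  by rewrite ler_wpM2l//; apply: pairs_le_B; exact: ler01.
have b3 : \sum_(l < N) (beta d tau l * coef ST E3 l) ^+ 2 <= ((1 + 2 * T) * M2 * tau ^+ 3) ^+ 2.
  apply: (@le_trans _ _ ((tau ^+ 2 * (1 + 2 * T)) ^+ 2 * (M2 * tau) ^+ 2)); last first.
    by rewrite le_eqVlt; apply/orP; left; apply/eqP; ring.
  apply: le_trans (ler_wpM2l (sqr_ge0 _) a3).
  rewrite mulr_sumr; apply: ler_sum => l _; rewrite -exprMn mulrA.
  apply: (coef_dominated (x := beta d tau) (y := fun l => tau ^+ 2 * (1 + 2 * T) * B_coef d 1 l)) => // fl.
  apply/andP; split; first exact: beta_ge0.
  rewrite beta_B// -[leLHS]mulrA -[leRHS]mulrA ler_wpM2l ?sqr_ge0//.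
  have B1 : 0 <= B_coef d (1 : R) l by apply: le_trans (@pairs_ge0 R d l) _; apply: pairs_le_B; exact: ler01.
  have h := B_coef_le d l tau0'; have tB : (1 + tau) * B_coef d 1 l <= (1 + 2 * T) * B_coef d 1 l.
    by rewrite ler_wpM2r//; lra.
  have hp : 0 <= B_coef d tau l by apply: le_trans (@pairs_ge0 R d l) _; exact: pairs_le_B.
  by lra.
have D3 (x y z : 'I_N -> R) (a b c : R) : 0 <= a -> 0 <= b -> 0 <= c ->
    \sum_l x l ^+ 2 <= a ^+ 2 -> \sum_l y l ^+ 2 <= b ^+ 2 -> \sum_l z l ^+ 2 <= c ^+ 2 ->
    \sum_l (x l + y l + z l) ^+ 2 <= (2 * a + 2 * b + 2 * c) ^+ 2.
  move=> a0 b0 c0 ha hb hc.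
  have := sqD_le2 (fun l => x l + y l) z; have := sqD_le2 x y; rewrite /sq => k1 k2.
  apply: (le_trans k2); have := mulr_ge0 a0 b0; have := mulr_ge0 b0 c0; have := mulr_ge0 a0 c0.
  have := sqr_ge0 a; have := sqr_ge0 b; have := sqr_ge0 c; lra.
have M1t : 0 <= M1 * tau ^+ 3 by rewrite mulr_ge0.
have M2t : 0 <= 3 * M2 * tau ^+ 3 by rewrite !mulr_ge0.
have M3t : 0 <= (1 + 2 * T) * M2 * tau ^+ 3 by rewrite !mulr_ge0//; lra.
have := D3 _ _ _ _ _ _ M1t M2t M3t a1 b2 b3.
have -> : 2 * (M1 * tau ^+ 3) + 2 * (3 * M2 * tau ^+ 3) + 2 * ((1 + 2 * T) * M2 * tau ^+ 3) =
   (2 * M1 + 6 * M2 + 2 * (1 + 2 * T) * M2) * tau ^+ 3 by ring.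
exact.
Qed.

(** The zero mean lets the weight absorb the 1 in [alpha = 1 + Y_weight ^+ 2]. *)
Lemma alpha_coef (q : field) l : zero_mean q ->
  (Num.sqrt (alpha R d l) * coef finset.set0 q l) ^+ 2 <= 2 * (Y_weight R d l * coef finset.set0 q l) ^+ 2.
Proof.
move=> zq; have h := coef_weight l zq; have E : alpha R d l = 1 + Y_weight R d l ^+ 2 by rewrite -prod_1lam.
have F : Num.sqrt (alpha R d l) ^+ 2 = 1 + Y_weight R d l ^+ 2 by rewrite sqr_sqrtr// ltW// alpha_gt0.
by move: h; rewrite [X in _ -> X <= _]exprMn F !exprMn; lra.
Qed.

Lemma alpha_sum (q : field) (tau a : R) M : 0 <= a -> zero_mean q ->
  (forall n, \sum_(0 <= l < n) (Y_weight R d l * coef finset.set0 q l) ^+ 2 <= a ^+ 2) ->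
  \sum_(l < M) (tau * Num.sqrt (alpha R d l) * coef finset.set0 q l) ^+ 2 <= (2 * tau * a) ^+ 2.
Proof.
move=> a0 zq h; have := h M; rewrite big_mkord => hM.
apply: (@le_trans _ _ (2 * tau ^+ 2 * \sum_(l < M) (Y_weight R d l * coef finset.set0 q l) ^+ 2)).
  rewrite mulr_sumr; apply: ler_sum => l _; have := alpha_coef l zq.
  rewrite -mulrA [X in _ -> X <= _]exprMn => k; apply: (le_trans (ler_wpM2l (sqr_ge0 tau) k)).
  by rewrite mulrCA mulrA.
apply: (le_trans (ler_wpM2l _ hM)); first by rewrite mulr_ge0// sqr_ge0.
by have := sqr_ge0 (tau * a); rewrite !exprMn; lra.
Qed.

Lemma zero_mean_B (v w : field) : zero_mean v -> zero_mean w -> zero_mean (fun x => v x - w x).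
Proof.
move=> zv zw; have lv := zv.1; have lw := zw.1; apply/(zero_meanE (L2_B lv lw)).
by rewrite ip_Bl//; [rewrite ((zero_meanE lv).1 zv) ((zero_meanE lw).1 zw) subrr|exact: L2_cst].
Qed.

End consistency.

(** * Double sums and monotone limits *)

Section sums.
Context (R : realType).

Lemma weighted_CS (I J : finType) (w a b : I -> J -> R) : (forall i j, 0 <= w i j) ->
  (\sum_i \sum_j w i j * a i j * b i j) ^+ 2 <=
  (\sum_i \sum_j w i j * a i j ^+ 2) * (\sum_i \sum_j w i j * b i j ^+ 2).
Proof.
move=> w0; rewrite !pair_bigA/=.
pose f (p : I * J) := Num.sqrt (w p.1 p.2) * a p.1 p.2; pose g (p : I * J) := Num.sqrt (w p.1 p.2) * b p.1 p.2.
have -> : \sum_p w p.1 p.2 * a p.1 p.2 * b p.1 p.2 = dot f g.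
  by apply: eq_bigr => p _; rewrite /f /g mulrACA -expr2 sqr_sqrtr ?w0// mulrA.
have -> : \sum_p w p.1 p.2 * a p.1 p.2 ^+ 2 = sq f.
  by apply: eq_bigr => p _; rewrite /f exprMn sqr_sqrtr ?w0.
have -> : \sum_p w p.1 p.2 * b p.1 p.2 ^+ 2 = sq g.
  by apply: eq_bigr => p _; rewrite /g exprMn sqr_sqrtr ?w0.
exact: dot_CS2.
Qed.

Lemma cvg_le_const (u : R^nat) (l B : R) : u n @[n --> \oo] --> l -> (forall n, u n <= B) -> l <= B.
Proof.
move=> ul uB; rewrite -(cvg_lim (@Rhausdorff R) ul).
by apply: limr_le; [apply/cvg_ex; exists l|exact: nearW].
Qed.

(** The stability bounds hold for each truncation [N] after summation over the steps. Monotone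
    limits provide one bound for each step, valid for all truncations, with the same total. *)
Lemma sum_of_suprema (y : nat -> nat -> R) n (B : R) : (forall k N, 0 <= y k N) ->
  (forall k N N', (N <= N')%N -> y k N <= y k N') ->
  (forall N, \sum_(0 <= k < n) y k N <= B) ->
  exists Y : nat -> R, [/\ forall k, 0 <= Y k, forall k N, (k < n)%N -> y k N <= Y k &
    \sum_(0 <= k < n) Y k <= B].
Proof.
move=> y0 yN yB; pose Y k := if (k < n)%N then lim (y k N @[N --> \oo]) else 0.
have cY k : (k < n)%N -> y k N @[N --> \oo] --> Y k.
  move=> kn; rewrite /Y kn; apply: nondecreasing_is_cvgn; first by move=> a b; exact: yN.
  exists B => _ [N _ <-]; apply: le_trans (yB N).
  rewrite (big_cat_nat (n := k))//=; last exact: ltnW.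
  rewrite (big_ltn kn)/= addrCA lerDl addr_ge0// sumr_ge0//.
have YN k N : (k < n)%N -> y k N <= Y k.
  move=> kn; have /cvgP ck := cY _ kn; rewrite -(cvg_lim (@Rhausdorff R) (cY _ kn)).
  by apply: nondecreasing_cvgn_le => // a b; exact: yN.
exists Y; split => //.
  move=> k; have [kn|nk] := ltnP k n; first by apply: le_trans (YN k 0%N kn).
  by rewrite /Y ltnNge nk.
have cS m : (m <= n)%N -> \sum_(0 <= k < m) y k N @[N --> \oo] --> \sum_(0 <= k < m) Y k.
  elim: m => [_|m IH mn].
    by under eq_fun do rewrite big_geq//; rewrite big_geq//; exact: cvg_cst.
  under eq_fun do rewrite big_nat_recr//=; rewrite big_nat_recr//=.
  by apply: cvgD; [apply: IH; exact: ltnW|exact: cY].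
exact: cvg_le_const (cS n (leqnn n)) yB.
Qed.

Lemma sqr_sum5 (a b c e f : R) :
  (a + b + c + e + f) ^+ 2 <= 5 * (a ^+ 2 + b ^+ 2 + c ^+ 2 + e ^+ 2 + f ^+ 2).
Proof.
have := sqr_ge0 (a - b); have := sqr_ge0 (a - c); have := sqr_ge0 (a - e); have := sqr_ge0 (a - f).
have := sqr_ge0 (b - c); have := sqr_ge0 (b - e); have := sqr_ge0 (b - f).
have := sqr_ge0 (c - e); have := sqr_ge0 (c - f); have := sqr_ge0 (e - f); lra.
Qed.

End sums.

(** * The norm of [Z] in sine coefficients *)

Section Z_norm.
Context (R : realType) (d : nat) (d0 : (0 < d)%N) (d2 : (2 <= d)%N) (d3 : (d <= 3)%N).
Local Notation field := (scalar_field R d).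
Local Notation ST := [set: 'I_d]%SET.

Lemma Z_L2 (v : vector_field R d) i : Z v -> L2 (v i).
Proof. by move=> /(_ i)[[h _] _]; exact: weakly_diff_L2 (h i). Qed.

Lemma Z_coef_sum tau (v : vector_field R d) N : 0 <= tau -> Z v ->
  \sum_i \sum_(l < N) B_coef d tau l * coef ST (v i) l ^+ 2 <= normZ tau v ^+ 2.
Proof.
move=> t0 Zv; rewrite /normZ sqr_sqrtr; last first.
  by apply: sumr_ge0 => i _; apply: addr_ge0; rewrite ?mulr_ge0 ?divr_ge0//; apply: sumr_ge0 => A _; exact: sqr_ge0.
apply: ler_sum => i _; have [hv wd] := Zv i.
have S (A : {set 'I_d}) : (#|A| == 2) || (#|A| == 3) ->
    \sum_(l < N) (\prod_(j in A) lam R l j) * coef ST (v i) l ^+ 2 <= normL2 (wpartial (enum A) (v i)) ^+ 2.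
  move=> cA; rewrite normL2_sqr; have := coef_sum_H10 d0 N hv (wd _ cA).
  by rewrite big_mkord.
under eq_bigr do rewrite /B_coef mulrDl -mulrA !mulr_suml.
rewrite big_split/= -mulr_sumr; apply: lerD.
  by rewrite exchange_big/=; apply: ler_sum => A cA; apply: S; rewrite cA.
rewrite ler_wpM2l ?divr_ge0// exchange_big/=; apply: ler_sum => A cA.
by apply: S; rewrite cA orbT.
Qed.

Lemma Z_weight tau (v : vector_field R d) N (x : 'I_d -> nat -> R) (c : R) : 0 <= tau -> 0 <= c -> Z v ->
  (forall i l, (forall j : 'I_d, freq l j != 0%N) -> x i l <= c * B_coef d tau l) ->
  \sum_i \sum_(l < N) x i l * coef ST (v i) l ^+ 2 <= c * normZ tau v ^+ 2.
Proof.
move=> t0 c0 Zv h; apply: le_trans (ler_wpM2l c0 (Z_coef_sum N t0 Zv)).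
rewrite mulr_sumr; apply: ler_sum => i _; rewrite mulr_sumr; apply: ler_sum => l _.
have [fl|/existsNP[j /negP]] := pselect (forall j : 'I_d, freq l j != 0%N).
  by rewrite [leRHS]mulrA ler_wpM2r ?sqr_ge0//; exact: h.
by rewrite negbK => /eqP fj; rewrite (coef_null (Z_L2 i Zv) fj) expr0n/= !mulr0.
Qed.

(** The pressure has no trace to offer; the sine vanishes along [i] instead, so the derivative falls
    on the basis function. *)
Lemma coef_grad (q : field) i l : weakly_diff [:: i] q ->
  coef ST (wpartial [:: i] q) l = - ip q (dsin i l).
Proof.
move=> wq; have lq := weakly_diff_L2 wq; have := @coef_wpartial R d d0 q (fun=> cst 0) ST [set i]%SET l.
rewrite enum_set1 => ->//; last by move=> j _; rewrite inE.
rewrite big_set1 inE /dfreq mul1r.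
have -> : symdiff ST [set i]%SET = (~: [set i])%SET.
  by apply/setP => j; rewrite !inE; case: eqP.
by rewrite /dsin ip_Zr//; [rewrite mulNr|exact: L2_bas].
Qed.

Lemma ip_le_coef (f : field) A (X : R) : L2 f ->
  (forall M, \sum_(m < M) coef A f m ^+ 2 <= X) -> ip f f <= X.
Proof.
move=> lf h; apply: cvg_le_const (ip_parseval A lf lf) _ => M.
by rewrite big_mkord; under eq_bigr do rewrite -expr2.
Qed.

(** The left side pairs [f] with the divergence of a sine sum; 3 bounds the number of components. *)
Lemma ip_dsin_le (f : field) (b : 'I_d -> nat -> R) N (V : R) : L2 f ->
  \sum_i \sum_(l < N) lam R l i * b i l ^+ 2 <= V ->
  (\sum_i \sum_(l < N) ip f (dsin i l) * b i l) ^+ 2 <= 3 * V * ip f f.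
Proof.
move=> lf hV; pose g i : field := comb (~: [set i])%SET (fun l : 'I_N => pi * (freq l i)%:R * b i l).
have lg i : L2 (g i) by exact: L2_comb.
have gE i : \sum_(l < N) ip f (dsin i l) * b i l = ip f (g i).
  rewrite /g ip_comb//; apply: eq_bigr => l _; rewrite /dsin ip_Zr//; last exact: L2_bas.
  by rewrite /coef mulrAC.
under eq_bigr do rewrite gE.
have gg i : ip (g i) (g i) <= \sum_(l < N) lam R l i * b i l ^+ 2.
  apply: le_trans (comb_sqr_le _ _) _; apply: ler_sum => l _.
  by rewrite exprMn.
have -> : \sum_i ip f (g i) = dot (fun=> 1) (fun i : 'I_d => ip f (g i)).
  by apply: eq_bigr => i _; rewrite mul1r.
apply: (le_trans (dot_CS2 _ _)); rewrite /sq/= expr1n sumr_const card_ord.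
have V0 : 0 <= V by apply: le_trans hV; apply: sumr_ge0 => i _; apply: sumr_ge0 => l _; rewrite mulr_ge0 ?lam_ge0 ?sqr_ge0.
rewrite -mulrA; apply: ler_pM; rewrite ?ler0n ?ler_nat//.
  by apply: sumr_ge0 => i _; exact: sqr_ge0.
apply: (@le_trans _ _ (\sum_i ip (g i) (g i) * ip f f)).
  by apply: ler_sum => i _; rewrite [leRHS]mulrC; exact: ip_CS2.
rewrite -mulr_suml ler_wpM2r ?ip_ge0//; apply: le_trans hV; exact: ler_sum.
Qed.

End Z_norm.

(** * The budget of the final estimate *)

Section real_sums.
Context (R : realType).

Lemma sum_ord_mono (f : nat -> R) N N' : (forall l, 0 <= f l) -> (N <= N')%N ->
  \sum_(l < N) f l <= \sum_(l < N') f l.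
Proof.
move=> f0 NN; rewrite -!(big_mkord xpredT f) (big_cat_nat (n := N) (p := N'))//= lerDl.
exact: sumr_ge0.
Qed.

Lemma cvg_sum_fin (I : Type) (r : seq I) (a : I -> nat -> R) (l : I -> R) :
  (forall i, a i n @[n --> \oo] --> l i) ->
  \sum_(i <- r) a i n @[n --> \oo] --> \sum_(i <- r) l i.
Proof.
move=> al; elim: r => [|i r IH].
  by under eq_fun do rewrite big_nil; rewrite big_nil; exact: cvg_cst.
by under eq_fun do rewrite big_cons; rewrite big_cons; apply: cvgD.
Qed.

Lemma momentum_identity (tau x y b beta de ka se F : R) :
  (1 + beta) * de + ka / 2 * se = F + tau * y ->
  tau * ((x + y) * b) = tau * (x * b) + 1 * de * b + beta * de * b + ka / 2 * se * b + 1 * (- F) * b.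
Proof.
move=> E; have -> : tau * ((x + y) * b) = tau * (x * b) + (tau * y) * b by ring.
have -> : tau * y = (1 + beta) * de + ka / 2 * se - F by rewrite E addrAC subrr add0r.
by ring.
Qed.

Lemma sum_indicator1 m : \sum_(0 <= k < m) ((k == 1%N)%:R : R) <= 1.
Proof.
suff -> : \sum_(0 <= k < m) ((k == 1%N)%:R : R) = (1 < m)%N%:R by case: (1 < m)%N.
elim: m => [|m IH]; first by rewrite big_geq.
by rewrite big_nat_recr//= IH; case: m {IH} => [|[|m]]; rewrite /= ?addr0 ?add0r.
Qed.

(** The summands are the contributions collected in [gradient_bound]. Terms present at every step
    lose one power of [tau] over at most [2 * C0 / tau] steps, while the larger error of [s 1] is
    paid once. *)
Lemma sum_budget (Z D S : nat -> R) (C C0 tau : R) n : 1 <= C0 -> 0 <= C -> 0 < tau -> tau <= C0 ->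
  n%:R * tau <= C0 -> (forall k, 0 <= Z k) ->
  \sum_(0 <= k < n.+1) Z k <= C * tau ^+ 3 -> \sum_(0 <= k < n.+1) D k <= C * tau ^+ 3 ->
  \sum_(0 <= k < n.+1) S k <= C * tau ^+ 2 ->
  \sum_(0 <= k < n.+1) (45 * (Z k + Z k.-1 + ((k == 1%N)%:R * (C0 ^+ 2 * tau ^+ 4) + C0 ^+ 2 * tau ^+ 6))
      + 5 * (D k + C * tau ^+ 4 + tau * S k + C0 ^+ 2 * tau ^+ 6)) <=
  (145 * C + 10 * C0 * C + 45 * C0 ^+ 3 + 100 * C0 ^+ 5) * tau ^+ 3.
Proof.
move=> C01 C_ge0 tau0 tauC nC Z0 hZ hD hS; have tau0' := ltW tau0.
have E m : \sum_(0 <= k < m) (45 * (Z k + Z k.-1 + ((k == 1%N)%:R * (C0 ^+ 2 * tau ^+ 4) + C0 ^+ 2 * tau ^+ 6))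
      + 5 * (D k + C * tau ^+ 4 + tau * S k + C0 ^+ 2 * tau ^+ 6)) =
    45 * (\sum_(0 <= k < m) Z k + \sum_(0 <= k < m) Z k.-1 +
      (\sum_(0 <= k < m) (k == 1%N)%:R) * (C0 ^+ 2 * tau ^+ 4) + m%:R * (C0 ^+ 2 * tau ^+ 6))
    + 5 * (\sum_(0 <= k < m) D k + m%:R * (C * tau ^+ 4) + tau * \sum_(0 <= k < m) S k + m%:R * (C0 ^+ 2 * tau ^+ 6)).
  elim: m => [|m IH]; first by rewrite !big_geq//; ring.
  by rewrite !big_nat_recr//= IH -natr1; ring.
have Zp : \sum_(0 <= k < n.+1) Z k.-1 <= 2 * (C * tau ^+ 3).
  have a0 : \sum_(0 <= k < n.+1) Z k = \sum_(0 <= k < n) Z k + Z n by rewrite big_nat_recr.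
  have a1 : \sum_(0 <= k < n.+1) Z k = Z 0%N + \sum_(1 <= k < n.+1) Z k by rewrite big_ltn.
  have a2 : 0 <= \sum_(1 <= i < n.+1) Z i by exact: sumr_ge0.
  rewrite big_nat_recl//=; move: a0 a1 a2 hZ (Z0 n); clear; lra.
have C00 : 0 <= C0 by lra.
have nt : n.+1%:R * tau <= 2 * C0 by rewrite -natr1 mulrDl mul1r; lra.
have t3 : 0 <= tau ^+ 3 by rewrite exprn_ge0.
have h1 : n.+1%:R * (C * tau ^+ 4) <= 2 * C0 * C * tau ^+ 3.
  rewrite (_ : n.+1%:R * (C * tau ^+ 4) = (n.+1%:R * tau) * (C * tau ^+ 3)); last by ring.
  by rewrite -[leRHS]mulrA ler_wpM2r// mulr_ge0.
have C02 : 0 <= C0 ^+ 2 by exact: sqr_ge0.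
have tt : tau ^+ 2 <= C0 ^+ 2 by exact: ler_sqr_le.
have h2 : n.+1%:R * (C0 ^+ 2 * tau ^+ 6) <= 2 * C0 ^+ 5 * tau ^+ 3.
  rewrite (_ : n.+1%:R * (C0 ^+ 2 * tau ^+ 6) = (n.+1%:R * tau) * (C0 ^+ 2 * tau ^+ 2 * tau ^+ 3)); last by ring.
  rewrite (_ : 2 * C0 ^+ 5 * tau ^+ 3 = 2 * C0 * (C0 ^+ 2 * C0 ^+ 2 * tau ^+ 3)); last by ring.
  have h2a : C0 ^+ 2 * tau ^+ 2 * tau ^+ 3 <= C0 ^+ 2 * C0 ^+ 2 * tau ^+ 3 by rewrite ler_wpM2r// ler_wpM2l.
  have h2b : 0 <= C0 ^+ 2 * tau ^+ 2 * tau ^+ 3 by apply: mulr_ge0 => //; apply: mulr_ge0 => //; exact: sqr_ge0.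
  exact: ler_pM (mulr_ge0 (ler0n _ _) tau0') h2b nt h2a.
have h3 : (\sum_(0 <= k < n.+1) (k == 1%N)%:R) * (C0 ^+ 2 * tau ^+ 4) <= C0 ^+ 3 * tau ^+ 3.
  apply: (@le_trans _ _ (1 * (C0 ^+ 2 * tau ^+ 4))).
    by rewrite ler_wpM2r ?sum_indicator1// mulr_ge0 ?exprn_ge0.
  rewrite mul1r (_ : C0 ^+ 2 * tau ^+ 4 = C0 ^+ 2 * tau ^+ 3 * tau); last by ring.
  rewrite (_ : C0 ^+ 3 * tau ^+ 3 = C0 ^+ 2 * tau ^+ 3 * C0); last by ring.
  by rewrite ler_wpM2l// mulr_ge0.
have h4 : tau * \sum_(0 <= k < n.+1) S k <= C * tau ^+ 3.
  rewrite (_ : C * tau ^+ 3 = tau * (C * tau ^+ 2)); last by ring.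
  by rewrite ler_wpM2l.
rewrite E; move: hZ hD Zp h1 h2 h3 h4; clear.
move: (\sum_(0 <= k < n.+1) Z k) (\sum_(0 <= k < n.+1) Z k.-1) (\sum_(0 <= k < n.+1) D k)
  (tau * \sum_(0 <= k < n.+1) S k) (n.+1%:R * (C * tau ^+ 4)) (n.+1%:R * (C0 ^+ 2 * tau ^+ 6))
  (_ * (C0 ^+ 2 * tau ^+ 4)) => a1 a2 a3 a4 a5 a6 a7.
by lra.
Qed.

End real_sums.

Definition stability_const (R : realType) (C0 : R) : R := 5 * 10 ^+ 9 * (10 * C0 ^+ 3) ^+ 6.

(** * The pressure gradient through the momentum equation *)

Section gradient_bound.
Context (R : realType) (d : nat).
Local Notation field := (scalar_field R d).
Local Notation ST := [set: 'I_d]%SET.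

Lemma alpha_ge1 m : 1 <= alpha R d m.
Proof. by rewrite /alpha prod_1lam lerDl sqr_ge0. Qed.

Lemma ip_scaled_coef (f : field) (x : nat -> R) (tau X : R) : 0 < tau -> L2 f ->
  (forall m, tau * Num.sqrt (alpha R d m) * coef finset.set0 f m = x m) ->
  (forall M, \sum_(m < M) x m ^+ 2 <= X) -> tau ^+ 2 * ip f f <= X.
Proof.
move=> t0 lf fx hX; have t2 : 0 < tau ^+ 2 by rewrite exprn_gt0.
rewrite mulrC -ler_pdivlMr//; apply: (@ip_le_coef R d f finset.set0) => // M.
rewrite ler_pdivlMr// mulr_suml; apply: le_trans (hX M); apply: ler_sum => m _.
rewrite -fx !exprMn sqr_sqrtr; last by apply: ltW; exact: alpha_gt0.
rewrite mulrC -mulrA ler_wpM2l ?(ltW t2)//.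
by rewrite ler_peMl ?sqr_ge0// alpha_ge1.
Qed.

(** The momentum equation gives the gradient of the predicted error [w], and [eps - w] consists of
    increments of [q], already small in L^2. [P] selects the directions in which the weak derivative
    of the error exists. *)
Lemma gradient_bound (d0 : (0 < d)%N) (d2 : (2 <= d)%N) (d3 : (d <= 3)%N)
  (C0 tau : R) (n : nat) (e : nat -> 'I_d -> field) (w : nat -> field)
  (q r s : nat -> nat -> R) (F : nat -> 'I_d -> nat -> R) (eps : nat -> field)
  (C01 : 1 <= C0) (tau0 : 0 < tau) (tauC : tau <= C0) (ntau : n%:R * tau <= C0)
  (Le : forall k i, L2 (e k i)) (Lw : forall k, L2 (w k))
  (e0 : forall i l, coef ST (e 0%N i) l = 0) (q0 : forall m, q 0%N m = 0)
  (Hdiv : forall k, (k < n.+1)%N -> forall m,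
  q k.+1 m - q k m = gdiv (e k.+1) m + r k.+1 m)
  (Hpre : forall k, (0 < k < n.+1)%N -> forall m,
  tau * Num.sqrt (alpha R d m) * coef finset.set0 (w k) m = q k m + (q k m - q k.-1 m) + s k m)
  (Hmom : forall k, (k < n.+1)%N -> forall i l,
  (1 + beta d tau l) * (coef ST (e k.+1 i) l - coef ST (e k i) l)
  + kappa d tau l / 2 * (coef ST (e k.+1 i) l + coef ST (e k i) l) =
  F k i l + tau * ip (w k) (dsin i l))
  (HF : forall k, (k < n.+1)%N -> forall N,
  \sum_i \sum_(l < N) F k i l ^+ 2 <= (C0 * tau ^+ 3) ^+ 2)
  (Hr : forall k, (0 < k <= n.+1)%N -> forall M,
  \sum_(m < M) r k m ^+ 2 <= (C0 * tau ^+ 2) ^+ 2)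
  (Hdr : forall k, (1 < k < n.+1)%N -> forall M,
  \sum_(m < M) (r k.+1 m - r k m) ^+ 2 <= (C0 * tau ^+ 3) ^+ 2)
  (Hs1 : forall M, \sum_(m < M) s 1%N m ^+ 2 <= (C0 * tau ^+ 2) ^+ 2)
  (Hs : forall k, (1 < k < n.+1)%N -> forall M,
  \sum_(m < M) s k m ^+ 2 <= (C0 * tau ^+ 3) ^+ 2)
  (Hw0 : ip (w 0%N) (w 0%N) <= (C0 * tau) ^+ 2)
  (Leps : forall k, (k <= n)%N -> L2 (eps k))
  (Heps0 : forall m,
  tau * Num.sqrt (alpha R d m) * coef finset.set0 (eps 0%N) m = q 1%N m - q 0%N m)
  (Heps : forall k, (0 < k <= n)%N -> forall m,
  tau * Num.sqrt (alpha R d m) * coef finset.set0 (fun x => eps k x - w k x) m =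
  (q k.+1 m - q k m) - (q k m - q k.-1 m) - s k m)
  (C := stability_const C0) : exists2 Y : nat -> R,
  \sum_(0 <= k < n.+1) Y k <= (145 * C + 10 * C0 * C + 45 * C0 ^+ 3 + 100 * C0 ^+ 5) * tau ^+ 3 &
  forall k, (k <= n)%N -> 0 <= Y k /\ forall (v : vector_field R d) (P : pred 'I_d), Z v ->
    (forall i, P i -> weakly_diff [:: i] (eps k)) ->
    (tau * \sum_(i | P i) ip (wpartial [:: i] (eps k)) (v i)) ^+ 2 <= Y k * normZ tau v ^+ 2.
Proof.
have tau0' := ltW tau0.
have := semi_discrete_stability d0 d3 C01 tau0 tauC ntau Le Lw e0 q0 Hdiv Hpre Hmom HF Hr Hdr Hs1 Hs Hw0.
rewrite -/(stability_const C0) -/C => st.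
have C00 : 0 <= C0 by exact: le_trans ler01 C01.
have C_ge0 : 0 <= C.
  by rewrite /C /stability_const !mulr_ge0 ?exprn_ge0// ?mulr_ge0 ?exprn_ge0.
pose de k i l := coef ST (e k.+1 i) l - coef ST (e k i) l.
pose se k i l := coef ST (e k.+1 i) l + coef ST (e k i) l.
have mono (f : nat -> 'I_d -> nat -> R) : (forall k i l, 0 <= f k i l) ->
    forall k N N', (N <= N')%N -> \sum_i \sum_(l < N) f k i l <= \sum_i \sum_(l < N') f k i l.
  by move=> f0 k N N' NN; apply: ler_sum => i _; exact: sum_ord_mono.
have [D [D0 hD sD]] : exists Y : nat -> R, [/\ forall k, 0 <= Y k,
    forall k N, (k < n.+1)%N -> \sum_i \sum_(l < N) de k i l ^+ 2 <= Y k &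
    \sum_(0 <= k < n.+1) Y k <= C * tau ^+ 3].
  apply: sum_of_suprema.
  - by move=> k N; apply: sumr_ge0 => i _; apply: sumr_ge0 => l _; exact: sqr_ge0.
  - by apply: (mono (fun k i l => de k i l ^+ 2)) => k i l; exact: sqr_ge0.
  - by move=> N; have [h _ _ _] := st N 0%N.
have [Zq [Z0 hZ sZ]] : exists Y : nat -> R, [/\ forall k, 0 <= Y k,
    forall k N, (k < n.+1)%N -> \sum_(m < N) (q k.+1 m - q k m) ^+ 2 <= Y k &
    \sum_(0 <= k < n.+1) Y k <= C * tau ^+ 3].
  apply: sum_of_suprema.
  - by move=> k N; apply: sumr_ge0 => l _; exact: sqr_ge0.
  - by move=> k N N'; apply: (sum_ord_mono (f := fun m => (q k.+1 m - q k m) ^+ 2)) => l; exact: sqr_ge0.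
  - by move=> N; have [_ h _ _] := st 0%N N.
have ka0 l : 0 <= kappa d tau l by exact: kappa_ge0.
have be0 l : 0 <= beta d tau l by exact: beta_ge0.
have [S [S0 hS sS]] : exists Y : nat -> R, [/\ forall k, 0 <= Y k,
    forall k N, (k < n.+1)%N -> \sum_i \sum_(l < N) kappa d tau l * se k i l ^+ 2 <= Y k &
    \sum_(0 <= k < n.+1) Y k <= C * tau ^+ 2].
  apply: sum_of_suprema.
  - by move=> k N; apply: sumr_ge0 => i _; apply: sumr_ge0 => l _; rewrite mulr_ge0 ?sqr_ge0.
  - by apply: (mono (fun k i l => kappa d tau l * se k i l ^+ 2)) => k i l; rewrite mulr_ge0 ?sqr_ge0.
  - by move=> N; have [_ _ h _] := st N 0%N.
have be k N : (k < n.+1)%N -> \sum_i \sum_(l < N) beta d tau l * de k i l ^+ 2 <= 4 * C * tau ^+ 2.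
  move=> kn; have [_ _ _ h] := st N 0%N; have := h k (ltnW kn); have := h k.+1 kn.
  set a := \sum_i _; set b := \sum_i _ => ha hb.
  apply: (@le_trans _ _ (2 * a + 2 * b)); last by move: ha hb; clear; lra.
  rewrite /a /b !mulr_sumr -big_split/=; apply: ler_sum => i _.
  rewrite !mulr_sumr -big_split/=; apply: ler_sum => l _.
  rewrite /de; move: (coef ST (e k.+1 i) l) (coef ST (e k i) l) (beta d tau l) (be0 l) => x y c c0.
  have := mulr_ge0 c0 (sqr_ge0 (x + y)); clear; lra.
exists (fun k => 45 * (Zq k + Zq k.-1 + ((k == 1%N)%:R * (C0 ^+ 2 * tau ^+ 4) + C0 ^+ 2 * tau ^+ 6))
      + 5 * (D k + C * tau ^+ 4 + tau * S k + C0 ^+ 2 * tau ^+ 6)).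
  exact: sum_budget.
move=> k kn; split.
  have e4 : 0 <= tau ^+ 4 by rewrite exprn_ge0.
  have e6 : 0 <= tau ^+ 6 by rewrite exprn_ge0.
  have s6 : 0 <= C0 ^+ 2 * tau ^+ 6 by rewrite mulr_ge0 ?sqr_ge0.
  apply: addr_ge0; apply: mulr_ge0 => //; rewrite !addr_ge0 ?Z0 ?D0//.
  - by rewrite !mulr_ge0 ?sqr_ge0.
  - by rewrite mulr_ge0.
  - by rewrite mulr_ge0 ?S0.
move=> v P Zv wd; set V := normZ tau v ^+ 2; have V0 : 0 <= V by exact: sqr_ge0.
pose b i l := (P i)%:R * coef ST (v i) l.
have bV (x : 'I_d -> nat -> R) (c : R) N : 0 <= c -> (forall i l, 0 <= x i l) ->
    (forall i l, (forall j : 'I_d, freq l j != 0%N) -> x i l <= c * B_coef d tau l) ->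
    \sum_i \sum_(l < N) x i l * b i l ^+ 2 <= c * V.
  move=> c0 x0 h; apply: le_trans (Z_weight d0 N tau0' c0 Zv h).
  apply: ler_sum => i _; apply: ler_sum => l _; rewrite ler_wpM2l// /b.
  by case: (P i); rewrite ?mul1r// mul0r expr0n sqr_ge0.
have lamV N : \sum_i \sum_(l < N) lam R l i * b i l ^+ 2 <= V.
  rewrite -[V]mul1r; apply: (bV (fun i l => lam R l i)) => // [i l|i l fl]; first exact: lam_ge0.
  by rewrite mul1r; apply: (le_trans (lam_le_pairs R i d2 fl)); exact: pairs_le_B.
pose A N := \sum_i \sum_(l < N) ip (eps k) (dsin i l) * b i l.
have cA : A N @[N --> \oo] --> - \sum_(i | P i) ip (wpartial [:: i] (eps k)) (v i).
  rewrite -sumrN big_mkcond/=; apply: cvg_sum_fin => i; case: (boolP (P i)) => Pi; last first.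
    under eq_fun do under eq_bigr do rewrite /b (negbTE Pi) mul0r mulr0.
    by under eq_fun do rewrite big1//; exact: cvg_cst.
  have := ip_parseval ST (L2_wpartial (wd i Pi)) (Z_L2 i Zv) => /cvgN.
  apply: cvg_trans; apply: near_eq_cvg; apply: nearW => N /=.
  change (- (\sum_(0 <= l < N) coef ST (wpartial [:: i] (eps k)) l * coef ST (v i) l) =
    \sum_(l < N) ip (eps k) (dsin i l) * b i l).
  rewrite big_mkord -sumrN; apply: eq_bigr => l _.
  by rewrite (coef_grad d0 l (wd i Pi)) /b Pi mul1r mulNr opprK.
suff hA N : (tau * A N) ^+ 2 <= (45 * (Zq k + Zq k.-1 + ((k == 1%N)%:R * (C0 ^+ 2 * tau ^+ 4) + C0 ^+ 2 * tau ^+ 6))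
      + 5 * (D k + C * tau ^+ 4 + tau * S k + C0 ^+ 2 * tau ^+ 6)) * V.
  apply: (cvg_le_const (u := fun N => (tau * A N) ^+ 2)) => //.
  rewrite -sqrrN -mulrN; under eq_fun do rewrite expr2; rewrite expr2.
  by apply: cvgM; apply: cvgM => //; exact: cvg_cst.
have t4 : 0 <= tau ^+ 4 by rewrite exprn_ge0.
have t6 : 0 <= tau ^+ 6 by rewrite exprn_ge0.
have C02 : 0 <= C0 ^+ 2 by exact: sqr_ge0.
have p4 := mulr_ge0 C02 t4; have p6 := mulr_ge0 C02 t6; have c4 := mulr_ge0 C_ge0 t4.
have tS := mulr_ge0 tau0' (S0 k).
(* At the first step [w 0] has no scaled expansion, but [eps 0] is itself the increment [q 1 - q 0],
   so the momentum equation is not called upon. *)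
have [k0|k0] := posnP k.
  subst k; have i0 := ip_scaled_coef tau0 (Leps _ (leq0n n)) Heps0 (fun M => hZ 0%N M (ltn0Sn n)).
  have hA := ip_dsin_le d3 (Leps _ kn) (lamV N).
  rewrite exprMn; apply: (le_trans (ler_wpM2l (sqr_ge0 tau) hA)).
  apply: (@le_trans _ _ (3 * (tau ^+ 2 * ip (eps 0%N) (eps 0%N)) * V)).
    by rewrite le_eqVlt; apply/orP; left; apply/eqP; ring.
  rewrite ler_wpM2r//= mul0r add0r; have z0 := Z0 0%N; have d0' := D0 0%N.
  by move: i0 z0 d0' p6 c4 tS; clear; lra.
have kn1 : (0 < k < n.+1)%N by rewrite k0 ltnS.
have kn1' : (0 < k <= n)%N by rewrite k0.
have knn : (k < n.+1)%N by rewrite ltnS.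
pose chi : field := fun x => eps k x - w k x.
have Lchi : L2 chi by apply: L2_B => //; exact: Leps.
have chiB : tau ^+ 2 * ip chi chi <=
    3 * (Zq k + Zq k.-1 + ((k == 1%N)%:R * (C0 ^+ 2 * tau ^+ 4) + C0 ^+ 2 * tau ^+ 6)).
  apply: (ip_scaled_coef tau0 Lchi (Heps _ kn1')) => M.
  have h1 := hZ k M knn; have h2 : \sum_(m < M) (q k m - q k.-1 m) ^+ 2 <= Zq k.-1.
    by have := hZ k.-1 M; rewrite prednK// => ->//; exact: ltnW.
  have h3 : \sum_(m < M) s k m ^+ 2 <= (k == 1%N)%:R * (C0 ^+ 2 * tau ^+ 4) + C0 ^+ 2 * tau ^+ 6.
    have [k1|k1] := eqVneq k 1%N.
      rewrite k1 mul1r; apply: (le_trans (Hs1 M)); rewrite exprMn -exprM; move: p6; clear; lra.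
    have kk : (1 < k < n.+1)%N by rewrite knn andbT ltn_neqAle eq_sym k1.
    by rewrite mul0r add0r; apply: (le_trans (Hs _ kk M)); rewrite exprMn -exprM.
  apply: (@le_trans _ _ (3 * (\sum_(m < M) (q k.+1 m - q k m) ^+ 2 + \sum_(m < M) (q k m - q k.-1 m) ^+ 2
     + \sum_(m < M) s k m ^+ 2))); last first.
    by move: h1 h2 h3; clear; lra.
  rewrite -!big_split/= mulr_sumr; apply: ler_sum => m _.
  move: (q k.+1 m - q k m) (q k m - q k.-1 m) (s k m) => x y z; clear.
  have := sqr_ge0 (x + y); have := sqr_ge0 (x + z); have := sqr_ge0 (y - z); lra.
(* [X1] comes from [eps - w], [X2] from the increment of the velocity error, [X3] from the splitting
   term, [X4] from diffusion and [X5] from the defect. *)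
pose X1 := \sum_i \sum_(l < N) ip chi (dsin i l) * b i l.
pose X2 := \sum_i \sum_(l < N) 1 * de k i l * b i l.
pose X3 := \sum_i \sum_(l < N) beta d tau l * de k i l * b i l.
pose X4 := \sum_i \sum_(l < N) kappa d tau l / 2 * se k i l * b i l.
pose X5 := \sum_i \sum_(l < N) 1 * (- F k i l) * b i l.
have AE : tau * A N = tau * X1 + X2 + X3 + X4 + X5.
  rewrite /A /X1 !mulr_sumr -!big_split/=; apply: eq_bigr => i _.
  rewrite !mulr_sumr -!big_split/=; apply: eq_bigr => l _.
  have Ew : ip (eps k) (dsin i l) = ip chi (dsin i l) + ip (w k) (dsin i l).
    by rewrite /chi ip_Bl//; [rewrite subrK|exact: Leps|exact: L2_dsin].
  by rewrite Ew; apply: momentum_identity; exact: Hmom.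
have B1 l : (forall j : 'I_d, freq l j != 0%N) -> 1 <= B_coef d tau l.
  by move=> fl; apply: (le_trans (pairs_ge1 R d2 fl)); exact: pairs_le_B.
have oneV : \sum_i \sum_(l < N) 1 * b i l ^+ 2 <= V.
  by rewrite -[V]mul1r; apply: (bV (fun _ _ => 1)) => // i l fl; rewrite mul1r; exact: B1.
have x1 : (tau * X1) ^+ 2 <= 9 * (Zq k + Zq k.-1 + ((k == 1%N)%:R * (C0 ^+ 2 * tau ^+ 4) + C0 ^+ 2 * tau ^+ 6)) * V.
  rewrite exprMn; apply: (le_trans (ler_wpM2l (sqr_ge0 tau) (ip_dsin_le d3 Lchi (lamV N)))).
  apply: (@le_trans _ _ (3 * (tau ^+ 2 * ip chi chi) * V)).
    by rewrite le_eqVlt; apply/orP; left; apply/eqP; ring.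
  by rewrite ler_wpM2r//; move: chiB; clear; lra.
have x2 : X2 ^+ 2 <= D k * V.
  apply: le_trans (weighted_CS _ _ _) _ => //; apply: ler_pM => //.
  - by apply: sumr_ge0 => i _; apply: sumr_ge0 => l _; rewrite mul1r sqr_ge0.
  - by apply: sumr_ge0 => i _; apply: sumr_ge0 => l _; rewrite mul1r sqr_ge0.
  - by under eq_bigr do under eq_bigr do rewrite mul1r; exact: hD.
(* The weight [beta] is shared between both factors: on the error the energy bounds it by order
   [tau ^+ 2], and on the test field it is [tau ^+ 2 / 4] times the symbol of the norm of [Z]. *)
have x3 : X3 ^+ 2 <= C * tau ^+ 4 * V.
  apply: le_trans (weighted_CS _ _ _) _ => //.
  apply: (@le_trans _ _ ((4 * C * tau ^+ 2) * (tau ^+ 2 / 4 * V))); last first.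
    by rewrite le_eqVlt; apply/orP; left; apply/eqP; field.
  apply: ler_pM.
  - by apply: sumr_ge0 => i _; apply: sumr_ge0 => l _; rewrite mulr_ge0 ?sqr_ge0.
  - by apply: sumr_ge0 => i _; apply: sumr_ge0 => l _; rewrite mulr_ge0 ?sqr_ge0.
  - exact: be.
  - apply: (bV (fun _ l => beta d tau l)) => //; first by rewrite divr_ge0 ?sqr_ge0.
    by move=> i l _; rewrite beta_B.
(* On the test field [kappa] is at most [3 * tau] times the symbol of the norm of [Z]; this [tau]
   upgrades the order [tau ^+ 2] of the sum of the [S k]. *)
have x4 : X4 ^+ 2 <= tau * S k * V.
  have k2 l : 0 <= kappa d tau l / 2 by rewrite divr_ge0.
  apply: le_trans (weighted_CS _ _ _) _ => //.
  apply: (@le_trans _ _ ((S k / 2) * (3 * tau / 2 * V))); last first.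
    by move: (mulr_ge0 tS V0); clear; lra.
  apply: ler_pM.
  - by apply: sumr_ge0 => i _; apply: sumr_ge0 => l _; rewrite mulr_ge0 ?sqr_ge0.
  - by apply: sumr_ge0 => i _; apply: sumr_ge0 => l _; rewrite mulr_ge0 ?sqr_ge0.
  - rewrite ler_pdivlMr// mulr_suml; apply: le_trans (hS k N knn); apply: ler_sum => i _.
    rewrite mulr_suml; apply: ler_sum => l _.
    by rewrite mulrAC divfK ?pnatr_eq0.
  - apply: (bV (fun _ l => kappa d tau l / 2)) => //; first by rewrite divr_ge0// mulr_ge0.
    move=> i l fl; rewrite /kappa.
    have h1 := sum_lam_le R d2 d3 fl; have h2 := @pairs_le_B R d tau l tau0'.
    have : tau * \sum_(j : 'I_d) lam R l j <= tau * (3 * B_coef d tau l).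
      by rewrite ler_wpM2l//; apply: (le_trans h1); rewrite ler_wpM2l.
    by move: (tau * \sum_(j : 'I_d) _) => x; clear; lra.
have x5 : X5 ^+ 2 <= C0 ^+ 2 * tau ^+ 6 * V.
  apply: le_trans (weighted_CS _ _ _) _ => //; apply: ler_pM => //.
  - by apply: sumr_ge0 => i _; apply: sumr_ge0 => l _; rewrite mul1r sqr_ge0.
  - by apply: sumr_ge0 => i _; apply: sumr_ge0 => l _; rewrite mul1r sqr_ge0.
  - have := HF _ knn N; rewrite exprMn -exprM; apply: le_trans.
    by apply: ler_sum => i _; apply: ler_sum => l _; rewrite mul1r sqrrN.
rewrite AE; apply: (le_trans (sqr_sum5 _ _ _ _ _)).
move: x1 x2 x3 x4 x5; clear.
move: ((tau * X1) ^+ 2) (X2 ^+ 2) (X3 ^+ 2) (X4 ^+ 2) (X5 ^+ 2) => y1 y2 y3 y4 y5.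
move: (Zq k + Zq k.-1 + ((k == 1%N)%:R * (C0 ^+ 2 * tau ^+ 4) + C0 ^+ 2 * tau ^+ 6))
  (D k) (C * tau ^+ 4) (tau * S k) (C0 ^+ 2 * tau ^+ 6) => z1 z2 z3 z4 z5; lra.
Qed.

End gradient_bound.

(** * Divergence, source term and number of steps *)

Section generic.
Context (R : realType) (d : nat).
Local Notation field := (scalar_field R d).
Local Notation ST := [set: 'I_d]%SET.

Lemma vanish_ae i (f g V : field) : (0 < d)%N -> L2 f -> L2 g -> ae_eq_cube f g -> vanish i f V -> vanish i g V.
Proof.
move=> d0 lf lg fg [lV h]; split => // t st; rewrite -h//; apply/esym; apply: ip_ae => //.
by apply: L2_smooth; exact: smooth_tensor.
Qed.

Lemma zero_mean_D (v w : field) : zero_mean v -> zero_mean w -> zero_mean (fun x => v x + w x).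
Proof.
move=> zv zw; have lv := zv.1; have lw := zw.1; apply/(zero_meanE (L2_D lv lw)).
by rewrite ip_Dl//; [rewrite ((zero_meanE lv).1 zv) ((zero_meanE lw).1 zw) addr0|exact: L2_cst].
Qed.

Lemma gdiv_coef (v : 'I_d -> field) m : (forall i, L2 (v i)) ->
  gdiv v m = - (Num.sqrt (alpha R d m))^-1 * \sum_i pi * (freq m i)%:R * coef [set i]%SET (v i) m.
Proof.
move=> lv; rewrite /gdiv mulNr -mulrN -sumrN; congr (_ * _); apply: eq_bigr => i _.
by rewrite ip_dbas// mulNr.
Qed.

Lemma gdiv_B (v w : 'I_d -> field) m : (forall i, L2 (v i)) -> (forall i, L2 (w i)) ->
  gdiv (fun i x => v i x - w i x) m = gdiv v m - gdiv w m.
Proof.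
move=> lv lw; rewrite /gdiv -mulrBr -sumrB; congr (_ * _); apply: eq_bigr => i _.
by rewrite ip_Bl//; exact: L2_dbas.
Qed.

Lemma gdiv_divfree (v : 'I_d -> field) (V : 'I_d -> field) m : (0 < d)%N -> is_div v (cst 0) ->
  (forall i, vanish i (v i) (V i)) -> gdiv v m = 0.
Proof.
move=> d0 hv hV; have lv i : L2 (v i) by have [h _ _] := hv; exact: h.
by rewrite gdiv_coef// -(coef_div d0 m hv hV) coef_cst0 mulr0.
Qed.

(** The correction equation divided by [Num.sqrt alpha]: the scaled pressure increment is the scaled
    divergence of the new velocity. *)
Lemma gdiv_correction (U : 'I_d -> field) (V : 'I_d -> field) (phi : field) (tau : R) m : (0 < d)%N -> 0 < tau ->
  (exists g, is_div U g) -> (forall i, vanish i (U i) (V i)) -> is_A phi (fun x => - tau^-1 * div U x) ->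
  tau * Num.sqrt (alpha R d m) * coef finset.set0 phi m = gdiv U m.
Proof.
move=> d0 t0 [g hg] hV hA; have hd : is_div U (div U) by rewrite /div; apply: xgetPex; exists g.
have [lU ld _] := hd; rewrite gdiv_coef// -(coef_div d0 m hd hV).
have := coef_A d0 m hA (L2_Z _ ld); rewrite coefZ// -/(alpha R d m).
have a0 := alpha_gt0 R d m; have s0 : 0 < Num.sqrt (alpha R d m) by rewrite sqrtr_gt0.
move=> E; have -> : coef finset.set0 (div U) m = - tau * (alpha R d m * coef finset.set0 phi m).
  by rewrite -E mulrA mulrNN divff ?mul1r// gt_eqF.
rewrite -[in X in _ = _ * (_ * (X * _))](sqr_sqrtr (ltW a0)).
move: (Num.sqrt _) s0 (coef finset.set0 phi m) => y y0 x.
by field; rewrite gt_eqF.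
Qed.

(** The extrapolated velocity is a linear combination of values of the curve, so it keeps the zero
    divergence. *)
Lemma extrap_gdiv T tau t (g : R -> 'I_d -> field) m : 0 < tau -> 0 <= t -> t + tau / 2 <= T ->
  (forall i s, 0 <= s <= T -> L2 (g s i)) -> (forall s, 0 <= s <= T -> gdiv (g s) m = 0) ->
  gdiv (fun i => extrapf T tau t (fun s => g s i)) m = 0.
Proof.
move=> tau0 t0 tT lg g0; rewrite /gdiv.
have E0 i : ip (extrapf T tau t (fun s => g s i)) (dbas i m) = extrap T tau t (fun s => ip (g s i) (dbas i m)).
  by apply: ip_extrapf => // [s sT|]; [exact: lg|exact: L2_dbas].
rewrite (eq_bigr _ (fun i _ => E0 i)).
have h s : 0 <= s <= T -> (Num.sqrt (alpha R d m))^-1 * \sum_i ip (g s i) (dbas i m) = 0 by move=> /g0.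
rewrite /extrap; have [hT|hT] := boolP (t + tau <= T); first by apply: h; lra.
have E (a b c : 'I_d -> R) : \sum_i (3 * a i - 8 * b i + 6 * c i) =
    3 * \sum_i a i - 8 * \sum_i b i + 6 * \sum_i c i by rewrite big_split sumrB -!mulr_sumr.
have E2 (y a b c : R) : y * a = 0 -> y * b = 0 -> y * c = 0 -> y * (3 * a - 8 * b + 6 * c) = 0.
  move=> ya yb yc; have -> : y * (3 * a - 8 * b + 6 * c) = 3 * (y * a) - 8 * (y * b) + 6 * (y * c) by ring.
  by rewrite ya yb yc !mulr0 subr0 addr0.
by rewrite E; apply: E2; apply: h; lra.
Qed.

Lemma strong_source (f : R -> vector_field R d) t i :
  smooth (fun z : R * 'rV[R]_d => f z.1 i z.2) -> L2 (f t i).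
Proof.
move=> /(_ [::])[c _]; apply: L2_continuous => x.
apply: (@continuous_comp _ _ _ (fun x : 'rV[R]_d => (t, x)) (fun z : R * 'rV[R]_d => f z.1 i z.2)).
  move=> A /= [[B C] [tB xC] BC]; apply: filterS xC => y Cy; apply: BC; split => //.
  exact: nbhs_singleton.
exact: c.
Qed.

Lemma truncn_halftime (T tau : R) : 0 < tau -> tau / 2 <= T ->
  exists n, forall k, (half_time tau k <= T) = (k <= n)%N.
Proof.
move=> t0 h; have x0 : 0 <= T / tau - 2^-1 by rewrite subr_ge0 ler_pdivlMr// mulrC.
exists (Num.truncn (T / tau - 2^-1)) => k.
by rewrite /half_time -ler_pdivlMr// -lerBrDr truncn_ge_nat.
Qed.

End generic.

(** * The error equation of one velocity coefficient *)

Section time_levels.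
Context (R : realType) (d : nat) (d0 : (0 < d)%N).
Local Notation field := (scalar_field R d).
Local Notation ST := [set: 'I_d]%SET.

Lemma heat_balance_coef (ut ff P : field) (W : 'I_d -> field) (c x : R) l :
  L2 ut -> L2 ff -> L2 P -> (forall j, L2 (W j)) ->
  ae_eq_cube (fun y => ut y - \sum_j W j y + P y) ff ->
  (forall j : 'I_d, coef ST (W j) l = - lam R l j * c) -> coef ST P l = - x ->
  coef ST ut l + (\sum_(j : 'I_d) lam R l j) * c = coef ST ff l + x.
Proof.
move=> lu lf lP lW heq hW hP; have LS : L2 (fun y => \sum_j W j y) by exact: L2_sum.
have LB : L2 (fun y => ut y - \sum_j W j y) by exact: L2_B.
rewrite -(coef_ae ST l (L2_D LB lP) lf heq) (coefD ST l LB lP) (coefB ST l lu LS) (coef_sum ST l lW) hP.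
rewrite (eq_bigr _ (fun j _ => hW j)) -mulr_suml sumrN.
by move: (\sum_(j : 'I_d) lam R l j) => y; ring.
Qed.

Lemma stokes_coef T (f : R -> vector_field R d) u0 u p t i : stokes_solution T f u0 u p ->
  0 < t <= T -> L2 (f t i) -> exists2 ut, is_time_derivative T (fun s => u s i) t ut &
  forall l, coef ST ut l + (\sum_(j : 'I_d) lam R l j) * coef ST (u t i) l = coef ST (f t i) l + ip (p t) (dsin i l).
Proof.
move=> [h1 _ h3 _ _] tT lf; have [ut [hut wd wp heq]] := h1 t tT i; exists ut; first exact: hut.
move=> l; apply: (@heat_balance_coef ut (f t i) (wpartial [:: i] (p t)) (fun j => wpartial [:: j; j] (u t i))).
- exact: hut.1.
- exact: lf.
- exact: (L2_wpartial wp).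
- by move=> j; exact: (L2_wpartial (wd j)).
- exact: heq.
- by move=> j; apply: (coef_wpartial_ii d0 l (wd j) (V := wpartial [:: j] (u t i))); apply: vanish_H10; exact: h3.
- exact: (coef_grad d0 l wp).
Qed.

(** One coefficient at a time: [L] is the symbol of minus the Laplacian, [P] and [Q] are minus the
    exact and the predicted pressure gradients, and the Stokes equation at the midpoint eliminates
    the source [ff]. *)
Lemma momentum_error (tau ut ex u U1 U um ff P Q be L : R) :
  ut + L * um = ff + P ->
  (1 + tau / 2 * L + be) * (U1 - U) = tau * (ff + Q - L * U) ->
  (1 + be) * ((ex - U1) - (u - U)) + tau * L / 2 * ((ex - U1) + (u - U)) =
  ((ex - u - tau * ut) + tau * L * (2^-1 * (ex + u) - um) + be * (ex - u)) + tau * (P - Q).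
Proof.
move=> E1 E2; have -> : P = ut + L * um - ff by rewrite E1 addrAC subrr add0r.
have -> : (1 + be) * ((ex - U1) - (u - U)) + tau * L / 2 * ((ex - U1) + (u - U)) =
  (1 + be) * (ex - u) + tau * L / 2 * (ex + u) - (1 + tau / 2 * L + be) * (U1 - U) - tau * L * U by field.
by rewrite E2; field.
Qed.

End time_levels.

(** * Almost everywhere equal representatives, and the trace at time 0 *)

Section transfer.
Context (R : realType) (d : nat) (d0 : (0 < d)%N) (d2 : (2 <= d)%N).
Local Notation field := (scalar_field R d).
Local Notation ST := [set: 'I_d]%SET.

Lemma is_weak_partial_ae s (f f' g : field) : ae_eq_cube f f' -> L2 f' ->
  is_weak_partial s f g -> is_weak_partial s f' g.
Proof.
move=> ff lf' [lf lg h]; split => // phi tp; rewrite h//; apply: ip_ae => //.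
by apply: L2_Z; apply: L2_smooth; exact: tp.1.
Qed.

Lemma wpartial_transfer s (f f' v : field) : ae_eq_cube f f' -> L2 f' -> L2 v -> weakly_diff s f ->
  weakly_diff s f' /\ ip (wpartial s f) v = ip (wpartial s f') v.
Proof.
move=> ff lf' lv wf; have h := is_weak_partial_ae ff lf' (wpartialP wf).
have wf' : weakly_diff s f' by exists (wpartial s f).
split; first exact: wf'.
apply/esym; apply: (ip_ae (L2_wpartial wf') (L2_wpartial wf) lv); exact: wpartial_ae h.
Qed.

(** The Stokes problem states its boundary condition for positive times. At time 0 the trace comes
    from the bound on [B]: on the modes that count, [pairs] is at least 1 and dominates [lam], so
    [lam] is below the square of [B_coef]. *)
Lemma vanish_initial T (u : R -> field) : 0 < T -> Winfty (@DB R d 1) (@normDB R d 1) 2 T u ->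
  L2 (u 0) -> forall j, exists V, vanish j (u 0) V.
Proof.
move=> T0 Wb l0 j; have [M M0 [h _]] := velocity_B_bound d0 T0 Wb.
apply: (vanish_sum d0 (C := M ^+ 2)) => // m.
have := h 0 m; rewrite lexx ltW// => /(_ isT); apply: le_trans.
apply: ler_sum => l _; have [fl|/existsNP[i /negP]] := pselect (forall j : 'I_d, freq l j != 0%N); last first.
  by rewrite negbK => /eqP fi; rewrite (coef_null l0 fi) !mulr0 expr0n/= mulr0.
have h1 := lam_le_pairs R j d2 fl; have h2 := pairs_ge1 R d2 fl.
have h3 : pairs R d l <= B_coef d 1 l by apply: pairs_le_B; exact: ler01.
rewrite exprMn ler_wpM2r ?sqr_ge0//; move: h1 h2 h3; clear.
by move: (pairs R d l) (B_coef d 1 l) (lam R l j) => a b c; nra.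
Qed.

End transfer.

(** * The scheme as an instance of the error recursion *)

Section scheme_error.
Context (R : realType) (d : nat).
Local Notation field := (scalar_field R d).
Local Notation ST := [set: 'I_d]%SET.

(** The pressure levels: the first interval is half a step, all the later ones are full steps. *)
Definition level_time (tau : R) (k : nat) : R := if k is k'.+1 then half_time tau k' else 0.

Lemma level_time_step (tau : R) k : 0 < tau -> (0 < k)%N ->
  [/\ 0 <= level_time tau k.-1, level_time tau k.-1 < level_time tau k &
      level_time tau k - level_time tau k.-1 <= tau].
Proof.
move=> t0; case: k => [|[|k]]//= _; rewrite /half_time.
  by rewrite add0r subr0; split; lra.
have y0 : 0 <= (k%:R + 2^-1) * tau by rewrite mulr_ge0 ?ltW// addr_ge0.
have -> : (k.+1%:R + 2^-1) * tau = (k%:R + 2^-1) * tau + tau by rewrite -[k.+1%:R]natr1; ring.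
by move: ((k%:R + 2^-1) * tau) y0 => y y0; split; lra.
Qed.

(** The scheme fixes its pressures almost everywhere only; this representative satisfies the update
    at every point. *)
Fixpoint level_pressure (p0 : field) (Phi : nat -> field) (k : nat) : field :=
  if k is k'.+1 then fun x => level_pressure p0 Phi k' x + Phi k x else p0.

Lemma scheme_gradient_bound (d0 : (0 < d)%N) (d2 : (2 <= d)%N) (d3 : (d <= 3)%N)
    (T : R) (f : R -> vector_field R d) (u0 : vector_field R d) (u : R -> vector_field R d)
    (p : R -> field) (c0 : R) : 0 < T ->
  (forall i, smooth (fun z : R * 'rV[R]_d => f z.1 i z.2)) -> stokes_solution T f u0 u p ->
  (forall i, L2 (u0 i)) ->
  (forall i, Winfty (@H2 R d) (@normH2 R d) 3 T (fun t => u t i)) ->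
  (forall i, Winfty (@DB R d 1) (@normDB R d 1) 2 T (fun t => u t i)) ->
  Winfty (@Y R d) (@normY R d) 3 T p ->
  exists2 K, 0 <= K & forall tau, 0 < tau -> forall (phi0 : field) (U : nat -> vector_field R d)
    (P Phi : nat -> field) n, zero_mean phi0 ->
    normL2 (fun x => p (tau / 2) x - (p 0 x + phi0 x)) <= c0 * tau ->
    splitting_scheme 0 T tau f u0 (p 0) phi0 U P Phi ->
    (forall k, (half_time tau k <= T) = (k <= n)%N) ->
    exists2 Y : nat -> R, \sum_(0 <= k < n.+1) Y k <= K * tau ^+ 3 &
    forall k, (k <= n)%N -> 0 <= Y k /\ forall (v : vector_field R d) (D : pred 'I_d), Z v ->
      (forall i, D i -> weakly_diff [:: i] (pressure_error tau p P k)) ->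
      (tau * \sum_(i | D i) ip (wpartial [:: i] (pressure_error tau p P k)) (v i)) ^+ 2 <=
      Y k * normZ tau v ^+ 2.
Proof.
move=> T0 hf hst lu0 Wu Wb Wp; have Lf t i : L2 (f t i) by exact: strong_source.
have Lu s i : 0 <= s <= T -> L2 (u s i) by exact: (curve_L2 (Wu i)).
have zp s : 0 <= s <= T -> zero_mean (p s) by have [_ _ _ _ h] := hst; exact: h.
have [Mf hMf] := choice (fun i => let: ex_intro2 M M0 h := defect_bound d0 d2 d3 T0 (Wu i) (Wb i) in
  ex_intro (fun M => 0 <= M /\ _) M (conj M0 h)).
have [Mp Mp0 [hp1 hp2]] := pressure_bound d0 T0 Wp.
have Mf0 i : 0 <= Mf i by have [] := hMf i.
have SM0 : 0 <= \sum_i Mf i by exact: sumr_ge0.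
(* One constant for the length of the time interval, the initial pressure error and all the
   consistency bounds. *)
pose C0 := 1 + 2 * T + `|c0| + 4 * Mp + \sum_i Mf i.
have c00 := normr_ge0 c0.
have C01 : 1 <= C0 by rewrite /C0; move: T0 Mp0 SM0 c00; clear; lra.
have CT : 2 * T <= C0 by rewrite /C0; move: T0 Mp0 SM0 c00; clear; lra.
have Cc : `|c0| <= C0 by rewrite /C0; move: T0 Mp0 SM0 c00; clear; lra.
have CM : 4 * Mp <= C0 by rewrite /C0; move: T0 Mp0 SM0 c00; clear; lra.
have CF : \sum_i Mf i <= C0 by rewrite /C0; move: T0 Mp0 SM0 c00; clear; lra.
have C00 : 0 <= C0 by exact: le_trans ler01 C01.
have vu0 i j : exists V, vanish j (u 0 i) V.
  by apply: (vanish_initial d0 d2 T0 (Wb i)); apply: Lu; rewrite lexx ltW.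
have divu s m : 0 <= s <= T -> gdiv (u s) m = 0.
  move=> sT; have [_ h2 h3 _ _] := hst; have [s0|s0] := eqVneq s 0.
    have [V hV] := choice (fun i => vu0 i i).
    by rewrite s0; apply: (gdiv_divfree m d0 (V := V)) => //; apply: h2; rewrite lexx ltW.
  apply: (gdiv_divfree m d0 (V := fun i => wpartial [:: i] (u s i))); first exact: h2.
  by move=> i; apply: vanish_H10; apply: h3; move: sT; rewrite lt_neqAle eq_sym s0.
set C := stability_const C0; exists (145 * C + 10 * C0 * C + 45 * C0 ^+ 3 + 100 * C0 ^+ 5).
  have : 0 <= C by rewrite /C /stability_const !mulr_ge0 ?exprn_ge0// ?mulr_ge0 ?exprn_ge0.
  by move=> C_ge0; rewrite !addr_ge0 ?mulr_ge0 ?exprn_ge0.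
move=> tau tau0 phi0 U P Phi n zphi hinit0 hsch hn; have tau0' := ltW tau0.
have [U0 P0 Phi0 step] := hsch.
have htE k : half_time tau k = k%:R * tau + tau / 2 by rewrite /half_time mulrDl [2^-1 * _]mulrC.
have kt0 k : 0 <= k%:R * tau by rewrite mulr_ge0.
have htT k : (k <= n)%N -> k%:R * tau + tau / 2 <= T by rewrite -htE hn.
have ht0 k : 0 < half_time tau k by rewrite htE; apply: ltr_wpDl => //; rewrite divr_gt0.
have tauT : tau <= 2 * T by have := htT 0%N isT; clear; lra.
have nT : n%:R * tau <= C0 by have := htT n (leqnn n); move: CT tau0 T0; clear; lra.
have tauC : tau <= C0 by exact: le_trans CT.
pose tm := level_time tau; pose pm k := p (tm k); pose Pc := level_pressure (p 0) Phi.
have tmT k : (k <= n.+1)%N -> 0 <= tm k <= T.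
  case: k => [|k] kn; first by rewrite /tm /= lexx ltW.
  by rewrite /tm /= (ltW (ht0 k)) hn.
have Lpm k : (k <= n.+1)%N -> L2 (pm k) by move=> /tmT /zp[].
have zPhi k : (k <= n.+1)%N -> zero_mean (Phi k).
  case: k => [_|k kn]; first by rewrite Phi0.
  by have /step[_ _ [h _] _] : half_time tau k <= T by rewrite hn.
have zPc k : (k <= n.+1)%N -> zero_mean (Pc k).
  elim: k => [_|k IH kn]; first by apply: zp; rewrite lexx ltW.
  by apply: zero_mean_D; [apply: IH; exact: ltnW|exact: zPhi].
have LPhi k : (k <= n.+1)%N -> L2 (Phi k) by move=> /zPhi[].
have LPc k : (k <= n.+1)%N -> L2 (Pc k) by move=> /zPc[].
have PPc k : (k <= n.+1)%N -> ae_eq_cube (P k) (Pc k).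
  elim: k => [_|k IH kn]; first by rewrite P0; exact: nearW.
  have /step[_ _ _ h] : half_time tau k <= T by rewrite hn.
  by move: h (IH (ltnW kn)); apply: filterS2 => x -> /= ->; rewrite mul0r subr0.
have hU k : (k <= n.+1)%N -> forall i, L2 (U k i) /\ forall j, exists V, vanish j (U k i) V.
  elim: k => [_|k IH kn] i.
    rewrite U0; split=> // j; have [V hV] := vu0 i j; exists V.
    have [_ _ _ h _] := hst; apply: (vanish_ae d0 _ (lu0 i) (h i) hV).
    by apply: Lu; rewrite lexx ltW.
  have [lk vk] := IH (ltnW kn) i; have /step[hv _ _ _] : half_time tau k <= T by rewrite hn.
  by have [h1 h2 _ _] := velocity_recursion tau0 (Lf _ _) hv vk.
have LU k i : (k <= n.+1)%N -> L2 (U k i) by move=> /hU/(_ i)[].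
pose ex k i : field := extrapf T tau (k%:R * tau) (fun s => u s i).
have Lex k i : (k <= n)%N -> L2 (ex k i).
  by move=> kn; apply: L2_extrapf => //; [exact: htT|move=> s sT; exact: Lu].
(* The last velocity level may lie beyond [T] and is compared with the extrapolated velocity. Later
   indices get the zero field, so that [e] is in L^2 for all [k]. *)
pose e k : 'I_d -> field := if k is k'.+1 then (if (k' <= n)%N then fun i x => ex k' i x - U k i x else fun=> cst 0)
  else fun i x => u 0 i x - U 0%N i x.
have ktT k : (k <= n)%N -> 0 <= k%:R * tau <= T.
  by move=> /htT; rewrite kt0 /=; move: tau0; clear; lra.
have exE k i : (k < n)%N -> ex k i = u (k.+1%:R * tau) i.
  move=> kn; apply/funext => x; rewrite /ex /extrapf /extrap -natr1 mulrDl mul1r.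
  by have /andP[_] := ktT _ kn; rewrite -natr1 mulrDl mul1r => ->.
have eE k i : (k <= n)%N -> e k i = (fun x => u (k%:R * tau) i x - U k i x).
  case: k => [_|k kn]; first by rewrite /e mul0r.
  by rewrite /e ltnW// exE.
have eSE k i : (k <= n)%N -> e k.+1 i = (fun x => ex k i x - U k.+1 i x) by rewrite /e => ->.
(* Pressure level [k.+1] is the midpoint of velocity step [k], hence the shift of index. *)
pose w k : field := if (k <= n)%N then fun x => pm k.+1 x - (Pc k x + Phi k x) else cst 0.
pose al m := tau * Num.sqrt (alpha R d m).
pose a k m := coef finset.set0 (pm k) m; pose b k m := coef finset.set0 (Pc k) m.
pose ph k m := coef finset.set0 (Phi k) m.
pose q k m := al m * coef finset.set0 (fun x => pm k x - Pc k x) m.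
have qE k m : (k <= n.+1)%N -> q k m = al m * (a k m - b k m).
  by move=> kn; rewrite /q coefB//; [exact: Lpm|exact: LPc].
have bS k m : (k <= n)%N -> b k.+1 m = b k m + ph k.+1 m.
  by move=> kn; rewrite /b /= coefD//; [exact: LPc (leqW kn)|exact: LPhi].
pose r k m := if (0 < k <= n.+1)%N then al m * coef finset.set0 (fun x => pm k x - pm k.-1 x) m else 0.
have rE k m : (0 < k <= n.+1)%N -> r k m = al m * (a k m - a k.-1 m).
  move=> kn; rewrite /r kn; have /andP[k0 k1] := kn.
  by rewrite coefB//; apply: Lpm => //; exact: leq_trans (leq_pred _) k1.
(* The prediction repeats the previous pressure increment, so [s] is a second difference of the
   exact pressure. *)
pose s k m := r k.+1 m - r k m.
pose sol k i (ut : field) := is_time_derivative T (fun s => u s i) (half_time tau k) ut /\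
  forall l, coef ST ut l + (\sum_(j : 'I_d) lam R l j) * coef ST (u (half_time tau k) i) l =
    coef ST (f (half_time tau k) i) l + ip (p (half_time tau k)) (dsin i l).
pose gt k i : field := xget (cst 0) (sol k i).
have hgt k i : (k <= n)%N -> sol k i (gt k i).
  move=> kn; rewrite /gt; apply: xgetPex.
  have tT : 0 < half_time tau k <= T by rewrite ht0 hn.
  by have [ut h1 h2] := stokes_coef d0 hst tT (Lf _ i); exists ut.
pose F k i l := defect T tau (k%:R * tau) (fun s => u s i) (gt k i) l.
have Le k i : L2 (e k i).
  case: k => [|k]; first by rewrite /e; apply: L2_B; [apply: Lu; rewrite lexx ltW|exact: LU].
  rewrite /e; case: ifP => kn; last exact: L2_cst.
  by apply: L2_B; [exact: Lex|exact: LU].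
have Lw k : L2 (w k).
  rewrite /w; case: ifP => kn; last exact: L2_cst.
  by apply: L2_B; [exact: Lpm|apply: L2_D; [exact: LPc (leqW kn)|exact: LPhi (leqW kn)]].
have e0 i l : coef ST (e 0%N i) l = 0.
  have [_ _ _ h _] := hst; have lu : L2 (u 0 i) by apply: Lu; rewrite lexx ltW.
  by rewrite /e coefB ?U0// (coef_ae ST l lu (lu0 i) (h i)) subrr.
have q0 m : q 0%N m = 0 by rewrite qE// /a /b /pm /tm /= subrr mulr0.
have Hdiv k : (k < n.+1)%N -> forall m, q k.+1 m - q k m = gdiv (e k.+1) m + r k.+1 m.
  rewrite ltnS => kn m; rewrite (qE k.+1 m kn) (qE k m (leqW kn)) (rE k.+1 m kn) (bS k m kn) /=.
  have -> : gdiv (e k.+1) m = - (al m * ph k.+1 m).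
    have -> : e k.+1 = (fun i x => ex k i x - U k.+1 i x) by apply/funext => i; rewrite eSE.
    rewrite gdiv_B; [|by move=> i; exact: Lex|by move=> i; exact: LU].
    have -> : gdiv (ex k) m = 0.
      apply: (extrap_gdiv (g := u) tau0 (kt0 k) (htT k kn)); first by move=> i t; exact: Lu.
      by move=> t; exact: divu.
    have /step[_ hd hA _] : half_time tau k <= T by rewrite hn.
    have [V hV] := choice (fun i => (hU k.+1 kn i).2 i).
    by rewrite -(gdiv_correction m d0 tau0 hd hV hA) sub0r.
  by move: (al m) (a k.+1 m) (a k m) (b k m) (ph k.+1 m); clear => *; ring.
have Hpre k : (0 < k < n.+1)%N -> forall m, tau * Num.sqrt (alpha R d m) * coef finset.set0 (w k) m =
    q k m + (q k m - q k.-1 m) + s k m.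
  move=> /andP[k0 kn] m; rewrite -/(al m).
  have kn' : (k <= n)%N by [].
  have kp : (k.-1 <= n)%N by exact: leq_trans (leq_pred _) kn'.
  rewrite /w kn' coefB; [|exact: Lpm|by apply: L2_D; [exact: LPc (leqW kn')|exact: LPhi (leqW kn')]].
  rewrite coefD; [|exact: LPc (leqW kn')|exact: LPhi (leqW kn')].
  have k0n : (0 < k <= n.+1)%N by rewrite k0 leqW.
  rewrite -/(a k.+1 m) -/(b k m) -/(ph k m) (qE k m (leqW kn')) (qE k.-1 m (leqW kp)) /s (rE k.+1 m kn') (rE k m k0n) /=.
  have := bS k.-1 m kp; rewrite prednK// => ->.
  by move: (al m) (a k.+1 m) (a k m) (a k.-1 m) (b k.-1 m) (ph k m); clear => *; ring.
have Hmom k : (k < n.+1)%N -> forall i l,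
  (1 + beta d tau l) * (coef ST (e k.+1 i) l - coef ST (e k i) l)
  + kappa d tau l / 2 * (coef ST (e k.+1 i) l + coef ST (e k i) l) = F k i l + tau * ip (w k) (dsin i l).
  rewrite ltnS => kn i l; have [hd hut] := hgt k i kn.
  have /step[hv _ _ _] : half_time tau k <= T by rewrite hn.
  have [lk vk] := hU k (leqW kn) i.
  have [_ _ wq hrec] := velocity_recursion tau0 (Lf _ _) hv vk.
  have := hrec l; rewrite (coef_grad d0 l wq) opprK.
  have lq := weakly_diff_L2 wq.
  have LQ : L2 (fun x => Pc k x + Phi k x) by apply: L2_D; [exact: LPc (leqW kn)|exact: LPhi (leqW kn)].
  have aeq : ae_eq_cube (fun x => P k x + Phi k x) (fun x => Pc k x + Phi k x).
    by have := PPc k (leqW kn); apply: filterS => x ->.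
  rewrite (ip_ae lq LQ (L2_dsin R i l) aeq) => E2.
  have bE : \prod_(j : 'I_d) (1 + tau / 2 * lam R l j) = 1 + tau / 2 * (\sum_(j : 'I_d) lam R l j) + beta d tau l.
    by rewrite /beta; move: (\prod_(j : 'I_d) _) (tau / 2 * _); clear => *; ring.
  rewrite bE in E2; rewrite eSE// eE// /F /defect /w kn -/(ex k i) /kappa.
  have lu := Lu _ i (ktT k kn); have lm : L2 (u (half_time tau k) i) by apply: Lu; rewrite (ltW (ht0 k)) hn.
  have lx := Lex k i kn; have lgt := hd.1.
  rewrite -htE (coefB ST l lx (LU k.+1 i kn)) (coefB ST l lu lk).
  rewrite (coefB ST l (L2_B lx lu) (L2_Z tau lgt)) (coefB ST l lx lu) (coefZ ST tau l lgt).
  rewrite (coefB ST l (L2_Z _ (L2_D lx lu)) lm) (coefZ ST _ l (L2_D lx lu)) (coefD ST l lx lu).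
  rewrite (ip_Bl (Lpm k.+1 kn) LQ (L2_dsin R i l)).
  exact: momentum_error (hut l) E2.
have HF k : (k < n.+1)%N -> forall N, \sum_i \sum_(l < N) F k i l ^+ 2 <= (C0 * tau ^+ 3) ^+ 2.
  rewrite ltnS => kn N; have t3 : 0 <= tau ^+ 3 by rewrite exprn_ge0.
  apply: (@le_trans _ _ (\sum_i (Mf i * tau ^+ 3) ^+ 2)).
    apply: ler_sum => i _; have [_ h] := hMf i; apply: h => //; first exact: htT.
    by rewrite -htE; exact: (hgt k i kn).1.
  apply: (@le_trans _ _ ((\sum_i Mf i * tau ^+ 3) ^+ 2)); last first.
    by rewrite -mulr_suml; apply: ler_sqr_le; [rewrite mulr_ge0|rewrite ler_wpM2r].
  have x0 i : 0 <= Mf i * tau ^+ 3 by rewrite mulr_ge0.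
  rewrite [leRHS]expr2 mulr_suml; apply: ler_sum => i _; rewrite expr2 ler_wpM2l//.
  by rewrite (bigD1 i)//= lerDl sumr_ge0.
have tm_step k : (0 < k <= n.+1)%N -> 0 <= tm k.-1 /\ tm k.-1 < tm k /\ tm k <= T /\ tm k - tm k.-1 <= tau.
  move=> /andP[k0 kn]; have /andP[_ t2] := tmT k kn.
  by have [h1 h2 h3] := level_time_step tau0 k0.
have Hr' k M : \sum_(m < M) r k m ^+ 2 <= (2 * Mp * tau ^+ 2) ^+ 2.
  rewrite /r; have [kn|kn] := boolP (0 < k <= n.+1)%N; last by rewrite big1 ?sqr_ge0// => m _; rewrite expr0n.
  have [t1 [t2 [t3 t4]]] := tm_step k kn; have td : 0 <= tm k - tm k.-1 by rewrite subr_ge0 ltW.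
  have zz : zero_mean (fun x => pm k x - pm k.-1 x).
    by apply: zero_mean_B; apply: zp; rewrite ?t1 ?t3 /= ?(le_trans t1 (ltW t2)) ?(le_trans (ltW t2) t3).
  have h := alpha_sum tau M (mulr_ge0 Mp0 td) zz (hp1 _ _ t1 t2 t3).
  apply: (le_trans h); apply: ler_sqr_le; first by rewrite !mulr_ge0.
  rewrite (_ : 2 * Mp * tau ^+ 2 = 2 * tau * (Mp * tau)); last by ring.
  by rewrite ler_wpM2l ?mulr_ge0// ler_wpM2l.
have Mle (x y : R) : 0 <= x -> x <= 4 * Mp -> 0 <= y -> (x * y) ^+ 2 <= (C0 * y) ^+ 2.
  by move=> x0 xM y0; apply: ler_sqr_le; rewrite ?mulr_ge0// ler_wpM2r// (le_trans xM CM).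
have M2 : 0 <= 2 * Mp by rewrite mulr_ge0.
have M24 : 2 * Mp <= 4 * Mp by move: Mp0; clear; lra.
have Hr k : (0 < k <= n.+1)%N -> forall M, \sum_(m < M) r k m ^+ 2 <= (C0 * tau ^+ 2) ^+ 2.
  by move=> _ M; apply: (le_trans (Hr' k M)); apply: Mle; rewrite ?sqr_ge0.
(* From [k = 2] on the three levels are equally spaced, and second differences of [p] gain an
   order. *)
have Hs k : (1 < k < n.+1)%N -> forall M, \sum_(m < M) s k m ^+ 2 <= (C0 * tau ^+ 3) ^+ 2.
  case: k => [|[|k]]// /andP[_ kn] M; rewrite ltnS in kn.
  have x0 := ltW (ht0 k); have hE : half_time tau k.+1 = half_time tau k + tau.
    rewrite !htE -[k.+1%:R]natr1 mulrDl mul1r; move: (k%:R * tau); clear => x; ring.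
  have hE2 : half_time tau k.+2 = half_time tau k + 2 * tau.
    rewrite !htE -[k.+2%:R]natr1 -[k.+1%:R]natr1 !mulrDl !mul1r; move: (k%:R * tau); clear => x; ring.
  have xT : half_time tau k + 2 * tau <= T by rewrite -hE2 hn.
  pose D2 : field := fun x => p (half_time tau k + 2 * tau) x - 2 * p (half_time tau k + tau) x + p (half_time tau k) x.
  have z2 : zero_mean (p (half_time tau k + 2 * tau)) by rewrite -hE2; apply: zp; rewrite (ltW (ht0 _)) hn.
  have z1 : zero_mean (p (half_time tau k + tau)) by rewrite -hE; apply: zp; rewrite (ltW (ht0 _)) hn ltnW.
  have z0 : zero_mean (p (half_time tau k)) by apply: zp; rewrite (ltW (ht0 _)) hn ltnW// ltnW.
  have l2 := z2.1; have l1 := z1.1; have l0 := z0.1.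
  have zz : zero_mean D2.
    have -> : D2 = (fun x => (p (half_time tau k + 2 * tau) x - p (half_time tau k + tau) x) -
      (p (half_time tau k + tau) x - p (half_time tau k) x)) by apply/funext => x; rewrite /D2; ring.
    by apply: zero_mean_B; apply: zero_mean_B.
  have sE m : s k.+2 m = al m * coef finset.set0 D2 m.
    rewrite /s (rE k.+3 m kn) (rE k.+2 m (leqW kn)) /= /D2 coefD//; last by apply: L2_B => //; exact: L2_Z.
    rewrite coefB//; last exact: L2_Z.
    rewrite coefZ// /a /pm /tm /= hE2 hE.
    by move: (al m) (coef _ _ _) (coef _ (p (half_time tau k + tau)) m) (coef _ (p (half_time tau k)) m); clear => *; ring.
  under eq_bigr do rewrite sE.
  have t2 : 0 <= tau ^+ 2 by exact: sqr_ge0.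
  have h := alpha_sum tau M (mulr_ge0 Mp0 t2) zz (hp2 _ _ x0 tau0 xT).
  apply: (le_trans h); rewrite (_ : 2 * tau * (Mp * tau ^+ 2) = 2 * Mp * tau ^+ 3); last by ring.
  by apply: Mle; rewrite ?exprn_ge0.
(* The levels 0, [tau / 2] and [3 * tau / 2] are not equally spaced: only first differences are
   available, and one order is lost. *)
have Hs1 M : \sum_(m < M) s 1%N m ^+ 2 <= (C0 * tau ^+ 2) ^+ 2.
  have h1 := Hr' 1%N M; have h2 := Hr' 2%N M.
  have := sqB_le2 (fun m : 'I_M => r 2%N m) (fun m : 'I_M => r 1%N m); rewrite /sq => h.
  apply: (le_trans h); apply: (@le_trans _ _ ((4 * Mp * tau ^+ 2) ^+ 2)); last first.
    by apply: Mle; rewrite ?sqr_ge0 ?mulr_ge0.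
  rewrite (_ : 4 * Mp * tau ^+ 2 = 2 * (2 * Mp * tau ^+ 2)); last by ring.
  by rewrite [leRHS]exprMn; move: h1 h2; clear; lra.
have Hw0 : ip (w 0%N) (w 0%N) <= (C0 * tau) ^+ 2.
  rewrite -normL2_sqr; apply: ler_sqr_le; first exact: normL2_ge0.
  have -> : w 0%N = (fun x => p (tau / 2) x - (p 0 x + phi0 x)).
    by rewrite /w /= Phi0 /pm /tm /= htE mul0r add0r.
  apply: (le_trans hinit0); rewrite ler_wpM2r//; exact: le_trans (ler_norm _) Cc.
pose eps k : field := fun x => pm k.+1 x - Pc k.+1 x.
have Leps k : (k <= n)%N -> L2 (eps k) by move=> kn; apply: L2_B; [exact: Lpm|exact: LPc].
have Heps0 m : tau * Num.sqrt (alpha R d m) * coef finset.set0 (eps 0%N) m = q 1%N m - q 0%N m.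
  by rewrite q0 subr0.
have Heps k : (0 < k <= n)%N -> forall m,
    tau * Num.sqrt (alpha R d m) * coef finset.set0 (fun x => eps k x - w k x) m =
    (q k.+1 m - q k m) - (q k m - q k.-1 m) - s k m.
  move=> /andP[k0 kn] m; rewrite -/(al m).
  have kp : (k.-1 <= n)%N by exact: leq_trans (leq_pred _) kn.
  have LB : L2 (fun x => Pc k x + Phi k x) by apply: L2_D; [exact: LPc (leqW kn)|exact: LPhi (leqW kn)].
  rewrite (coefB _ _ (Leps k kn) (Lw k)) /w kn (coefB _ _ (Lpm k.+1 kn) LB) (coefB _ _ (Lpm k.+1 kn) (LPc k.+1 kn)).
  rewrite (coefD _ _ (LPc k (leqW kn)) (LPhi k (leqW kn))) -/(a k.+1 m) -/(b k m) -/(ph k m) -/(b k.+1 m).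
  have k0n : (0 < k <= n.+1)%N by rewrite k0 leqW.
  rewrite (qE k.+1 m kn) (qE k m (leqW kn)) (qE k.-1 m (leqW kp)) /s (rE k.+1 m kn) (rE k m k0n) /=.
  have := bS k.-1 m kp; rewrite prednK// => E.
  have -> : b k.-1 m = b k m - ph k m by rewrite E addrK.
  by move: (al m) (a k.+1 m) (a k m) (a k.-1 m) (b k m) (b k.+1 m) (ph k m); clear => *; ring.
have [Y sY hY] := gradient_bound d0 d2 d3 C01 tau0 tauC nT Le Lw e0 q0 Hdiv Hpre Hmom HF Hr Hs Hs1 Hs Hw0 Leps Heps0 Heps.
exists Y => // k kn; have [Yk0 hYk] := hY k kn; split=> // v D Zv wd.
have aeq : ae_eq_cube (pressure_error tau p P k) (eps k).
  by have := PPc k.+1 kn; apply: filterS => x; rewrite /pressure_error /eps => ->.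
have tr i : D i -> weakly_diff [:: i] (eps k) /\
    ip (wpartial [:: i] (pressure_error tau p P k)) (v i) = ip (wpartial [:: i] (eps k)) (v i).
  by move=> Di; exact: (wpartial_transfer d0 aeq (Leps k kn) (Z_L2 i Zv) (wd i Di)).
rewrite (eq_bigr (fun i => ip (wpartial [:: i] (eps k)) (v i))); last by move=> i /tr[].
by apply: hYk => // i /tr[].
Qed.

End scheme_error.

(** * Test fields in [Z] and the supremum norm *)

Section test_fields.
Context (R : realType) (d : nat).
Local Notation field := (scalar_field R d).

Lemma smooth_partial s (psi : field) : smooth psi -> smooth (partial s psi).
Proof.
move=> h s'; have -> : iter_derive s' (partial s psi) = iter_derive (s' ++ [seq delta_mx ord0 i | i <- s]) psi.
  by rewrite /partial /iter_derive foldr_cat.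
exact: h.
Qed.

Lemma test_function_partial s (phi : field) : test_function cube phi -> test_function cube (partial s phi).
Proof.
move=> [sp [K [cK KO out]]]; split; first exact: smooth_partial.
by exists K; split => // x; exact: (test_function_out s cK out).
Qed.

Lemma test_weak_partial s (phi : field) : test_function cube phi -> weakly_diff s phi.
Proof.
have H r (f : field) : test_function cube f -> exists2 g, L2 g &
    forall psi, smooth psi -> ip g psi = (-1) ^+ size r * ip f (partial r psi).
  elim: r f => [|i r IH] f tf.
    by exists f => [|psi _]; [exact: (@L2_smooth R d f [::] tf.1)|rewrite mul1r].
  have [g lg hg] := IH _ (test_function_partial [:: i] tf); exists g => // psi sp.
  rewrite hg// (ip_partial_test i tf (smooth_partial r sp)) exprS mulN1r mulrN mulNr.
  by [].
move=> tp; have [g lg hg] := H s phi tp; exists g; split => //.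
  exact: (@L2_smooth R d phi [::] tp.1).
move=> psi tpsi; rewrite hg; last exact: tpsi.1.
by rewrite ip_Zr//; [exact: L2_smooth tpsi.1|exact: (@L2_smooth R d phi [::] tp.1)].
Qed.

Lemma normL2_ae0 (f : field) : L2 f -> ae_eq_cube f (cst 0) -> normL2 f = 0.
Proof.
move=> lf f0; rewrite /normL2 (ip_ae lf (L2_cst d (0 : R)) lf f0) ip_0l sqrtr0 //.
Qed.

Lemma Z_test (phi : field) : (0 < d)%N -> test_function cube phi -> Z (fun=> phi).
Proof.
move=> d0 tp i; split; last by move=> A _; exact: test_weak_partial.
have lp : L2 phi := @L2_smooth R d phi [::] tp.1.
split=> [j|e e0]; first exact: test_weak_partial.
exists phi; split => //.
  rewrite normL2_ae0//; first exact: L2_B.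
  by apply: nearW => x /=; rewrite subrr.
move=> j; have wj := smooth_weak_partial j tp.1.
have lw : L2 (wpartial [:: j] phi) := L2_wpartial (test_weak_partial [:: j] tp).
rewrite normL2_ae0//; first by apply: L2_B => //; exact: L2_smooth tp.1.
by have := wpartial_ae d0 wj; apply: filterS => x /= ->; rewrite subrr.
Qed.

(** A supremum over no field would be minus infinity, with an infinite square. If all test functions
    were null, every function in L^2 would be orthogonal to them and hence null, even the constant
    mode. *)
Lemma Z_nontrivial : (0 < d)%N ->
  exists v : vector_field R d, Z v /\ ~ (forall i, ae_eq_cube (v i) (cst 0)).
Proof.
move=> d0; apply: contrapT => h.
have h0 (phi : field) : test_function cube phi -> ae_eq_cube phi (cst 0).
  move=> tp; apply: contrapT => np; apply: h; exists (fun=> phi); split; first exact: Z_test.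
  by move=> /(_ (Ordinal d0)).
pose w : field := trig finset.set0 (fun=> 0%N); have lw : L2 w by exact: L2_trig.
have w0 : ae_eq_cube w (cst 0).
  apply: (ae_eq0_test d0) => // phi tp; have lp : L2 phi := @L2_smooth R d phi [::] tp.1.
  by rewrite ipC (ip_ae lp (L2_cst d (0 : R)) lw (h0 _ tp)) ip_0l.
have : ip w w = 0 by rewrite (ip_ae lw (L2_cst d (0 : R)) lw w0) ip_0l.
rewrite /w trig_orth; case: forallP => [_ /eqP|[]]; first by rewrite oner_eq0.
by move=> i; rewrite eqxx inE.
Qed.

(** A single nonzero field bounds the supremum from below by [- a], which is needed before
    squaring. *)
Lemma norm_triangle_sqr_le (tau : R) (q : field) (a : R) : (0 < d)%N -> 0 <= a ->
  (forall v : vector_field R d, Z v ->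
     `|(\sum_i ip (wpartial [:: i] q) (v i)) / normZ tau v| <= a) ->
  (norm_triangle tau q ^+ 2 <= (a ^+ 2)%:E)%E.
Proof.
move=> d0 a0 h; have [v [Zv v0]] := Z_nontrivial d0.
have up : (norm_triangle tau q <= a%:E)%E.
  apply: ge_ereal_sup => _ [z [Zz _ ->]]; rewrite lee_fin; exact: le_trans (ler_norm _) (h z Zz).
have lo : ((- a)%:E <= norm_triangle tau q)%E.
  apply: (@le_trans _ _ ((\sum_i ip (wpartial [:: i] q) (v i)) / normZ tau v)%:E).
    by rewrite lee_fin; have := h v Zv; rewrite ler_norml => /andP[].
  by apply: ereal_sup_ubound; exists v.
move: up lo; case: (norm_triangle tau q) => [x| |]//=.
rewrite !lee_fin => up lo.
have h1 : 0 <= a - x by rewrite subr_ge0.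
have h2 : 0 <= a + x by move: lo; clear; lra.
by rewrite -expr2; have := mulr_ge0 h1 h2; clear; lra.
Qed.

Lemma quotient_bound (tau x z y : R) : 0 < tau -> 0 <= z -> 0 <= y ->
  (tau * x) ^+ 2 <= y * z ^+ 2 -> `|x / z| <= Num.sqrt (y / tau ^+ 2).
Proof.
move=> t0 z0 y0 h; rewrite -sqrtr_sqr; apply: ler_wsqrtr.
have t2 : 0 < tau ^+ 2 by rewrite exprn_gt0.
(* With a zero norm the quotient is 0, by the convention on the inverse of 0. *)
have [->|zn] := eqVneq z 0; first by rewrite invr0 mulr0 expr0n/= divr_ge0// ltW.
have z2 : 0 < z ^+ 2 by rewrite exprn_gt0// lt_neqAle eq_sym zn.
rewrite ler_pdivlMr// exprMn exprVn mulrAC ler_pdivrMr//.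
by rewrite -exprMn [x * tau]mulrC.
Qed.

Lemma sum_truncate (y : nat -> R) m n : (forall k, (k <= n)%N -> 0 <= y k) ->
  \sum_(0 <= k < m | (k <= n)%N) y k <= \sum_(0 <= k < n.+1) y k.
Proof.
move=> y0; have E j : \sum_(0 <= k < j) (if (k <= n)%N then y k else 0) <= \sum_(0 <= k < minn j n.+1) y k.
  elim: j => [|j IH]; first by rewrite min0n !big_geq.
  rewrite big_nat_recr//=; case: leqP => jn.
    have -> : minn j.+1 n.+1 = j.+1 by apply/minn_idPl.
    rewrite big_nat_recr//= lerD2r; apply: (le_trans IH).
    by have -> : minn j n.+1 = j by apply/minn_idPl; exact: leqW.
  have -> : minn j.+1 n.+1 = n.+1 by apply/minn_idPr; exact: leqW.
  by rewrite addr0; apply: (le_trans IH); have -> : minn j n.+1 = n.+1 by apply/minn_idPr.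
rewrite big_mkcond/=; apply: (le_trans (E m)).
rewrite (big_cat_nat (n := minn m n.+1) (p := n.+1))//=; last exact: geq_minr.
rewrite lerDl big_nat; apply: sumr_ge0 => k /andP[_ kn]; exact: y0.
Qed.

End test_fields.

(* The error estimate in the triangle norm *)
Require Import Defs.
From mathcomp Require Import all_boot all_order all_algebra.
From mathcomp Require Import all_classical all_reals all_analysis.
Import Order.TTheory GRing.Theory Num.Theory.
Local Open Scope classical_set_scope.
Local Open Scope ring_scope.

Theorem theorem3p2 (R : realType) (d : nat) (hd : d = 2%N \/ d = 3%N)
    (T : R) (hT : 0 < T)
    (f : R -> vector_field R d) (u0 : vector_field R d)
    (u : R -> vector_field R d) (p : R -> scalar_field R d)
    (hf : forall i, smooth (fun z : R * 'rV[R]_d => f z.1 i z.2))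
    (hstokes : stokes_solution T f u0 u p)
    (hinit : initial_data (f 0) u0 (p 0))
    (huH2 : forall i, Winfty (@H2 R d) (@normH2 R d) 3 T (fun t => u t i))
    (huDB : forall tau, 0 < tau -> forall i,
      Winfty (@DB R d tau) (@normDB R d tau) 2 T (fun t => u t i))
    (hp : Winfty (@Y R d) (@normY R d) 3 T p)
    (c0 : R) :
  exists c : R, forall tau : R, 0 < tau ->
    forall (phi0 : scalar_field R d) (U : nat -> vector_field R d)
           (P Phi : nat -> scalar_field R d),
      H1 phi0 -> zero_mean phi0 ->
      normL2 (fun x => p (tau / 2) x - (p 0 x + phi0 x)) <= c0 * tau ->
      splitting_scheme 0 T tau f u0 (p 0) phi0 U P Phi ->
      (l2_norm_triangle T tau (pressure_error tau p P) <= (c * tau)%:E)%E.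
Proof.
have d2 : (2 <= d)%N by case: hd => ->.
have d3 : (d <= 3)%N by case: hd => ->.
have d0 : (0 < d)%N by exact: leq_trans d2.
have lu0 i : L2 (u0 i).
  have [_ [_ h] _ _] := hinit; exact: weakly_diff_L2 (h i (Ordinal d0)).
have [K K0 hK] := scheme_gradient_bound d0 d2 d3 c0 hT hf hstokes lu0 huH2 (huDB 1 ltr01) hp.
exists (Num.sqrt K) => tau tau0 phi0 U P Phi _ zphi hi hs; have tau0' := ltW tau0.
have t2 : 0 < tau ^+ 2 by rewrite exprn_gt0.
suff hsum : (tau%:E * \sum_(0 <= k < nb_steps T tau | (half_time tau k <= T)%R)
      norm_triangle tau (pressure_error tau p P k) ^+ 2 <= (K * tau ^+ 2)%:E)%E.
  have s0 : (0 <= tau%:E * \sum_(0 <= k < nb_steps T tau | (half_time tau k <= T)%R)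
      norm_triangle tau (pressure_error tau p P k) ^+ 2)%E.
    by apply: mule_ge0; rewrite ?lee_fin//; apply: sume_ge0 => k _; exact: sqre_ge0.
  rewrite /l2_norm_triangle; have h2 : (0 : R) <= 2^-1 by rewrite invr_ge0.
  have kt : 0 <= K * tau ^+ 2 by rewrite mulr_ge0// ltW.
  apply: (@le_trans _ _ (poweR (K * tau ^+ 2)%:E 2^-1)).
    by apply: gt0_ler_poweR => //; rewrite in_itv /= ?s0 ?lee_fin ?kt leey.
  by rewrite poweR_EFin powR12_sqrt// sqrtrM// sqrtr_sqr ger0_norm.
(* If the first midpoint already lies beyond [T], the sum is empty. *)
have [hh|hh] := leP (tau / 2) T; last first.
  rewrite big1 ?mule0 ?lee_fin; first by rewrite mulr_ge0// ltW.
  move=> k; rewrite /half_time => hk; exfalso; move: hk; apply/negP; rewrite -ltNge.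
  apply: (lt_le_trans hh); rewrite mulrC ler_wpM2r// lerDr.
  exact: ler0n.
have [n hn] := truncn_halftime tau0 hh.
have [Y sY hY] := hK tau tau0 phi0 U P Phi n zphi hi hs hn.
under eq_bigl do rewrite hn.
have bnd k : (k <= n)%N -> (norm_triangle tau (pressure_error tau p P k) ^+ 2 <= (Y k / tau ^+ 2)%:E)%E.
  move=> kn; have [Yk hv] := hY k kn; have yt : 0 <= Y k / tau ^+ 2 by rewrite divr_ge0// ltW.
  rewrite -(sqr_sqrtr yt); apply: norm_triangle_sqr_le => // v Zv.
  apply: quotient_bound => //; first exact: sqrtr_ge0.
  (* In a direction without weak derivative [wpartial] takes its default value 0, so the sum reduces
     to the directions covered by the estimate. *)
  pose D i := `[< weakly_diff [:: i] (pressure_error tau p P k) >].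
  have E : \sum_i ip (wpartial [:: i] (pressure_error tau p P k)) (v i) =
      \sum_(i | D i) ip (wpartial [:: i] (pressure_error tau p P k)) (v i).
    rewrite [LHS](bigID D)/= [X in _ + X]big1 ?addr0// => i /asboolPn nD.
    by rewrite /wpartial xgetPN ?ip_0l// => g hg; apply: nD; exists g.
  have wD i : D i -> weakly_diff [:: i] (pressure_error tau p P k) by move=> /asboolW.
  by rewrite E; exact: hv v D Zv wD.
apply: (@le_trans _ _ (tau%:E * (\sum_(0 <= k < nb_steps T tau | (k <= n)%N) Y k / tau ^+ 2)%:E)%E).
  rewrite lee_wpmul2l ?lee_fin// -sumEFin; apply: lee_sum => k kn; exact: bnd.
rewrite -EFinM lee_fin; have y0 k : (k <= n)%N -> 0 <= Y k / tau ^+ 2.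
  by move=> /hY[h _]; rewrite divr_ge0// ltW.
apply: (le_trans (ler_wpM2l tau0' (sum_truncate (nb_steps T tau) y0))).
(* The powers balance: [tau] from the norm, [tau ^+ 3] from the sum of the [Y k], divided by
   [tau ^+ 2]. *)
rewrite -mulr_suml mulrA ler_pdivrMr//.
apply: (le_trans (ler_wpM2l tau0' sY)); rewrite le_eqVlt; apply/orP; left; apply/eqP.
by ring.
Qed.
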